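(* Let $F_n(z):=F_{n,0}(z)$ denote the $n$-th Taylor coefficient at $s=0$ of the doubly-completed weight-$0$ Eisenstein series, i.e. $\widehat{\widehat{E}}_0(z,s)=\sum_{n\ge 0}F_n(z)s^n$. For every integer $m\ge 1$ one has $V_0^m(0)=V_0^{m-1/2}(0)$, the space $V_0^m(0)$ is $m$-dimensional, and $\{F_0(z),F_1(z),\dots,F_{m-1}(z)\}$ is a basis of $V_0^m(0)$.
   Context: Write $z=x+iy\in\mathbb H$ (upper half-plane). For $k\in 2\mathbb Z$ the weight-$k$ hyperbolic Laplacian is $\Delta_k=y^2(\partial_x^2+\partial_y^2)-iky(\partial_x+i\partial_y)$. A weight-$k$ modular form here means a smooth $f:\mathbb H\to\mathbb C$ with $f(\frac{az+b}{cz+d})=(cz+d)^kf(z)$ for all $\begin{pmatrix}a&b\\c&d\end{pmatrix}\in SL_2(\mathbb Z)$; it has moderate growth if there is $\alpha\in\mathbb R$ with $f(x+iy)=O(y^\alpha)$ as $y\to\infty$ uniformly in $x$. For an integer $m\ge0$, $V_k^m(0)$ is the complex vector space of weight-$k$ modular forms of moderate growth with $\Delta_k^m f=0$ (so $V_k^0(0)=\{0\}$), and $V_k^{m+1/2}(0)$ is the space of weight-$k$ modular forms of moderate growth such that $\Delta_k^m f$ is a holomorphic function on $\mathbb H$ (so $V_k^{1/2}(0)=M_k$, the space of holomorphic weight-$k$ modular forms of moderate growth). Eisenstein series: for $k\in2\mathbb Z$, $E_k(z,s)=\frac12\sum_{(m,n)\in\mathbb Z^2\setminus\{(0,0)\}}\frac{y^s}{(mz+n)^k|mz+n|^{2s}}$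 for $\mathrm{Re}(2s+k)>2$, meromorphically continued in $s$; $\widehat E_k(z,s)=\pi^{-(s+k/2)}\Gamma(s+\frac k2+\frac{|k|}2)E_k(z,s)$; and $\widehat{\widehat E}_k(z,s)=(s+\frac k2)(s+\frac k2-1)\widehat E_k(z,s)$, which is entire in $s$. Its Taylor coefficients at $s=0$ are denoted $F_{n,k}(z)$ for $k\le0$ and $G_{n,k}(z)$ for $k\ge2$: $\widehat{\widehat E}_k(z,s)=\sum_{n\ge0}F_{n,k}(z)s^n$ ($k\le 0$), $=\sum_{n\ge0}G_{n,k}(z)s^n$ ($k\ge2$). *)

(* Defs.v *)
From Stdlib Require Import Reals Lra ZArith ClassicalEpsilon.
Open Scope R_scope.

Record Cplx := mkC { Re : R ; Im : R }.

Definition C0 : Cplx := mkC 0 0.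
Definition C1 : Cplx := mkC 1 0.
Definition Ci : Cplx := mkC 0 1.
Definition RtoC (r : R) : Cplx := mkC r 0.
Definition Cadd (z w : Cplx) : Cplx := mkC (Re z + Re w) (Im z + Im w).
Definition Copp (z : Cplx) : Cplx := mkC (- Re z) (- Im z).
Definition Csub (z w : Cplx) : Cplx := Cadd z (Copp w).
Definition Cmul (z w : Cplx) : Cplx :=
  mkC (Re z * Re w - Im z * Im w) (Re z * Im w + Im z * Re w).
Definition Cinv (z : Cplx) : Cplx :=
  let d := Re z * Re z + Im z * Im z in mkC (Re z / d) (- Im z / d).
Definition Cdiv (z w : Cplx) : Cplx := Cmul z (Cinv w).
Definition Cnorm (z : Cplx) : R := sqrt (Re z * Re z + Im z * Im z).
Definition Cexp (z : Cplx) : Cplx := mkC (exp (Re z) * cos (Im z)) (exp (Re z) * sin (Im z)).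

Fixpoint Cpow (z : Cplx) (n : nat) : Cplx :=
  match n with O => C1 | S n => Cmul z (Cpow z n) end.

Definition Cpowz (z : Cplx) (k : Z) : Cplx :=
  match k with
  | Z0 => C1
  | Zpos p => Cpow z (Pos.to_nat p)
  | Zneg p => Cinv (Cpow z (Pos.to_nat p))
  end.

Definition Rcpow (r : R) (s : Cplx) : Cplx := Cexp (Cmul s (RtoC (ln r))).

Fixpoint Csum (f : nat -> Cplx) (n : nat) : Cplx :=
  match n with O => C0 | S n => Cadd (Csum f n) (f n) end.

Fixpoint Cprod (f : nat -> Cplx) (n : nat) : Cplx :=
  match n with O => C1 | S n => Cmul (Cprod f n) (f n) end.

Definition Cseq_cv (u : nat -> Cplx) (l : Cplx) : Prop :=
  forall eps, eps > 0 -> exists N, forall n, (n >= N)%nat -> Cnorm (Csub (u n) l) < eps.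

Definition Cseries_cv (u : nat -> Cplx) (l : Cplx) : Prop :=
  Cseq_cv (fun N => Csum u N) l.

Definition inH (z : Cplx) : Prop := Im z > 0.

Definition is_dx (f g : Cplx -> Cplx) : Prop :=
  forall z, inH z ->
    derivable_pt_lim (fun t => Re (f (mkC t (Im z)))) (Re z) (Re (g z)) /\
    derivable_pt_lim (fun t => Im (f (mkC t (Im z)))) (Re z) (Im (g z)).

Definition is_dy (f g : Cplx -> Cplx) : Prop :=
  forall z, inH z ->
    derivable_pt_lim (fun t => Re (f (mkC (Re z) t))) (Im z) (Re (g z)) /\
    derivable_pt_lim (fun t => Im (f (mkC (Re z) t))) (Im z) (Im (g z)).

Definition continuous_on_H (f : Cplx -> Cplx) : Prop :=
  forall z, inH z -> forall eps, eps > 0 -> exists delta, delta > 0 /\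
    forall w, inH w -> Cnorm (Csub w z) < delta -> Cnorm (Csub (f w) (f z)) < eps.

CoInductive smooth_on_H (f : Cplx -> Cplx) : Prop :=
  smooth_intro : forall fx fy : Cplx -> Cplx,
    continuous_on_H f -> is_dx f fx -> is_dy f fy ->
    smooth_on_H fx -> smooth_on_H fy -> smooth_on_H f.

Definition Cderiv_at (f : Cplx -> Cplx) (z l : Cplx) : Prop :=
  forall eps, eps > 0 -> exists delta, delta > 0 /\
    forall h, h <> C0 -> Cnorm h < delta ->
      Cnorm (Csub (Cdiv (Csub (f (Cadd z h)) (f z)) h) l) < eps.

Definition holomorphic_on_H (f : Cplx -> Cplx) : Prop :=
  forall z, inH z -> exists l, Cderiv_at f z l.

Definition is_Delta (k : Z) (f g : Cplx -> Cplx) : Prop :=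
  exists fx fy fxx fyy : Cplx -> Cplx,
    is_dx f fx /\ is_dy f fy /\ is_dx fx fxx /\ is_dy fy fyy /\
    forall z, inH z ->
      g z = Csub (Cmul (RtoC (Im z * Im z)) (Cadd (fxx z) (fyy z)))
                 (Cmul (Cmul Ci (RtoC (IZR k * Im z))) (Cadd (fx z) (Cmul Ci (fy z)))).

Inductive iterDelta (k : Z) : nat -> (Cplx -> Cplx) -> (Cplx -> Cplx) -> Prop :=
  | iterDelta0 : forall f, iterDelta k 0 f f
  | iterDeltaS : forall n f g h, iterDelta k n f g -> is_Delta k g h ->
                   iterDelta k (S n) f h.

Definition moebius (a b c d : Z) (z : Cplx) : Cplx :=
  Cdiv (Cadd (Cmul (RtoC (IZR a)) z) (RtoC (IZR b)))
       (Cadd (Cmul (RtoC (IZR c)) z) (RtoC (IZR d))).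

Definition modular_of_weight (k : Z) (f : Cplx -> Cplx) : Prop :=
  smooth_on_H f /\
  forall a b c d : Z, (a * d - b * c = 1)%Z -> forall z, inH z ->
    f (moebius a b c d z) =
    Cmul (Cpowz (Cadd (Cmul (RtoC (IZR c)) z) (RtoC (IZR d))) k) (f z).

Definition moderate_growth (f : Cplx -> Cplx) : Prop :=
  exists alpha K Y : R, Y > 0 /\
    forall x y : R, y > Y -> Cnorm (f (mkC x y)) <= K * Rpower y alpha.

Definition inV (k : Z) (m : nat) (f : Cplx -> Cplx) : Prop :=
  modular_of_weight k f /\ moderate_growth f /\
  exists g, iterDelta k m f g /\ forall z, inH z -> g z = C0.

(* V_k^{m+1/2}(0) *)
Definition inV_half (k : Z) (m : nat) (f : Cplx -> Cplx) : Prop :=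
  modular_of_weight k f /\ moderate_growth f /\
  exists g, iterDelta k m f g /\ holomorphic_on_H g.

Definition is_basis_on_H (V : (Cplx -> Cplx) -> Prop) (m : nat) (b : nat -> Cplx -> Cplx) : Prop :=
  (forall j, (j < m)%nat -> V (b j)) /\
  (forall c : nat -> Cplx,
     (forall z, inH z -> Csum (fun j => Cmul (c j) (b j z)) m = C0) ->
     forall j, (j < m)%nat -> c j = C0) /\
  (forall f, V f -> exists c : nat -> Cplx,
     forall z, inH z -> f z = Csum (fun j => Cmul (c j) (b j z)) m).

Definition eis_term (k : Z) (z s : Cplx) (m n : Z) : Cplx :=
  let w := Cadd (Cmul (RtoC (IZR m)) z) (RtoC (IZR n)) in
  Cdiv (Rcpow (Im z) s)
       (Cmul (Cpowz w k) (Rcpow (Re w * Re w + Im w * Im w) s)).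

Definition eis_partial (k : Z) (z s : Cplx) (N : nat) : Cplx :=
  Csum (fun i => Csum (fun j =>
     let m := (Z.of_nat i - Z.of_nat N)%Z in
     let n := (Z.of_nat j - Z.of_nat N)%Z in
     if (Z.eqb m 0 && Z.eqb n 0)%bool then C0 else eis_term k z s m n)
   (2 * N + 1)) (2 * N + 1).

(* E_k(z,s) = v, in the region of absolute convergence Re(2s+k) > 2 *)
Definition Eis_val (k : Z) (z s v : Cplx) : Prop :=
  Cseq_cv (fun N => Cmul (RtoC (1/2)) (eis_partial k z s N)) v.

(* Gamma function (Gauss's limit formula): Gamma(s) = lim n^s n! / (s(s+1)...(s+n)) *)
Definition Gamma_val (s g : Cplx) : Prop :=
  Cseq_cv (fun n => Cdiv (Cmul (Rcpow (INR n) s) (RtoC (INR (fact n))))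
                         (Cprod (fun j => Cadd s (RtoC (INR j))) (S n))) g.

Definition hhE_val (k : Z) (z s v : Cplx) : Prop :=
  let t := Cadd s (RtoC (IZR k / 2)) in
  exists e g, Eis_val k z s e /\
    Gamma_val (Cadd t (RtoC (IZR (Z.abs k) / 2))) g /\
    v = Cmul (Cmul (Cmul t (Csub t C1)) (Rcpow PI (Copp t))) (Cmul g e).

(* a is the sequence of Taylor coefficients at s = 0 of the entire function
   s |-> hat-hat E_k(z,s): the power series sum a_n s^n converges for every s,
   and on Re(2s+k) > 2 its sum is hat-hat E_k(z,s)  (by uniqueness of analytic
   continuation and of power series expansions, such a is unique) *)
Definition is_taylor_hhE (k : Z) (z : Cplx) (a : nat -> Cplx) : Prop :=
  forall s, exists v, Cseries_cv (fun n => Cmul (a n) (Cpow s n)) v /\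
    (2 * Re s + IZR k > 2 -> hhE_val k z s v).

Definition hhE_coeff (k : Z) (n : nat) (z : Cplx) : Cplx :=
  epsilon (inhabits (fun _ : nat => C0)) (is_taylor_hhE k z) n.

Definition F_nk (n : nat) (k : Z) : Cplx -> Cplx := hhE_coeff k n.
Definition F_n (n : nat) : Cplx -> Cplx := F_nk n 0.

(* Main.v *)
(* With [theta(t)] the sum of [e^(- pi t |m z + n|^2 / y)] over all [(m, n)], Poisson summation gives
   [theta(1/t) = t theta(t)], and the Mellin transform of [theta - 1] yields, for all [s],
     hat-hat E_0(z, s) = 1/2 + s (s - 1) / 2 * (Lambda(z, s) + Lambda(z, 1 - s)),
   where [Lambda(z, s)] is the integral of [(theta(t) - 1) t^(s-1) dt] over [t >= 1]. Expanding [t^s]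
   in powers of [s] gives [F_n] as such integrals with weights [(ln t)^j] and [t (ln t)^j]; integration by
   parts in [t] then gives [Delta F_0 = 0] and [Delta F_(n+1) = F_(n-1) - F_n] (with [F_(-1) = 0]),
   while [F_0 = 1/2]. Hence [Delta^n F_n] is a nonzero constant, which yields linear independence.
   Conversely, if [Delta^m f = 0] then [g = Delta^(m-1) f] is invariant and harmonic. Its Fourier
   coefficients are derivatives of functions of moderate growth, which excludes the exponentially
   growing solutions, so [g] is [a + b y] up to an exponentially small error. Up to sign, [g] then
   attains its minimum on the fundamental domain, and the mean value property makes it constant.
   Subtracting a multiple of [F_(m-1)] lowers [m]. *)
From Coquelicot Require Import Rcomplements Rbar Lim_seq Continuity Derive Derive_2d RInt RInt_analysis Hierarchy Series PSeries AutoDerive Compactness.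
From Stdlib Require Import Reals Lra Lia ZArith List ClassicalEpsilon Permutation.
Require Import Defs.
Open Scope R_scope.

(** [F_n] is an [epsilon] choice, so nothing is known about it until a power series with the
    defining property is exhibited and shown to be unique; uniqueness has only Re s > 1 to start
    from and needs an identity theorem that reaches s = 0. [Gamma_val] is Gauss's limit, while a
    Mellin transform yields Euler's integral; the two are matched by the concentration of t^n e^(-t)
    near t = n. With t = e^u, powers of t become exponentials and powers of ln t become polynomials:
    every weight grows at most exponentially in u, against theta terms that decay like exp(-c e^u).
    This makes differentiation of all orders under sum and integral uniform. On weights the
    Laplacian becomes w'' - w'. Its boundary terms at u = 0 add up to a constant because theta(1/t)
    = t theta(t), differentiated at t = 1, gives 2 theta'(1) + theta(1) = 0. For the half-integral
    space: a holomorphic Delta^(m-1) f is harmonic by Cauchy-Riemann, hence constant by the same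
    argument, and constants are both holomorphic and killed by Delta. *)

Ltac rring := apply Rminus_diag_uniq; ring.

(** * Integrals of continuous functions, mean value and Taylor estimates *)

Notation contR f := (forall x : R, continuous (f : R -> R) x).

Lemma contR_ex_RInt (f : R -> R) a b : contR f -> ex_RInt f a b.
Proof. intros H; apply (ex_RInt_continuous (V := R_CompleteNormedModule)); auto. Qed.

Lemma RIplus (f g : R -> R) a b : contR f -> contR g ->
  RInt (fun x => f x + g x) a b = RInt f a b + RInt g a b.
Proof. intros; apply (RInt_plus (V := R_CompleteNormedModule)); apply contR_ex_RInt; auto. Qed.

Lemma RIminus (f g : R -> R) a b : contR f -> contR g ->
  RInt (fun x => f x - g x) a b = RInt f a b - RInt g a b.
Proof. intros; apply (RInt_minus (V := R_CompleteNormedModule)); apply contR_ex_RInt; auto. Qed.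

Lemma RIscal (f : R -> R) c a b : contR f ->
  RInt (fun x => c * f x) a b = c * RInt f a b.
Proof. intros; apply (RInt_scal (V := R_CompleteNormedModule)); apply contR_ex_RInt; auto. Qed.

Lemma RIconst c a b : RInt (fun _ : R => c) a b = (b - a) * c.
Proof. apply (RInt_const (V := R_CompleteNormedModule)). Qed.

Lemma RIChasles (f : R -> R) a b c : contR f ->
  RInt f a b + RInt f b c = RInt f a c.
Proof. intros; apply (RInt_Chasles (V := R_CompleteNormedModule)); apply contR_ex_RInt; auto. Qed.

Lemma RIle (f g : R -> R) a b : a <= b -> contR f -> contR g ->
  (forall x, a <= x <= b -> f x <= g x) -> RInt f a b <= RInt g a b.
Proof.
intros; apply RInt_le; auto; try (apply contR_ex_RInt; auto).
intros; apply H2; lra.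
Qed.

Lemma RIabs (f g : R -> R) a b : a <= b -> contR f -> contR g ->
  (forall x, a <= x <= b -> Rabs (f x) <= g x) -> Rabs (RInt f a b) <= RInt g a b.
Proof.
intros Hab Hf Hg H.
apply Rabs_le; split.
- replace (- RInt g a b) with (RInt (fun x => (-1) * g x) a b) by (rewrite (RIscal g); [rring|auto]).
  apply RIle; auto.
  + intros x; apply (continuous_scal_r (-1) g); auto.
  + intros x Hx; specialize (H x Hx). apply Rabs_le_between in H; lra.
- apply RIle; auto. intros x Hx; specialize (H x Hx). apply Rabs_le_between in H; lra.
Qed.

Lemma RIabs_const (f : R -> R) M a b : a <= b -> contR f ->
  (forall x, a <= x <= b -> Rabs (f x) <= M) -> Rabs (RInt f a b) <= (b - a) * M.
Proof.
intros; rewrite <- RIconst; apply RIabs; auto; intros; apply continuous_const.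
Qed.

Lemma FTC (F f : R -> R) a b : (forall x, is_derive F x (f x)) -> contR f ->
  RInt f a b = F b - F a.
Proof.
intros HF Hf. apply is_RInt_unique.
apply (is_RInt_derive (V := R_CompleteNormedModule) F f); auto.
Qed.

Lemma FTC_is_derive (f : R -> R) a x : contR f ->
  is_derive (fun b => RInt f a b) x (f x).
Proof.
intros Hf. apply (is_derive_RInt (V := R_CompleteNormedModule) f _ a x); auto.
apply filter_forall; intros b. apply RInt_correct, contR_ex_RInt; auto.
Qed.

Lemma RI_comp_lin (f : R -> R) u v a b : contR f ->
  RInt (fun y => u * f (u * y + v)) a b = RInt f (u * a + v) (u * b + v).
Proof.
intros Hf. apply (RInt_comp_lin (V := R_CompleteNormedModule)), contR_ex_RInt; auto.
Qed.

Lemma RI_shift (f : R -> R) c a b : contR f ->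
  RInt (fun y => f (y + c)) a b = RInt f (a + c) (b + c).
Proof.
intros Hf. rewrite (RInt_ext _ (fun y => 1 * f (1 * y + c))).
- rewrite RI_comp_lin; auto. f_equal; ring.
- intros; rewrite !Rmult_1_l; auto.
Qed.

Lemma derive_contR (f f' : R -> R) : (forall x, is_derive f x (f' x)) -> contR f.
Proof. intros H x; apply (ex_derive_continuous f x); eexists; apply H. Qed.

Lemma contR_plus (f g : R -> R) : contR f -> contR g -> contR (fun x => f x + g x).
Proof. intros; apply (continuous_plus f g); auto. Qed.

Lemma contR_minus (f g : R -> R) : contR f -> contR g -> contR (fun x => f x - g x).
Proof. intros; apply (continuous_minus f g); auto. Qed.

Lemma contR_mult (f g : R -> R) : contR f -> contR g -> contR (fun x => f x * g x).
Proof. intros; apply (continuous_mult f g); auto. Qed.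

Lemma contR_const c : contR (fun _ => c).
Proof. intros; apply continuous_const. Qed.

Lemma contR_comp (f g : R -> R) : contR f -> contR g -> contR (fun x => f (g x)).
Proof. intros; apply (continuous_comp g f); auto. Qed.

Lemma contR_abs (f : R -> R) : contR f -> contR (fun x => Rabs (f x)).
Proof. intros H x; apply (continuous_comp f Rabs); auto; apply continuity_pt_filterlim, Rcontinuity_abs. Qed.

Lemma MVT_le (f f' : R -> R) M a b :
  (forall x, Rmin a b <= x <= Rmax a b -> is_derive f x (f' x)) ->
  (forall x, Rmin a b <= x <= Rmax a b -> Rabs (f' x) <= M) ->
  Rabs (f b - f a) <= M * Rabs (b - a).
Proof.
intros Hd HM. destruct (MVT_gen f a b f') as [c [Hc E]].
- intros x Hx; apply Hd; lra.
- intros x Hx. apply continuity_pt_filterlim. apply (ex_derive_continuous f x); eexists; apply Hd; auto.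
- rewrite E, Rabs_mult. apply Rmult_le_compat_r; [apply Rabs_pos|auto].
Qed.

(** The mean value bound is used twice, for f' and then for f(x) - f'(a)(x - a). This yields [M] in
    place of the sharp M/2; the constant is immaterial in what follows. *)
Lemma Taylor2_le (f f' f'' : R -> R) M a b :
  (forall x, Rmin a b <= x <= Rmax a b -> is_derive f x (f' x)) ->
  (forall x, Rmin a b <= x <= Rmax a b -> is_derive f' x (f'' x)) ->
  (forall x, Rmin a b <= x <= Rmax a b -> Rabs (f'' x) <= M) ->
  Rabs (f b - f a - f' a * (b - a)) <= M * (b - a) ^ 2.
Proof.
intros Hd Hd2 HM.
assert (H1 : Rabs ((f b - f' a * (b - a)) - (f a - f' a * (a - a))) <= (M * Rabs (b - a)) * Rabs (b - a)).
{ apply (MVT_le (fun x => f x - f' a * (x - a)) (fun x => f' x - f' a)).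
  - intros x Hx. apply (is_derive_minus f (fun x => f' a * (x - a)) x (f' x) (f' a)); auto.
    auto_derive; auto; ring.
  - intros x Hx.
    assert (Hs : Rmin a b <= Rmin a x /\ Rmax a x <= Rmax a b).
    { unfold Rmin, Rmax in *; repeat destruct Rle_dec; lra. }
    apply Rle_trans with (M * Rabs (x - a)).
    + apply (MVT_le f' f''); intros t Ht; [apply Hd2|apply HM]; lra.
    + apply Rmult_le_compat_l.
      * apply Rle_trans with (Rabs (f'' x)); [apply Rabs_pos|apply HM; auto].
      * unfold Rmin, Rmax, Rabs in *; repeat destruct Rle_dec; repeat destruct Rcase_abs; lra. }
replace (f b - f a - f' a * (b - a)) with (f b - f' a * (b - a) - (f a - f' a * (a - a))) by ring.
eapply Rle_trans; [apply H1|]. rewrite Rmult_assoc, <- Rabs_mult, Rabs_pos_eq.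
- apply Req_le; ring.
- apply (Rle_0_sqr (b - a)).
Qed.

(** A quadratic remainder bound is an inequality with an explicit constant, so it survives summation
    and integration under a majorant. Derivatives of lattice sums and of improper integrals are
    obtained in this way, from bounds on second derivatives. *)
Lemma is_derive_quadratic (f : R -> R) x l C d : 0 < d ->
  (forall h, Rabs h < d -> Rabs (f (x + h) - f x - l * h) <= C * h ^ 2) ->
  is_derive f x l.
Proof.
intros Hd H. apply is_derive_Reals. intros eps Heps.
assert (HC : 0 < Rabs C + 1) by (pose proof (Rabs_pos C); lra).
assert (Hm : 0 < Rmin d (eps / (Rabs C + 1))).
{ apply Rmin_pos; auto. apply Rdiv_lt_0_compat; auto. }
exists (mkposreal _ Hm). intros h Hh0 Hh; simpl in Hh.
assert (Hh1 : Rabs h < d) by (eapply Rlt_le_trans; [apply Hh|apply Rmin_l]).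
assert (Hh2 : Rabs h < eps / (Rabs C + 1)) by (eapply Rlt_le_trans; [apply Hh|apply Rmin_r]).
specialize (H h Hh1).
assert (Hp : 0 < Rabs h) by (apply Rabs_pos_lt; auto).
replace ((f (x + h) - f x) / h - l) with ((f (x + h) - f x - l * h) / h) by (field; auto).
unfold Rdiv; rewrite Rabs_mult, Rabs_inv.
apply Rmult_lt_reg_r with (Rabs h); auto.
rewrite Rmult_assoc, Rinv_l, Rmult_1_r by lra.
eapply Rle_lt_trans; [apply H|].
replace (h ^ 2) with (Rabs h * Rabs h) by (rewrite <- Rabs_mult, Rabs_pos_eq; [ring|apply (Rle_0_sqr h)]).
rewrite <- Rmult_assoc. apply Rmult_lt_compat_r; auto.
apply Rle_lt_trans with (Rabs C * Rabs h).
- apply Rmult_le_compat_r; [lra|apply Rle_abs].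
- apply Rle_lt_trans with ((Rabs C + 1) * Rabs h); [nra|].
  apply Rlt_le_trans with ((Rabs C + 1) * (eps / (Rabs C + 1))).
  + apply Rmult_lt_compat_l; auto.
  + apply Req_le; field; lra.
Qed.

Ltac pow2n := repeat match goal with |- context [?x * (?x * 1)] => change (x * (x * 1)) with (x ^ 2) end.

Lemma RI_swap (f : R -> R) a b : contR f -> RInt f b a = - RInt f a b.
Proof.
intros Hf. pose proof (RIChasles f a b a Hf) as H.
assert (E : RInt f a a = 0) by apply (RInt_point (V := R_CompleteNormedModule)). lra.
Qed.

Lemma RI_opp (f : R -> R) a b : contR f -> RInt (fun y => f (- y)) a b = RInt f (- b) (- a).
Proof.
intros Hf. pose proof (RI_comp_lin f (-1) 0 a b Hf) as H.
replace (-1 * a + 0) with (- a) in H by ring. replace (-1 * b + 0) with (- b) in H by ring.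
rewrite (RI_swap f (- a) (- b) Hf), <- H.
assert (Hc : contR (fun y => f (- y))).
{ apply (contR_comp f); auto. intros x. apply (ex_derive_continuous Ropp x). auto_derive; auto. }
rewrite (RInt_ext (fun y => -1 * f (-1 * y + 0)) (fun y => -1 * f (- y))).
- rewrite (RIscal (fun y => f (- y))) by auto. rring.
- intros x _. f_equal. f_equal. ring.
Qed.

(** * Unordered sums *)

Fixpoint fsum {T} (f : T -> R) (l : list T) : R :=
  match l with nil => 0 | v :: l => f v + fsum f l end.

(** Convergence along the finite subsets ordered by inclusion, that is, unconditional summability.
    No enumeration of the lattice is fixed, so [SL_2(Z)] may permute it and the two summation
    variables may be exchanged. *)
Definition is_usum {T} (f : T -> R) (l : R) : Prop :=
  forall eps, 0 < eps -> exists A, NoDup A /\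
    forall B, NoDup B -> incl A B -> Rabs (fsum f B - l) <= eps.

Definition usum {T} (f : T -> R) : R := epsilon (inhabits 0) (is_usum f).

(** Summability of a nonnegative majorant, expressed by bounded finite sums so that comparison and
    scaling do not mention the value of the sum. *)
Definition dom {T} (M : T -> R) : Prop :=
  (forall v, 0 <= M v) /\ exists K, forall B, NoDup B -> fsum M B <= K.

Definition eq_dec_cl {T} (x y : T) : {x = y} + {x <> y} := excluded_middle_informative (x = y).

Lemma fsum_ext {T} (f g : T -> R) l : (forall v, In v l -> f v = g v) -> fsum f l = fsum g l.
Proof. induction l; simpl; intros H; auto. rewrite H, IHl; auto. Qed.

Lemma fsum_plus {T} (f g : T -> R) l : fsum (fun v => f v + g v) l = fsum f l + fsum g l.
Proof. induction l; simpl; [ring|rewrite IHl; ring]. Qed.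

Lemma fsum_scal {T} c (f : T -> R) l : fsum (fun v => c * f v) l = c * fsum f l.
Proof. induction l; simpl; [ring|rewrite IHl; ring]. Qed.

Lemma fsum_le {T} (f g : T -> R) l : (forall v, In v l -> f v <= g v) -> fsum f l <= fsum g l.
Proof. induction l; simpl; intros H; [lra|]. apply Rplus_le_compat; auto. Qed.

Lemma fsum_abs {T} (f : T -> R) l : Rabs (fsum f l) <= fsum (fun v => Rabs (f v)) l.
Proof.
induction l; simpl; [rewrite Rabs_R0; lra|].
eapply Rle_trans; [apply Rabs_triang|lra].
Qed.

Lemma fsum_nonneg {T} (f : T -> R) l : (forall v, 0 <= f v) -> 0 <= fsum f l.
Proof. intros H; induction l; simpl; [lra|]. specialize (H a); lra. Qed.

Lemma fsum_app {T} (f : T -> R) l1 l2 : fsum f (l1 ++ l2) = fsum f l1 + fsum f l2.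
Proof. induction l1; simpl; [ring|rewrite IHl1; ring]. Qed.

Lemma fsum_perm {T} (f : T -> R) l1 l2 : Permutation l1 l2 -> fsum f l1 = fsum f l2.
Proof. induction 1; simpl; lra. Qed.

Lemma fsum_map {T U} (g : T -> U) (f : U -> R) l : fsum f (map g l) = fsum (fun v => f (g v)) l.
Proof. induction l; simpl; auto. rewrite IHl; auto. Qed.

Lemma incl_split {T} (A B : list T) : NoDup A -> NoDup B -> incl A B ->
  exists C, NoDup C /\ (forall v, In v C -> ~ In v A) /\ Permutation B (A ++ C).
Proof.
intros HA HB HAB.
exists (filter (fun v => if in_dec eq_dec_cl v A then false else true) B).
assert (Hc : forall v, In v (filter (fun v => if in_dec eq_dec_cl v A then false else true) B) <-> In v B /\ ~ In v A).
{ intros v; rewrite filter_In. destruct in_dec; intuition discriminate. }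
split; [|split].
- apply NoDup_filter; auto.
- intros v Hv; apply Hc in Hv; tauto.
- apply NoDup_Permutation; auto.
  + apply NoDup_app; auto.
    * apply NoDup_filter; auto.
    * intros v Hv Hv'; apply Hc in Hv'; tauto.
  + intros v; rewrite in_app_iff, Hc. destruct (in_dec eq_dec_cl v A); intuition.
Qed.

Lemma fsum_incl {T} (f : T -> R) A B : (forall v, 0 <= f v) ->
  NoDup A -> NoDup B -> incl A B -> fsum f A <= fsum f B.
Proof.
intros Hf HA HB HAB. destruct (incl_split A B) as [C [_ [_ HP]]]; auto.
rewrite (fsum_perm _ _ _ HP), fsum_app. pose proof (fsum_nonneg f C Hf); lra.
Qed.

Definition lunion {T} (A B : list T) := nodup eq_dec_cl (A ++ B).

Lemma lunion_nodup {T} (A B : list T) : NoDup (lunion A B).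
Proof. apply NoDup_nodup. Qed.

Lemma lunion_l {T} (A B : list T) : incl A (lunion A B).
Proof. intros v Hv; apply nodup_In, in_app_iff; auto. Qed.

Lemma lunion_r {T} (A B : list T) : incl B (lunion A B).
Proof. intros v Hv; apply nodup_In, in_app_iff; auto. Qed.

Lemma Rle_eps_eq a b : (forall eps, 0 < eps -> Rabs (a - b) <= eps) -> a = b.
Proof.
intros H. destruct (Req_dec a b) as [|n]; auto.
assert (Hp : 0 < Rabs (a - b)) by (apply Rabs_pos_lt; lra).
specialize (H (Rabs (a - b) / 2)); lra.
Qed.

Lemma is_usum_unique {T} (f : T -> R) l1 l2 : is_usum f l1 -> is_usum f l2 -> l1 = l2.
Proof.
intros H1 H2. apply Rle_eps_eq; intros eps He.
destruct (H1 (eps / 2)) as [A [HA HA']]; [lra|].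
destruct (H2 (eps / 2)) as [B [HB HB']]; [lra|].
specialize (HA' (lunion A B) (lunion_nodup _ _) (lunion_l _ _)).
specialize (HB' (lunion A B) (lunion_nodup _ _) (lunion_r _ _)).
apply Rabs_le_between in HA'. apply Rabs_le_between in HB'. apply Rabs_le; lra.
Qed.

Lemma usum_unique {T} (f : T -> R) l : is_usum f l -> usum f = l.
Proof.
intros H. apply (is_usum_unique f); auto.
unfold usum; apply epsilon_spec; exists l; auto.
Qed.

Lemma usum_correct {T} (f : T -> R) l : is_usum f l -> is_usum f (usum f).
Proof. intros H; rewrite (usum_unique _ _ H); auto. Qed.

Lemma is_usum_plus {T} (f g : T -> R) a b : is_usum f a -> is_usum g b ->
  is_usum (fun v => f v + g v) (a + b).
Proof.
intros H1 H2 eps He.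
destruct (H1 (eps / 2)) as [A [HA HA']]; [lra|].
destruct (H2 (eps / 2)) as [B [HB HB']]; [lra|].
exists (lunion A B); split; [apply lunion_nodup|]. intros D HD HDi.
specialize (HA' D HD (incl_tran (lunion_l A B) HDi)).
specialize (HB' D HD (incl_tran (lunion_r A B) HDi)).
rewrite fsum_plus. apply Rabs_le_between in HA'. apply Rabs_le_between in HB'. apply Rabs_le; lra.
Qed.

Lemma is_usum_scal {T} c (f : T -> R) a : is_usum f a -> is_usum (fun v => c * f v) (c * a).
Proof.
intros H eps He. pose proof (Rabs_pos c).
destruct (H (eps / (Rabs c + 1))) as [A [HA HA']]; [apply Rdiv_lt_0_compat; lra|].
exists A; split; auto. intros B HB HAB. specialize (HA' B HB HAB).
rewrite fsum_scal, <- Rmult_minus_distr_l, Rabs_mult.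
apply Rle_trans with (Rabs c * (eps / (Rabs c + 1))).
- apply Rmult_le_compat_l; auto.
- apply Rmult_le_reg_r with (Rabs c + 1); [lra|].
  replace (Rabs c * (eps / (Rabs c + 1)) * (Rabs c + 1)) with (Rabs c * eps) by (field; lra). nra.
Qed.

Lemma is_usum_ext {T} (f g : T -> R) a : (forall v, f v = g v) -> is_usum f a -> is_usum g a.
Proof.
intros E H eps He. destruct (H eps He) as [A [HA HA']]. exists A; split; auto.
intros B HB HAB. rewrite <- (fsum_ext f g); auto.
Qed.

Lemma usum_ext {T} (f g : T -> R) : (forall v, f v = g v) -> usum f = usum g.
Proof.
intros E. unfold usum. f_equal. 
assert (f = g) by (apply FunctionalExtensionality.functional_extensionality; auto). subst; auto.
Qed.

Lemma is_usum_nonneg_dom {T} (M : T -> R) : dom M -> exists l, is_usum M l.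
Proof.
intros [HM [K HK]].
destruct (completeness (fun x => exists B, NoDup B /\ x = fsum M B)) as [l [Hub Hlub]].
- exists K; intros x [B [HB ->]]; auto.
- exists 0, nil; split; [constructor|auto].
- exists l. intros eps He.
  destruct (classic (exists A, NoDup A /\ l - eps < fsum M A)) as [[A [HA HA']]|n].
  + exists A; split; auto. intros B HB HAB. pose proof (fsum_incl M A B HM HA HB HAB).
    assert (fsum M B <= l) by (apply Hub; eauto). apply Rabs_le; lra.
  + exfalso. assert (l <= l - eps); [|lra]. apply Hlub. intros x [B [HB ->]].
    apply Rnot_lt_le; intros Hl; apply n; eauto.
Qed.

Lemma dom_scal {T} c (M : T -> R) : 0 <= c -> dom M -> dom (fun v => c * M v).
Proof.
intros Hc [HM [K HK]]; split.
- intros v; apply Rmult_le_pos; auto.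
- exists (c * K); intros B HB; rewrite fsum_scal. apply Rmult_le_compat_l; auto.
Qed.

Lemma dom_le {T} (M N : T -> R) : (forall v, 0 <= M v <= N v) -> dom N -> dom M.
Proof.
intros H [HN [K HK]]; split; [intros v; apply H|].
exists K; intros B HB. eapply Rle_trans; [apply fsum_le|apply HK; auto]. intros; apply H.
Qed.

(** Write f = (f + M) - M: both parts are nonnegative with bounded finite sums, so the supremum
    argument applies to each. *)
Lemma is_usum_dom {T} (f M : T -> R) : dom M -> (forall v, Rabs (f v) <= M v) -> is_usum f (usum f).
Proof.
intros HM Hf.
assert (Hb : forall v, - M v <= f v <= M v) by (intros v; apply Rabs_le_between; auto).
destruct (is_usum_nonneg_dom (fun v => f v + M v)) as [a Ha].
{ apply dom_le with (fun v => 2 * M v).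
  - intros v; specialize (Hb v); lra.
  - apply dom_scal; auto; lra. }
destruct (is_usum_nonneg_dom M HM) as [b Hb'].
apply usum_correct with (a + (-1) * b).
apply is_usum_ext with (fun v => (f v + M v) + (-1) * M v); [intros; ring|].
apply is_usum_plus; auto. apply is_usum_scal; auto.
Qed.

Lemma is_usum_le {T} (f g : T -> R) a b : (forall v, f v <= g v) -> is_usum f a -> is_usum g b -> a <= b.
Proof.
intros H H1 H2. apply Rnot_lt_le; intros Hlt.
destruct (H1 ((a - b) / 3)) as [A [HA HA']]; [lra|].
destruct (H2 ((a - b) / 3)) as [B [HB HB']]; [lra|].
specialize (HA' (lunion A B) (lunion_nodup _ _) (lunion_l _ _)).
specialize (HB' (lunion A B) (lunion_nodup _ _) (lunion_r _ _)).
apply Rabs_le_between in HA'. apply Rabs_le_between in HB'.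
assert (fsum f (lunion A B) <= fsum g (lunion A B)) by (apply fsum_le; auto). lra.
Qed.

Lemma usum_scal {T} c (f M : T -> R) : dom M -> (forall v, Rabs (f v) <= M v) ->
  usum (fun v => c * f v) = c * usum f.
Proof. intros HM Hf. apply usum_unique, is_usum_scal, (is_usum_dom f M); auto. Qed.

Lemma usum_abs {T} (f M : T -> R) : dom M -> (forall v, Rabs (f v) <= M v) -> Rabs (usum f) <= usum M.
Proof.
intros HM Hf.
assert (Hb : forall v, - M v <= f v <= M v) by (intros v; apply Rabs_le_between; auto).
assert (HM' : is_usum M (usum M)).
{ destruct (is_usum_nonneg_dom M HM) as [l Hl]; eapply usum_correct; eauto. }
assert (Hf' : is_usum f (usum f)) by (apply (is_usum_dom f M); auto).
apply Rabs_le; split.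
- assert (- usum f <= usum M); [|lra]. apply is_usum_le with (fun v => (-1) * f v) M; auto.
  + intros v; specialize (Hb v); lra.
  + replace (- usum f) with ((-1) * usum f) by ring. apply is_usum_scal; auto.
- apply is_usum_le with f M; auto. intros v; apply Hb.
Qed.

Lemma is_usum_reindex {T U} (p : T -> U) (q : U -> T) (f : U -> R) a :
  (forall v, q (p v) = v) -> (forall w, p (q w) = w) ->
  is_usum f a -> is_usum (fun v => f (p v)) a.
Proof.
intros Hqp Hpq H eps He. destruct (H eps He) as [A [HA HA']].
assert (Hinj : forall (V W : Type) (p : V -> W) (q : W -> V), (forall v, q (p v) = v) ->
  forall l, NoDup l -> NoDup (map p l)).
{ intros V W p' q' E l Hl. apply FinFun.Injective_map_NoDup; auto.
  intros x y Hxy. rewrite <- (E x), <- (E y), Hxy; auto. }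
exists (map q A); split.
- eapply Hinj; eauto.
- intros B HB HAB. rewrite <- fsum_map. apply HA'.
  + eapply Hinj; eauto.
  + intros v Hv. rewrite <- (Hpq v). apply in_map, HAB, in_map; auto.
Qed.

(** The finite set depends on the majorant alone, so the tail estimate is uniform over all families
    below it. This uniformity in a parameter gives continuity of sums and their exchange with
    integrals. *)
Lemma usum_tail {T} (M : T -> R) : dom M -> forall eps, 0 < eps -> exists A, NoDup A /\
  forall B, NoDup B -> incl A B -> forall f, (forall v, Rabs (f v) <= M v) ->
  Rabs (usum f - fsum f B) <= eps.
Proof.
intros HM eps He. destruct (is_usum_nonneg_dom M HM) as [l Hl].
destruct (Hl (eps / 4)) as [A [HA HA']]; [lra|].
exists A; split; auto. intros B HB HAB f Hf.
assert (Hf' : is_usum f (usum f)) by (apply (is_usum_dom f M); auto).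
destruct (Hf' (eps / 4)) as [D [HD HD']]; [lra|].
specialize (HD' (lunion B D) (lunion_nodup _ _) (lunion_r _ _)).
(* The sums over [B] and over [lunion B D] differ by a sum over [C], which is disjoint from [A] and
   hence bounded by the tail of [M]. *)
destruct (incl_split B (lunion B D)) as [C [HC [_ HP]]]; auto.
{ apply lunion_nodup. } { apply lunion_l. }
rewrite (fsum_perm _ _ _ HP), fsum_app in HD'.
pose proof (HA' B HB HAB) as H1.
pose proof (HA' (lunion B D) (lunion_nodup _ _) (incl_tran HAB (lunion_l _ _))) as H2.
rewrite (fsum_perm _ _ _ HP), fsum_app in H2.
pose proof (fsum_abs f C) as H3.
assert (H4 : fsum (fun v => Rabs (f v)) C <= fsum M C) by (apply fsum_le; auto).
apply Rabs_le_between in H1. apply Rabs_le_between in H2.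
apply Rabs_le_between in HD'.
assert (H5 : Rabs (fsum f C) <= eps / 2) by lra. apply Rabs_le_between in H5.
apply Rabs_le; lra.
Qed.

Lemma is_usum_seq {T} (f : T -> R) a (L : nat -> list T) :
  is_usum f a -> (forall N, NoDup (L N)) ->
  (forall v, exists N0, forall N, (N0 <= N)%nat -> In v (L N)) ->
  is_lim_seq (fun N => fsum f (L N)) a.
Proof.
intros H HN HL. apply is_lim_seq_spec. intros eps.
destruct (H (eps / 2)) as [A [HA HA']]; [apply is_pos_div_2|].
assert (HE : exists N0, forall N, (N0 <= N)%nat -> incl A (L N)).
{ clear HA HA'. induction A as [|v A [N0 IH]].
  - exists 0%nat; intros N _ x [].
  - destruct (HL v) as [N1 H1]. exists (max N0 N1); intros N HN'.
    apply incl_cons; [apply H1; lia|apply IH; lia]. }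
destruct HE as [N0 HE]. exists N0; intros N HN'.
eapply Rle_lt_trans; [apply HA'; auto|]. pose proof (cond_pos eps); lra.
Qed.

Lemma fsum_fiber {T U} (f : T * U -> R) (B : T -> list U) l :
  fsum (fun m => fsum (fun n => f (m, n)) (B m)) l = fsum f (flat_map (fun m => map (pair m) (B m)) l).
Proof.
induction l; simpl; auto. rewrite fsum_app, fsum_map, IHl; auto.
Qed.

Lemma NoDup_fiber {T U} (B : T -> list U) l : NoDup l -> (forall m, NoDup (B m)) ->
  NoDup (flat_map (fun m => map (pair m) (B m)) l).
Proof.
intros Hl HB; induction Hl; simpl; [constructor|].
apply NoDup_app; auto.
- apply FinFun.Injective_map_NoDup; auto. intros a b E; congruence.
- intros [a b] H1 H2. apply in_map_iff in H1 as [n [E _]]. injection E as -> ->.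
  apply in_flat_map in H2 as [m [Hm Hm']]. apply in_map_iff in Hm' as [n' [E _]]. congruence.
Qed.

(** For a finite set of rows, each row sum is approximated by a finite part of the row that contains
    the entries of [A] in it. The union of these parts contains [A], so its total is already close
    to [a]. *)
Lemma usum_fubini {T U} (f : T * U -> R) (g : T -> R) a :
  is_usum f a -> (forall m, is_usum (fun n => f (m, n)) (g m)) -> is_usum g a.
Proof.
intros H Hg eps He. destruct (H (eps / 2)) as [A [HA HA']]; [lra|].
exists (nodup eq_dec_cl (map fst A)); split; [apply NoDup_nodup|].
intros B HB HAB.
(* An error of k per row adds up to at most eps/2 over [B]; the [+ 1] keeps the denominator positive
   when [B] is empty. *)
set (k := eps / (2 * (INR (length B) + 1))).
assert (Hlen := pos_INR (length B)).
assert (Hk : 0 < k) by (apply Rdiv_lt_0_compat; lra).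
assert (Hc : forall m, exists C, NoDup C /\ (forall n, In (m, n) A -> In n C) /\
   Rabs (fsum (fun n => f (m, n)) C - g m) <= k).
{ intros m. destruct (Hg m k Hk) as [C [HC HC']].
  set (A' := map snd (filter (fun v => if eq_dec_cl (fst v) m then true else false) A)).
  exists (lunion C A'); split; [apply lunion_nodup|]. split.
  - intros n Hn. apply lunion_r. unfold A'. apply in_map_iff. exists (m, n); split; auto.
    apply filter_In; split; auto. simpl; destruct eq_dec_cl; tauto.
  - apply HC'; [apply lunion_nodup|apply lunion_l]. }
set (Bs := fun m => epsilon (inhabits nil) (fun C => NoDup C /\ (forall n, In (m, n) A -> In n C) /\
   Rabs (fsum (fun n => f (m, n)) C - g m) <= k)).
assert (HBs : forall m, NoDup (Bs m) /\ (forall n, In (m, n) A -> In n (Bs m)) /\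
   Rabs (fsum (fun n => f (m, n)) (Bs m) - g m) <= k).
{ intros m; apply (epsilon_spec (inhabits nil) _ (Hc m)). }
specialize (HA' (flat_map (fun m => map (pair m) (Bs m)) B)).
assert (H1 : Rabs (fsum f (flat_map (fun m => map (pair m) (Bs m)) B) - a) <= eps / 2).
{ apply HA'.
  - apply NoDup_fiber; auto. apply HBs.
  - intros [m n] Hv. apply in_flat_map. exists m; split.
    + apply HAB, nodup_In. apply (in_map fst) in Hv; auto.
    + apply in_map, HBs; auto. }
rewrite <- fsum_fiber in H1.
assert (H2 : Rabs (fsum (fun m => fsum (fun n => f (m, n)) (Bs m)) B - fsum g B) <= INR (length B) * k).
{ clear - HBs. clearbody Bs k. induction B as [|b B IHB].
  - simpl. rewrite Rminus_0_r, Rabs_R0; lra.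
  - simpl length; rewrite S_INR; simpl fsum. destruct (HBs b) as [_ [_ Ha]].
    apply Rabs_le_between in Ha. apply Rabs_le_between in IHB. apply Rabs_le; lra. }
assert (H3 : INR (length B) * k <= eps / 2).
{ unfold k. apply Rmult_le_reg_r with (2 * (INR (length B) + 1)); [lra|].
  replace (INR (length B) * (eps / (2 * (INR (length B) + 1))) * (2 * (INR (length B) + 1)))
    with (INR (length B) * eps) by (field; lra). nra. }
apply Rabs_le_between in H1. apply Rabs_le_between in H2. apply Rabs_le; lra.
Qed.

Lemma contR_fsum {T} (g : T -> R -> R) B : (forall v, contR (g v)) -> contR (fun u => fsum (fun v => g v u) B).
Proof.
intros Hg; induction B; simpl; [apply contR_const|]. apply contR_plus; auto.
Qed.

(** On each interval |u| <= X the sum is a uniform limit of finite sums; the majorant may depend on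
    X. *)
Lemma contR_usum {T} (g : T -> R -> R) (M : R -> T -> R) :
  (forall v, contR (g v)) ->
  (forall X, dom (M X)) -> (forall X v u, Rabs u <= X -> Rabs (g v u) <= M X v) ->
  contR (fun u => usum (fun v => g v u)).
Proof.
intros Hc HM Hg u. apply continuity_pt_filterlim. intros eps He.
destruct (usum_tail (M (Rabs u + 1)) (HM _) (eps / 4)) as [A [HA HA']]; [lra|].
assert (HcA : continuity_pt (fun u => fsum (fun v => g v u) A) u).
{ apply continuity_pt_filterlim, contR_fsum; auto. }
destruct (HcA (eps / 4)) as [d [Hd Hd']]; [lra|].
exists (Rmin d 1); split; [apply Rmin_pos; lra|]. intros x [Hx Hxd].
simpl in *. unfold R_dist in *.
assert (Hx1 : Rabs (x - u) < d) by (eapply Rlt_le_trans; [apply Hxd|apply Rmin_l]).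
assert (Hx2 : Rabs (x - u) < 1) by (eapply Rlt_le_trans; [apply Hxd|apply Rmin_r]).
assert (Hx3 : Rabs x <= Rabs u + 1).
{ replace x with (u + (x - u)) by ring. eapply Rle_trans; [apply Rabs_triang|lra]. }
specialize (Hd' x (conj Hx Hx1)).
assert (Hu : Rabs u <= Rabs u + 1) by lra.
pose proof (HA' A HA (incl_refl A) (fun v => g v x) (fun v => Hg _ v x Hx3)) as H1.
pose proof (HA' A HA (incl_refl A) (fun v => g v u) (fun v => Hg _ v u Hu)) as H2.
apply Rabs_le_between in H1. apply Rabs_le_between in H2.
assert (Hd'' := Rlt_le _ _ Hd'). apply Rabs_le_between in Hd''.
apply Rle_lt_trans with (3 * (eps / 4)); [apply Rabs_le; lra|lra].
Qed.

Lemma RInt_fsum {T} (g : T -> R -> R) B a b : (forall v, contR (g v)) ->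
  RInt (fun u => fsum (fun v => g v u) B) a b = fsum (fun v => RInt (g v) a b) B.
Proof.
intros Hg; induction B; simpl.
- rewrite RIconst; rring.
- rewrite RIplus; auto. { rewrite IHB; auto. } apply contR_fsum; auto.
Qed.

(** * Integrals over the half line *)

Definition is_II (f : R -> R) (l : R) : Prop :=
  forall eps, 0 < eps -> exists b0, forall b, b0 <= b -> Rabs (RInt f 0 b - l) <= eps.

Definition II (f : R -> R) : R := epsilon (inhabits 0) (is_II f).

(** Exponential decay rather than mere integrability: it provides existence of the integral, the
    bound C/e and vanishing boundary terms at infinity all at once. *)
Definition decays (f : R -> R) (C e : R) : Prop :=
  contR f /\ 0 < e /\ forall u, 0 <= u -> Rabs (f u) <= C * exp (- (e * u)).

Lemma is_II_unique f a b : is_II f a -> is_II f b -> a = b.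
Proof.
intros Ha Hb. apply Rle_eps_eq; intros eps He.
destruct (Ha (eps / 2)) as [x Hx]; [lra|]. destruct (Hb (eps / 2)) as [y Hy]; [lra|].
specialize (Hx (Rmax x y) (Rmax_l _ _)). specialize (Hy (Rmax x y) (Rmax_r _ _)).
apply Rabs_le_between in Hx. apply Rabs_le_between in Hy. apply Rabs_le; lra.
Qed.

Lemma II_unique f a : is_II f a -> II f = a.
Proof.
intros H; apply (is_II_unique f); auto. unfold II; apply epsilon_spec; eauto.
Qed.

Lemma II_ext f g : (forall u, f u = g u) -> II f = II g.
Proof.
intros E. assert (f = g) by (apply FunctionalExtensionality.functional_extensionality; auto). subst; auto.
Qed.

Lemma is_II_plus f g a b : contR f -> contR g -> is_II f a -> is_II g b ->
  is_II (fun u => f u + g u) (a + b).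
Proof.
intros Hf Hg Ha Hb eps He.
destruct (Ha (eps / 2)) as [x Hx]; [lra|]. destruct (Hb (eps / 2)) as [y Hy]; [lra|].
exists (Rmax x y); intros z Hz. rewrite RIplus; auto.
assert (Hzx := Rle_trans _ _ _ (Rmax_l _ _) Hz). assert (Hzy := Rle_trans _ _ _ (Rmax_r _ _) Hz).
specialize (Hx z Hzx). specialize (Hy z Hzy).
apply Rabs_le_between in Hx. apply Rabs_le_between in Hy. apply Rabs_le; lra.
Qed.

Lemma is_II_scal f c a : contR f -> is_II f a -> is_II (fun u => c * f u) (c * a).
Proof.
intros Hf H eps He. pose proof (Rabs_pos c).
destruct (H (eps / (Rabs c + 1))) as [x Hx]; [apply Rdiv_lt_0_compat; lra|].
exists x; intros b Hb. specialize (Hx b Hb). rewrite RIscal; auto.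
rewrite <- Rmult_minus_distr_l, Rabs_mult.
apply Rle_trans with (Rabs c * (eps / (Rabs c + 1))).
- apply Rmult_le_compat_l; auto.
- apply Rmult_le_reg_r with (Rabs c + 1); [lra|].
  replace (Rabs c * (eps / (Rabs c + 1)) * (Rabs c + 1)) with (Rabs c * eps) by (field; lra). nra.
Qed.

Lemma contR_exp_decay C e : contR (fun u => C * exp (- (e * u))).
Proof. intros u. apply (ex_derive_continuous (fun u => C * exp (- (e * u))) u). auto_derive; auto. Qed.

Lemma exp_decay_small C e : 0 < e -> forall eps, 0 < eps -> exists b0, 0 <= b0 /\
  forall b, b0 <= b -> Rabs (C * exp (- (e * b))) <= eps.
Proof.
intros He eps Heps. pose proof (Rabs_pos C).
exists (Rabs C / (eps * e)). assert (H0 : 0 <= Rabs C / (eps * e)).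
{ apply Rmult_le_pos; auto. left; apply Rinv_0_lt_compat, Rmult_lt_0_compat; auto. }
split; auto. intros b Hb.
rewrite Rabs_mult, (Rabs_pos_eq (exp _)) by (left; apply exp_pos).
rewrite exp_Ropp. apply Rmult_le_reg_r with (exp (e * b)); [apply exp_pos|].
rewrite Rmult_assoc, Rinv_l by (apply Rgt_not_eq, exp_pos). rewrite Rmult_1_r.
assert (H1 : 1 + e * b <= exp (e * b)) by (apply exp_ineq1_le).
assert (H2 : Rabs C <= eps * (e * b)).
{ apply (Rmult_le_compat_l (eps * e)) in Hb; [|nra].
  replace (eps * e * (Rabs C / (eps * e))) with (Rabs C) in Hb by (field; lra). lra. }
nra.
Qed.

Lemma RInt_exp_decay C e a b : 0 < e ->
  RInt (fun u => C * exp (- (e * u))) a b = C / e * exp (- (e * a)) - C / e * exp (- (e * b)).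
Proof.
intros He. rewrite (FTC (fun u => - (C / e) * exp (- (e * u)))).
- rring.
- intros x. auto_derive; auto. field; lra.
- apply contR_exp_decay.
Qed.

(** Cauchy criterion: the integral over [a, b] is at most (C/e) e^(-e a). *)
Lemma II_correct f C e : decays f C e -> is_II f (II f).
Proof.
intros [Hc [He Hf]].
assert (HC : 0 <= C).
{ specialize (Hf 0 (Rle_refl 0)). rewrite Rmult_0_r, Ropp_0, exp_0 in Hf.
  pose proof (Rabs_pos (f 0)); lra. }
assert (Hcau : forall a b, 0 <= a <= b -> Rabs (RInt f a b) <= C / e * exp (- (e * a))).
{ intros a b Hab. apply Rle_trans with (RInt (fun u => C * exp (- (e * u))) a b).
  - apply RIabs; auto; [lra|apply contR_exp_decay|]. intros; apply Hf; lra.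
  - rewrite RInt_exp_decay by auto.
    assert (0 <= C / e * exp (- (e * b))); [|lra].
    apply Rmult_le_pos; [|left; apply exp_pos]. apply Rmult_le_pos; auto. left; apply Rinv_0_lt_compat; auto. }
destruct (proj1 (filterlim_locally_cauchy (U := R_CompleteSpace) (F := Rbar_locally p_infty) (fun b => RInt f 0 b))) as [l Hl].
- intros eps. destruct (exp_decay_small (C / e) e He (eps / 2)) as [b0 [Hb0 Hb]]; [apply is_pos_div_2|].
  exists (fun b => b0 < b); split; [exists b0; auto|].
  assert (Hw : forall u v, b0 < u -> u <= v -> Rabs (RInt f 0 v - RInt f 0 u) < eps).
  { intros u v Hu Huv. rewrite <- (RIChasles f 0 u v) by auto. replace (RInt f 0 u + RInt f u v - RInt f 0 u) with (RInt f u v) by rring.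
    eapply Rle_lt_trans; [apply Hcau; lra|]. specialize (Hb u (Rlt_le _ _ Hu)).
    apply Rabs_le_between in Hb. pose proof (cond_pos eps); lra. }
  intros u v Hu Hv. change (Rabs (RInt f 0 v - RInt f 0 u) < eps).
  destruct (Rle_dec u v) as [H|H].
  + apply Hw; auto.
  + rewrite Rabs_minus_sym. apply Hw; auto; lra.
- assert (H : is_II f l).
  { intros eps Heps. apply filterlim_locally with (eps := mkposreal eps Heps) in Hl.
    destruct Hl as [M HM]. exists (M + 1); intros b Hb.
    left. apply (HM b); lra. }
  rewrite (II_unique _ _ H); auto.
Qed.

Definition nice f := exists C e, decays f C e.

Lemma nice_cont f : nice f -> contR f.
Proof. intros [C [e H]]; apply H. Qed.

Lemma nice_II f : nice f -> is_II f (II f).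
Proof. intros [C [e H]]; eapply II_correct; eauto. Qed.

Lemma decays_weaken f C C' e e' : 0 < e' <= e -> C <= C' -> decays f C e -> decays f C' e'.
Proof.
intros He HC [Hc [He' Hf]]. split; [|split]; auto; [lra|].
intros u Hu. specialize (Hf u Hu). eapply Rle_trans; [apply Hf|].
assert (0 <= C).
{ destruct (Rle_dec 0 C); auto. pose proof (Rabs_pos (f u)). pose proof (exp_pos (- (e * u))). nra. }
apply Rmult_le_compat; auto; [left; apply exp_pos|].
destruct (Req_dec (e' * u) (e * u)) as [E|E]; [rewrite E; lra|]. left; apply exp_increasing. nra.
Qed.

Lemma nice_plus f g : nice f -> nice g -> nice (fun u => f u + g u).
Proof.
intros [C [e H]] [C' [e' H']].
assert (He := proj1 (proj2 H)). assert (He' := proj1 (proj2 H')).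
exists (C + C'), (Rmin e e').
destruct (decays_weaken f C C e (Rmin e e')) as [Hc [Hp Hf]]; auto; try lra.
{ split; [apply Rmin_pos; auto|apply Rmin_l]. }
destruct (decays_weaken g C' C' e' (Rmin e e')) as [Hc' [_ Hf']]; auto; try lra.
{ split; [apply Rmin_pos; auto|apply Rmin_r]. }
split; [apply contR_plus; auto|]. split; auto.
intros u Hu. eapply Rle_trans; [apply Rabs_triang|].
rewrite Rmult_plus_distr_r. apply Rplus_le_compat; auto.
Qed.

Lemma nice_scal c f : nice f -> nice (fun u => c * f u).
Proof.
intros [C [e [Hc [He Hf]]]]. exists (Rabs c * C), e. split; [|split]; auto.
- apply contR_mult; auto; apply contR_const.
- intros u Hu; rewrite Rabs_mult, Rmult_assoc. apply Rmult_le_compat_l; auto; apply Rabs_pos.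
Qed.

Lemma nice_ext f g : (forall u, f u = g u) -> nice f -> nice g.
Proof.
intros E. assert (f = g) by (apply FunctionalExtensionality.functional_extensionality; auto). subst; auto.
Qed.

Lemma nice_le f C e : contR f -> 0 < e -> (forall u, 0 <= u -> Rabs (f u) <= C * exp (- (e * u))) -> nice f.
Proof. intros; exists C, e; split; auto. Qed.

Lemma II_plus f g : nice f -> nice g -> II (fun u => f u + g u) = II f + II g.
Proof.
intros Hf Hg; apply II_unique, is_II_plus; auto using nice_cont, nice_II.
Qed.

Lemma II_scal c f : nice f -> II (fun u => c * f u) = c * II f.
Proof. intros Hf; apply II_unique, is_II_scal; auto using nice_cont, nice_II. Qed.

Lemma nice_minus f g : nice f -> nice g -> nice (fun u => f u - g u).
Proof.
intros Hf Hg. apply nice_ext with (fun u => f u + (-1) * g u); [intros; ring|].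
apply nice_plus; auto. apply nice_scal; auto.
Qed.

Lemma II_minus f g : nice f -> nice g -> II (fun u => f u - g u) = II f - II g.
Proof.
intros Hf Hg. rewrite (II_ext _ (fun u => f u + (-1) * g u)) by (intros; rring).
rewrite II_plus, II_scal; auto; [ring|]. apply nice_scal; auto.
Qed.

Lemma II_abs f C e : decays f C e -> Rabs (II f) <= C / e.
Proof.
intros H. assert (HI := II_correct f C e H). destruct H as [Hc [He Hf]].
assert (HC : 0 <= C).
{ specialize (Hf 0 (Rle_refl 0)). rewrite Rmult_0_r, Ropp_0, exp_0 in Hf.
  pose proof (Rabs_pos (f 0)); lra. }
apply Rnot_lt_le; intros Hlt.
destruct (HI ((Rabs (II f) - C / e) / 2)) as [b0 Hb]; [lra|].
specialize (Hb (Rmax 0 b0) (Rmax_r _ _)).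
assert (Hx := Rmax_l 0 b0). set (b := Rmax 0 b0) in *.
assert (H1 : Rabs (RInt f 0 b) <= C / e).
{ apply Rle_trans with (RInt (fun u => C * exp (- (e * u))) 0 b).
  - apply RIabs; auto; [apply contR_exp_decay|]. intros; apply Hf; lra.
  - rewrite RInt_exp_decay by auto. rewrite Rmult_0_r, Ropp_0, exp_0, Rmult_1_r.
    assert (0 <= C / e * exp (- (e * b))); [|lra].
    apply Rmult_le_pos; [|left; apply exp_pos]. apply Rmult_le_pos; auto. left; apply Rinv_0_lt_compat; auto. }
pose proof (Rabs_triang_inv (II f) (RInt f 0 b)). rewrite Rabs_minus_sym in Hb. lra.
Qed.

Lemma is_II_FTC (F f : R -> R) C e : (forall x, is_derive F x (f x)) -> contR f -> 0 < e ->
  (forall u, 0 <= u -> Rabs (F u) <= C * exp (- (e * u))) -> is_II f (- F 0).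
Proof.
intros HF Hc He Hb eps Heps. destruct (exp_decay_small C e He eps Heps) as [b0 [Hb0 H]].
exists b0; intros b Hbb. rewrite (FTC F f) by auto.
replace (F b - F 0 - - F 0) with (F b) by rring.
eapply Rle_trans; [apply Hb; lra|]. eapply Rle_trans; [apply Rle_abs|auto].
Qed.

Lemma II_FTC (F f : R -> R) C e : (forall x, is_derive F x (f x)) -> contR f -> 0 < e ->
  (forall u, 0 <= u -> Rabs (F u) <= C * exp (- (e * u))) -> II f = - F 0.
Proof. intros; apply II_unique; eapply is_II_FTC; eauto. Qed.

Lemma is_usum_abs_le {T} (f M : T -> R) a : dom M -> is_usum f a -> (forall v, Rabs (f v) <= M v) ->
  Rabs a <= usum M.
Proof.
intros HM H Hf. rewrite <- (usum_unique _ _ H). apply usum_abs; auto.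
Qed.

Lemma nice_fsum {T} (g : T -> R -> R) B : (forall v, nice (g v)) -> nice (fun u => fsum (fun v => g v u) B).
Proof.
intros Hg; induction B; simpl.
- exists 0, 1; split; [apply contR_const|]. split; [lra|]. intros; rewrite Rabs_R0; lra.
- apply nice_plus; auto.
Qed.

Lemma II_fsum {T} (g : T -> R -> R) B : (forall v, nice (g v)) ->
  II (fun u => fsum (fun v => g v u) B) = fsum (fun v => II (g v)) B.
Proof.
intros Hg; induction B; simpl.
- apply II_unique. intros eps He; exists 0; intros b Hb. rewrite RIconst.
  replace ((b - 0) * 0 - 0) with 0 by ring. rewrite Rabs_R0; lra.
- rewrite II_plus; auto. { rewrite IHB; auto. } apply nice_fsum; auto.
Qed.

(** Two majorants with different tasks: [M], with the factor e^(-e u), controls the half-line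
    integral; [MX], locally uniform on the whole line, makes the sum continuous also for u < 0, as
    [contR] demands. *)
Lemma usum_II {T} (g : T -> R -> R) (M : T -> R) (MX : R -> T -> R) e :
  (forall v, contR (g v)) -> 0 < e -> dom M ->
  (forall v u, 0 <= u -> Rabs (g v u) <= M v * exp (- (e * u))) ->
  (forall X, dom (MX X)) -> (forall X v u, Rabs u <= X -> Rabs (g v u) <= MX X v) ->
  nice (fun u => usum (fun v => g v u)) /\
  is_usum (fun v => II (g v)) (II (fun u => usum (fun v => g v u))).
Proof.
intros Hc He HM Hg HMX HgX.
assert (Hcont : contR (fun u => usum (fun v => g v u))) by (apply (contR_usum g MX); auto).
assert (HME : forall u, dom (fun v => M v * exp (- (e * u)))).
{ intros u. apply dom_le with (fun v => exp (- (e * u)) * M v).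
  - intros v; rewrite Rmult_comm. split; [|lra]. apply Rmult_le_pos; [left; apply exp_pos|apply HM].
  - apply dom_scal; auto. left; apply exp_pos. }
assert (Hn : nice (fun u => usum (fun v => g v u))).
{ apply nice_le with (usum M) e; auto. intros u Hu.
  eapply Rle_trans; [apply usum_abs with (M := fun v => M v * exp (- (e * u))); auto|].
  apply Req_le. rewrite (Rmult_comm (usum M)), (usum_ext (fun v => M v * exp (- (e * u))) (fun v => exp (- (e * u)) * M v)) by (intros; rring).
  apply usum_scal with M; auto. intros v; rewrite Rabs_pos_eq; [lra|apply HM]. }
assert (Hnv : forall v, nice (g v)).
{ intros v; apply nice_le with (M v) e; auto. }
split; auto. intros eps Heps.
destruct (usum_tail M HM (eps * e)) as [A [HA HA']]; [apply Rmult_lt_0_compat; auto|].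
exists A; split; auto. intros B HB HAB.
rewrite <- II_fsum by auto. rewrite Rabs_minus_sym, <- II_minus; auto; [|apply nice_fsum; auto].
replace eps with (eps * e / e) by (field; lra).
apply II_abs. split; [|split]; auto.
- apply contR_minus; auto. apply contR_fsum; auto.
- intros u Hu.
  (* Multiplied by e^(e u), the family lies below [M] for every u >= 0. A single finite set
     therefore works for all u, and the tail keeps the exponential decay. *)
  assert (Hf : forall v, Rabs (exp (e * u) * g v u) <= M v).
  { intros v. rewrite Rabs_mult, Rabs_pos_eq by (left; apply exp_pos).
    specialize (Hg v u Hu). apply (Rmult_le_compat_l (exp (e * u))) in Hg; [|left; apply exp_pos].
    eapply Rle_trans; [apply Hg|]. apply Req_le.
    rewrite exp_Ropp. field. apply Rgt_not_eq, exp_pos. }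
  specialize (HA' B HB HAB (fun v => exp (e * u) * g v u) Hf).
  rewrite fsum_scal in HA'.
  rewrite (usum_scal (exp (e * u)) (fun v => g v u) (fun v => M v * exp (- (e * u)))) in HA' by auto.
  rewrite <- Rmult_minus_distr_l, Rabs_mult, Rabs_pos_eq in HA' by (left; apply exp_pos).
  apply Rmult_le_reg_l with (exp (e * u)); [apply exp_pos|].
  eapply Rle_trans; [apply HA'|]. apply Req_le. rewrite exp_Ropp. field. apply Rgt_not_eq, exp_pos.
Qed.

Lemma usum_RInt {T} (g : T -> R -> R) (M : T -> R) (MX : R -> T -> R) a b : a <= b ->
  (forall v, contR (g v)) -> dom M ->
  (forall v u, a <= u <= b -> Rabs (g v u) <= M v) ->
  (forall X, dom (MX X)) -> (forall X v u, Rabs u <= X -> Rabs (g v u) <= MX X v) ->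
  is_usum (fun v => RInt (g v) a b) (RInt (fun u => usum (fun v => g v u)) a b).
Proof.
intros Hab Hc HM Hg HMX HgX.
assert (Hcont : contR (fun u => usum (fun v => g v u))) by (apply (contR_usum g MX); auto).
intros eps Heps.
destruct (usum_tail M HM (eps / (b - a + 1))) as [A [HA HA']]; [apply Rdiv_lt_0_compat; lra|].
exists A; split; auto. intros B HB HAB.
rewrite <- RInt_fsum by auto. rewrite Rabs_minus_sym, <- RIminus; auto; [|apply contR_fsum; auto].
apply Rle_trans with ((b - a) * (eps / (b - a + 1))).
- apply RIabs_const; auto.
  apply contR_minus; auto. apply contR_fsum; auto.
- apply Rmult_le_reg_r with (b - a + 1); [lra|].
  replace ((b - a) * (eps / (b - a + 1)) * (b - a + 1)) with ((b - a) * eps) by (field; lra). nra.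
Qed.

(** * Fejer's theorem *)

Fixpoint rsum (f : nat -> R) (n : nat) : R :=
  match n with O => 0 | S n => rsum f n + f n end.

Definition ccos (n : nat) (x : R) := cos (2 * PI * INR n * x).

Definition ssin (n : nat) (x : R) := sin (2 * PI * INR n * x).

Definition dirichlet (k : nat) (x : R) := 1 + 2 * rsum (fun n => ccos (S n) x) k.

(** Not divided by N: the integral over a period is N, and all estimates are compared with N times a
    bound. *)
Definition fejer (N : nat) (x : R) := rsum (fun k => dirichlet k x) N.

(** 2 sin(PI x) cos(2 PI n x) telescopes. Leaving sin(PI x) on the left covers the points where it
    vanishes. *)
Lemma sin_dirichlet k x : sin (PI * x) * dirichlet k x = sin ((2 * INR k + 1) * (PI * x)).
Proof.
unfold dirichlet, ccos. induction k; cbn [rsum].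
- simpl. rewrite Rmult_0_r, Rplus_0_r, Rmult_1_r. f_equal; ring.
- transitivity (sin (PI * x) * (1 + 2 * rsum (fun n => cos (2 * PI * INR (S n) * x)) k)
    + 2 * (sin (PI * x) * cos (2 * PI * INR (S k) * x))); [ring|].
  rewrite IHk, S_INR.
  replace ((2 * INR k + 1) * (PI * x)) with (2 * PI * (INR k + 1) * x - PI * x) by ring.
  replace ((2 * (INR k + 1) + 1) * (PI * x)) with (2 * PI * (INR k + 1) * x + PI * x) by ring.
  rewrite sin_plus, sin_minus. ring.
Qed.

(** The kernel is thus at most 1 / sin^2(PI x) independently of N, while its mass is N: the mass
    concentrates at 0. Nonnegativity is read off from here as well. *)
Lemma sin2_fejer N x : sin (PI * x) ^ 2 * fejer N x = sin (INR N * (PI * x)) ^ 2.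
Proof.
unfold fejer. induction N; cbn [rsum].
- simpl. rewrite Rmult_0_l, sin_0. ring.
- rewrite Rmult_plus_distr_l, IHN.
  replace (sin (PI * x) ^ 2 * dirichlet N x) with (sin (PI * x) * (sin (PI * x) * dirichlet N x)) by ring.
  rewrite sin_dirichlet, S_INR.
  set (a := INR N * (PI * x)). set (b := PI * x).
  replace ((2 * INR N + 1) * b) with (a + a + b) by (unfold a, b; ring).
  replace ((INR N + 1) * b) with (a + b) by (unfold a, b; ring).
  rewrite !sin_plus, !cos_plus.
  pose proof (sin2_cos2 a) as Ha. pose proof (sin2_cos2 b) as Hb. unfold Rsqr in *.
  replace (sin a ^ 2) with (sin a * sin a * (sin b * sin b + cos b * cos b)) by (rewrite Hb; ring).
  ring.
Qed.

Lemma contR_cos a : contR (fun x => cos (a * x)).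
Proof. intros x. apply (ex_derive_continuous (fun x => cos (a * x)) x). auto_derive; auto. Qed.

Lemma contR_sin a : contR (fun x => sin (a * x)).
Proof. intros x. apply (ex_derive_continuous (fun x => sin (a * x)) x). auto_derive; auto. Qed.

Lemma contR_rsum (f : nat -> R -> R) n : (forall k, contR (f k)) -> contR (fun x => rsum (fun k => f k x) n).
Proof.
intros H; induction n; cbn [rsum]; [apply contR_const|]. apply (contR_plus (fun x => rsum (fun k => f k x) n)); auto.
Qed.

Lemma contR_dirichlet k : contR (dirichlet k).
Proof.
unfold dirichlet. apply contR_plus; [apply contR_const|]. apply contR_mult; [apply contR_const|].
apply (contR_rsum (fun n x => ccos (S n) x)). intros n; apply contR_cos.
Qed.

Lemma contR_fejer N : contR (fejer N).
Proof. apply (contR_rsum (fun k x => dirichlet k x)). intros; apply contR_dirichlet. Qed.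

Lemma RInt_rsum (f : nat -> R -> R) n a b : (forall k, contR (f k)) ->
  RInt (fun x => rsum (fun k => f k x) n) a b = rsum (fun k => RInt (f k) a b) n.
Proof.
intros H; induction n; cbn [rsum].
- rewrite RIconst; rring.
- rewrite (RIplus (fun x => rsum (fun k => f k x) n)); auto; [rewrite IHn; auto|].
  apply contR_rsum; auto.
Qed.

Lemma rsum_ext f g n : (forall k, (k < n)%nat -> f k = g k) -> rsum f n = rsum g n.
Proof. induction n; intros H; simpl; auto. rewrite IHn, H; auto. Qed.

Lemma rsum_const c n : rsum (fun _ => c) n = INR n * c.
Proof. induction n; [simpl; ring|]. rewrite S_INR; simpl rsum; rewrite IHn; ring. Qed.

Lemma rsum_scal c f n : rsum (fun k => c * f k) n = c * rsum f n.
Proof. induction n; simpl; [ring|rewrite IHn; ring]. Qed.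

Lemma rsum_le f g n : (forall k, (k < n)%nat -> f k <= g k) -> rsum f n <= rsum g n.
Proof. induction n; simpl; intros H; [lra|]. apply Rplus_le_compat; auto. Qed.

Lemma rsum_abs f n : Rabs (rsum f n) <= rsum (fun k => Rabs (f k)) n.
Proof.
induction n; simpl; [rewrite Rabs_R0; lra|]. eapply Rle_trans; [apply Rabs_triang|lra].
Qed.

Lemma sin_INR_PI n : sin (INR n * PI) = 0.
Proof.
induction n; [simpl; rewrite Rmult_0_l; apply sin_0|].
rewrite S_INR, Rmult_plus_distr_r, Rmult_1_l, neg_sin, IHn; ring.
Qed.

Lemma RInt_ccos n : RInt (ccos (S n)) (- / 2) (/ 2) = 0.
Proof.
assert (Hn : INR (S n) <> 0) by (apply not_0_INR; lia). pose proof PI_neq0.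
rewrite (FTC (fun x => / (2 * PI * INR (S n)) * sin (2 * PI * INR (S n) * x))).
- replace (2 * PI * INR (S n) * / 2) with (INR (S n) * PI) by field.
  replace (2 * PI * INR (S n) * - / 2) with (- (INR (S n) * PI)) by field.
  rewrite sin_neg, sin_INR_PI; rring.
- intros x; unfold ccos. set (c := INR (S n)) in *. clearbody c. auto_derive; auto. field. auto.
- apply contR_cos.
Qed.

Lemma RInt_dirichlet k : RInt (dirichlet k) (- / 2) (/ 2) = 1.
Proof.
assert (H : contR (fun x => rsum (fun n => ccos (S n) x) k)).
{ apply (contR_rsum (fun n x => ccos (S n) x)). intros n; apply contR_cos. }
unfold dirichlet. rewrite (RIplus (fun _ => 1)), RIconst, RIscal, (RInt_rsum (fun n x => ccos (S n) x)); auto.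
- rewrite (rsum_ext _ (fun _ => 0)), rsum_const; [apply Rminus_diag_uniq; field|]. intros; apply RInt_ccos.
- intros; apply contR_cos.
- apply contR_const.
- apply contR_mult; auto; apply contR_const.
Qed.

Lemma fejer_nonneg N t : - / 2 <= t <= / 2 -> 0 <= fejer N t.
Proof.
intros Ht. destruct (Req_dec t 0) as [->|n].
(* At t = 0 the closed formula only says 0 = 0; each Dirichlet kernel takes the value 2k + 1
   there. *)
- unfold fejer. replace 0 with (rsum (fun _ => 0) N) at 1 by (rewrite rsum_const; ring).
  apply rsum_le; intros k _. unfold dirichlet.
  rewrite (rsum_ext _ (fun _ => 1)).
  + rewrite rsum_const. pose proof (pos_INR k); lra.
  + intros; unfold ccos; rewrite Rmult_0_r; apply cos_0.
- assert (Hs : 0 < sin (PI * t) ^ 2).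
  { pose proof PI_RGT_0.
    assert (sin (PI * t) <> 0).
    { destruct (Rlt_dec 0 t).
      - apply Rgt_not_eq, sin_gt_0; nra.
      - replace (PI * t) with (- (PI * - t)) by ring. rewrite sin_neg.
        apply Ropp_neq_0_compat, Rgt_not_eq, sin_gt_0; nra. }
    apply pow2_gt_0; auto. }
  pose proof (sin2_fejer N t) as E. pose proof (pow2_ge_0 (sin (INR N * (PI * t)))).
  apply Rmult_le_reg_l with (sin (PI * t) ^ 2); auto. lra.
Qed.

Lemma contR_bounded (f : R -> R) a b : a <= b -> contR f -> exists M, 0 <= M /\ forall x, a <= x <= b -> Rabs (f x) <= M.
Proof.
intros Hab Hf. destruct (continuity_ab_maj (fun x => Rabs (f x)) a b Hab) as [x0 [H _]].
- intros c _. apply continuity_pt_filterlim, contR_abs; auto.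
- exists (Rabs (f x0)); split; auto. apply Rabs_pos.
Qed.

Definition periodic1 (u : R -> R) := forall x, u (x + 1) = u x.

Lemma RInt_periodic_shift (u : R -> R) a : contR u -> periodic1 u -> RInt u a (a + 1) = RInt u 0 1.
Proof.
intros Hc Hp.
assert (H : RInt u 0 a = RInt u 1 (a + 1)).
{ replace 1 with (0 + 1) at 1 by ring. rewrite <- (RI_shift u 1 0 a); auto.
  apply RInt_ext; intros; symmetry; apply Hp. }
pose proof (RIChasles u 0 a (a + 1) Hc). pose proof (RIChasles u 0 1 (a + 1) Hc). lra.
Qed.

Lemma ccos_period n : periodic1 (ccos n).
Proof.
intros x; unfold ccos. replace (2 * PI * INR n * (x + 1)) with (2 * PI * INR n * x + 2 * INR n * PI) by ring.
apply cos_period.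
Qed.

Lemma ssin_period n : periodic1 (ssin n).
Proof.
intros x; unfold ssin. replace (2 * PI * INR n * (x + 1)) with (2 * PI * INR n * x + 2 * INR n * PI) by ring.
apply sin_period.
Qed.

(** Continuity near t = 0 and boundedness away from 0 are merged into one inequality. By
    [sin2_fejer] its second term contributes at most C when integrated against the kernel, whatever
    N is. *)
Lemma modulus_sin (u : R -> R) x eta : contR u -> 0 < eta ->
  exists C, 0 <= C /\ forall t, - / 2 <= t <= / 2 -> Rabs (u (x + t) - u x) <= eta + C * sin (PI * t) ^ 2.
Proof.
intros Hc He.
assert (Hc' : contR (fun t => u (x + t) - u x)).
{ apply contR_minus; [|apply contR_const]. apply (contR_comp u); auto.
  apply contR_plus; [apply contR_const|]. intros t; apply continuous_id. }
assert (Hab : - / 2 <= / 2) by lra.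
destruct (contR_bounded _ (- / 2) (/ 2) Hab Hc') as [M [HM0 HM]].
assert (Hx : continuity_pt u x) by (apply continuity_pt_filterlim, Hc).
destruct (Hx eta He) as [d [Hd Hd']].
(* At most 1/4, so that PI e stays where sin is positive and increasing; below d, the radius of
   continuity. *)
set (e := Rmin (d / 2) (/ 4)).
assert (He0 : 0 < e <= / 4). { split; [apply Rmin_pos; lra|apply Rmin_r]. }
assert (Hed : e < d). { apply Rle_lt_trans with (d / 2); [apply Rmin_l|lra]. }
pose proof PI_RGT_0 as HPI.
assert (Hse : 0 < sin (PI * e)) by (apply sin_gt_0; nra).
assert (Hp2 : 0 < sin (PI * e) ^ 2) by (apply pow2_gt_0; lra).
exists (M / sin (PI * e) ^ 2). split.
{ apply Rmult_le_pos; auto. left; apply Rinv_0_lt_compat; auto. }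
intros t Ht. destruct (Rlt_dec (Rabs t) e) as [Hlt|Hge].
- apply Rle_trans with eta.
  + destruct (Req_dec t 0) as [->|n].
    * rewrite Rplus_0_r, Rminus_diag, Rabs_R0; lra.
    * left. apply (Hd' (x + t)). split.
      { split; [exact I|]. lra. }
      simpl; unfold R_dist. replace (x + t - x) with t by ring. lra.
  + assert (0 <= M / sin (PI * e) ^ 2 * sin (PI * t) ^ 2); [|lra].
    apply Rmult_le_pos; [|apply pow2_ge_0]. apply Rmult_le_pos; auto. left; apply Rinv_0_lt_compat; auto.
- assert (Hs : sin (PI * e) ^ 2 <= sin (PI * t) ^ 2).
  { replace (sin (PI * t) ^ 2) with (sin (PI * Rabs t) ^ 2).
    - apply pow_incr. split; [lra|].
      assert (Rabs t <= / 2) by (apply Rabs_le; lra).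
      assert (PI * e <= PI * Rabs t) by (apply Rmult_le_compat_l; lra).
      assert (PI * Rabs t <= PI * / 2) by (apply Rmult_le_compat_l; lra).
      assert (0 < PI * e) by (apply Rmult_lt_0_compat; lra).
      apply sin_incr_1; lra.
    - unfold Rabs; destruct Rcase_abs; auto. replace (PI * - t) with (- (PI * t)) by ring. rewrite sin_neg; ring. }
  eapply Rle_trans; [apply HM; auto|].
  apply Rle_trans with (M / sin (PI * e) ^ 2 * sin (PI * t) ^ 2); [|lra].
  apply Rle_trans with (M / sin (PI * e) ^ 2 * sin (PI * e) ^ 2).
  + apply Req_le; field; lra.
  + apply Rmult_le_compat_l; auto. apply Rmult_le_pos; auto. left; apply Rinv_0_lt_compat; auto.
Qed.

(** Addition theorem for cos(2 PI n (x + t)) and periodicity. The left side is what convolution with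
    a Dirichlet kernel over [-1/2, 1/2] produces. *)
Lemma fourier_shift (u : R -> R) n x : contR u -> periodic1 u ->
  RInt (fun t => u (x + t) * ccos n t) (- / 2) (/ 2) =
  ccos n x * RInt (fun t => u t * ccos n t) 0 1 + ssin n x * RInt (fun t => u t * ssin n t) 0 1.
Proof.
intros Hc Hp.
assert (Hcc : contR (fun t => u t * ccos n t)) by (apply contR_mult; auto; apply contR_cos).
assert (Hcs : contR (fun t => u t * ssin n t)) by (apply contR_mult; auto; apply contR_sin).
rewrite <- (RInt_periodic_shift (fun t => u t * ccos n t) (- / 2 + x)), <- (RInt_periodic_shift (fun t => u t * ssin n t) (- / 2 + x)); auto.
2: intros t; rewrite Hp, ssin_period; auto.
2: intros t; rewrite Hp, ccos_period; auto.
rewrite <- !RIscal, <- RIplus; auto; try (apply contR_mult; auto; apply contR_const).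
replace (- / 2 + x + 1) with (/ 2 + x) by field.
rewrite <- RI_shift.
- apply RInt_ext. intros t _. rewrite (Rplus_comm t x). unfold ccos, ssin.
  replace (2 * PI * INR n * (x + t)) with (2 * PI * INR n * x + 2 * PI * INR n * t) by ring.
  rewrite sin_plus, cos_plus. pose proof (sin2_cos2 (2 * PI * INR n * x)) as E; unfold Rsqr in E.
  set (a := cos (2 * PI * INR n * x)) in *. set (b := sin (2 * PI * INR n * x)) in *.
  set (c := cos (2 * PI * INR n * t)). set (d := sin (2 * PI * INR n * t)).
  change (u (x + t) * c = a * (u (x + t) * (a * c - b * d)) + b * (u (x + t) * (b * c + a * d))).
  replace (u (x + t) * c) with (u (x + t) * c * (b * b + a * a)) by (rewrite E; ring). ring.
- apply contR_plus; apply contR_mult; auto; apply contR_const.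
Qed.

Lemma contR_translate (u : R -> R) x : contR u -> contR (fun t => u (x + t)).
Proof.
intros Hu. apply (contR_comp u); auto. apply contR_plus; [apply contR_const|]. intros t; apply continuous_id.
Qed.

(* Quantitative form of Fejer's theorem. *)
Lemma fourier_bound (u : R -> R) e0 (e : nat -> R) B : contR u -> periodic1 u ->
  Rabs (RInt u 0 1) <= e0 ->
  (forall n, Rabs (RInt (fun t => u t * ccos (S n) t) 0 1) <= e n) ->
  (forall n, Rabs (RInt (fun t => u t * ssin (S n) t) 0 1) <= e n) ->
  (forall n, e0 + 4 * rsum e n <= B) -> forall x, Rabs (u x) <= B.
Proof.
intros Hc Hp H0 Hcc Hss HB x.
assert (Hux : contR (fun t => u (x + t))) by (apply contR_translate; auto).
(* Convolution with a Dirichlet kernel is a Fourier partial sum. Each frequency brings a cosine and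
   a sine term with factor 2, hence the 4. *)
assert (HD : forall k, Rabs (RInt (fun t => u (x + t) * dirichlet k t) (- / 2) (/ 2)) <= B).
{ intros k. apply Rle_trans with (e0 + 4 * rsum e k); auto.
  rewrite (RInt_ext _ (fun t => u (x + t) + 2 * rsum (fun n => u (x + t) * ccos (S n) t) k)).
  2: { intros t _. rewrite rsum_scal. unfold dirichlet. rring. }
  assert (Hr : contR (fun t => rsum (fun n => u (x + t) * ccos (S n) t) k)).
  { apply (contR_rsum (fun n t => u (x + t) * ccos (S n) t)). intros; apply contR_mult; auto; apply contR_cos. }
  rewrite RIplus, RIscal, (RInt_rsum (fun n t => u (x + t) * ccos (S n) t)); auto.
  2: intros; apply contR_mult; auto; apply contR_cos.
  2: apply contR_mult; auto; apply contR_const.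
  eapply Rle_trans; [apply Rabs_triang|]. apply Rplus_le_compat.
  - rewrite (RInt_ext _ (fun t => u (t + x))) by (intros; rewrite Rplus_comm; auto).
    rewrite RI_shift; auto. replace (/ 2 + x) with (- / 2 + x + 1) by field.
    rewrite RInt_periodic_shift; auto.
  - rewrite Rabs_mult, Rabs_pos_eq by lra.
    replace (4 * rsum e k) with (2 * rsum (fun n => 2 * e n) k) by (rewrite rsum_scal; ring).
    apply Rmult_le_compat_l; [lra|]. eapply Rle_trans; [apply rsum_abs|].
    apply rsum_le; intros n _. rewrite fourier_shift; auto.
    eapply Rle_trans; [apply Rabs_triang|]. rewrite !Rabs_mult.
    assert (Rabs (ccos (S n) x) <= 1) by (apply Rabs_le; unfold ccos; apply COS_bound).
    assert (Rabs (ssin (S n) x) <= 1) by (apply Rabs_le; unfold ssin; apply SIN_bound).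
    specialize (Hcc n). specialize (Hss n).
    set (p := Rabs (RInt _ _ _)) in Hcc. set (q := Rabs (RInt _ _ _)) in Hss.
    assert (0 <= p) by apply Rabs_pos. assert (0 <= q) by apply Rabs_pos.
    fold p q. replace (2 * e n) with (e n + e n) by ring.
    apply Rplus_le_compat.
    + apply Rle_trans with (1 * p); [apply Rmult_le_compat_r; auto|lra].
    + apply Rle_trans with (1 * q); [apply Rmult_le_compat_r; auto|lra]. }
assert (HF : forall N, Rabs (RInt (fun t => u (x + t) * fejer N t) (- / 2) (/ 2)) <= INR N * B).
{ intros N.
  rewrite (RInt_ext _ (fun t => rsum (fun k => u (x + t) * dirichlet k t) N)).
  2: { intros t _. rewrite rsum_scal; auto. }
  rewrite (RInt_rsum (fun k t => u (x + t) * dirichlet k t)).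
  2: intros; apply contR_mult; auto; apply contR_dirichlet.
  eapply Rle_trans; [apply rsum_abs|]. rewrite <- rsum_const. apply rsum_le; auto. }
apply Rnot_lt_le; intros Hlt.
set (eta := (Rabs (u x) - B) / 3). assert (Heta : 0 < eta) by (unfold eta; lra).
destruct (modulus_sin u x eta Hc Heta) as [C [HC Hm]].
(* N > C/eta makes C < eta N. Then N |u(x)| <= N B + eta N + C < N (B + 2 eta), against |u(x)| = B +
   3 eta. *)
destruct (INR_unbounded (C / eta)) as [N HN].
assert (HN0 : 0 < INR N).
{ apply Rle_lt_trans with (C / eta); auto. apply Rmult_le_pos; auto. left; apply Rinv_0_lt_compat; auto. }
assert (Hint : RInt (fejer N) (- / 2) (/ 2) = INR N).
{ unfold fejer. rewrite (RInt_rsum (fun k t => dirichlet k t)); [|intros; apply contR_dirichlet].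
  rewrite (rsum_ext _ (fun _ => 1)), rsum_const; [rring|]. intros; apply RInt_dirichlet. }
assert (Hdiff : Rabs (RInt (fun t => (u (x + t) - u x) * fejer N t) (- / 2) (/ 2)) <= eta * INR N + C).
{ apply Rle_trans with (RInt (fun t => eta * fejer N t + C) (- / 2) (/ 2)).
  - apply RIabs; [lra| | |].
    + apply contR_mult; [|apply contR_fejer]. apply contR_minus; auto. apply contR_const.
    + apply contR_plus; [|apply contR_const]. apply contR_mult; [apply contR_const|apply contR_fejer].
    + intros t Ht. pose proof (fejer_nonneg N t Ht). rewrite Rabs_mult, (Rabs_pos_eq (fejer N t)) by auto.
      apply Rle_trans with ((eta + C * sin (PI * t) ^ 2) * fejer N t).
      * apply Rmult_le_compat_r; auto.
      * rewrite Rmult_plus_distr_r, Rmult_assoc, sin2_fejer.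
        assert (sin (INR N * (PI * t)) ^ 2 <= 1).
        { pose proof (SIN_bound (INR N * (PI * t))). nra. }
        nra.
  - rewrite RIplus, RIscal, RIconst, Hint; [|apply contR_fejer| |apply contR_const].
    + lra.
    + apply contR_mult; [apply contR_const|apply contR_fejer]. }
rewrite (RInt_ext _ (fun t => u (x + t) * fejer N t - u x * fejer N t)) in Hdiff by (intros; rring).
rewrite RIminus, RIscal, Hint in Hdiff; [|apply contR_fejer| |].
2: apply contR_mult; auto; apply contR_fejer.
2: apply contR_mult; [apply contR_const|apply contR_fejer].
specialize (HF N).
assert (HCN : C < eta * INR N).
{ apply (Rmult_lt_compat_l eta) in HN; auto. replace (eta * (C / eta)) with C in HN by (field; lra). auto. }
assert (Rabs (u x) * INR N <= INR N * B + (eta * INR N + C)).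
{ rewrite <- (Rabs_pos_eq (INR N)) at 1 by lra. rewrite <- Rabs_mult.
  apply Rabs_le_between in HF. apply Rabs_le_between in Hdiff. apply Rabs_le; lra. }
assert (Rabs (u x) = B + 3 * eta) by (unfold eta; field).
nra.
Qed.

(** * Lattice sums and the theta function *)

Definition zw (A : R) (n : Z) : R := Rpower (1 + Rabs (IZR n)) (- A).

(** A product weight instead of a power of |(m, n)|: its lattice sum factorizes into two sums over
    the integers and converges for every A > 1. *)
Definition pw (A : R) (v : Z * Z) : R := zw A (fst v) * zw A (snd v).

Fixpoint zl (N : nat) : list Z :=
  match N with O => 0%Z :: nil | S M => Z.of_nat N :: (- Z.of_nat N)%Z :: zl M end.

Lemma zl_In N n : In n (zl N) <-> (Z.abs n <= Z.of_nat N)%Z.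
Proof.
induction N; [simpl; lia|]. change (zl (S N)) with (Z.of_nat (S N) :: (- Z.of_nat (S N))%Z :: zl N).
simpl In. rewrite IHN. lia.
Qed.

Lemma zl_NoDup N : NoDup (zl N).
Proof.
induction N; [simpl; constructor; [intros []|constructor]|].
change (zl (S N)) with (Z.of_nat (S N) :: (- Z.of_nat (S N))%Z :: zl N).
constructor.
- intros [H|H]; [lia|]. apply zl_In in H; lia.
- constructor; auto. intros H; apply zl_In in H; lia.
Qed.

Lemma zl_incl (B : list Z) : exists N0, forall N, (N0 <= N)%nat -> incl B (zl N).
Proof.
induction B as [|b B [N0 H]]; [exists 0%nat; intros N _ x []|].
exists (max N0 (Z.abs_nat b)). intros N HN. apply incl_cons; [apply zl_In; lia|apply H; lia].
Qed.

Lemma zw_pos A n : 0 < zw A n.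
Proof. apply exp_pos. Qed.

Lemma one_plus_abs n : 1 <= 1 + Rabs (IZR n).
Proof. pose proof (Rabs_pos (IZR n)); lra. Qed.

(** Comparison with the integral of t^(-A) over [x, x + 1], by the mean value theorem for
    t^(1-A). *)
Lemma Rpower_telescope A x : 1 < A -> 1 <= x ->
  (A - 1) * Rpower (x + 1) (- A) <= Rpower x (1 - A) - Rpower (x + 1) (1 - A).
Proof.
intros HA Hx.
destruct (MVT_gen (fun t => Rpower t (1 - A)) x (x + 1) (fun t => (1 - A) * Rpower t (1 - A - 1))) as [c [Hc E]].
- intros t Ht. rewrite Rmin_left, Rmax_right in Ht by lra.
  apply is_derive_Reals, derivable_pt_lim_power; lra.
- intros t Ht. rewrite Rmin_left, Rmax_right in Ht by lra.
  apply derivable_continuous_pt. eexists. apply derivable_pt_lim_power; lra.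
- rewrite Rmin_left, Rmax_right in Hc by lra.
  replace (Rpower x (1 - A) - Rpower (x + 1) (1 - A)) with ((A - 1) * Rpower c (1 - A - 1)).
  + apply Rmult_le_compat_l; [lra|]. replace (1 - A - 1) with (- A) by ring.
    unfold Rpower. destruct (Req_dec c (x + 1)) as [->|n]; [lra|].
    left. apply exp_increasing. assert (ln c < ln (x + 1)) by (apply ln_increasing; lra). nra.
  + apply (f_equal Ropp) in E. ring_simplify in E. rewrite <- Ropp_minus_distr. 
    simpl in E. nra.
Qed.

Lemma fsum_zw A N : 1 < A -> fsum (zw A) (zl N) <= 1 + 2 / (A - 1) * (1 - Rpower (INR N + 1) (1 - A)).
Proof.
intros HA. induction N.
- assert (E : forall p, Rpower 1 p = 1) by (intros p; unfold Rpower; rewrite ln_1, Rmult_0_r; apply exp_0).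
  simpl. unfold zw. rewrite Rabs_R0. replace (1 + 0) with 1 by ring. replace (0 + 1) with 1 by ring. rewrite !E. lra.
- change (zl (S N)) with (Z.of_nat (S N) :: (- Z.of_nat (S N))%Z :: zl N). cbn [fsum].
  assert (E : zw A (- Z.of_nat (S N)) = zw A (Z.of_nat (S N))).
  { unfold zw. rewrite opp_IZR, Rabs_Ropp; auto. }
  rewrite E. unfold zw at 1 2. rewrite <- INR_IZR_INZ, Rabs_pos_eq by apply pos_INR.
  pose proof (pos_INR N). assert (HN1 : 1 <= INR N + 1) by lra.
  pose proof (Rpower_telescope A (INR N + 1) HA HN1) as HT. rewrite S_INR. rewrite (Rplus_comm 1).
  set (p := Rpower (INR N + 1 + 1) (- A)) in *. set (q := Rpower (INR N + 1) (1 - A)) in *.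
  set (r := Rpower (INR N + 1 + 1) (1 - A)) in *.
  assert (p <= / (A - 1) * (q - r)).
  { apply Rmult_le_reg_l with (A - 1); [lra|]. rewrite <- Rmult_assoc, Rinv_r by lra. lra. }
  unfold Rdiv in *. lra.
Qed.

Lemma dom_zw A : 1 < A -> dom (zw A).
Proof.
intros HA. split; [intros; left; apply zw_pos|]. exists (1 + 2 / (A - 1)). intros B HB.
destruct (zl_incl B) as [N HN]. eapply Rle_trans; [apply (fsum_incl (zw A) B (zl N)); auto|].
- intros; left; apply zw_pos.
- apply zl_NoDup.
- eapply Rle_trans; [apply fsum_zw; auto|].
  assert (0 < 2 / (A - 1)) by (apply Rdiv_lt_0_compat; lra).
  assert (0 < Rpower (INR N + 1) (1 - A)) by apply exp_pos. nra.
Qed.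

Lemma fsum_prod {T U} (f : T -> R) (g : U -> R) B C :
  fsum (fun v => f (fst v) * g (snd v)) (list_prod B C) = fsum f B * fsum g C.
Proof.
induction B; simpl; [ring|]. rewrite fsum_app, fsum_map, IHB. simpl. rewrite fsum_scal. ring.
Qed.

Lemma NoDup_prod {T U} (B : list T) (C : list U) : NoDup B -> NoDup C -> NoDup (list_prod B C).
Proof.
intros HB HC. induction HB; simpl; [constructor|]. apply NoDup_app; auto.
- apply FinFun.Injective_map_NoDup; auto. intros a b E; congruence.
- intros [a b] H1 H2. apply in_map_iff in H1 as [n [E _]]. injection E as -> ->.
  apply in_prod_iff in H2. tauto.
Qed.

Definition zl2 N := list_prod (zl N) (zl N).

Lemma zl2_NoDup N : NoDup (zl2 N).
Proof. apply NoDup_prod; apply zl_NoDup. Qed.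

Lemma zl2_incl (B : list (Z * Z)) : exists N0, forall N, (N0 <= N)%nat -> incl B (zl2 N).
Proof.
induction B as [|[a b] B [N0 H]]; [exists 0%nat; intros N _ x []|].
exists (max N0 (max (Z.abs_nat a) (Z.abs_nat b))). intros N HN.
apply incl_cons; [apply in_prod_iff; split; apply zl_In; lia|apply H; lia].
Qed.

Lemma dom_prod (M1 M2 : Z -> R) : dom M1 -> dom M2 -> dom (fun v => M1 (fst v) * M2 (snd v)).
Proof.
intros [H1 [K1 HK1]] [H2 [K2 HK2]]. split.
- intros v; apply Rmult_le_pos; auto.
- exists (K1 * K2). intros B HB. destruct (zl2_incl B) as [N HN].
  eapply Rle_trans; [apply (fsum_incl _ B (zl2 N)); auto|].
  + intros v; apply Rmult_le_pos; auto.
  + apply zl2_NoDup.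
  + unfold zl2. rewrite fsum_prod. apply Rmult_le_compat.
    * apply fsum_nonneg; auto. * apply fsum_nonneg; auto.
    * apply HK1, zl_NoDup. * apply HK2, zl_NoDup.
Qed.

Lemma dom_pw A : 1 < A -> dom (pw A).
Proof. intros HA. apply (dom_prod (zw A) (zw A)); apply dom_zw; auto. Qed.

Definition latD (v : Z * Z) : R := (1 + Rabs (IZR (fst v))) * (1 + Rabs (IZR (snd v))).

Lemma latD_ge1 v : 1 <= latD v.
Proof.
unfold latD. pose proof (one_plus_abs (fst v)). pose proof (one_plus_abs (snd v)). nra.
Qed.

Lemma pw_latD A v : pw A v = Rpower (latD v) (- A).
Proof.
unfold pw, zw, latD. pose proof (one_plus_abs (fst v)). pose proof (one_plus_abs (snd v)).
rewrite Rpower_mult_distr; auto; lra.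
Qed.

Lemma pw_pos A v : 0 < pw A v.
Proof. apply Rmult_lt_0_compat; apply zw_pos. Qed.

Lemma pw_le A B v : B <= A -> pw A v <= pw B v.
Proof.
intros H. rewrite !pw_latD. pose proof (latD_ge1 v).
apply Rle_Rpower; lra.
Qed.

Lemma PI_gt_3 : 3 < PI.
Proof. pose proof PI2_3_2; lra. Qed.

(** ln(X/A) <= X/A - 1, multiplied by A. It trades exponential decay for decay of any chosen order
    A. *)
Lemma exp_le_Rpower A X : 0 < A -> 0 < X -> exp (- X) <= Rpower A A * Rpower X (- A).
Proof.
intros HA HX. unfold Rpower. rewrite <- exp_plus.
assert (H : ln (X / A) <= X / A - 1).
{ assert (Hp : 0 < X / A) by (apply Rdiv_lt_0_compat; auto).
  pose proof (exp_ineq1_le (ln (X / A))). rewrite exp_ln in H by auto. lra. }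
unfold Rdiv in H. rewrite ln_mult, ln_Rinv in H; auto; [|apply Rinv_0_lt_compat; auto].
apply (Rmult_le_compat_l A) in H; [|lra].
replace (A * (X * / A - 1)) with (X - A) in H by (field; lra).
destruct (Rle_lt_or_eq_dec (- X) (A * ln A + - A * ln X)) as [Hl|He]; [lra|left; apply exp_increasing; auto|right; f_equal; auto].
Qed.

(* [|m z + n|^2 / y] for [v = (m, n)] *)
Definition Q (x y : R) (v : Z * Z) : R :=
  IZR (fst v) ^ 2 * y + (IZR (fst v) * x + IZR (snd v)) ^ 2 / y.

(** The factor 3 comes from (1 + |m|)(1 + |n|) <= 3 (m^2 + n^2) off the origin, the rest from n^2 <=
    2 (m x + n)^2 + 2 X^2 m^2 and m^2 <= Y^2 m^2 y^2. In the resulting bound Q >= (Qc / y)(1 +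
    |m|)(1 + |n|) the height y stays explicit, so that growth in y can be read off later. *)
Definition Qc (X Y : R) : R := / (3 * (2 + (1 + 2 * X ^ 2) * Y ^ 2)).

Lemma Qc_pos X Y : 0 < Qc X Y.
Proof. unfold Qc. apply Rinv_0_lt_compat. pose proof (pow2_ge_0 X). pose proof (pow2_ge_0 Y). nra. Qed.

Lemma IZR_sq_ge1 n : n <> 0%Z -> 1 <= IZR n ^ 2.
Proof.
intros H. replace (IZR n ^ 2) with (IZR (n * n)) by (rewrite mult_IZR; ring).
apply IZR_le. nia.
Qed.

Lemma Q_lower x y X Y v : Rabs x <= X -> 0 < Y -> / Y <= y -> v <> (0, 0)%Z ->
  Qc X Y / y * latD v <= Q x y v.
Proof.
intros Hx HY Hy Hv. destruct v as [m n]. unfold Q, latD; simpl fst; simpl snd.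
assert (Hy0 : 0 < y). { eapply Rlt_le_trans; [apply Rinv_0_lt_compat; apply HY|auto]. }
assert (HyY : 1 <= y * Y). { apply (Rmult_le_compat_r Y) in Hy; [|lra]. rewrite Rinv_l in Hy by lra. auto. }
assert (Hmn : 1 <= IZR m ^ 2 + IZR n ^ 2).
{ destruct (Z.eq_dec m 0) as [->|Hm].
  - assert (n <> 0%Z) by congruence. pose proof (IZR_sq_ge1 n H). pose proof (pow2_ge_0 0). simpl in *; lra.
  - pose proof (IZR_sq_ge1 m Hm). pose proof (pow2_ge_0 (IZR n)). lra. }
set (a := IZR m) in *. set (b := IZR n) in *.
assert (HD : (1 + Rabs a) * (1 + Rabs b) <= 3 * (a ^ 2 + b ^ 2)).
{ rewrite (pow2_abs a), (pow2_abs b) || rewrite <- (pow2_abs a), <- (pow2_abs b) in *.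
  pose proof (Rabs_pos a). pose proof (Rabs_pos b).
  pose proof (pow2_ge_0 (Rabs a - Rabs b)). pose proof (pow2_ge_0 (Rabs a - 1)). pose proof (pow2_ge_0 (Rabs b - 1)). nra. }
assert (Hb : b ^ 2 <= 2 * (a * x + b) ^ 2 + 2 * X ^ 2 * a ^ 2).
{ assert (Hx2 : x ^ 2 <= X ^ 2). { rewrite <- (pow2_abs x). apply pow_incr; split; [apply Rabs_pos|auto]. }
  pose proof (pow2_ge_0 (a * x + b + a * x)). pose proof (pow2_ge_0 a).
  assert (a ^ 2 * x ^ 2 <= a ^ 2 * X ^ 2) by (apply Rmult_le_compat_l; auto).
  pose proof (pow2_ge_0 (2 * (a * x) + b)). nra. }
assert (HY2 : a ^ 2 <= Y ^ 2 * (a ^ 2 * y ^ 2)).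
{ assert (1 <= (y * Y) ^ 2) by (apply pow_R1_Rle; auto). pose proof (pow2_ge_0 a). nra. }
set (P := a ^ 2 * y ^ 2 + (a * x + b) ^ 2).
assert (HP : a ^ 2 + b ^ 2 <= (2 + (1 + 2 * X ^ 2) * Y ^ 2) * P).
{ unfold P. pose proof (pow2_ge_0 (a * x + b)). pose proof (pow2_ge_0 X). pose proof (pow2_ge_0 Y).
  pose proof (pow2_ge_0 a). pose proof (pow2_ge_0 y).
  assert (0 <= a ^ 2 * y ^ 2) by (apply Rmult_le_pos; auto).
  assert (0 <= (1 + 2 * X ^ 2) * Y ^ 2 * (a * x + b) ^ 2) by (apply Rmult_le_pos; auto; nra).
  assert ((1 + 2 * X ^ 2) * a ^ 2 <= (1 + 2 * X ^ 2) * (Y ^ 2 * (a ^ 2 * y ^ 2))) by (apply Rmult_le_compat_l; nra).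
  nra. }
replace (a ^ 2 * y + (a * x + b) ^ 2 / y) with (P / y) by (unfold P; field; lra).
unfold Rdiv. rewrite (Rmult_comm _ (/ y)), Rmult_assoc, (Rmult_comm P).
apply Rmult_le_compat_l; [left; apply Rinv_0_lt_compat; auto|].
unfold Qc. set (K := 2 + (1 + 2 * X ^ 2) * Y ^ 2) in *.
assert (HK : 0 < K). { unfold K. pose proof (pow2_ge_0 X). pose proof (pow2_ge_0 Y). nra. }
apply Rmult_le_reg_l with (3 * K); [lra|]. rewrite <- Rmult_assoc, Rinv_r, Rmult_1_l by lra. nra.
Qed.

Lemma Q_nonneg x y v : 0 < y -> 0 <= Q x y v.
Proof.
intros Hy. unfold Q. apply Rplus_le_le_0_compat.
- apply Rmult_le_pos; [apply pow2_ge_0|lra].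
- apply Rmult_le_pos; [apply pow2_ge_0|left; apply Rinv_0_lt_compat; auto].
Qed.

Lemma Q_pos x y v : 0 < y -> v <> (0, 0)%Z -> 0 < Q x y v.
Proof.
intros Hy Hv. eapply Rlt_le_trans; [|apply (Q_lower x y (Rabs x) (/ y))]; auto.
- apply Rmult_lt_0_compat; [|pose proof (latD_ge1 v); lra].
  apply Rdiv_lt_0_compat; auto; apply Qc_pos.
- lra.
- apply Rinv_0_lt_compat; auto.
- rewrite Rinv_inv; lra.
Qed.

Lemma Rpower_neg_antimono A a b : 0 < A -> 0 < a <= b -> Rpower b (- A) <= Rpower a (- A).
Proof.
intros HA [Ha Hab]. unfold Rpower. destruct (Req_dec a b) as [->|n]; [lra|].
left; apply exp_increasing. assert (ln a < ln b) by (apply ln_increasing; lra). nra.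
Qed.

(** The order A is free: it yields summability over the lattice together with decay of the same
    order in t. *)
Lemma exp_Q_le x y X Y v A t : Rabs x <= X -> 0 < Y -> / Y <= y -> v <> (0, 0)%Z -> 0 < A -> 0 < t ->
  exp (- (PI * t * Q x y v)) <= Rpower A A * Rpower (Qc X Y / y) (- A) * Rpower t (- A) * pw A v.
Proof.
intros Hx HY Hy Hv HA Ht.
assert (Hy0 : 0 < y). { eapply Rlt_le_trans; [apply Rinv_0_lt_compat; apply HY|auto]. }
pose proof (Q_lower x y X Y v Hx HY Hy Hv) as HQ. pose proof (latD_ge1 v).
assert (Hc : 0 < Qc X Y / y) by (apply Rdiv_lt_0_compat; auto; apply Qc_pos).
rewrite pw_latD, !Rmult_assoc, !Rpower_mult_distr; try lra.
2: apply Rmult_lt_0_compat; lra.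
pose proof PI_gt_3 as HPI.
eapply Rle_trans; [apply exp_le_Rpower with (A := A); auto|].
- assert (0 < t * Q x y v) by (apply Rmult_lt_0_compat; auto; apply Q_pos; auto).
  rewrite ?Rmult_assoc. apply Rmult_lt_0_compat; lra.
- apply Rmult_le_compat_l; [left; apply exp_pos|]. apply Rpower_neg_antimono; auto. split.
  + apply Rmult_lt_0_compat; auto. apply Rmult_lt_0_compat; lra.
  + replace (Qc X Y / y * (t * latD v)) with (t * (Qc X Y / y * latD v)) by ring.
    apply Rle_trans with (t * Q x y v); [apply Rmult_le_compat_l; lra|].
    rewrite ?Rmult_assoc. assert (0 < t * Q x y v) by (apply Rmult_lt_0_compat; auto; apply Q_pos; auto).
    nra.
Qed.

Lemma zw2 n : zw 2 n = / (1 + Rabs (IZR n)) ^ 2.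
Proof.
unfold zw. pose proof (one_plus_abs n). rewrite Rpower_Ropp. f_equal.
replace 2 with (INR 2) at 1 by (simpl; ring). apply Rpower_pow; lra.
Qed.

Lemma exp_neg_le t : 0 <= t -> exp (- t) <= / (1 + t).
Proof.
intros Ht. rewrite exp_Ropp. apply Rinv_le_contravar; [lra|]. apply exp_ineq1_le.
Qed.

Lemma gauss_zw c n : 0 < c -> exp (- (c * IZR n ^ 2)) <= (2 + 2 / c) * zw 2 n.
Proof.
intros Hc. pose proof (pow2_ge_0 (IZR n)) as H.
eapply Rle_trans; [apply exp_neg_le; apply Rmult_le_pos; lra|].
rewrite zw2. assert (Hd : 0 < 2 / c) by (apply Rdiv_lt_0_compat; lra).
assert (H1 : (1 + Rabs (IZR n)) ^ 2 <= (2 + 2 / c) * (1 + c * IZR n ^ 2)).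
{ rewrite <- (pow2_abs (IZR n)) in *. set (t := Rabs (IZR n)) in *.
  pose proof (pow2_ge_0 (t - 1)).
  replace ((2 + 2 / c) * (1 + c * t ^ 2)) with (2 + 2 * t ^ 2 + 2 / c + 2 * (c * t ^ 2)) by (field; lra).
  assert (0 <= c * t ^ 2) by (apply Rmult_le_pos; lra). nra. }
assert (Hp : 0 < (1 + Rabs (IZR n)) ^ 2) by (apply pow_lt; pose proof (one_plus_abs n); lra).
assert (Hq : 0 < 1 + c * IZR n ^ 2). { assert (0 <= c * IZR n ^ 2) by (apply Rmult_le_pos; lra). lra. }
apply Rmult_le_reg_r with (1 + c * IZR n ^ 2); auto. rewrite Rinv_l by lra.
apply Rmult_le_reg_r with ((1 + Rabs (IZR n)) ^ 2); auto.
rewrite Rmult_1_l. eapply Rle_trans; [apply H1|]. apply Req_le. field. pose proof (one_plus_abs n). repeat split; lra.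
Qed.

(** * Poisson summation for one-dimensional Gaussian sums *)

Definition gterm (a : R) (n : Z) (x : R) : R := exp (- (PI * a * (IZR n + x) ^ 2)).

(** From (n + x)^2 >= n^2/2 - X^2 for |x| <= X: the factor e^(PI a X^2) pays for the shift, and half
    of the Gaussian remains. *)
Definition gdom (a X : R) (n : Z) : R := exp (PI * a * X ^ 2) * (2 + 2 / (PI * a / 2)) * zw 2 n.

Definition theta1 (a x : R) : R := usum (fun n => gterm a n x).

Lemma dom_gdom a X : 0 < a -> dom (gdom a X).
Proof.
intros Ha. pose proof PI_RGT_0. apply dom_scal; [|apply dom_zw; lra].
apply Rmult_le_pos; [left; apply exp_pos|].
assert (H0 : 0 < 2 / (PI * a / 2)) by (apply Rdiv_lt_0_compat; nra).
set (q := 2 / (PI * a / 2)) in *. lra.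
Qed.

Lemma gterm_le a X n x : 0 < a -> Rabs x <= X -> Rabs (gterm a n x) <= gdom a X n.
Proof.
intros Ha Hx. pose proof PI_RGT_0. unfold gterm. rewrite Rabs_pos_eq by (left; apply exp_pos).
unfold gdom. assert (Hc : 0 < PI * a / 2) by nra.
pose proof (gauss_zw (PI * a / 2) n Hc) as Hg.
apply Rle_trans with (exp (PI * a * X ^ 2) * exp (- (PI * a / 2 * IZR n ^ 2))).
- rewrite <- exp_plus.
  assert (HX : x ^ 2 <= X ^ 2). { rewrite <- (pow2_abs x). apply pow_incr; split; [apply Rabs_pos|auto]. }
  assert (H1 : IZR n ^ 2 / 2 - X ^ 2 <= (IZR n + x) ^ 2).
  { pose proof (pow2_ge_0 (IZR n + 2 * x)). nra. }
  apply (Rmult_le_compat_l (PI * a)) in H1; [|nra].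
  destruct (Rle_lt_or_eq_dec (- (PI * a * (IZR n + x) ^ 2)) (PI * a * X ^ 2 + - (PI * a / 2 * IZR n ^ 2))) as [Hl|He];
   [lra|left; apply exp_increasing; auto|rewrite He; lra].
- rewrite (Rmult_assoc (exp _)). apply Rmult_le_compat_l; auto. left; apply exp_pos.
Qed.

Lemma contR_gterm a n : contR (gterm a n).
Proof. intros x. apply (ex_derive_continuous (gterm a n) x). unfold gterm. auto_derive; auto. Qed.

Lemma contR_theta1 a : 0 < a -> contR (theta1 a).
Proof.
intros Ha. apply (contR_usum (fun n x => gterm a n x) (gdom a)).
- intros; apply contR_gterm.
- intros; apply dom_gdom; auto.
- intros; apply gterm_le; auto.
Qed.

Lemma is_usum_gterm a x : 0 < a -> is_usum (fun n => gterm a n x) (theta1 a x).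
Proof.
intros Ha. apply is_usum_dom with (gdom a (Rabs x)); [apply dom_gdom; auto|].
intros; apply gterm_le; auto; lra.
Qed.

Lemma theta1_period a : 0 < a -> periodic1 (theta1 a).
Proof.
intros Ha x. apply usum_unique.
apply is_usum_ext with (fun n => gterm a (n + 1) x).
- intros n. unfold gterm. rewrite plus_IZR. do 2 f_equal. ring.
- apply (is_usum_reindex (fun n => (n + 1)%Z) (fun n => (n - 1)%Z) (fun n => gterm a n x)); try (intros; ring).
  apply is_usum_gterm; auto.
Qed.

(** Half of the Fourier transform of the Gaussian, which is even; the full transform is twice
    this. *)
Definition gft (a xi : R) : R := II (fun x => exp (- (PI * a * x ^ 2)) * cos (2 * PI * xi * x)).

Lemma exp_le x y : x <= y -> exp x <= exp y.
Proof. intros [H| ->]; [left; apply exp_increasing; auto|lra]. Qed.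

(** (1 + x)^2 <= e^(2x), and 3x <= PI a x^2 + 9/(4 PI a) by completing the square. Degree 2 is
    enough, since the second-order remainder in xi brings down x^2. *)
Lemma gauss_decay a k x : 0 < a -> 0 <= x -> (k <= 2)%nat ->
  (1 + x) ^ k * exp (- (PI * a * x ^ 2)) <= exp (9 / (4 * PI * a)) * exp (- (1 * x)).
Proof.
intros Ha Hx Hk. pose proof PI_RGT_0.
apply Rle_trans with (exp (2 * x) * exp (- (PI * a * x ^ 2))).
- apply Rmult_le_compat_r; [left; apply exp_pos|].
  apply Rle_trans with ((1 + x) ^ 2); [apply Rle_pow; [lra|lia]|].
  replace (2 * x) with (x + x) by ring. rewrite exp_plus.
  pose proof (exp_ineq1_le x). simpl. rewrite Rmult_1_r. apply Rmult_le_compat; lra.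
- rewrite <- !exp_plus. apply exp_le. set (p := PI * a). assert (Hp : 0 < p) by (apply Rmult_lt_0_compat; auto).
  replace (4 * PI * a) with (4 * p) by (unfold p; ring).
  assert (Hsq : 0 <= p * (x - 3 / (2 * p)) ^ 2) by (apply Rmult_le_pos; [lra|apply pow2_ge_0]).
  replace (p * (x - 3 / (2 * p)) ^ 2) with (p * x ^ 2 - 3 * x + 9 / (4 * p)) in Hsq by (field; lra). lra.
Qed.

Lemma nice_gauss a (h : R -> R) K k : 0 < a -> contR h -> (k <= 2)%nat ->
  (forall x, 0 <= x -> Rabs (h x) <= K * (1 + x) ^ k) ->
  decays (fun x => exp (- (PI * a * x ^ 2)) * h x) (K * exp (9 / (4 * PI * a))) 1.
Proof.
intros Ha Hh Hk Hb. split; [|split; [lra|]].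
- apply contR_mult; auto. intros x. apply (ex_derive_continuous (fun x => exp (- (PI * a * x ^ 2))) x). auto_derive; auto.
- intros x Hx. rewrite Rabs_mult, Rabs_pos_eq by (left; apply exp_pos).
  specialize (Hb x Hx). pose proof (gauss_decay a k x Ha Hx Hk) as Hd.
  assert (HK : 0 <= K).
  { pose proof (Rabs_pos (h x)). assert (0 < (1 + x) ^ k) by (apply pow_lt; lra).
    destruct (Rle_dec 0 K); auto. nra. }
  apply Rle_trans with (K * ((1 + x) ^ k * exp (- (PI * a * x ^ 2)))).
  + rewrite Rmult_comm, <- Rmult_assoc. apply Rmult_le_compat_r; auto. left; apply exp_pos.
  + rewrite (Rmult_assoc K). apply Rmult_le_compat_l; auto.
Qed.

(** Differentiation under the integral brings down -2 PI x and turns cos into sin; one integration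
    by parts leads back to a multiple of [gft]. This is the first-order equation that characterizes
    the Gaussian. *)
Lemma gft_derive a xi : 0 < a -> is_derive (gft a) xi (- (2 * PI * xi / a) * gft a xi).
Proof.
intros Ha. pose proof PI_RGT_0 as HPI.
assert (Hcos : forall b, decays (fun x => exp (- (PI * a * x ^ 2)) * cos (2 * PI * b * x)) (1 * exp (9 / (4 * PI * a))) 1).
{ intros b. apply nice_gauss with (k := 0%nat); auto; [apply contR_cos|].
  intros x Hx. simpl. rewrite Rmult_1_r. apply Rabs_le, COS_bound. }
assert (Hcx : contR (fun x => 2 * PI * x)).
{ intros x. apply (ex_derive_continuous (fun x => 2 * PI * x) x). auto_derive; auto. }
assert (Hsin : decays (fun x => exp (- (PI * a * x ^ 2)) * (2 * PI * x * sin (2 * PI * xi * x))) (2 * PI * exp (9 / (4 * PI * a))) 1).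
{ apply nice_gauss with (k := 1%nat); auto.
  - apply contR_mult; [auto|apply contR_sin].
  - intros x Hx. rewrite Rabs_mult. simpl. rewrite Rmult_1_r. rewrite (Rabs_pos_eq (2 * PI * x)) by nra.
    assert (Rabs (sin (2 * PI * xi * x)) <= 1) by (apply Rabs_le, SIN_bound).
    assert (0 <= 2 * PI * x) by nra. pose proof (Rabs_pos (sin (2 * PI * xi * x))). nra. }
assert (Hparts : II (fun x => exp (- (PI * a * x ^ 2)) * (2 * PI * x * sin (2 * PI * xi * x))) = 2 * PI * xi / a * gft a xi).
{ assert (E : II (fun x => (2 * PI * xi / a) * (exp (- (PI * a * x ^ 2)) * cos (2 * PI * xi * x)) -
     exp (- (PI * a * x ^ 2)) * (2 * PI * x * sin (2 * PI * xi * x))) = 0).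
  { rewrite (II_FTC (fun x => exp (- (PI * a * x ^ 2)) * (/ a * sin (2 * PI * xi * x))) _ (/ a * exp (9 / (4 * PI * a))) 1).
    - rewrite !Rmult_0_r, sin_0; ring.
    - intros x. auto_derive; auto. pow2n. field. lra.
    - apply contR_minus; [|apply Hsin]. apply contR_mult; [apply contR_const|apply (Hcos xi)].
    - lra.
    - apply (nice_gauss a (fun x => / a * sin (2 * PI * xi * x)) (/ a) 0); auto.
      + apply contR_mult; [apply contR_const|apply contR_sin].
      + intros x Hx. rewrite Rabs_mult, (Rabs_pos_eq (/ a)) by (left; apply Rinv_0_lt_compat; auto).
        assert (Rabs (sin (2 * PI * xi * x)) <= 1) by (apply Rabs_le, SIN_bound).
        assert (0 < / a) by (apply Rinv_0_lt_compat; auto). simpl; nra. }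
  rewrite II_minus, II_scal in E.
  - unfold gft. lra.
  - do 2 eexists; apply Hcos.
  - apply nice_scal. do 2 eexists; apply Hcos.
  - do 2 eexists; apply Hsin. }
apply is_derive_quadratic with ((2 * PI) ^ 2 * exp (9 / (4 * PI * a))) 1; [lra|].
intros h _. replace (- (2 * PI * xi / a) * gft a xi * h) with ((- h) * (2 * PI * xi / a * gft a xi)) by ring.
rewrite <- Hparts. unfold gft at 1 2.
assert (Hn1 := ex_intro _ _ (ex_intro _ _ (Hcos (xi + h))) : nice _).
assert (Hn2 := ex_intro _ _ (ex_intro _ _ (Hcos xi)) : nice _).
assert (Hn3 := ex_intro _ _ (ex_intro _ _ Hsin) : nice _).
rewrite <- (II_scal (- h) _ Hn3), <- (II_minus _ _ Hn1 Hn2), <- (II_minus _ _ (nice_minus _ _ Hn1 Hn2) (nice_scal (- h) _ Hn3)).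
replace ((2 * PI) ^ 2 * exp (9 / (4 * PI * a)) * h ^ 2) with (((2 * PI) ^ 2 * h ^ 2) * exp (9 / (4 * PI * a)) / 1) by field.
  apply II_abs.
  (* Taylor expansion of cos: the remainder is at most (2 PI h x)^2, quadratic in h with the
     integrable factor x^2 times the Gaussian. *)
  assert (Hd : decays (fun x => exp (- (PI * a * x ^ 2)) * (cos (2 * PI * (xi + h) * x) - cos (2 * PI * xi * x) + h * (2 * PI * x * sin (2 * PI * xi * x))))
      ((2 * PI) ^ 2 * h ^ 2 * exp (9 / (4 * PI * a))) 1).
  { apply nice_gauss with (k := 2%nat); auto.
    - apply contR_plus; [apply contR_minus; apply contR_cos|]. apply contR_mult; [apply contR_const|].
      apply contR_mult; auto; apply contR_sin.
    - intros x Hx.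
      pose proof (Taylor2_le cos (fun t => - sin t) (fun t => - cos t) 1 (2 * PI * xi * x) (2 * PI * (xi + h) * x)) as HT.
      assert (Hdc : forall t, is_derive cos t (- sin t)) by (intros t; apply is_derive_Reals, derivable_pt_lim_cos).
      assert (HT' := HT (fun t _ => Hdc t)). clear HT.
      assert (Hs : forall t, is_derive (fun t => - sin t) t (- cos t)).
      { intros t; auto_derive; auto; ring. }
      specialize (HT' (fun t _ => Hs t)).
      assert (Hc1 : forall t, Rabs (- cos t) <= 1) by (intros t; rewrite Rabs_Ropp; apply Rabs_le, COS_bound).
      specialize (HT' (fun t _ => Hc1 t)).
      replace (2 * PI * (xi + h) * x - 2 * PI * xi * x) with (2 * PI * h * x) in HT' by ring.
      replace (cos (2 * PI * (xi + h) * x) - cos (2 * PI * xi * x) + h * (2 * PI * x * sin (2 * PI * xi * x))) with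
        (cos (2 * PI * (xi + h) * x) - cos (2 * PI * xi * x) - - sin (2 * PI * xi * x) * (2 * PI * h * x)) by ring.
      eapply Rle_trans; [apply HT'|].
      replace (1 * (2 * PI * h * x) ^ 2) with ((2 * PI) ^ 2 * h ^ 2 * x ^ 2) by ring.
      apply Rmult_le_compat_l; [apply Rmult_le_pos; apply pow2_ge_0|].
      apply pow_incr; lra. }
  destruct Hd as [Hc1 [_ Hb]].
  assert (E : forall x, exp (- (PI * a * x ^ 2)) * (cos (2 * PI * (xi + h) * x) - cos (2 * PI * xi * x) + h * (2 * PI * x * sin (2 * PI * xi * x)))
    = exp (- (PI * a * x ^ 2)) * cos (2 * PI * (xi + h) * x) - exp (- (PI * a * x ^ 2)) * cos (2 * PI * xi * x) -
      - h * (exp (- (PI * a * x ^ 2)) * (2 * PI * x * sin (2 * PI * xi * x)))) by (intros; ring).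
  split; [|split; [lra|]].
  + apply contR_minus; [apply contR_minus; apply Hcos|]. apply contR_mult; [apply contR_const|apply Hsin].
  + intros u Hu. rewrite <- E. apply Hb; auto.
Qed.

(** Multiplication by e^(PI xi^2 / a) gives a function with derivative 0. The constant [gft a 0]
    stays unknown until [gft_1] and [gft_scale]. *)
Lemma gft_eq a xi : 0 < a -> gft a xi = gft a 0 * exp (- (PI * xi ^ 2 / a)).
Proof.
intros Ha. pose proof PI_RGT_0 as HPI.
set (F := fun t => gft a t * exp (PI * t ^ 2 / a)).
assert (HF : forall t, is_derive F t 0).
{ intros t. unfold F.
  replace 0 with ((- (2 * PI * t / a) * gft a t) * exp (PI * t ^ 2 / a) + gft a t * (2 * PI * t / a * exp (PI * t ^ 2 / a))) by ring.
  apply (is_derive_mult (gft a) (fun t => exp (PI * t ^ 2 / a)) t).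
  - apply gft_derive; auto.
  - auto_derive; auto. unfold Rdiv; pow2n. field; lra. }
assert (H : Rabs (F xi - F 0) <= 0 * Rabs (xi - 0)).
{ apply (MVT_le F (fun _ => 0)); auto. intros; rewrite Rabs_R0; lra. }
rewrite Rmult_0_l in H. assert (E : F xi = F 0).
{ pose proof (Rabs_pos (F xi - F 0)). apply Rminus_diag_uniq. destruct (Req_dec (F xi - F 0) 0); auto.
  pose proof (Rabs_pos_lt _ H1). lra. }
unfold F in E. replace (PI * 0 ^ 2 / a) with 0 in E by (field; lra). rewrite exp_0, Rmult_1_r in E.
rewrite <- E, Rmult_assoc, <- exp_plus.
replace (PI * xi ^ 2 / a + - (PI * xi ^ 2 / a)) with 0 by ring. rewrite exp_0; ring.
Qed.

Lemma periodic1_Z u : periodic1 u -> forall n x, u (x + IZR n) = u x.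
Proof.
intros Hp. assert (Hn : forall n x, u (x + INR n) = u x).
{ induction n; intros x; [simpl; rewrite Rplus_0_r; auto|]. rewrite S_INR, <- Rplus_assoc, Hp; auto. }
intros n x. destruct (Z.le_gt_cases 0 n) as [H|H].
- rewrite <- (Z2Nat.id n), <- INR_IZR_INZ by auto. apply Hn.
- rewrite <- (Hn (Z.to_nat (- n)) (x + IZR n)). f_equal.
  rewrite INR_IZR_INZ, Z2Nat.id, opp_IZR by lia. ring.
Qed.

Lemma usum_zl_lim (J : Z -> R) a b : is_usum J a ->
  (forall eps, 0 < eps -> exists N0, forall N, (N0 <= N)%nat -> Rabs (fsum J (zl N) - b) <= eps) -> a = b.
Proof.
intros Ha Hb. apply Rle_eps_eq; intros eps He.
destruct (Ha (eps / 2)) as [A [HA HA']]; [lra|].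
destruct (Hb (eps / 2)) as [N0 HN]; [lra|].
destruct (zl_incl A) as [N1 HN1].
specialize (HN (max N0 N1) (Nat.le_max_l _ _)).
specialize (HA' (zl (max N0 N1)) (zl_NoDup _) (HN1 _ (Nat.le_max_r _ _))).
apply Rabs_le_between in HN. apply Rabs_le_between in HA'. apply Rabs_le; lra.
Qed.

Lemma fsum_unfold (G : R -> R) N : contR G ->
  fsum (fun n => RInt G (IZR n) (IZR n + 1)) (zl N) = RInt G (- INR N) (INR N + 1).
Proof.
intros Hc. induction N.
- simpl. rewrite Ropp_0, Rplus_0_r, Rplus_0_l; auto.
- change (zl (S N)) with (Z.of_nat (S N) :: (- Z.of_nat (S N))%Z :: zl N). cbn [fsum].
  rewrite IHN, opp_IZR, <- INR_IZR_INZ, S_INR.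
  rewrite <- (RIChasles G (- (INR N + 1)) (- INR N) (INR N + 1 + 1)) by auto.
  rewrite <- (RIChasles G (- INR N) (INR N + 1) (INR N + 1 + 1)) by auto.
  replace (- (INR N + 1) + 1) with (- INR N) by ring. rring.
Qed.

(** The intervals [n, n + 1] tile the line. Parity, with [sg] equal to 1 or -1, folds the negative
    half onto the positive one, so everything is expressed by [II]. *)
Lemma usum_unfold (G : R -> R) a (sg : R) : contR G -> (forall x, G (- x) = sg * G x) -> nice G ->
  is_usum (fun n => RInt G (IZR n) (IZR n + 1)) a -> a = (1 + sg) * II G.
Proof.
intros Hc Hs Hn Ha. apply (usum_zl_lim _ _ _ Ha). intros eps He.
pose proof (Rabs_pos sg).
destruct (nice_II G Hn (eps / (1 + Rabs sg))) as [b0 Hb]; [apply Rdiv_lt_0_compat; lra|].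
destruct (INR_unbounded b0) as [N0 HN0]. exists N0; intros N HN.
assert (HNN : b0 <= INR N). { apply le_INR in HN. lra. }
rewrite fsum_unfold by auto.
rewrite <- (RIChasles G _ 0) by auto.
assert (E : RInt G (- INR N) 0 = sg * RInt G 0 (INR N)).
{ rewrite <- RIscal by auto. rewrite (RInt_ext (fun x => sg * G x) (fun x => G (- x))).
  - rewrite RI_opp, Ropp_0; auto.
  - intros; rewrite Hs; auto. }
rewrite E. pose proof (Hb (INR N) HNN) as H1. pose proof (Hb (INR N + 1) ltac:(lra)) as H2.
replace (sg * RInt G 0 (INR N) + RInt G 0 (INR N + 1) - (1 + sg) * II G) with
  (sg * (RInt G 0 (INR N) - II G) + (RInt G 0 (INR N + 1) - II G)) by ring.
eapply Rle_trans; [apply Rabs_triang|]. rewrite Rabs_mult.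
apply Rle_trans with (Rabs sg * (eps / (1 + Rabs sg)) + eps / (1 + Rabs sg)).
- apply Rplus_le_compat; auto. apply Rmult_le_compat_l; auto.
- apply Req_le; field; lra.
Qed.

Lemma nice_gft a b (h : R -> R) : 0 < a -> contR h -> (forall x, Rabs (h x) <= b) ->
  nice (fun x => exp (- (PI * a * x ^ 2)) * h x).
Proof.
intros Ha Hh Hb. do 2 eexists. apply (nice_gauss a h b 0); auto.
intros x Hx. simpl. rewrite Rmult_1_r; auto.
Qed.

(** Unfolding: integrating all translates of the Gaussian over one period is integrating the
    Gaussian over the line. The sign [sg] separates cosines from sines. *)
Lemma theta1_coef a (w : R -> R) sg : 0 < a -> contR w -> periodic1 w -> (forall x, Rabs (w x) <= 1) ->
  (forall x, w (- x) = sg * w x) ->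
  RInt (fun x => theta1 a x * w x) 0 1 = (1 + sg) * II (fun x => exp (- (PI * a * x ^ 2)) * w x).
Proof.
intros Ha Hw Hp Hb Hs. set (G := fun x => exp (- (PI * a * x ^ 2)) * w x).
assert (HG : contR G).
{ apply contR_mult; auto. intros x. apply (ex_derive_continuous (fun x => exp (- (PI * a * x ^ 2))) x). auto_derive; auto. }
apply usum_unfold; auto.
- intros x. unfold G. rewrite Hs. replace ((- x) ^ 2) with (x ^ 2) by ring. ring.
- apply nice_gft with 1; auto.
- assert (H : is_usum (fun n => RInt (fun x => gterm a n x * w x) 0 1) (RInt (fun x => usum (fun n => gterm a n x * w x)) 0 1)).
  { assert (Hd : forall X v u, Rabs u <= X -> Rabs (gterm a v u * w u) <= gdom a X v).
    { intros X v u Hu. rewrite Rabs_mult. apply Rle_trans with (Rabs (gterm a v u) * 1).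
      - apply Rmult_le_compat_l; [apply Rabs_pos|auto].
      - rewrite Rmult_1_r; apply gterm_le; auto. }
    apply (usum_RInt (fun n x => gterm a n x * w x) (gdom a 1) (gdom a)); auto.
    - lra.
    - intros v. apply contR_mult; auto; apply contR_gterm.
    - apply dom_gdom; auto.
    - intros v u Hu. apply Hd. apply Rabs_le; lra.
    - intros; apply dom_gdom; auto. }
  replace (RInt (fun x => theta1 a x * w x) 0 1) with (RInt (fun x => usum (fun n => gterm a n x * w x)) 0 1).
  + apply is_usum_ext with (fun n => RInt (fun x => gterm a n x * w x) 0 1); auto.
    intros n. replace (IZR n) with (0 + IZR n) by ring. rewrite (Rplus_assoc 0), (Rplus_comm (IZR n)), <- (Rplus_assoc 0).
    replace (0 + 1) with 1 by ring. rewrite <- (RI_shift G (IZR n)) by auto.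
    apply RInt_ext. intros x _. unfold G, gterm. rewrite periodic1_Z by auto. rewrite (Rplus_comm (IZR n)). auto.
  + apply RInt_ext. intros x _. unfold theta1.
    rewrite (usum_ext _ (fun n => w x * gterm a n x)) by (intros; rring).
    rewrite (usum_scal _ _ (gdom a (Rabs x))); [rring|apply dom_gdom; auto|].
    intros; apply gterm_le; auto; lra.
Qed.

Lemma theta1_ccos a k : 0 < a ->
  RInt (fun x => theta1 a x * ccos k x) 0 1 = 2 * gft a 0 * exp (- (PI / a * INR k ^ 2)).
Proof.
intros Ha. rewrite theta1_coef with (sg := 1); auto.
- replace (PI / a * INR k ^ 2) with (PI * INR k ^ 2 / a) by (field; lra).
  transitivity (2 * gft a (INR k)); [unfold gft, ccos; rring|rewrite (gft_eq a (INR k)) by auto; rring].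
- apply contR_cos.
- apply ccos_period.
- intros; apply Rabs_le, COS_bound.
- intros x; unfold ccos. rewrite <- (cos_neg (2 * PI * INR k * x)), Rmult_1_l. f_equal; ring.
Qed.

Lemma theta1_ssin a k : 0 < a -> RInt (fun x => theta1 a x * ssin k x) 0 1 = 0.
Proof.
intros Ha. rewrite theta1_coef with (sg := -1); auto.
- rring.
- apply contR_sin.
- apply ssin_period.
- intros; apply Rabs_le, SIN_bound.
- intros x; unfold ssin. replace (2 * PI * INR k * - x) with (- (2 * PI * INR k * x)) by ring. rewrite sin_neg. ring.
Qed.

Lemma RInt_period_cos k : RInt (fun x => cos (2 * PI * IZR k * x)) 0 1 = if Z.eq_dec k 0 then 1 else 0.
Proof.
destruct Z.eq_dec as [->|n].
- rewrite (RInt_ext _ (fun _ => 1)); [rewrite RIconst; rring|]. intros; rewrite Rmult_0_r, Rmult_0_l; apply cos_0.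
- assert (Hn : IZR k <> 0) by (apply not_0_IZR; auto). pose proof PI_neq0.
  rewrite (FTC (fun x => / (2 * PI * IZR k) * sin (2 * PI * IZR k * x))).
  + rewrite Rmult_0_r, sin_0, Rmult_1_r, Rmult_0_r, Rminus_0_r.
    assert (E : sin (2 * PI * IZR k) = 0).
    { replace (2 * PI * IZR k) with (2 * (PI * IZR k)) by ring. rewrite sin_2a.
      rewrite (sin_eq_0_1 (PI * IZR k)); [ring|]. exists k; ring. }
    rewrite E; rring.
  + intros x. auto_derive; auto. field. auto.
  + apply contR_cos.
Qed.

Lemma RInt_period_sin k : RInt (fun x => sin (2 * PI * IZR k * x)) 0 1 = 0.
Proof.
destruct (Z.eq_dec k 0) as [->|n].
- rewrite (RInt_ext _ (fun _ => 0)); [rewrite RIconst; rring|]. intros; rewrite Rmult_0_r, Rmult_0_l; apply sin_0.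
- assert (Hn : IZR k <> 0) by (apply not_0_IZR; auto). pose proof PI_neq0.
  rewrite (FTC (fun x => - / (2 * PI * IZR k) * cos (2 * PI * IZR k * x))).
  + rewrite Rmult_0_r, cos_0, Rmult_1_r.
    assert (E : cos (2 * PI * IZR k) = 1).
    { pose proof (periodic1_Z (ccos 1) (ccos_period 1) k 0) as E. unfold ccos in E. simpl in E.
      rewrite Rmult_0_r, cos_0 in E. rewrite <- E. f_equal; ring. }
    rewrite E; rring.
  + intros x. auto_derive; auto. field. auto.
  + apply contR_sin.
Qed.

Lemma RInt_cos_cos j k : (0 < j)%nat -> (0 < k)%nat ->
  RInt (fun x => ccos j x * ccos k x) 0 1 = if Nat.eq_dec j k then / 2 else 0.
Proof.
intros Hj Hk.
rewrite (RInt_ext _ (fun x => / 2 * (cos (2 * PI * IZR (Z.of_nat j - Z.of_nat k) * x) + cos (2 * PI * IZR (Z.of_nat j + Z.of_nat k) * x)))).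
- rewrite RIscal, RIplus, !RInt_period_cos; try apply contR_cos.
  + destruct (Z.eq_dec (Z.of_nat j + Z.of_nat k) 0); [lia|].
    destruct (Nat.eq_dec j k), (Z.eq_dec (Z.of_nat j - Z.of_nat k) 0); try lia; apply Rminus_diag_uniq; field.
  + apply contR_plus; apply contR_cos.
- intros x _. unfold ccos. rewrite minus_IZR, plus_IZR, <- !INR_IZR_INZ.
  replace (2 * PI * (INR j - INR k) * x) with (2 * PI * INR j * x - 2 * PI * INR k * x) by ring.
  replace (2 * PI * (INR j + INR k) * x) with (2 * PI * INR j * x + 2 * PI * INR k * x) by ring.
  rewrite cos_plus, cos_minus. apply Rminus_diag_uniq; field.
Qed.

Lemma RInt_cos_sin j k : RInt (fun x => ccos j x * ssin k x) 0 1 = 0.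
Proof.
rewrite (RInt_ext _ (fun x => / 2 * (sin (2 * PI * IZR (Z.of_nat k - Z.of_nat j) * x) + sin (2 * PI * IZR (Z.of_nat k + Z.of_nat j) * x)))).
- rewrite RIscal, RIplus, !RInt_period_sin; try apply contR_sin.
  + rring.
  + apply contR_plus; apply contR_sin.
- intros x _. unfold ccos, ssin. rewrite minus_IZR, plus_IZR, <- !INR_IZR_INZ.
  replace (2 * PI * (INR k - INR j) * x) with (2 * PI * INR k * x - 2 * PI * INR j * x) by ring.
  replace (2 * PI * (INR k + INR j) * x) with (2 * PI * INR k * x + 2 * PI * INR j * x) by ring.
  rewrite sin_plus, sin_minus. apply Rminus_diag_uniq; field.
Qed.

Definition trigpoly (al : nat -> R) (N : nat) (x : R) := al 0%nat + rsum (fun k => 2 * al (S k) * ccos (S k) x) N.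

Lemma contR_trigpoly al N : contR (trigpoly al N).
Proof.
unfold trigpoly. apply contR_plus; [apply contR_const|].
apply (contR_rsum (fun k x => 2 * al (S k) * ccos (S k) x)). intros k. apply contR_mult; [apply contR_const|apply contR_cos].
Qed.

Lemma trigpoly_coef al N (w : R -> R) : contR w -> RInt (fun x => trigpoly al N x * w x) 0 1 =
  al 0%nat * RInt w 0 1 + rsum (fun k => 2 * al (S k) * RInt (fun x => ccos (S k) x * w x) 0 1) N.
Proof.
intros Hw.
assert (Hk : forall k, contR (fun x => ccos (S k) x * w x)) by (intros; apply contR_mult; auto; apply contR_cos).
rewrite (RInt_ext _ (fun x => al 0%nat * w x + rsum (fun k => 2 * al (S k) * (ccos (S k) x * w x)) N)).
- rewrite RIplus, RIscal, (RInt_rsum (fun k x => 2 * al (S k) * (ccos (S k) x * w x))); auto.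
  + f_equal. apply rsum_ext. intros; apply RIscal; auto.
  + intros k; apply contR_mult; auto; apply contR_const.
  + apply contR_mult; auto; apply contR_const.
  + apply (contR_rsum (fun k x => 2 * al (S k) * (ccos (S k) x * w x))). intros k; apply contR_mult; auto; apply contR_const.
- intros x _. unfold trigpoly. rewrite Rmult_plus_distr_r, (Rmult_comm (rsum _ _)), <- rsum_scal.
  f_equal. apply rsum_ext; intros; rring.
Qed.

Lemma rsum_zero f n : (forall k, (k < n)%nat -> f k = 0) -> rsum f n = 0.
Proof. intros H. rewrite (rsum_ext _ (fun _ => 0)), rsum_const by auto. ring. Qed.

Lemma rsum_delta (f : nat -> R) j n : rsum (fun k => if Nat.eq_dec k j then f k else 0) n = if lt_dec j n then f j else 0.
Proof.
induction n; cbn [rsum]; [destruct (lt_dec j 0); [lia|auto]|].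
rewrite IHn. destruct (Nat.eq_dec n j), (lt_dec j n), (lt_dec j (S n)); subst; try lia; ring.
Qed.

(** [fourier_bound] applied to u minus its partial sum: the first N coefficients cancel and [tl N]
    bounds what remains. The [al] are integrals against cosines, which accounts for the factor 2 in
    [trigpoly]. *)
Lemma fourier_cos_series (u : R -> R) (al : nat -> R) (tl : nat -> R) : contR u -> periodic1 u ->
  (forall k, RInt (fun x => u x * ccos k x) 0 1 = al k) ->
  (forall k, RInt (fun x => u x * ssin k x) 0 1 = 0) ->
  (forall k, 0 <= al k) -> (forall N n, rsum (fun k => if lt_dec k N then 0 else al (S k)) n <= tl N) ->
  forall N x, Rabs (u x - trigpoly al N x) <= 4 * tl N.
Proof.
intros Hc Hp Hcos Hsin Hal Htl N.
assert (Hcu : contR (fun x => u x - trigpoly al N x)) by (apply contR_minus; auto; apply contR_trigpoly).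
assert (Hco : forall w, contR w -> RInt (fun x => (u x - trigpoly al N x) * w x) 0 1 =
  RInt (fun x => u x * w x) 0 1 - (al 0%nat * RInt w 0 1 + rsum (fun k => 2 * al (S k) * RInt (fun x => ccos (S k) x * w x) 0 1) N)).
{ intros w Hw. rewrite <- trigpoly_coef, <- RIminus; auto.
  - apply RInt_ext; intros; rring.
  - apply contR_mult; auto.
  - apply contR_mult; auto; apply contR_trigpoly. }
apply (fourier_bound (fun x => u x - trigpoly al N x) 0 (fun k => if lt_dec k N then 0 else al (S k))); auto.
- intros x. rewrite Hp. unfold trigpoly. do 2 f_equal. apply rsum_ext. intros; rewrite ccos_period; auto.
- rewrite (RInt_ext _ (fun x => (u x - trigpoly al N x) * ccos 0 x)).
  + rewrite Hco, Hcos by apply contR_cos.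
    rewrite (rsum_zero (fun k => _)).
    * replace (RInt (ccos 0) 0 1) with 1; [rewrite Rmult_1_r, Rplus_0_r, Rminus_diag, Rabs_R0; lra|].
      rewrite (RInt_ext _ (fun _ => 1)); [rewrite RIconst; rring|]. intros; unfold ccos; simpl. rewrite Rmult_0_r, Rmult_0_l; apply cos_0.
    * intros k _. rewrite (RInt_ext _ (fun x => cos (2 * PI * IZR (Z.of_nat (S k)) * x))).
      { rewrite RInt_period_cos. destruct Z.eq_dec; [lia|rring]. }
      intros x _. unfold ccos. rewrite INR_IZR_INZ. simpl INR. rewrite Rmult_0_r, Rmult_0_l, cos_0. rring.
  + intros x _. unfold ccos. simpl. rewrite Rmult_0_r, Rmult_0_l, cos_0. rring.
- intros n. rewrite Hco, Hcos by apply contR_cos.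
  replace (RInt (ccos (S n)) 0 1) with 0.
  2: { unfold ccos. rewrite INR_IZR_INZ, RInt_period_cos. destruct Z.eq_dec; [lia|auto]. }
  rewrite (rsum_ext _ (fun k => if Nat.eq_dec k n then al (S k) else 0)).
  + rewrite rsum_delta. destruct (lt_dec n N).
    * replace (al (S n) - (al 0%nat * 0 + al (S n))) with 0 by ring. rewrite Rabs_R0; lra.
    * replace (al (S n) - (al 0%nat * 0 + 0)) with (al (S n)) by ring. rewrite Rabs_pos_eq; auto; lra.
  + intros k _. rewrite RInt_cos_cos by lia.
    destruct (Nat.eq_dec (S k) (S n)), (Nat.eq_dec k n); try lia; apply Rminus_diag_uniq; field.
- intros n. rewrite Hco, Hsin by apply contR_sin.
  replace (RInt (ssin (S n)) 0 1) with 0.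
  2: { unfold ssin. rewrite INR_IZR_INZ, RInt_period_sin. auto. }
  rewrite rsum_zero.
  + replace (0 - (al 0%nat * 0 + 0)) with 0 by ring. rewrite Rabs_R0. destruct lt_dec; auto; lra.
  + intros k _. rewrite RInt_cos_sin; ring.
- intros n. rewrite Rplus_0_l. apply Rmult_le_compat_l; [lra|auto].
Qed.

(** 1/(k+2)^2 <= 1/(k+1) - 1/(k+2) telescopes. The shift by 2 matches [zw 2] at the integer k +
    1. *)
Lemma rsum_inv_sq_tail K N n : 0 <= K ->
  rsum (fun k => if lt_dec k N then 0 else K * / (INR k + 2) ^ 2) n <= K / (INR N + 1).
Proof.
intros HK. assert (H : rsum (fun k => if lt_dec k N then 0 else K * / (INR k + 2) ^ 2) n <=
  if lt_dec n N then 0 else K * (/ (INR N + 1) - / (INR n + 1))).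
{ induction n; cbn [rsum].
  - destruct (lt_dec 0 N); [lra|]. replace N with 0%nat by lia. lra.
  - destruct (lt_dec n N).
    + destruct (lt_dec (S n) N); [lra|]. assert (N = S n) by lia. subst N. lra.
    + destruct (lt_dec (S n) N); [lia|]. rewrite S_INR. pose proof (pos_INR n).
      assert (Hs : / (INR n + 2) ^ 2 <= / (INR n + 1) - / (INR n + 1 + 1)).
      { replace (/ (INR n + 1) - / (INR n + 1 + 1)) with (/ ((INR n + 1) * (INR n + 2))) by (field; lra).
        apply Rinv_le_contravar; [apply Rmult_lt_0_compat; lra|]. simpl. rewrite Rmult_1_r. apply Rmult_le_compat_r; lra. }
      apply (Rmult_le_compat_l K) in Hs; auto. lra. }
eapply Rle_trans; [apply H|]. pose proof (pos_INR N). pose proof (pos_INR n).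
destruct lt_dec.
- apply Rmult_le_pos; auto. left; apply Rinv_0_lt_compat; lra.
- apply Rmult_le_compat_l; auto. assert (0 < / (INR n + 1)) by (apply Rinv_0_lt_compat; lra). lra.
Qed.

Lemma theta1_pos a x : 0 < a -> 0 < theta1 a x.
Proof.
intros Ha. apply Rlt_le_trans with (gterm a 0 x); [apply exp_pos|].
apply Rnot_lt_le; intros Hlt.
destruct (is_usum_gterm a x Ha ((gterm a 0 x - theta1 a x) / 2)) as [A [HA HA']]; [lra|].
specialize (HA' (lunion A (0%Z :: nil)) (lunion_nodup _ _) (lunion_l _ _)).
assert (gterm a 0 x <= fsum (fun n => gterm a n x) (lunion A (0%Z :: nil))).
{ replace (gterm a 0 x) with (fsum (fun n => gterm a n x) (0%Z :: nil)) by (simpl; ring).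
  apply fsum_incl; [intros; left; apply exp_pos| | |apply lunion_r].
  - constructor; [intros []|constructor].
  - apply lunion_nodup. }
apply Rabs_le_between in HA'. lra.
Qed.

(** Poisson summation up to the still unknown factor 2 [gft a 0]. The dual sum is compared with the
    Fourier series along symmetric partial sums, where n and -n pair up to a cosine. *)
Lemma theta1_series a x : 0 < a ->
  is_usum (fun n => 2 * gft a 0 * (exp (- (PI / a * IZR n ^ 2)) * cos (2 * PI * IZR n * x))) (theta1 a x).
Proof.
intros Ha. pose proof PI_RGT_0 as HPI.
set (al := fun k => 2 * gft a 0 * exp (- (PI / a * INR k ^ 2))).
assert (Hg0 : 0 <= 2 * gft a 0).
{ pose proof (theta1_ccos a 0 Ha) as E. simpl INR in E. replace (PI / a * 0 ^ 2) with 0 in E by ring.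
  rewrite Ropp_0, exp_0, Rmult_1_r in E. rewrite <- E.
  apply Rle_trans with (RInt (fun _ => 0) 0 1); [rewrite RIconst; lra|].
  apply RIle; [lra|apply contR_const| |].
  - apply contR_mult; [apply contR_theta1; auto|apply contR_cos].
  - intros t _. unfold ccos; simpl. rewrite Rmult_0_r, Rmult_0_l, cos_0, Rmult_1_r. left; apply theta1_pos; auto. }
assert (Hal : forall k, 0 <= al k) by (intros; apply Rmult_le_pos; auto; left; apply exp_pos).
assert (Hc : 0 < PI / a) by (apply Rdiv_lt_0_compat; auto).
set (K := 2 * gft a 0 * (2 + 2 / (PI / a))).
assert (HK : 0 <= K).
{ apply Rmult_le_pos; auto. assert (H0 : 0 < 2 / (PI / a)) by (apply Rdiv_lt_0_compat; lra).
  set (q := 2 / (PI / a)) in *; lra. }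
assert (Hdn : forall n, 2 * gft a 0 * exp (- (PI / a * IZR n ^ 2)) <= K * zw 2 n).
{ intros n. unfold K. rewrite (Rmult_assoc (2 * gft a 0)). apply Rmult_le_compat_l; auto. apply gauss_zw; auto. }
assert (Hdom : forall n, Rabs (2 * gft a 0 * (exp (- (PI / a * IZR n ^ 2)) * cos (2 * PI * IZR n * x))) <= K * zw 2 n).
{ intros n. rewrite <- (Rmult_assoc (2 * gft a 0)), Rabs_mult.
  assert (Hc1 : Rabs (cos (2 * PI * IZR n * x)) <= 1) by (apply Rabs_le, COS_bound).
  rewrite Rabs_pos_eq by (apply Rmult_le_pos; auto; left; apply exp_pos).
  eapply Rle_trans; [|apply Hdn]. rewrite <- (Rmult_1_r (2 * gft a 0 * exp _)) at 2.
  apply Rmult_le_compat_l; auto. apply Rmult_le_pos; auto; left; apply exp_pos. }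
assert (Hs := is_usum_dom _ (fun n => K * zw 2 n) (dom_scal K _ HK (dom_zw 2 ltac:(lra))) Hdom).
replace (theta1 a x) with (usum (fun n => 2 * gft a 0 * (exp (- (PI / a * IZR n ^ 2)) * cos (2 * PI * IZR n * x)))); auto.
apply (usum_zl_lim _ _ _ Hs). intros eps Heps.
assert (Hb : forall N, Rabs (theta1 a x - trigpoly al N x) <= 4 * (K / (INR N + 1))).
{ intros N. apply (fourier_cos_series (theta1 a) al (fun N => K / (INR N + 1))); auto.
  - apply contR_theta1; auto.
  - apply theta1_period; auto.
  - intros; apply theta1_ccos; auto.
  - intros; apply theta1_ssin; auto.
  - intros M n. eapply Rle_trans; [|apply (rsum_inv_sq_tail K M n HK)].
    apply rsum_le. intros k _. destruct lt_dec; [lra|]. unfold al. rewrite INR_IZR_INZ.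
    eapply Rle_trans; [apply Hdn|]. apply Req_le. rewrite zw2, <- INR_IZR_INZ, Rabs_pos_eq by apply pos_INR.
    rewrite S_INR. do 3 f_equal. ring. }
assert (Ht : forall N, fsum (fun n => 2 * gft a 0 * (exp (- (PI / a * IZR n ^ 2)) * cos (2 * PI * IZR n * x))) (zl N) = trigpoly al N x).
{ induction N.
  - unfold trigpoly, al. cbn [rsum fsum zl INR]. replace (2 * PI * IZR 0 * x) with 0 by ring. rewrite cos_0. ring.
  - change (zl (S N)) with (Z.of_nat (S N) :: (- Z.of_nat (S N))%Z :: zl N). cbn [fsum]. rewrite IHN.
    unfold trigpoly. cbn [rsum]. rewrite opp_IZR, <- INR_IZR_INZ. unfold al, ccos.
    replace (2 * PI * - INR (S N) * x) with (- (2 * PI * INR (S N) * x)) by ring. rewrite cos_neg.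
    replace ((- INR (S N)) ^ 2) with (INR (S N) ^ 2) by ring. ring. }
destruct (INR_unbounded (4 * K / eps)) as [N0 HN0]. exists N0; intros N HN.
rewrite Ht, Rabs_minus_sym. eapply Rle_trans; [apply Hb|].
apply le_INR in HN. assert (4 * K < eps * INR N).
{ assert (4 * K / eps < INR N) by lra. apply (Rmult_lt_compat_l eps) in H; auto.
  replace (eps * (4 * K / eps)) with (4 * K) in H by (field; lra). auto. }
pose proof (pos_INR N). apply Rmult_le_reg_r with (INR N + 1); [lra|].
replace (4 * (K / (INR N + 1)) * (INR N + 1)) with (4 * K) by (field; lra). nra.
Qed.

(** At a = 1, x = 0 Poisson summation compares a positive theta value with a multiple of itself,
    which forces the factor to be 1. The Gaussian integral is thus evaluated from the self-duality
    of theta. *)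
Lemma gft_1 : 2 * gft 1 0 = 1.
Proof.
assert (H1 : 0 < 1) by lra.
assert (E : is_usum (fun n => 2 * gft 1 0 * gterm 1 n 0) (theta1 1 0)).
{ apply is_usum_ext with (2 := theta1_series 1 0 H1). intros n. unfold gterm.
  rewrite Rmult_0_r, cos_0, Rmult_1_r. do 3 f_equal. field. }
pose proof (is_usum_scal (2 * gft 1 0) _ _ (is_usum_gterm 1 0 H1)) as E2.
pose proof (is_usum_unique _ _ _ E E2) as E3. pose proof (theta1_pos 1 0 H1).
apply Rmult_eq_reg_r with (theta1 1 0); lra.
Qed.

Lemma gft_scale a : 0 < a -> 2 * gft a 0 = / sqrt a.
Proof.
intros Ha. assert (Hs : 0 < sqrt a) by (apply sqrt_lt_R0; auto).
assert (E : gft a 0 = / sqrt a * gft 1 0).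
{ set (f := fun x => exp (- (PI * 1 * x ^ 2)) * cos (2 * PI * 0 * x)).
  assert (Hcf : contR f).
  { apply contR_mult; [|apply contR_cos]. intros x. apply (ex_derive_continuous (fun x => exp (- (PI * 1 * x ^ 2))) x). auto_derive; auto. }
  assert (Hnf : nice f). { apply nice_gft with 1; [lra|apply contR_cos|intros; apply Rabs_le, COS_bound]. }
  assert (Hsc : forall b, RInt (fun x => exp (- (PI * a * x ^ 2)) * cos (2 * PI * 0 * x)) 0 b = / sqrt a * RInt f 0 (sqrt a * b)).
  { intros b. pose proof (RI_comp_lin f (sqrt a) 0 0 b Hcf) as E. rewrite Rmult_0_r, !Rplus_0_r in E. rewrite <- E.
    assert (E1 : forall y, sqrt a * f (sqrt a * y + 0) = sqrt a * (exp (- (PI * a * y ^ 2)) * cos (2 * PI * 0 * y))).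
    { intros y. unfold f. rewrite Rplus_0_r, Rpow_mult_distr, pow2_sqrt by lra. rewrite !Rmult_0_r, !Rmult_0_l. do 4 f_equal. ring. }
    rewrite (RInt_ext (fun y => sqrt a * f (sqrt a * y + 0)) (fun y => sqrt a * (exp (- (PI * a * y ^ 2)) * cos (2 * PI * 0 * y)))) by (intros; apply E1).
    rewrite (RIscal (fun y => exp (- (PI * a * y ^ 2)) * cos (2 * PI * 0 * y))).
    - apply Rminus_diag_uniq. field. lra.
    - apply contR_mult; [|apply contR_cos]. intros x. apply (ex_derive_continuous (fun x => exp (- (PI * a * x ^ 2))) x). auto_derive; auto. }
  apply II_unique. intros eps He.
  destruct (nice_II f Hnf (eps * sqrt a)) as [b0 Hb]; [apply Rmult_lt_0_compat; auto|].
  exists (b0 / sqrt a). intros b Hbb. rewrite Hsc.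
  unfold gft. fold f. rewrite <- Rmult_minus_distr_l, Rabs_mult, Rabs_pos_eq by (left; apply Rinv_0_lt_compat; auto).
  apply Rmult_le_reg_l with (sqrt a); auto. rewrite <- Rmult_assoc, Rinv_r, Rmult_1_l by lra. rewrite (Rmult_comm (sqrt a) eps). apply Hb.
  apply (Rmult_le_compat_l (sqrt a)) in Hbb; [|lra]. replace (sqrt a * (b0 / sqrt a)) with b0 in Hbb by (field; lra). auto. }
pose proof gft_1. rewrite E. replace (2 * (/ sqrt a * gft 1 0)) with (/ sqrt a * (2 * gft 1 0)) by ring. rewrite H; ring.
Qed.

Lemma theta1_poisson a x : 0 < a ->
  is_usum (fun n => exp (- (PI / a * IZR n ^ 2)) * cos (2 * PI * IZR n * x)) (sqrt a * theta1 a x).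
Proof.
intros Ha. assert (Hs : 0 < sqrt a) by (apply sqrt_lt_R0; auto).
apply is_usum_ext with (2 := is_usum_scal (sqrt a) _ _ (theta1_series a x Ha)).
intros n. rewrite gft_scale by auto. field. lra.
Qed.

Definition theta_lat (t x y : R) : R := usum (fun v => exp (- (PI * t * Q x y v))).

(** The summand 1 covers the origin, where the exponential equals 1 and [exp_Q_le] does not
    apply. *)
Definition Qdom (t x y A : R) : R := 1 + Rpower A A * Rpower (Qc (Rabs x) (/ y) / y) (- A) * Rpower t (- A).

Lemma Q_0 x y : Q x y (0, 0)%Z = 0.
Proof. unfold Q; simpl. unfold Rdiv; ring. Qed.

Lemma exp_Q_le_all t x y A v : 0 < t -> 0 < y -> 0 < A -> exp (- (PI * t * Q x y v)) <= Qdom t x y A * pw A v.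
Proof.
intros Ht Hy HA. unfold Qdom. set (K := Rpower A A * _ * _).
assert (HK : 0 < K) by (repeat apply Rmult_lt_0_compat; apply exp_pos).
pose proof (pw_pos A v). destruct (excluded_middle_informative (v = (0, 0)%Z)) as [->|n].
- rewrite Q_0, Rmult_0_r, Ropp_0, exp_0. unfold pw, zw; simpl. rewrite Rabs_R0, Rplus_0_r.
  unfold Rpower; rewrite ln_1, Rmult_0_r, exp_0. lra.
- apply Rle_trans with (K * pw A v); [|nra]. apply exp_Q_le; auto; [lra|apply Rinv_0_lt_compat; auto|rewrite Rinv_inv; lra].
Qed.

Lemma dom_Q t x y A : 1 < A -> dom (fun v => Qdom t x y A * pw A v).
Proof.
intros HA. apply dom_scal; [|apply dom_pw; auto].
unfold Qdom. assert (0 < Rpower A A * Rpower (Qc (Rabs x) (/ y) / y) (- A) * Rpower t (- A)) by (repeat apply Rmult_lt_0_compat; apply exp_pos). lra.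
Qed.

Lemma is_usum_theta_lat t x y : 0 < t -> 0 < y -> is_usum (fun v => exp (- (PI * t * Q x y v))) (theta_lat t x y).
Proof.
intros Ht Hy. apply is_usum_dom with (fun v => Qdom t x y 2 * pw 2 v); [apply dom_Q; lra|].
intros v. rewrite Rabs_pos_eq by (left; apply exp_pos). apply exp_Q_le_all; auto; lra.
Qed.

Lemma usum_swap (f : Z * Z -> R) a : is_usum f a -> is_usum (fun v => f (snd v, fst v)) a.
Proof.
intros H. apply (is_usum_reindex (fun v : Z * Z => (snd v, fst v)) (fun v => (snd v, fst v)) f a); auto; intros []; auto.
Qed.

(* Poisson summation in [n], then in [m]. *)
Lemma theta_lat_functional t x y : 0 < t -> 0 < y -> theta_lat (/ t) x y = t * theta_lat t x y.
Proof.
intros Ht Hy. pose proof PI_RGT_0 as HPI.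
assert (Hty : 0 < t / y) by (apply Rdiv_lt_0_compat; auto).
assert (Hyt : 0 < t * y) by (apply Rmult_lt_0_compat; auto).
set (b := / (t * y)). assert (Hb : 0 < b) by (apply Rinv_0_lt_compat; auto).
(* [h] is Poisson-dual to theta in exactly one variable: summed over n it gives theta at t, summed
   over m it gives theta at 1/t. Its absolute summability permits both orders. *)
set (h := fun v : Z * Z => exp (- (PI / b * IZR (fst v) ^ 2)) * (exp (- (PI / (t / y) * IZR (snd v) ^ 2)) * cos (2 * PI * IZR (snd v) * (IZR (fst v) * x)))).
assert (Hc1 : 0 < PI / b) by (apply Rdiv_lt_0_compat; auto).
assert (Hc2 : 0 < PI / (t / y)) by (apply Rdiv_lt_0_compat; auto).
assert (Hh : is_usum h (usum h)).
{ apply is_usum_dom with (fun v => ((2 + 2 / (PI / b)) * zw 2 (fst v)) * ((2 + 2 / (PI / (t / y))) * zw 2 (snd v))).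
  - assert (Hd : forall c, 0 < c -> dom (fun n => (2 + 2 / c) * zw 2 n)).
    { intros c Hc. apply dom_scal; [|apply dom_zw; lra]. assert (0 < 2 / c) by (apply Rdiv_lt_0_compat; lra). lra. }
    apply (dom_prod (fun n => (2 + 2 / (PI / b)) * zw 2 n) (fun n => (2 + 2 / (PI / (t / y))) * zw 2 n)); auto.
  - intros [m n]. unfold h; simpl fst; simpl snd. rewrite Rabs_mult, (Rabs_pos_eq (exp _)) by (left; apply exp_pos).
    apply Rmult_le_compat; [left; apply exp_pos|apply Rabs_pos|apply gauss_zw; auto|].
    rewrite Rabs_mult, (Rabs_pos_eq (exp _)) by (left; apply exp_pos).
    assert (Rabs (cos (2 * PI * IZR n * (IZR m * x))) <= 1) by (apply Rabs_le, COS_bound).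
    eapply Rle_trans; [|apply gauss_zw; auto]. rewrite <- Rmult_1_r. apply Rmult_le_compat_l; auto. left; apply exp_pos. }
assert (H1 : usum h = sqrt (t / y) * theta_lat t x y).
{ apply (is_usum_unique (fun m => exp (- (PI / b * IZR m ^ 2)) * (sqrt (t / y) * theta1 (t / y) (IZR m * x)))).
  - apply (usum_fubini h); auto. intros m. exact (is_usum_scal (exp (- (PI / b * IZR m ^ 2))) _ _ (theta1_poisson (t / y) (IZR m * x) Hty)).
  - apply (usum_fubini (fun v => sqrt (t / y) * exp (- (PI * t * Q x y v)))); [apply is_usum_scal, is_usum_theta_lat; auto|].
    intros m. apply is_usum_ext with (fun n => exp (- (PI / b * IZR m ^ 2)) * (sqrt (t / y) * gterm (t / y) n (IZR m * x))).
    + intros n. unfold gterm. rewrite <- Rmult_assoc, (Rmult_comm _ (sqrt _)), Rmult_assoc, <- exp_plus.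
      do 2 f_equal. unfold Q, b; simpl fst; simpl snd. field; lra.
    + exact (is_usum_scal _ _ _ (is_usum_scal _ _ _ (is_usum_gterm (t / y) (IZR m * x) Hty))). }
assert (H2 : usum h = sqrt b * theta_lat (/ t) x y).
{ apply (is_usum_unique (fun n => exp (- (PI / (t / y) * IZR n ^ 2)) * (sqrt b * theta1 b (IZR n * x)))).
  - apply (usum_fubini (fun v => h (snd v, fst v))); [apply usum_swap; auto|]. intros n.
    apply is_usum_ext with (fun m => exp (- (PI / (t / y) * IZR n ^ 2)) * (exp (- (PI / b * IZR m ^ 2)) * cos (2 * PI * IZR m * (IZR n * x)))).
    + intros m. unfold h; simpl fst; simpl snd.
      replace (2 * PI * IZR n * (IZR m * x)) with (2 * PI * IZR m * (IZR n * x)) by ring. ring.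
    + exact (is_usum_scal _ _ _ (theta1_poisson b (IZR n * x) Hb)).
  - apply (usum_fubini (fun v => sqrt b * exp (- (PI * (/ t) * Q x y v)))).
    + apply is_usum_scal, is_usum_theta_lat; auto. apply Rinv_0_lt_compat; auto.
    + intros n. apply is_usum_ext with (fun m => exp (- (PI / (t / y) * IZR n ^ 2)) * (sqrt b * gterm b m (IZR n * x))).
      * intros m. unfold gterm. rewrite <- Rmult_assoc, (Rmult_comm _ (sqrt _)), Rmult_assoc, <- exp_plus.
        do 2 f_equal. unfold Q, b; simpl fst; simpl snd. field; lra.
      * exact (is_usum_scal _ _ _ (is_usum_scal _ _ _ (is_usum_gterm b (IZR n * x) Hb))). }
rewrite H1 in H2.
assert (Hsb : sqrt (t / y) = t * sqrt b).
{ replace (t / y) with (t * t * b) by (unfold b; field; lra). rewrite sqrt_mult_alt by nra. rewrite sqrt_square; lra. }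
rewrite Hsb in H2. assert (0 < sqrt b) by (apply sqrt_lt_R0; auto).
apply Rmult_eq_reg_l with (sqrt b); lra.
Qed.

(** * Integrals of theta against weights *)

Definition nz (v : Z * Z) (a : R) : R := if eq_dec_cl v (0, 0)%Z then 0 else a.

Definition lattice_II (h : Z * Z -> R -> R) : R := usum (fun v => nz v (II (h v))).

(** The standard majorant off the origin: the decay e^(-u) makes each integral at most C [pw 2],
    which is summable. The origin is excluded because its theta term does not decay in u. *)
Definition ddC (h : Z * Z -> R -> R) (C : R) : Prop :=
  0 <= C /\ (forall v, contR (h v)) /\
  forall v u, v <> (0, 0)%Z -> 0 <= u -> Rabs (h v u) <= C * pw 2 v * exp (- (1 * u)).

Definition dd h := exists C, ddC h C.

Lemma dd_nice h v : dd h -> v <> (0, 0)%Z -> nice (h v).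
Proof.
intros [C [HC [Hc Hb]]] Hv. apply nice_le with (C * pw 2 v) 1; auto; lra.
Qed.

Lemma dd_term h C : ddC h C -> forall v, Rabs (nz v (II (h v))) <= C * pw 2 v.
Proof.
intros [HC [Hc Hb]] v. unfold nz. destruct eq_dec_cl as [E|E].
- rewrite Rabs_R0. apply Rmult_le_pos; auto. left; apply pw_pos.
- replace (C * pw 2 v) with (C * pw 2 v / 1) by field. apply II_abs.
  split; auto. split; [lra|]. auto.
Qed.

Lemma is_usum_lattice_II h : dd h -> is_usum (fun v => nz v (II (h v))) (lattice_II h).
Proof.
intros [C H]. apply is_usum_dom with (fun v => C * pw 2 v); [|apply dd_term; auto].
apply dom_scal; [apply H|apply dom_pw; lra].
Qed.

Lemma lattice_II_bound h C : ddC h C -> Rabs (lattice_II h) <= C * usum (pw 2).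
Proof.
intros H. assert (Hd : dom (pw 2)) by (apply dom_pw; lra).
rewrite <- (usum_scal C (pw 2) (pw 2)); auto.
- apply usum_abs; [apply dom_scal; auto; apply H|apply dd_term; auto].
- intros v; rewrite Rabs_pos_eq; [lra|left; apply pw_pos].
Qed.

Lemma dd_plus h k : dd h -> dd k -> dd (fun v u => h v u + k v u).
Proof.
intros [C [HC [Hc Hb]]] [D [HD [Hd He]]]. exists (C + D). split; [lra|]. split.
- intros; apply contR_plus; auto.
- intros v u Hv Hu. eapply Rle_trans; [apply Rabs_triang|]. rewrite !Rmult_plus_distr_r. apply Rplus_le_compat; auto.
Qed.

Lemma dd_scal c h : dd h -> dd (fun v u => c * h v u).
Proof.
intros [C [HC [Hc Hb]]]. exists (Rabs c * C). split; [apply Rmult_le_pos; auto; apply Rabs_pos|]. split.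
- intros; apply contR_mult; auto; apply contR_const.
- intros v u Hv Hu. rewrite Rabs_mult, !Rmult_assoc, <- (Rmult_assoc C). apply Rmult_le_compat_l; auto; apply Rabs_pos.
Qed.

Lemma lattice_II_ext h k : (forall v u, v <> (0, 0)%Z -> h v u = k v u) -> lattice_II h = lattice_II k.
Proof.
intros E. unfold lattice_II. apply usum_ext. intros v. unfold nz; destruct eq_dec_cl; auto. apply II_ext; auto.
Qed.

Lemma lattice_II_plus h k : dd h -> dd k -> lattice_II (fun v u => h v u + k v u) = lattice_II h + lattice_II k.
Proof.
intros Hh Hk. apply usum_unique.
apply is_usum_ext with (2 := is_usum_plus _ _ _ _ (is_usum_lattice_II h Hh) (is_usum_lattice_II k Hk)).
intros v. unfold nz; destruct eq_dec_cl; [ring|]. rewrite II_plus; auto using dd_nice.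
Qed.

Lemma lattice_II_scal c h : dd h -> lattice_II (fun v u => c * h v u) = c * lattice_II h.
Proof.
intros Hh. apply usum_unique.
apply is_usum_ext with (2 := is_usum_scal c _ _ (is_usum_lattice_II h Hh)).
intros v. unfold nz; destruct eq_dec_cl; [ring|]. rewrite II_scal; auto using dd_nice.
Qed.

Lemma lattice_II_minus h k : dd h -> dd k -> lattice_II (fun v u => h v u - k v u) = lattice_II h - lattice_II k.
Proof.
intros Hh Hk. rewrite (lattice_II_ext _ (fun v u => h v u + (-1) * k v u)) by (intros; ring).
rewrite lattice_II_plus, lattice_II_scal; auto; [ring|]. apply dd_scal; auto.
Qed.

(** * Families of integrands closed under differentiation *)

Definition fam := Z * Z -> R -> R -> R -> R.

Definition egrowth (w : R -> R) (C k : R) : Prop :=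
  contR w /\ 0 <= k /\ forall u, Rabs (w u) <= C * exp (k * Rabs u).

Definition theta_term (v : Z * Z) (u x y : R) : R := exp (- (PI * exp u * Q x y v)).

(** Generated by what differentiation of exp(-PI e^u Q) in x and y produces: the factors m, mx + n,
    1/y and e^u. The class is closed under both derivatives, so one majorant lemma serves
    derivatives of all orders. *)
Inductive cls : fam -> Prop :=
| cls_base w C k : egrowth w C k -> cls (fun v u x y => theta_term v u x y * w u)
| cls_m g : cls g -> cls (fun v u x y => IZR (fst v) * g v u x y)
| cls_l g : cls g -> cls (fun v u x y => (IZR (fst v) * x + IZR (snd v)) * g v u x y)
| cls_y g : cls g -> cls (fun v u x y => / y * g v u x y)
| cls_e g : cls g -> cls (fun v u x y => exp u * g v u x y)
| cls_plus g h : cls g -> cls h -> cls (fun v u x y => g v u x y + h v u x y)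
| cls_scal c g : cls g -> cls (fun v u x y => c * g v u x y).

Definition fdom (g : fam) X Y p C : Prop := 0 <= C /\
  forall v u x y, v <> (0, 0)%Z -> 0 <= u -> Rabs x <= X -> / Y <= y <= Y ->
    Rabs (g v u x y) <= C * pw p v * exp (- (p * u)).

Lemma egrowth_C w C k : egrowth w C k -> 0 <= C.
Proof.
intros [_ [_ H]]. specialize (H 0). rewrite Rabs_R0, Rmult_0_r, exp_0 in H. pose proof (Rabs_pos (w 0)); lra.
Qed.

Lemma theta_term_le v u x y X Y A : v <> (0, 0)%Z -> Rabs x <= X -> 0 < Y -> / Y <= y -> 0 < A ->
  theta_term v u x y <= Rpower A A * Rpower (Qc X Y / y) (- A) * exp (- (A * u)) * pw A v.
Proof.
intros Hv Hx HY Hy HA. eapply Rle_trans; [apply (exp_Q_le x y X Y v A (exp u)); auto; apply exp_pos|].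
apply Req_le. do 2 f_equal. unfold Rpower. rewrite ln_exp. f_equal; ring.
Qed.

(** Order A + k is taken from the theta term, so that e^(-(A+k)u) absorbs the growth e^(ku) of the
    weight and leaves e^(-Au). *)
Lemma base_dom w C k X Y y A : egrowth w C k -> 0 < Y -> 0 < A -> / Y <= y ->
  forall v u x, v <> (0, 0)%Z -> 0 <= u -> Rabs x <= X ->
  Rabs (theta_term v u x y * w u) <= C * (Rpower (A + k) (A + k) * Rpower (Qc X Y / y) (- (A + k))) * pw A v * exp (- (A * u)).
Proof.
intros Hw HY HA Hy v u x Hv Hu Hx. pose proof (egrowth_C _ _ _ Hw) as HC. destruct Hw as [_ [Hk Hw]].
rewrite Rabs_mult, (Rabs_pos_eq (theta_term _ _ _ _)) by (left; apply exp_pos).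
assert (HAk : 0 < A + k) by lra.
set (D := Rpower (A + k) (A + k) * Rpower (Qc X Y / y) (- (A + k))).
assert (HD : 0 < D) by (apply Rmult_lt_0_compat; apply exp_pos).
apply Rle_trans with ((D * exp (- ((A + k) * u)) * pw (A + k) v) * (C * exp (k * u))).
- apply Rmult_le_compat; [left; apply exp_pos|apply Rabs_pos|apply theta_term_le; auto|].
  specialize (Hw u). rewrite (Rabs_pos_eq u) in Hw by auto. auto.
- apply Rle_trans with ((D * exp (- ((A + k) * u)) * pw A v) * (C * exp (k * u))).
  + apply Rmult_le_compat_r; [apply Rmult_le_pos; auto; left; apply exp_pos|].
    apply Rmult_le_compat_l; [left; apply Rmult_lt_0_compat; auto; apply exp_pos|]. apply pw_le; lra.
  + apply Req_le. replace (- (A * u)) with (- ((A + k) * u) + k * u) by ring. rewrite exp_plus. ring.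
Qed.

Lemma latD_pw p v : latD v * pw (p + 1) v = pw p v.
Proof.
pose proof (latD_ge1 v). rewrite !pw_latD. rewrite <- (Rpower_1 (latD v)) at 1 by lra.
rewrite <- Rpower_plus. f_equal; ring.
Qed.

Lemma latD_m v : Rabs (IZR (fst v)) <= latD v.
Proof.
unfold latD. pose proof (Rabs_pos (IZR (fst v))). pose proof (Rabs_pos (IZR (snd v))). nra.
Qed.

Lemma latD_l x X v : Rabs x <= X -> Rabs (IZR (fst v) * x + IZR (snd v)) <= (X + 1) * latD v.
Proof.
intros Hx. eapply Rle_trans; [apply Rabs_triang|]. rewrite Rabs_mult. unfold latD.
pose proof (Rabs_pos (IZR (fst v))). pose proof (Rabs_pos (IZR (snd v))). pose proof (Rabs_pos x).
assert (Rabs (IZR (fst v)) * Rabs x <= Rabs (IZR (fst v)) * X) by (apply Rmult_le_compat_l; auto).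
assert (0 <= X * Rabs (IZR (fst v)) * Rabs (IZR (snd v))) by (repeat apply Rmult_le_pos; lra).
assert (0 <= X * Rabs (IZR (snd v))) by (apply Rmult_le_pos; lra).
assert (0 <= Rabs (IZR (fst v)) * Rabs (IZR (snd v))) by (apply Rmult_le_pos; lra).
nra.
Qed.

Lemma exp_decay_le p u : 0 <= u -> exp (- ((p + 1) * u)) <= exp (- (p * u)).
Proof. intros Hu. apply exp_le. lra. Qed.

(** The order p is quantified inside the induction: a factor m, mx + n or e^u costs one order, so
    the smaller family is used at p + 1. *)
Lemma cls_dom g : cls g -> forall X Y p, 0 < Y -> 0 < p -> exists C, fdom g X Y p C.
Proof.
induction 1 as [w C k Hw|g Hg IH|g Hg IH|g Hg IH|g Hg IH|g h Hg IHg Hh IHh|c g Hg IH]; intros X Y p HY Hp.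
- set (E := Rpower (p + k) (p + k) * Rpower (Qc X Y / Y) (- (p + k))).
  assert (HE : 0 < E) by (apply Rmult_lt_0_compat; apply exp_pos). pose proof (egrowth_C _ _ _ Hw) as HC.
  exists (C * E). split; [apply Rmult_le_pos; lra|]. intros v u x y Hv Hu Hx Hy.
  eapply Rle_trans; [apply (base_dom w C k X Y y p); auto; lra|].
  apply Rmult_le_compat_r; [left; apply exp_pos|]. apply Rmult_le_compat_r; [left; apply pw_pos|].
  apply Rmult_le_compat_l; auto. apply Rmult_le_compat_l; [left; apply exp_pos|].
  destruct Hw as [_ [Hk _]]. pose proof (Qc_pos X Y).
  assert (Hy0 : 0 < y). { eapply Rlt_le_trans; [apply Rinv_0_lt_compat; apply HY|apply Hy]. }
  apply Rpower_neg_antimono; [lra|]. split; [apply Rdiv_lt_0_compat; auto|].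
  apply Rmult_le_compat_l; [lra|]. apply Rinv_le_contravar; auto; lra.
- destruct (IH X Y (p + 1)) as [C [HC H]]; auto; [lra|]. exists C; split; auto.
  intros v u x y Hv Hu Hx Hy. rewrite Rabs_mult. specialize (H v u x y Hv Hu Hx Hy).
  apply Rle_trans with (latD v * (C * pw (p + 1) v * exp (- ((p + 1) * u)))).
  + apply Rmult_le_compat; auto using Rabs_pos, latD_m.
  + replace (latD v * (C * pw (p + 1) v * exp (- ((p + 1) * u)))) with (C * (latD v * pw (p + 1) v) * exp (- ((p + 1) * u))) by ring.
    rewrite latD_pw. apply Rmult_le_compat_l; [|apply exp_decay_le; auto]. apply Rmult_le_pos; auto; left; apply pw_pos.
- destruct (IH X Y (p + 1)) as [C [HC H]]; auto; [lra|].
  exists ((Rabs X + 1) * C). split; [apply Rmult_le_pos; auto; pose proof (Rabs_pos X); lra|].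
  intros v u x y Hv Hu Hx Hy. rewrite Rabs_mult. specialize (H v u x y Hv Hu Hx Hy).
  apply Rle_trans with ((Rabs X + 1) * latD v * (C * pw (p + 1) v * exp (- ((p + 1) * u)))).
  + apply Rmult_le_compat; auto using Rabs_pos. apply latD_l. pose proof (Rle_abs X); lra.
  + replace ((Rabs X + 1) * latD v * (C * pw (p + 1) v * exp (- ((p + 1) * u)))) with ((Rabs X + 1) * C * (latD v * pw (p + 1) v) * exp (- ((p + 1) * u))) by ring.
    rewrite latD_pw. apply Rmult_le_compat_l; [|apply exp_decay_le; auto].
    apply Rmult_le_pos; [|left; apply pw_pos]. apply Rmult_le_pos; auto. pose proof (Rabs_pos X); lra.
- destruct (IH X Y p) as [C [HC H]]; auto. exists (Y * C). split; [apply Rmult_le_pos; lra|].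
  intros v u x y Hv Hu Hx Hy. rewrite Rabs_mult. specialize (H v u x y Hv Hu Hx Hy).
  assert (Hy0 : 0 < y). { eapply Rlt_le_trans; [apply Rinv_0_lt_compat; apply HY|apply Hy]. }
  rewrite !Rmult_assoc, <- (Rmult_assoc C). apply Rmult_le_compat; auto using Rabs_pos.
  rewrite Rabs_pos_eq by (left; apply Rinv_0_lt_compat; auto).
  rewrite <- (Rinv_inv Y). apply Rinv_le_contravar; [apply Rinv_0_lt_compat; auto|apply Hy].
- destruct (IH X Y (p + 1)) as [C [HC H]]; auto; [lra|]. exists C; split; auto.
  intros v u x y Hv Hu Hx Hy. rewrite Rabs_mult, (Rabs_pos_eq (exp u)) by (left; apply exp_pos).
  specialize (H v u x y Hv Hu Hx Hy).
  apply Rle_trans with (exp u * (C * pw p v * exp (- ((p + 1) * u)))).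
  + apply Rmult_le_compat_l; [left; apply exp_pos|]. eapply Rle_trans; [apply H|].
    apply Rmult_le_compat_r; [left; apply exp_pos|]. apply Rmult_le_compat_l; auto. apply pw_le; lra.
  + apply Req_le. replace (- (p * u)) with (u + - ((p + 1) * u)) by ring. rewrite (exp_plus u). ring.
- destruct (IHg X Y p) as [C [HC H]]; auto. destruct (IHh X Y p) as [D [HD H']]; auto.
  exists (C + D). split; [lra|]. intros v u x y Hv Hu Hx Hy.
  eapply Rle_trans; [apply Rabs_triang|]. rewrite !Rmult_plus_distr_r. apply Rplus_le_compat; auto.
- destruct (IH X Y p) as [C [HC H]]; auto. exists (Rabs c * C). split; [apply Rmult_le_pos; auto; apply Rabs_pos|].
  intros v u x y Hv Hu Hx Hy. rewrite Rabs_mult, !Rmult_assoc, <- (Rmult_assoc C). apply Rmult_le_compat_l; auto; apply Rabs_pos.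
Qed.

Lemma contR_exp : contR exp.
Proof. intros x. apply (ex_derive_continuous exp x). auto_derive; auto. Qed.

Lemma cls_cont g : cls g -> forall v x y, contR (fun u => g v u x y).
Proof.
induction 1 as [w C k Hw|g Hg IH|g Hg IH|g Hg IH|g Hg IH|g h Hg IHg Hh IHh|c g Hg IH]; intros v x y.
- apply contR_mult; [|apply Hw]. intros u. apply (ex_derive_continuous (fun u => theta_term v u x y) u). unfold theta_term. auto_derive; auto.
- apply contR_mult; auto; apply contR_const.
- apply contR_mult; auto; apply contR_const.
- apply contR_mult; auto; apply contR_const.
- apply contR_mult; auto; apply contR_exp.
- apply contR_plus; auto.
- apply contR_mult; auto; apply contR_const.
Qed.

Lemma cls_dd g x y : cls g -> 0 < y -> dd (fun v u => g v u x y).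
Proof.
intros Hg Hy. assert (HY : 0 < y + / y) by (assert (0 < / y) by (apply Rinv_0_lt_compat; auto); lra).
assert (Hi : / (y + / y) <= y).
{ assert (0 < / y) by (apply Rinv_0_lt_compat; auto).
  rewrite <- (Rinv_inv y) at 3. apply Rinv_le_contravar; lra. }
destruct (cls_dom g Hg (Rabs x) (y + / y) 2) as [C [HC H]]; auto; [lra|].
exists C; split; auto. split; [intros; apply cls_cont; auto|].
intros v u Hv Hu. assert (0 < / y) by (apply Rinv_0_lt_compat; auto).
eapply Rle_trans; [apply H; auto; lra|]. apply Rmult_le_compat_l; [|apply exp_le; lra].
apply Rmult_le_pos; auto; left; apply pw_pos.
Qed.

Lemma is_derive_Q_x v x y : 0 < y -> is_derive (fun x => Q x y v) x (2 * IZR (fst v) * (IZR (fst v) * x + IZR (snd v)) / y).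
Proof. intros Hy. unfold Q. auto_derive; auto. pow2n. field. lra. Qed.

Lemma is_derive_Q_y v x y : 0 < y -> is_derive (fun y => Q x y v) y (IZR (fst v) ^ 2 - (IZR (fst v) * x + IZR (snd v)) ^ 2 / y ^ 2).
Proof. intros Hy. unfold Q. auto_derive; [lra|]. pow2n. field. lra. Qed.

Lemma is_derive_ext_val (f : R -> R) (x l l' : R) : is_derive f x l -> l = l' -> is_derive f x l'.
Proof. intros H ->; auto. Qed.

Lemma is_derive_exp_lin (f : R -> R) c k x l : is_derive f x l ->
  is_derive (fun x => exp (- (c * f x)) * k) x (- (c * l) * exp (- (c * f x)) * k).
Proof.
intros H. auto_derive; [eexists; apply H|]. match goal with |- context [Derive ?g x] => replace (Derive g x) with l by (symmetry; apply is_derive_unique; exact H) end. ring.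
Qed.

Lemma cls_deriv g : cls g -> exists gx gy, cls gx /\ cls gy /\ forall v u x y, 0 < y ->
  is_derive (fun x => g v u x y) x (gx v u x y) /\ is_derive (fun y => g v u x y) y (gy v u x y).
Proof.
induction 1 as [w C k Hw|g Hg IH|g Hg IH|g Hg IH|g Hg IH|g h Hg IHg Hh IHh|c g Hg IH].
- assert (HB := cls_base w C k Hw). set (B := fun v u x y => theta_term v u x y * w u) in *.
  exists (fun v u x y => (- 2 * PI) * (exp u * (IZR (fst v) * ((IZR (fst v) * x + IZR (snd v)) * (/ y * B v u x y))))).
  exists (fun v u x y => (- PI) * (exp u * (IZR (fst v) * (IZR (fst v) * B v u x y))) +
     PI * (exp u * ((IZR (fst v) * x + IZR (snd v)) * ((IZR (fst v) * x + IZR (snd v)) * (/ y * (/ y * B v u x y)))))).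
  split; [|split].
  + apply cls_scal, cls_e, cls_m, cls_l, cls_y; auto.
  + apply cls_plus; [apply cls_scal, cls_e, cls_m, cls_m; auto|apply cls_scal, cls_e, cls_l, cls_l, cls_y, cls_y; auto].
  + intros v u x y Hy. split.
    * unfold B, theta_term. pose proof (is_derive_Q_x v x y Hy) as HQ.
      eapply is_derive_ext_val; [apply is_derive_exp_lin, HQ|]. apply Rminus_diag_uniq; field; lra.
    * unfold B, theta_term. pose proof (is_derive_Q_y v x y Hy) as HQ.
      eapply is_derive_ext_val; [apply is_derive_exp_lin, HQ|]. apply Rminus_diag_uniq; field; lra.
- destruct IH as [gx [gy [Hx [Hy H]]]].
  exists (fun v u x y => IZR (fst v) * gx v u x y), (fun v u x y => IZR (fst v) * gy v u x y).
  split; [apply cls_m; auto|]. split; [apply cls_m; auto|]. intros v u x y Hyy. destruct (H v u x y Hyy) as [H1 H2].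
  split; apply is_derive_scal; auto.
- destruct IH as [gx [gy [Hx [Hy H]]]].
  exists (fun v u x y => IZR (fst v) * g v u x y + (IZR (fst v) * x + IZR (snd v)) * gx v u x y), (fun v u x y => (IZR (fst v) * x + IZR (snd v)) * gy v u x y).
  split; [apply cls_plus; [apply cls_m; auto|apply cls_l; auto]|]. split; [apply cls_l; auto|].
  intros v u x y Hyy. destruct (H v u x y Hyy) as [H1 H2]. split; [|apply is_derive_scal; auto].
  apply (is_derive_mult (fun x => IZR (fst v) * x + IZR (snd v)) (fun x => g v u x y)); auto.
  + auto_derive; auto; ring.
- destruct IH as [gx [gy [Hx [Hy H]]]].
  exists (fun v u x y => / y * gx v u x y), (fun v u x y => (-1) * (/ y * (/ y * g v u x y)) + / y * gy v u x y).
  split; [apply cls_y; auto|]. split; [apply cls_plus; [apply cls_scal, cls_y, cls_y; auto|apply cls_y; auto]|].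
  intros v u x y Hyy. destruct (H v u x y Hyy) as [H1 H2]. split; [apply is_derive_scal; auto|].
  replace (-1 * (/ y * (/ y * g v u x y))) with ((- / y ^ 2) * g v u x y) by (field; lra).
  apply (is_derive_mult (fun y => / y) (fun y => g v u x y)); auto.
  + auto_derive; [lra|field; lra].
- destruct IH as [gx [gy [Hx [Hy H]]]].
  exists (fun v u x y => exp u * gx v u x y), (fun v u x y => exp u * gy v u x y).
  split; [apply cls_e; auto|]. split; [apply cls_e; auto|]. intros v u x y Hyy. destruct (H v u x y Hyy) as [H1 H2].
  split; apply is_derive_scal; auto.
- destruct IHg as [gx [gy [Hx [Hy H]]]]. destruct IHh as [hx [hy [Hx' [Hy' H']]]].
  exists (fun v u x y => gx v u x y + hx v u x y), (fun v u x y => gy v u x y + hy v u x y).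
  split; [apply cls_plus; auto|]. split; [apply cls_plus; auto|]. intros v u x y Hyy.
  destruct (H v u x y Hyy) as [H1 H2]. destruct (H' v u x y Hyy) as [H3 H4].
  split; [apply (is_derive_plus (fun x => g v u x y) (fun x => h v u x y))|apply (is_derive_plus (fun y => g v u x y) (fun y => h v u x y))]; auto.
- destruct IH as [gx [gy [Hx [Hy H]]]].
  exists (fun v u x y => c * gx v u x y), (fun v u x y => c * gy v u x y).
  split; [apply cls_scal; auto|]. split; [apply cls_scal; auto|]. intros v u x y Hyy. destruct (H v u x y Hyy) as [H1 H2].
  split; apply is_derive_scal; auto.
Qed.

Definition Lam (g : fam) (x y : R) : R := lattice_II (fun v u => g v u x y).

Definition pdx (u v : R -> R -> R) : Prop := forall x y, 0 < y -> is_derive (fun t => u t y) x (v x y).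

Definition pdy (u v : R -> R -> R) : Prop := forall x y, 0 < y -> is_derive (fun t => u x t) y (v x y).

Definition cont2 (u : R -> R -> R) : Prop := forall x y, 0 < y -> forall eps, 0 < eps -> exists d, 0 < d /\
  forall x' y', 0 < y' -> Rabs (x' - x) < d -> Rabs (y' - y) < d -> Rabs (u x' y' - u x y) < eps.

(** Real-valued counterpart of [smooth_on_H] in two real variables, so that real calculus applies to
    real and imaginary parts separately. *)
CoInductive smooth2 (u : R -> R -> R) : Prop :=
  smooth2_intro : forall ux uy, cont2 u -> pdx u ux -> pdy u uy -> smooth2 ux -> smooth2 uy -> smooth2 u.

Lemma cls_local g x y : cls g -> 0 < y -> exists C d, 0 <= C /\ 0 < d < y /\
  forall v u x' y', v <> (0, 0)%Z -> 0 <= u -> Rabs (x' - x) <= d -> Rabs (y' - y) <= d ->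
  Rabs (g v u x' y') <= C * pw 2 v * exp (- (1 * u)).
Proof.
intros Hg Hy. assert (Hi : 0 < / y) by (apply Rinv_0_lt_compat; auto).
assert (HY : 0 < 2 * y + 2 * / y) by lra.
destruct (cls_dom g Hg (Rabs x + y) (2 * y + 2 * / y) 2) as [C [HC H]]; auto; [lra|].
exists C, (y / 2). split; auto. split; [lra|]. intros v u x' y' Hv Hu Hx Hy'.
eapply Rle_trans; [apply H; auto|].
- replace x' with (x + (x' - x)) by ring. eapply Rle_trans; [apply Rabs_triang|]. lra.
- apply Rabs_le_between in Hy'. split; [|lra].
  rewrite <- (Rinv_inv y'). apply Rinv_le_contravar; [apply Rinv_0_lt_compat; lra|].
  apply Rle_trans with (/ (y / 2)); [apply Rinv_le_contravar; lra|].
  replace (/ (y / 2)) with (2 * / y) by (field; lra). lra.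
- apply Rmult_le_compat_l; [|apply exp_le; lra]. apply Rmult_le_pos; auto; left; apply pw_pos.
Qed.

Lemma Lam_quad_bound (g0 g1 g2 : Z * Z -> R -> R) C h : dd g0 -> dd g1 -> dd g2 -> 0 <= C ->
  (forall v u, v <> (0, 0)%Z -> 0 <= u -> Rabs (g1 v u - g0 v u - g2 v u * h) <= C * pw 2 v * exp (- (1 * u)) * h ^ 2) ->
  Rabs (lattice_II g1 - lattice_II g0 - lattice_II g2 * h) <= C * usum (pw 2) * h ^ 2.
Proof.
intros H0 H1 H2 HC H. pose proof (pow2_ge_0 h).
rewrite (Rmult_comm (lattice_II g2)), <- lattice_II_scal, <- !lattice_II_minus; auto.
- replace (C * usum (pw 2) * h ^ 2) with ((C * h ^ 2) * usum (pw 2)) by ring. apply lattice_II_bound. split; [apply Rmult_le_pos; auto|]. split.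
  + destruct H0 as [? [? [Hc0 _]]]. destruct H1 as [? [? [Hc1 _]]]. destruct H2 as [? [? [Hc2 _]]].
    intros v. apply contR_minus; [apply contR_minus; auto|]. apply contR_mult; auto; apply contR_const.
  + intros v u Hv Hu. rewrite (Rmult_comm h). eapply Rle_trans; [apply H; auto|]. apply Req_le; ring.
- assert (E : dd (fun v u => g1 v u + (-1) * g0 v u)) by (apply dd_plus; auto; apply dd_scal; auto).
  destruct E as [D [HD [Hc Hb]]]. exists D. split; auto. split.
  + destruct H0 as [? [? [Hc0 _]]]. destruct H1 as [? [? [Hc1 _]]]. intros v. apply contR_minus; auto.
  + intros v u Hv Hu. replace (g1 v u - g0 v u) with (g1 v u + -1 * g0 v u) by ring. auto.
- apply dd_scal; auto.
Qed.

Lemma Rabs_between_min a b t : Rmin a b <= t <= Rmax a b -> Rabs (t - a) <= Rabs (b - a).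
Proof. unfold Rmin, Rmax, Rabs. repeat destruct Rle_dec; repeat destruct Rcase_abs; lra. Qed.

(** Second derivatives of the family lie in [cls] as well, so [Taylor2_le] gives a termwise
    quadratic remainder with summable coefficients, which is what [is_derive_quadratic] asks for. *)
Lemma Lam_deriv g : cls g -> exists gx gy, cls gx /\ cls gy /\ pdx (Lam g) (Lam gx) /\ pdy (Lam g) (Lam gy) /\
  forall v u x y, 0 < y -> is_derive (fun x => g v u x y) x (gx v u x y) /\ is_derive (fun y => g v u x y) y (gy v u x y).
Proof.
intros Hg. destruct (cls_deriv g Hg) as [gx [gy [Hx [Hy H]]]].
exists gx, gy. split; [|split; [|split; [|split]]]; auto.
- destruct (cls_deriv gx Hx) as [gxx [gxy [Hxx [_ H2]]]]. intros x y Hyp.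
  destruct (cls_local gxx x y Hxx Hyp) as [C [d [HC [Hd Hb]]]].
  apply is_derive_quadratic with (C * usum (pw 2)) d; [lra|]. intros h Hh.
  apply Lam_quad_bound; auto using cls_dd. intros v u Hv Hu.
  pose proof (Taylor2_le (fun t => g v u t y) (fun t => gx v u t y) (fun t => gxx v u t y) (C * pw 2 v * exp (- (1 * u))) x (x + h)) as HT.
  replace (x + h - x) with h in HT by ring. apply HT.
  + intros t _; apply H; auto.
  + intros t _; apply H2; auto.
  + intros t Ht. apply Hb; auto.
    * apply Rabs_between_min in Ht. replace (x + h - x) with h in Ht by ring. lra.
    * rewrite Rminus_diag, Rabs_R0; lra.
- destruct (cls_deriv gy Hy) as [gyx [gyy [_ [Hyy H2]]]]. intros x y Hyp.
  destruct (cls_local gyy x y Hyy Hyp) as [C [d [HC [Hd Hb]]]].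
  apply is_derive_quadratic with (C * usum (pw 2)) d; [lra|]. intros h Hh.
  assert (Hh2 := Rabs_def2 _ _ Hh).
  apply Lam_quad_bound; auto using cls_dd. { apply cls_dd; auto; lra. } intros v u Hv Hu.
  pose proof (Taylor2_le (fun t => g v u x t) (fun t => gy v u x t) (fun t => gyy v u x t) (C * pw 2 v * exp (- (1 * u))) y (y + h)) as HT.
  replace (y + h - y) with h in HT by ring.
  assert (Ht0 : forall t, Rmin y (y + h) <= t <= Rmax y (y + h) -> 0 < t /\ Rabs (t - y) <= d).
  { intros t Ht. apply Rabs_between_min in Ht. replace (y + h - y) with h in Ht by ring.
    assert (Ht' : Rabs (t - y) <= d) by lra. split; auto. apply Rabs_le_between in Ht'. lra. }
  apply HT.
  + intros t Ht; apply H; apply Ht0; auto.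
  + intros t Ht; apply H2; apply Ht0; auto.
  + intros t Ht. apply Hb; auto; [|apply Ht0; auto]. rewrite Rminus_diag, Rabs_R0; lra.
Qed.

Lemma Lam_cont2 g : cls g -> cont2 (Lam g).
Proof.
intros Hg. destruct (cls_deriv g Hg) as [gx [gy [Hx [Hy H]]]]. intros x y Hyp eps He.
destruct (cls_local gx x y Hx Hyp) as [C [d [HC [Hd Hb]]]].
destruct (cls_local gy x y Hy Hyp) as [D [e [HD [He' Hb']]]].
assert (HK : 0 <= usum (pw 2)).
{ eapply Rle_trans; [apply Rabs_pos|]. apply usum_abs; [apply dom_pw; lra|].
  intros v; rewrite Rabs_pos_eq; [apply Rle_refl|left; apply pw_pos]. }
set (K := (C + D) * usum (pw 2)). assert (HK0 : 0 <= K) by (apply Rmult_le_pos; lra).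
assert (Hm : 0 < Rmin (Rmin d e) (eps / (K + 1))).
{ repeat apply Rmin_pos; try lra. apply Rdiv_lt_0_compat; lra. }
set (r := Rmin (Rmin d e) (eps / (K + 1))) in *.
assert (Hr1 : r <= d) by (eapply Rle_trans; [apply Rmin_l|apply Rmin_l]).
assert (Hr2 : r <= e) by (eapply Rle_trans; [apply Rmin_l|apply Rmin_r]).
assert (Hr3 : r <= eps / (K + 1)) by apply Rmin_r.
exists r; split; auto. intros x' y' Hy' Hxd Hyd.
unfold Lam. rewrite <- lattice_II_minus by (apply cls_dd; auto).
apply Rle_lt_trans with (((C + D) * r) * usum (pw 2)).
- apply lattice_II_bound. split; [apply Rmult_le_pos; lra|]. split.
  + intros v. apply contR_minus; apply cls_cont; auto.
  + intros v u Hv Hu.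
    replace (g v u x' y' - g v u x y) with ((g v u x' y' - g v u x y') + (g v u x y' - g v u x y)) by ring.
    eapply Rle_trans; [apply Rabs_triang|].
    set (P := pw 2 v * exp (- (1 * u))). assert (HP : 0 <= P) by (apply Rmult_le_pos; left; [apply pw_pos|apply exp_pos]).
    assert (H1 : Rabs (g v u x' y' - g v u x y') <= C * P * Rabs (x' - x)).
    { apply (MVT_le (fun t => g v u t y') (fun t => gx v u t y')).
      - intros t _; apply H; auto.
      - intros t Ht. unfold P; rewrite <- Rmult_assoc. apply Hb; auto; [|lra].
        apply Rabs_between_min in Ht. lra. }
    assert (H2 : Rabs (g v u x y' - g v u x y) <= D * P * Rabs (y' - y)).
    { apply (MVT_le (fun t => g v u x t) (fun t => gy v u x t)).
      - intros t Ht; apply H. unfold Rmin in Ht. destruct Rle_dec; lra.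
      - intros t Ht. unfold P; rewrite <- Rmult_assoc. apply Hb'; auto; [rewrite Rminus_diag, Rabs_R0; lra|].
        apply Rabs_between_min in Ht. lra. }
    replace ((C + D) * r * pw 2 v * exp (- (1 * u))) with (C * P * r + D * P * r) by (unfold P; ring).
    apply Rplus_le_compat.
    * eapply Rle_trans; [apply H1|]. apply Rmult_le_compat_l; [apply Rmult_le_pos; auto|lra].
    * eapply Rle_trans; [apply H2|]. apply Rmult_le_compat_l; [apply Rmult_le_pos; auto|lra].
- replace ((C + D) * r * usum (pw 2)) with (K * r) by (unfold K; ring).
  apply Rle_lt_trans with (K * (eps / (K + 1))); [apply Rmult_le_compat_l; auto|].
  apply Rmult_lt_reg_r with (K + 1); [lra|]. replace (K * (eps / (K + 1)) * (K + 1)) with (K * eps) by (field; lra). nra.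
Qed.

(** Quantified over the whole class, because the corecursion passes from [g] to its derivatives,
    which [Lam_deriv] finds in [cls] again. *)
Lemma Lam_smooth : forall g, cls g -> smooth2 (Lam g).
Proof.
cofix IH. intros g Hg. destruct (Lam_deriv g Hg) as [gx [gy [Hx [Hy [H1 [H2 _]]]]]].
apply (smooth2_intro (Lam g) (Lam gx) (Lam gy)); auto. apply Lam_cont2; auto.
Qed.

(** * Exponentially bounded weights and the sequence [W n] *)

Definition egrowthE (w : R -> R) : Prop := exists C k, egrowth w C k.

Lemma egrowthE_plus w1 w2 : egrowthE w1 -> egrowthE w2 -> egrowthE (fun u => w1 u + w2 u).
Proof.
intros [C [k H]] [D [l H']]. pose proof (egrowth_C _ _ _ H). pose proof (egrowth_C _ _ _ H').
destruct H as [Hc [Hk H]], H' as [Hc' [Hl H']]. exists (C + D), (k + l). split; [|split].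
- apply contR_plus; auto.
- lra.
- intros u. eapply Rle_trans; [apply Rabs_triang|]. rewrite Rmult_plus_distr_r. pose proof (Rabs_pos u).
  apply Rplus_le_compat; (eapply Rle_trans; [apply H || apply H'|]); (apply Rmult_le_compat_l; [auto|apply exp_le; nra]).
Qed.

Lemma egrowthE_mult w1 w2 : egrowthE w1 -> egrowthE w2 -> egrowthE (fun u => w1 u * w2 u).
Proof.
intros [C [k H]] [D [l H']]. pose proof (egrowth_C _ _ _ H). pose proof (egrowth_C _ _ _ H').
destruct H as [Hc [Hk H]], H' as [Hc' [Hl H']]. exists (C * D), (k + l). split; [|split].
- apply contR_mult; auto.
- lra.
- intros u. rewrite Rabs_mult, Rmult_plus_distr_r, exp_plus.
  replace (C * D * (exp (k * Rabs u) * exp (l * Rabs u))) with ((C * exp (k * Rabs u)) * (D * exp (l * Rabs u))) by ring.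
  apply Rmult_le_compat; auto using Rabs_pos.
Qed.

Lemma egrowthE_const c : egrowthE (fun _ => c).
Proof.
exists (Rabs c), 0. split; [apply contR_const|]. split; [lra|]. intros u. rewrite Rmult_0_l, exp_0; lra.
Qed.

Lemma egrowthE_exp : egrowthE exp.
Proof.
exists 1, 1. split; [apply contR_exp|]. split; [lra|]. intros u. rewrite Rabs_pos_eq by (left; apply exp_pos).
rewrite !Rmult_1_l. apply exp_le, Rle_abs.
Qed.

Lemma is_derive_pow_fact n t : is_derive (fun t => t ^ S n / INR (fact (S n))) t (t ^ n / INR (fact n)).
Proof.
pose proof (INR_fact_neq_0 n). assert (INR (S n) <> 0) by (apply not_0_INR; lia).
assert (E : INR (fact (S n)) = INR (S n) * INR (fact n)) by (rewrite fact_simpl, mult_INR; auto).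
rewrite E. apply is_derive_ext_val with (INR (S n) * t ^ n / (INR (S n) * INR (fact n))); [|field; auto].
apply (is_derive_scal_l (fun t => t ^ S n) t (INR (S n) * t ^ n) (/ (INR (S n) * INR (fact n)))).
apply is_derive_Reals, derivable_pt_lim_pow.
Qed.

Lemma pow_fact_le_exp n u : 0 <= u -> u ^ n / INR (fact n) <= exp u.
Proof.
intros Hu. revert u Hu. induction n; intros u Hu.
- simpl. pose proof (exp_ineq1_le u). unfold Rdiv. rewrite Rinv_1. lra.
- assert (H : RInt (fun t => t ^ n / INR (fact n)) 0 u <= RInt exp 0 u).
  { apply RIle; auto; [|apply contR_exp|intros; apply IHn; lra].
    intros t. apply (ex_derive_continuous (fun t => t ^ n / INR (fact n)) t). auto_derive; auto. }
  pose proof (INR_fact_neq_0 n).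
  rewrite (FTC exp exp), (FTC (fun t => t ^ S n / INR (fact (S n)))) in H.
  + rewrite exp_0 in H. replace (0 ^ S n / INR (fact (S n))) with 0 in H by (simpl; unfold Rdiv; ring). lra.
  + intros t. apply is_derive_pow_fact.
  + intros t. apply (ex_derive_continuous (fun t => t ^ n / INR (fact n)) t). auto_derive; auto.
  + intros t. apply is_derive_Reals, derivable_pt_lim_exp.
  + apply contR_exp.
Qed.

(* [wA (S (S j)) u = u^j/j!] and [wB (S (S j)) u = (-u)^j/j! e^u]; their sum is the
   coefficient of [s^j] in [e^(us) + e^(u(1-s))]. The two leading zeros make the recursions for
   derivatives uniform in the index. *)
Definition wA (n : nat) (u : R) : R := match n with S (S j) => u ^ j / INR (fact j) | _ => 0 end.

Definition wB (n : nat) (u : R) : R := match n with S (S j) => (- u) ^ j / INR (fact j) * exp u | _ => 0 end.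

Definition W (n : nat) (u : R) : R := wA n u + wB n u.

Lemma contR_wA n : contR (wA n).
Proof.
intros u. destruct n as [|[|j]]; try apply continuous_const.
apply (ex_derive_continuous (wA (S (S j))) u). unfold wA. auto_derive; auto.
Qed.

Lemma egrowthE_wA n : egrowthE (wA n).
Proof.
exists 1, 1. split; [apply contR_wA|]. split; [lra|]. intros u. rewrite !Rmult_1_l.
destruct n as [|[|j]]; unfold wA; try (rewrite Rabs_R0; left; apply exp_pos).
unfold Rdiv. rewrite Rabs_mult, <- RPow_abs, Rabs_inv, (Rabs_pos_eq (INR _)) by apply pos_INR.
apply pow_fact_le_exp, Rabs_pos.
Qed.

Lemma wB_wA n u : wB n u = wA n (- u) * exp u.
Proof. destruct n as [|[|j]]; unfold wA, wB; auto; ring. Qed.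

Lemma egrowthE_ext w1 w2 : (forall u, w1 u = w2 u) -> egrowthE w1 -> egrowthE w2.
Proof.
intros E. assert (w1 = w2) by (apply FunctionalExtensionality.functional_extensionality; auto). subst; auto.
Qed.

Lemma egrowthE_wB n : egrowthE (wB n).
Proof.
apply egrowthE_ext with (fun u => wA n (- u) * exp u); [intros; rewrite wB_wA; auto|].
apply egrowthE_mult; [|apply egrowthE_exp]. destruct (egrowthE_wA n) as [C [k [Hc [Hk H]]]].
exists C, k. split; [|split]; auto.
- apply (contR_comp (wA n)); auto. intros u. apply (ex_derive_continuous Ropp u). auto_derive; auto.
- intros u. rewrite <- (Rabs_Ropp u). apply H.
Qed.

Lemma wA_deriv n u : is_derive (wA (S n)) u (wA n u).
Proof.
destruct n as [|[|j]].
- unfold wA. auto_derive; auto.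
- unfold wA. auto_derive; auto. ring.
- apply is_derive_pow_fact.
Qed.

Lemma wB_deriv n u : is_derive (wB (S n)) u (wB (S n) u - wB n u).
Proof.
apply is_derive_ext with (fun u => wA (S n) (- u) * exp u); [intros; rewrite wB_wA; auto|].
rewrite !wB_wA. replace (wA (S n) (- u) * exp u - wA n (- u) * exp u) with (- wA n (- u) * exp u + wA (S n) (- u) * exp u) by ring.
apply (is_derive_mult (fun u => wA (S n) (- u)) exp).
- apply is_derive_ext_val with ((-1) * wA n (- u)); [|ring].
  apply (is_derive_comp (wA (S n)) Ropp); [apply wA_deriv|]. auto_derive; auto.
- apply is_derive_Reals, derivable_pt_lim_exp.
Qed.

Definition W1 (n : nat) (u : R) : R := wA (S n) u + (wB (S (S n)) u - wB (S n) u).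

Definition W2 (n : nat) (u : R) : R := wA n u + ((wB (S (S n)) u - wB (S n) u) - (wB (S n) u - wB n u)).

Lemma W_deriv n u : is_derive (W (S (S n))) u (W1 n u).
Proof. apply (is_derive_plus (wA (S (S n))) (wB (S (S n)))); [apply wA_deriv|apply wB_deriv]. Qed.

Lemma W1_deriv n u : is_derive (W1 n) u (W2 n u).
Proof.
apply (is_derive_plus (wA (S n)) (fun u => wB (S (S n)) u - wB (S n) u)); [apply wA_deriv|].
apply (is_derive_minus (wB (S (S n))) (wB (S n))); apply wB_deriv.
Qed.

(** Both e^(us) and e^(u(1-s)) solve w'' - w' = s (s - 1) w; this compares the coefficients of s^n.
    The eigenvalue s (s - 1) of the Laplacian thereby becomes a recursion with two predecessors. *)
Lemma W_ode n u : W2 n u - W1 n u = W n u - W (S n) u.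
Proof. unfold W1, W2, W. ring. Qed.

Lemma egrowthE_scal c w : egrowthE w -> egrowthE (fun u => c * w u).
Proof. intros H. apply (egrowthE_mult (fun _ => c)); auto. apply egrowthE_const. Qed.

Lemma egrowthE_minus w1 w2 : egrowthE w1 -> egrowthE w2 -> egrowthE (fun u => w1 u - w2 u).
Proof.
intros H1 H2. apply egrowthE_ext with (fun u => w1 u + (-1) * w2 u); [intros; ring|].
apply egrowthE_plus; auto. apply egrowthE_scal; auto.
Qed.

Lemma egrowthE_W n : egrowthE (W n).
Proof. apply (egrowthE_plus (wA n) (wB n)); [apply egrowthE_wA|apply egrowthE_wB]. Qed.

Lemma egrowthE_W1 n : egrowthE (W1 n).
Proof. apply (egrowthE_plus (wA (S n))); [apply egrowthE_wA|]. apply egrowthE_minus; apply egrowthE_wB. Qed.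

Lemma egrowthE_W2 n : egrowthE (W2 n).
Proof.
apply (egrowthE_plus (wA n)); [apply egrowthE_wA|]. apply (egrowthE_minus (fun u => wB (S (S n)) u - wB (S n) u) (fun u => wB (S n) u - wB n u)); apply egrowthE_minus; apply egrowthE_wB.
Qed.

Definition base (w : R -> R) : fam := fun v u x y => theta_term v u x y * w u.

(* With [t = e^u], [LamW w] is the integral of [(theta(t) - 1) w(ln t) dt/t] over [t >= 1]. *)
Definition LamW (w : R -> R) : R -> R -> R := Lam (base w).

Lemma cls_baseE w : egrowthE w -> cls (base w).
Proof. intros [C [k H]]; eapply cls_base; eauto. Qed.

(** * The Laplacian of a theta integral *)

Lemma is_derive_loc_exp (f f1 : R -> R) c k x f2 : is_derive f x (f1 x) -> is_derive f1 x f2 ->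
  is_derive (fun t => - (c * f1 t) * exp (- (c * f t)) * k) x (((c * f1 x) ^ 2 - c * f2) * exp (- (c * f x)) * k).
Proof.
intros H1 H2.
apply is_derive_ext with (fun t => (- c * f1 t) * (exp (- (c * f t)) * k)); [intros; rring|].
apply is_derive_ext_val with ((- c * f2) * (exp (- (c * f x)) * k) + (- c * f1 x) * (- (c * f1 x) * exp (- (c * f x)) * k)); [|rring].
apply (is_derive_mult (fun t => - c * f1 t) (fun t => exp (- (c * f t)) * k)).
- apply is_derive_scal; auto.
- apply is_derive_exp_lin; auto.
Qed.

(** y^2 |grad Q|^2 = Q^2 and y^2 (Q_xx + Q_yy) = 2 Q. The derivatives are arbitrary witnesses, as
    [Lam_deriv] supplies them, and are identified with the explicit ones by uniqueness. *)
Lemma base_laplacian w gx gxx gy gyy :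
  (forall v u x y, 0 < y -> is_derive (fun x => base w v u x y) x (gx v u x y)) ->
  (forall v u x y, 0 < y -> is_derive (fun x => gx v u x y) x (gxx v u x y)) ->
  (forall v u x y, 0 < y -> is_derive (fun y => base w v u x y) y (gy v u x y)) ->
  (forall v u x y, 0 < y -> is_derive (fun y => gy v u x y) y (gyy v u x y)) ->
  forall v u x y, 0 < y -> y ^ 2 * (gxx v u x y + gyy v u x y) =
    ((PI * exp u * Q x y v) ^ 2 - 2 * (PI * exp u * Q x y v)) * (theta_term v u x y * w u).
Proof.
intros Hx Hxx Hy Hyy v u x y Hyp. set (c := PI * exp u). set (m := IZR (fst v)). set (n := IZR (snd v)).
assert (Ex : forall t, gx v u t y = - (c * (2 * m * (m * t + n) / y)) * exp (- (c * Q t y v)) * w u).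
{ intros t. rewrite <- (is_derive_unique _ _ _ (Hx v u t y Hyp)). apply is_derive_unique.
  unfold base, theta_term. apply is_derive_exp_lin, is_derive_Q_x; auto. }
assert (Exx : gxx v u x y = ((c * (2 * m * (m * x + n) / y)) ^ 2 - c * (2 * m * m / y)) * exp (- (c * Q x y v)) * w u).
{ rewrite <- (is_derive_unique _ _ _ (Hxx v u x y Hyp)). apply is_derive_unique.
  apply is_derive_ext with (fun t => - (c * (2 * m * (m * t + n) / y)) * exp (- (c * Q t y v)) * w u); [intros; symmetry; apply Ex|].
  apply (is_derive_loc_exp (fun t => Q t y v) (fun t => 2 * m * (m * t + n) / y)); [apply is_derive_Q_x; auto|].
  auto_derive; auto. field; lra. }
assert (Ey : forall t, 0 < t -> gy v u x t = - (c * (m ^ 2 - (m * x + n) ^ 2 / t ^ 2)) * exp (- (c * Q x t v)) * w u).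
{ intros t Ht. rewrite <- (is_derive_unique _ _ _ (Hy v u x t Ht)). apply is_derive_unique.
  unfold base, theta_term. apply is_derive_exp_lin, is_derive_Q_y; auto. }
assert (Eyy : gyy v u x y = ((c * (m ^ 2 - (m * x + n) ^ 2 / y ^ 2)) ^ 2 - c * (2 * (m * x + n) ^ 2 / y ^ 3)) * exp (- (c * Q x y v)) * w u).
{ rewrite <- (is_derive_unique _ _ _ (Hyy v u x y Hyp)). apply is_derive_unique.
  apply is_derive_ext_loc with (fun t => - (c * (m ^ 2 - (m * x + n) ^ 2 / t ^ 2)) * exp (- (c * Q x t v)) * w u).
  - exists (mkposreal y Hyp). intros t Ht. symmetry; apply Ey. apply Rabs_def2 in Ht. simpl in Ht. unfold minus, plus, opp in Ht; simpl in Ht. lra.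
  - apply (is_derive_loc_exp (fun t => Q x t v) (fun t => m ^ 2 - (m * x + n) ^ 2 / t ^ 2)); [apply is_derive_Q_y; auto|].
    auto_derive; [repeat apply Rmult_integral_contrapositive_currified; lra|]. field; lra. }
rewrite Exx, Eyy. change (theta_term v u x y) with (exp (- (c * Q x y v))).
set (E := exp (- (c * Q x y v))). unfold Q. fold m n. field. lra.
Qed.

Lemma base_decays w C k x y v : egrowth w C k -> 0 < y -> v <> (0, 0)%Z ->
  exists D, decays (fun u => theta_term v u x y * w u) D 1.
Proof.
intros Hw Hy Hv. eexists. split; [|split; [lra|]].
- apply (cls_cont _ (cls_base w C k Hw)).
- intros u Hu. eapply Rle_trans; [apply (base_dom w C k (Rabs x) (/ y) y 1); auto; try lra|].
  + apply Rinv_0_lt_compat; auto.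
  + rewrite Rinv_inv; lra.
  + apply Rle_refl.
Qed.

(** With X = PI e^u Q, (X^2 - 2X) e^(-X) is the second plus the first u-derivative of e^(-X), so the
    adjoint on weights is w'' - w'. At infinity nothing remains; the boundary term comes from u =
    0. *)
Lemma base_by_parts w w1 w2 x y v :
  egrowthE w -> egrowthE w1 -> egrowthE w2 ->
  (forall u, is_derive w u (w1 u)) -> (forall u, is_derive w1 u (w2 u)) -> 0 < y -> v <> (0, 0)%Z ->
  nice (fun u => ((PI * exp u * Q x y v) ^ 2 - 2 * (PI * exp u * Q x y v)) * (theta_term v u x y * w u)) ->
  II (fun u => ((PI * exp u * Q x y v) ^ 2 - 2 * (PI * exp u * Q x y v)) * (theta_term v u x y * w u)) =
  II (fun u => theta_term v u x y * (w2 u - w1 u)) + exp (- (PI * 1 * Q x y v)) * ((PI * Q x y v - 1) * w 0 + w1 0).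
Proof.
intros Hw Hw1 Hw2 Hd1 Hd2 Hy Hv Hn.
assert (Hn2 : nice (fun u => theta_term v u x y * (w2 u - w1 u))).
{ destruct (egrowthE_minus _ _ Hw2 Hw1) as [C [k H]]. destruct (base_decays _ C k x y v H Hy Hv) as [D HD]. exists D, 1; auto. }
set (q := Q x y v) in *.
(* Both integrations by parts in a single primitive: e^(-X) [wt] differentiates to the difference of
   the two integrands. *)
set (wt := fun u => (- (PI * q)) * exp u * w u + (w u - w1 u)).
assert (Hwt : egrowthE wt).
{ apply egrowthE_plus; [|apply egrowthE_minus; auto]. apply (egrowthE_mult (fun u => (- (PI * q)) * exp u)); auto. apply egrowthE_scal, egrowthE_exp. }
destruct Hwt as [C [k Hwt]]. destruct (base_decays wt C k x y v Hwt Hy Hv) as [D [_ [_ HD]]].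
assert (E : II (fun u => ((PI * exp u * q) ^ 2 - 2 * (PI * exp u * q)) * (theta_term v u x y * w u) - theta_term v u x y * (w2 u - w1 u)) = - (theta_term v 0 x y * wt 0)).
{ apply (II_FTC (fun u => theta_term v u x y * wt u) _ D 1); auto; [|apply contR_minus; apply nice_cont; auto|lra].
  intros u. unfold wt, theta_term. fold q.
  auto_derive.
  - repeat split; first [exact I|exact (ex_intro _ _ (Hd1 u))|exact (ex_intro _ _ (Hd2 u))].
  - repeat match goal with |- context [Derive ?g u] =>
      first [replace (Derive g u) with (w1 u) by (symmetry; apply is_derive_unique; exact (Hd1 u))
            |replace (Derive g u) with (w2 u) by (symmetry; apply is_derive_unique; exact (Hd2 u))] end.
    ring. }
rewrite (II_minus _ _ Hn Hn2) in E.
assert (Ef : - (theta_term v 0 x y * wt 0) = exp (- (PI * 1 * q)) * ((PI * q - 1) * w 0 + w1 0)).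
{ unfold wt, theta_term. fold q. rewrite exp_0. ring. }
rewrite <- Ef, <- E. rring.
Qed.

(** The boundary terms are left as a lattice sum, since they depend on [w 0] and [w1 0];
    [boundary_sum] evaluates the one nonzero case that occurs. *)
Lemma Lam_laplacian w w1 w2 : egrowthE w -> egrowthE w1 -> egrowthE w2 ->
  (forall u, is_derive w u (w1 u)) -> (forall u, is_derive w1 u (w2 u)) ->
  exists fx fy fxx fyy, pdx (LamW w) fx /\ pdy (LamW w) fy /\ pdx fx fxx /\ pdy fy fyy /\
  forall x y, 0 < y -> is_usum (fun v => nz v (exp (- (PI * 1 * Q x y v)) * ((PI * Q x y v - 1) * w 0 + w1 0)))
    (y ^ 2 * (fxx x y + fyy x y) - LamW (fun u => w2 u - w1 u) x y).
Proof.
intros Hw Hw1 Hw2 Hd1 Hd2. assert (Hb := cls_baseE w Hw).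
destruct (Lam_deriv _ Hb) as [gx [gy [Cx [Cy [Px [Py D1]]]]]].
destruct (Lam_deriv gx Cx) as [gxx [gxy [Cxx [_ [Pxx [_ D2]]]]]].
destruct (Lam_deriv gy Cy) as [gyx [gyy [_ [Cyy [_ [Pyy D3]]]]]].
exists (Lam gx), (Lam gy), (Lam gxx), (Lam gyy). split; [exact Px|]. split; [exact Py|]. split; [exact Pxx|]. split; [exact Pyy|]. intros x y Hy.
assert (HE : forall v u, y ^ 2 * (gxx v u x y + gyy v u x y) =
    ((PI * exp u * Q x y v) ^ 2 - 2 * (PI * exp u * Q x y v)) * (theta_term v u x y * w u)).
{ intros v u. apply (base_laplacian w gx gxx gy gyy); auto; intros; try (apply D1; auto); [apply D2|apply D3]; auto. }
assert (Hdd := cls_dd _ x y (cls_plus _ _ Cxx Cyy) Hy).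
assert (Hdd2 := dd_scal (y ^ 2) _ Hdd).
assert (EL : y ^ 2 * (Lam gxx x y + Lam gyy x y) = lattice_II (fun v u => y ^ 2 * (gxx v u x y + gyy v u x y))).
{ unfold Lam. rewrite lattice_II_scal, lattice_II_plus; auto; apply cls_dd; auto. }
rewrite EL.
assert (Hb2 := cls_baseE _ (egrowthE_minus _ _ Hw2 Hw1)).
assert (HL := is_usum_lattice_II _ Hdd2). assert (HR := is_usum_lattice_II _ (cls_dd _ x y Hb2 Hy)).
replace (lattice_II (fun v u => y ^ 2 * (gxx v u x y + gyy v u x y)) - LamW (fun u => w2 u - w1 u) x y)
  with (lattice_II (fun v u => y ^ 2 * (gxx v u x y + gyy v u x y)) + (-1) * lattice_II (fun v u => base (fun u => w2 u - w1 u) v u x y)) by (unfold LamW, Lam; ring).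
apply is_usum_ext with (2 := is_usum_plus _ _ _ _ HL (is_usum_scal (-1) _ _ HR)).
intros v. unfold nz. destruct eq_dec_cl as [E|Hv]; [ring|].
assert (Hnv := dd_nice _ v Hdd2 Hv).
rewrite (II_ext _ (fun u => ((PI * exp u * Q x y v) ^ 2 - 2 * (PI * exp u * Q x y v)) * (theta_term v u x y * w u))) by (intros; apply HE).
rewrite (base_by_parts w w1 w2); auto.
- unfold base. rring.
- apply nice_ext with (2 := Hnv). intros; apply HE.
Qed.

Lemma is_usum_single : is_usum (fun v : Z * Z => if eq_dec_cl v (0, 0)%Z then 1 else 0) 1.
Proof.
intros eps He. exists ((0, 0)%Z :: nil). split; [constructor; [intros []|constructor]|].
intros B HB HAB. assert (H : fsum (fun v : Z * Z => if eq_dec_cl v (0, 0)%Z then 1 else 0) B = if in_dec eq_dec_cl (0, 0)%Z B then 1 else 0).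
{ clear HAB. induction HB as [|b B Hb HB IH]; [simpl; auto|]. simpl fsum. rewrite IH.
  destruct (in_dec eq_dec_cl (0, 0)%Z B), (in_dec eq_dec_cl (0, 0)%Z (b :: B)), (eq_dec_cl b (0, 0)%Z); simpl in *; subst; try tauto; try ring. }
rewrite H. destruct in_dec as [|n]; [rewrite Rminus_diag, Rabs_R0; lra|].
exfalso; apply n, HAB; left; auto.
Qed.

(** 18 = 16 + 2, from (X/4)^2 <= e^(X/2) and X/2 <= e^(X/2). Half of the exponent is kept for
    summability over the lattice. *)
Lemma poly_exp_le X : 0 <= X -> (X ^ 2 + X) * exp (- X) <= 18 * exp (- (X / 2)).
Proof.
intros HX. assert (H1 : X ^ 2 + X <= 18 * exp (X / 2)).
{ pose proof (exp_ineq1_le (X / 4)) as H. pose proof (exp_ineq1_le (X / 2)) as H'.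
  replace (X / 2) with (X / 4 + X / 4) at 1 by field. rewrite exp_plus.
  assert ((X / 4) ^ 2 <= exp (X / 4) * exp (X / 4)) by (simpl; rewrite Rmult_1_r; apply Rmult_le_compat; lra).
  replace (X / 2) with (X / 4 + X / 4) in H' by field. rewrite exp_plus in H'. nra. }
apply Rle_trans with (18 * exp (X / 2) * exp (- X)); [apply Rmult_le_compat_r; auto; left; apply exp_pos|].
apply Req_le. rewrite Rmult_assoc, <- exp_plus. do 2 f_equal. field.
Qed.

(** The variable u = ln t places t = 1 at 0 and turns the inversion of t into u -> -u, in
    preparation for differentiating the functional equation. *)
Lemma theta_lat_deriv x y : 0 < y -> exists D,
  is_usum (fun v => - (PI * 1 * Q x y v) * exp (- (PI * 1 * Q x y v))) D /\ is_derive (fun u => theta_lat (exp u) x y) 0 D.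
Proof.
intros Hy. pose proof PI_RGT_0 as HPI.
set (f := fun v u => exp (- (PI * exp u * Q x y v))).
set (f1 := fun v u => - (PI * exp u * Q x y v) * exp (- (PI * exp u * Q x y v))).
set (f2 := fun v u => ((PI * exp u * Q x y v) ^ 2 - PI * exp u * Q x y v) * exp (- (PI * exp u * Q x y v))).
assert (Hf1 : forall v u, is_derive (f v) u (f1 v u)) by (intros; unfold f, f1; auto_derive; auto; ring).
assert (Hf2 : forall v u, is_derive (f1 v) u (f2 v u)) by (intros; unfold f1, f2; auto_derive; auto; ring).
(* For u >= -1 one has e^u >= 1/3, because e <= 3; [poly_exp_le] halves the exponent, hence the
   parameter 1/6. *)
set (M := fun v => 18 * (Qdom (/ 6) x y 2 * pw 2 v)).
assert (HM : dom M) by (apply dom_scal; [lra|apply dom_Q; lra]).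
assert (HQ : forall v, 0 <= Q x y v) by (intros; apply Q_nonneg; auto).
assert (Hb : forall v u, -1 <= u -> ((PI * exp u * Q x y v) ^ 2 + PI * exp u * Q x y v) * exp (- (PI * exp u * Q x y v)) <= M v).
{ intros v u Hu. specialize (HQ v).
  assert (He : / 3 <= exp u).
  { apply Rle_trans with (exp (-1)); [|apply exp_le; auto]. replace (-1) with (- (1)) by ring. rewrite exp_Ropp. apply Rinv_le_contravar; [apply exp_pos|apply exp_le_3]. }
  assert (HX : PI * / 6 * Q x y v <= (PI * exp u * Q x y v) / 2).
  { assert (0 <= PI * Q x y v) by (apply Rmult_le_pos; lra). nra. }
  eapply Rle_trans; [apply poly_exp_le; apply Rmult_le_pos; auto; apply Rmult_le_pos; [lra|left; apply exp_pos]|].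
  apply Rmult_le_compat_l; [lra|]. eapply Rle_trans; [|apply exp_Q_le_all; lra]. apply exp_le. lra. }
assert (Hp : forall v u, 0 <= PI * exp u * Q x y v).
{ intros. apply Rmult_le_pos; auto. apply Rmult_le_pos; [lra|left; apply exp_pos]. }
assert (Hb1 : forall v u, -1 <= u -> Rabs (f1 v u) <= M v).
{ intros v u Hu. eapply Rle_trans; [|apply (Hb v u Hu)]. unfold f1. rewrite Rabs_mult, (Rabs_pos_eq (exp _)) by (left; apply exp_pos).
  apply Rmult_le_compat_r; [left; apply exp_pos|]. rewrite Rabs_Ropp, Rabs_pos_eq by auto.
  pose proof (pow2_ge_0 (PI * exp u * Q x y v)). lra. }
assert (Hb2 : forall v u, -1 <= u -> Rabs (f2 v u) <= M v).
{ intros v u Hu. eapply Rle_trans; [|apply (Hb v u Hu)]. unfold f2. rewrite Rabs_mult, (Rabs_pos_eq (exp _)) by (left; apply exp_pos).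
  apply Rmult_le_compat_r; [left; apply exp_pos|]. pose proof (pow2_ge_0 (PI * exp u * Q x y v)). specialize (Hp v u). apply Rabs_le; lra. }
exists (usum (fun v => f1 v 0)). split.
- apply is_usum_ext with (fun v => f1 v 0); [intros v; unfold f1; rewrite exp_0; auto|].
  apply is_usum_dom with M; auto. intros; apply Hb1; lra.
- apply is_derive_quadratic with (usum M) 1; [lra|]. intros h Hh. rewrite Rplus_0_l.
  apply Rabs_def2 in Hh.
  assert (HS : is_usum (fun v => f v h + (-1) * f v 0 + (- h) * f1 v 0) (theta_lat (exp h) x y + (-1) * theta_lat (exp 0) x y + (- h) * usum (fun v => f1 v 0))).
  { apply is_usum_plus; [apply is_usum_plus|]; [apply is_usum_theta_lat; auto; apply exp_pos|apply is_usum_scal, is_usum_theta_lat; auto; apply exp_pos|].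
    apply is_usum_scal. apply is_usum_dom with M; auto. intros; apply Hb1; lra. }
  replace (theta_lat (exp h) x y - theta_lat (exp 0) x y - usum (fun v => f1 v 0) * h) with (theta_lat (exp h) x y + (-1) * theta_lat (exp 0) x y + (- h) * usum (fun v => f1 v 0)) by ring.
  rewrite (Rmult_comm (usum M)). rewrite <- (usum_scal (h ^ 2) M M); auto.
  2: intros v; rewrite Rabs_pos_eq; [lra|apply HM].
  apply (is_usum_abs_le _ (fun v => h ^ 2 * M v) _ (dom_scal _ _ (pow2_ge_0 h) HM) HS).
  intros v. replace (f v h + -1 * f v 0 + - h * f1 v 0) with (f v h - f v 0 - f1 v 0 * (h - 0)) by ring.
  rewrite (Rmult_comm (h ^ 2)). replace (h ^ 2) with ((h - 0) ^ 2) by ring.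
  apply (Taylor2_le (f v) (f1 v) (f2 v)); auto.
  intros t Ht. apply Hb2. unfold Rmin in Ht; destruct Rle_dec; lra.
Qed.

(** By 2 theta'(1) + theta(1) = 0, the sum of (2 PI Q - 1) e^(-PI Q) over the whole lattice is 0;
    the origin contributes -1, so the rest contributes 1. The numbers 2 and 1 are the value and the
    slope at 0 of the weight [W 2] = 1 + e^u. *)
Lemma boundary_sum x y : 0 < y ->
  is_usum (fun v => nz v (exp (- (PI * 1 * Q x y v)) * ((PI * Q x y v - 1) * 2 + 1))) 1.
Proof.
intros Hy. destruct (theta_lat_deriv x y Hy) as [D [HD Hd]].
assert (E : 2 * D + theta_lat 1 x y = 0).
{ assert (Hd1 : is_derive (fun u => theta_lat (exp (- u)) x y) 0 (- D)).
  { apply is_derive_ext_val with ((-1) * D); [|ring].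
    apply (is_derive_comp (fun u => theta_lat (exp u) x y) Ropp); [rewrite Ropp_0; auto|]. auto_derive; auto. }
  assert (Hd2 : is_derive (fun u => exp u * theta_lat (exp u) x y) 0 (1 * theta_lat (exp 0) x y + exp 0 * D)).
  { apply (is_derive_mult exp (fun u => theta_lat (exp u) x y)); auto.
    apply is_derive_ext_val with (exp 0); [|apply exp_0]. apply is_derive_Reals, derivable_pt_lim_exp. }
  assert (Hd3 : is_derive (fun u => theta_lat (exp (- u)) x y) 0 (1 * theta_lat (exp 0) x y + exp 0 * D)).
  { apply is_derive_ext with (2 := Hd2). intros u. rewrite exp_Ropp, theta_lat_functional; auto. apply exp_pos. }
  pose proof (is_derive_unique _ _ _ Hd1) as U1. rewrite (is_derive_unique _ _ _ Hd3) in U1. rewrite exp_0 in U1. lra. }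
assert (H0 : is_usum (fun v => (-2) * (- (PI * 1 * Q x y v) * exp (- (PI * 1 * Q x y v))) + (-1) * exp (- (PI * 1 * Q x y v)) + (if eq_dec_cl v (0, 0)%Z then 1 else 0))
   ((-2) * D + (-1) * theta_lat 1 x y + 1)).
{ apply is_usum_plus; [apply is_usum_plus; apply is_usum_scal; auto; apply is_usum_theta_lat; auto; lra|]. apply is_usum_single. }
replace ((-2) * D + (-1) * theta_lat 1 x y + 1) with 1 in H0 by lra.
apply is_usum_ext with (2 := H0). intros v. unfold nz. destruct eq_dec_cl as [->|n]; [|ring].
rewrite Q_0, !Rmult_0_r, Ropp_0, exp_0. ring.
Qed.

(** * Modular invariance and growth of theta integrals *)

Lemma Q_modular a b c d x y x' y' v : (a * d - b * c = 1)%Z -> 0 < y ->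
  let den := (IZR c * x + IZR d) ^ 2 + (IZR c * y) ^ 2 in
  x' = ((IZR a * x + IZR b) * (IZR c * x + IZR d) + IZR a * IZR c * y ^ 2) / den -> y' = y / den ->
  Q x' y' v = Q x y (fst v * a + snd v * c, fst v * b + snd v * d)%Z.
Proof.
intros Hdet Hy den Hx' Hy'.
assert (HD : IZR a * IZR d - IZR b * IZR c = 1) by (rewrite <- !mult_IZR, <- minus_IZR, Hdet; auto).
assert (Hden : 0 < den).
{ unfold den. destruct (Req_dec (IZR c) 0) as [E|E].
  - assert (IZR d <> 0) by (intros E'; rewrite E, E' in HD; lra).
    rewrite E, !Rmult_0_l. assert (0 < (0 + IZR d) ^ 2) by (apply pow2_gt_0; lra). lra.
  - assert (0 < (IZR c * y) ^ 2) by (apply pow2_gt_0, Rmult_integral_contrapositive_currified; lra).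
    pose proof (pow2_ge_0 (IZR c * x + IZR d)). lra. }
rewrite Hx', Hy'. unfold Q; simpl fst; simpl snd. rewrite !plus_IZR, !mult_IZR.
set (m := IZR (fst v)) in *. set (n := IZR (snd v)) in *.
set (A := IZR a) in *. set (B := IZR b) in *. set (C := IZR c) in *. set (E := IZR d) in *.
assert (HD2 : m ^ 2 * y = m ^ 2 * y * (A * E - B * C) ^ 2) by (rewrite HD; ring).
set (P := (A * x + B) * (C * x + E) + A * C * y ^ 2).
(* Both sides are |cz + d|^2 |m (az + b) + n (cz + d)|^2, since the determinant is 1: the action on
   z is traded for the right action on the row (m, n). *)
assert (Hkey : m ^ 2 * y ^ 2 * (A * E - B * C) ^ 2 + (m * P + n * den) ^ 2 =
  den * ((m * A + n * C) ^ 2 * y ^ 2 + ((m * A + n * C) * x + (m * B + n * E)) ^ 2)).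
{ unfold P, den. ring. }
rewrite HD in Hkey.
replace (m ^ 2 * (y / den) + (m * (P / den) + n) ^ 2 / (y / den)) with ((m ^ 2 * y ^ 2 * 1 ^ 2 + (m * P + n * den) ^ 2) / (den * y)) by (field; lra).
rewrite Hkey. field. lra.
Qed.

(** The right action of the matrix permutes the lattice and fixes the origin, so the sum may be
    reindexed; the inverse matrix gives the inverse map. *)
Lemma LamW_modular w a b c d x y x' y' : egrowthE w -> (a * d - b * c = 1)%Z -> 0 < y ->
  let den := (IZR c * x + IZR d) ^ 2 + (IZR c * y) ^ 2 in
  x' = ((IZR a * x + IZR b) * (IZR c * x + IZR d) + IZR a * IZR c * y ^ 2) / den -> y' = y / den ->
  LamW w x' y' = LamW w x y.
Proof.
intros Hw Hdet Hy den Hx' Hy'. apply usum_unique.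
set (p := fun v : Z * Z => (fst v * a + snd v * c, fst v * b + snd v * d)%Z).
set (q := fun v : Z * Z => (fst v * d - snd v * c, snd v * a - fst v * b)%Z).
assert (Hqp : forall v, q (p v) = v).
{ intros [m n]. unfold p, q; simpl. f_equal.
  - transitivity (m * (a * d - b * c))%Z; [ring|rewrite Hdet; ring].
  - transitivity (n * (a * d - b * c))%Z; [ring|rewrite Hdet; ring]. }
assert (Hpq : forall v, p (q v) = v).
{ intros [m n]. unfold p, q; simpl. f_equal.
  - transitivity (m * (a * d - b * c))%Z; [ring|rewrite Hdet; ring].
  - transitivity (n * (a * d - b * c))%Z; [ring|rewrite Hdet; ring]. }
pose proof (is_usum_lattice_II _ (cls_dd _ x y (cls_baseE w Hw) Hy)) as H.
apply is_usum_ext with (2 := is_usum_reindex p q _ _ Hqp Hpq H).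
intros v.
assert (EQv : forall u, base w (p v) u x y = base w v u x' y').
{ intros u. unfold base, theta_term. rewrite (Q_modular a b c d x y x' y' v); auto. }
rewrite (II_ext _ _ EQv). unfold nz.
destruct (eq_dec_cl (p v) (0, 0)%Z) as [E|E], (eq_dec_cl v (0, 0)%Z) as [E'|E']; auto; exfalso.
- apply E'. rewrite <- (Hqp v), E. unfold q; simpl. auto.
- apply E. rewrite E'. unfold p; simpl. auto.
Qed.

Lemma LamW_period w : egrowthE w -> forall y, 0 < y -> periodic1 (fun x => LamW w x y).
Proof.
intros Hw y Hy x. apply (LamW_modular w 1 1 0 1); auto.
- simpl. field.
- simpl. field.
Qed.

(** The factor (Qc/y)^(-(2+k)) of [base_dom] is a constant times a power of y. Periodicity reduces
    to |x| <= 1, where [Qc 1 1] serves all x. *)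
Lemma LamW_growth w : egrowthE w -> exists A K, 0 <= K /\ forall x y, 1 < y -> Rabs (LamW w x y) <= K * Rpower y A.
Proof.
intros [C [k Hw]]. assert (HwE : egrowthE w) by (exists C, k; auto).
exists (2 + k). set (E := Rpower (2 + k) (2 + k) * Rpower (Qc 1 1) (- (2 + k))).
assert (HE : 0 < E) by (apply Rmult_lt_0_compat; apply exp_pos). pose proof (egrowth_C _ _ _ Hw) as HC.
assert (Hus : 0 <= usum (pw 2)).
{ eapply Rle_trans; [apply Rabs_pos|]. apply usum_abs; [apply dom_pw; lra|].
  intros v; rewrite Rabs_pos_eq; [apply Rle_refl|left; apply pw_pos]. }
exists (C * E * usum (pw 2)). split; [apply Rmult_le_pos; auto; apply Rmult_le_pos; lra|]. intros x y Hy.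
assert (H : forall t, Rabs t <= 1 -> Rabs (LamW w t y) <= C * E * usum (pw 2) * Rpower y (2 + k)).
{ intros t Ht. replace (C * E * usum (pw 2) * Rpower y (2 + k)) with ((C * (E * Rpower y (2 + k))) * usum (pw 2)) by ring.
  apply lattice_II_bound. split; [|split].
  - apply Rmult_le_pos; auto. left; apply Rmult_lt_0_compat; auto; apply exp_pos.
  - intros v. apply (cls_cont _ (cls_baseE w HwE)).
  - intros v u Hv Hu. eapply Rle_trans; [apply (base_dom w C k 1 1 y 2); auto; try lra|].
    assert (H0 : 0 <= pw 2 v * exp (- (2 * u))) by (apply Rmult_le_pos; left; [apply pw_pos|apply exp_pos]).
    rewrite !(Rmult_assoc _ (pw 2 v)). apply Rmult_le_compat; auto.
    + apply Rmult_le_pos; auto. left; apply Rmult_lt_0_compat; apply exp_pos.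
    + apply Req_le. f_equal. unfold E. rewrite Rmult_assoc. f_equal.
      unfold Rpower. rewrite <- exp_plus. f_equal. unfold Rdiv. pose proof (Qc_pos 1 1).
      rewrite ln_mult, ln_Rinv; auto; [ring|lra|apply Rinv_0_lt_compat; lra].
    + apply Rmult_le_compat_l; [left; apply pw_pos|apply exp_le; lra]. }
pose proof (archimed x) as [H1 H2].
rewrite <- (periodic1_Z (fun x => LamW w x y) (LamW_period w HwE y ltac:(lra)) (- up x) x).
apply H. rewrite opp_IZR. apply Rabs_le; lra.
Qed.

(** * Smooth functions on the half-plane and the hyperbolic Laplacian *)

Lemma pd_local (y : R) (P : R -> Prop) : 0 < y -> (forall t, 0 < t -> P t) -> locally y P.
Proof.
intros Hy H. exists (mkposreal y Hy). intros t Ht. apply H.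
apply Rabs_def2 in Ht. simpl in Ht. unfold minus, plus, opp in Ht; simpl in Ht. lra.
Qed.

Lemma pdx_unique u v v' : pdx u v -> pdx u v' -> forall x y, 0 < y -> v x y = v' x y.
Proof.
intros H H' x y Hy. rewrite <- (is_derive_unique _ _ _ (H x y Hy)). apply is_derive_unique; auto.
Qed.

Lemma pdy_unique u v v' : pdy u v -> pdy u v' -> forall x y, 0 < y -> v x y = v' x y.
Proof.
intros H H' x y Hy. rewrite <- (is_derive_unique _ _ _ (H x y Hy)). apply is_derive_unique; auto.
Qed.

Definition eq_half (u v : R -> R -> R) : Prop := forall x y, 0 < y -> u x y = v x y.

Lemma eq_half_sym u v : eq_half u v -> eq_half v u.
Proof. intros H x y Hy; symmetry; auto. Qed.

Lemma pdx_ext u u' v v' : eq_half u u' -> eq_half v v' -> pdx u v -> pdx u' v'.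
Proof.
intros E E' H x y Hy. rewrite <- E' by auto. apply is_derive_ext with (fun t => u t y); auto.
Qed.

Lemma pdy_ext u u' v v' : eq_half u u' -> eq_half v v' -> pdy u v -> pdy u' v'.
Proof.
intros E E' H x y Hy. rewrite <- E' by auto. apply is_derive_ext_loc with (fun t => u x t); auto.
apply (pd_local y (fun t => u x t = u' x t)); auto.
Qed.

Lemma cont2_ext u v : eq_half u v -> cont2 u -> cont2 v.
Proof.
intros E H x y Hy eps He. destruct (H x y Hy eps He) as [d [Hd Hd']]. exists d; split; auto.
intros x' y' Hy' H1 H2. rewrite <- !E by auto. auto.
Qed.

Lemma smooth2_ext u v : eq_half u v -> smooth2 u -> smooth2 v.
Proof.
intros E [ux uy H1 H2 H3 H4 H5]. apply (smooth2_intro v ux uy); auto.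
- apply cont2_ext with u; auto.
- apply pdx_ext with u ux; auto. intros x y _; auto.
- apply pdy_ext with u uy; auto. intros x y _; auto.
Qed.

Lemma smooth2_cont u : smooth2 u -> cont2 u.
Proof. intros [ux uy H _ _ _ _]; auto. Qed.

Lemma smooth2_dx u v : smooth2 u -> pdx u v -> smooth2 v.
Proof.
intros [ux uy H1 H2 H3 H4 H5] H. apply smooth2_ext with ux; auto. intros x y Hy. eapply pdx_unique; eauto.
Qed.

Lemma smooth2_dy u v : smooth2 u -> pdy u v -> smooth2 v.
Proof.
intros [ux uy H1 H2 H3 H4 H5] H. apply smooth2_ext with uy; auto. intros x y Hy. eapply pdy_unique; eauto.
Qed.

Lemma smooth2_inv u : smooth2 u -> exists ux uy, pdx u ux /\ pdy u uy /\ smooth2 ux /\ smooth2 uy.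
Proof. intros [ux uy H1 H2 H3 H4 H5]. exists ux, uy; auto. Qed.

(* Closing [smooth2] under sums, scaling and multiplication by [y] before the corecursion keeps it guarded. *)
Inductive sclos : (R -> R -> R) -> Prop :=
| sc_base u : smooth2 u -> sclos u
| sc_plus u v : sclos u -> sclos v -> sclos (fun x y => u x y + v x y)
| sc_y u : sclos u -> sclos (fun x y => y * u x y)
| sc_scal c u : sclos u -> sclos (fun x y => c * u x y).

Lemma cont2_2d u : cont2 u -> forall x y, 0 < y -> continuity_2d_pt u x y.
Proof.
intros H x y Hy eps. destruct (H x y Hy eps (cond_pos eps)) as [d [Hd Hd']].
assert (Hm : 0 < Rmin d y) by (apply Rmin_pos; auto).
exists (mkposreal _ Hm). intros a b Ha Hb. simpl in *. apply Hd'.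
- assert (Rabs (b - y) < y) by (eapply Rlt_le_trans; [apply Hb|apply Rmin_r]). apply Rabs_def2 in H0. lra.
- eapply Rlt_le_trans; [apply Ha|apply Rmin_l].
- eapply Rlt_le_trans; [apply Hb|apply Rmin_l].
Qed.

Lemma c2d_cont2 u : (forall x y, 0 < y -> continuity_2d_pt u x y) -> cont2 u.
Proof.
intros H x y Hy eps He. destruct (H x y Hy (mkposreal eps He)) as [d Hd].
exists d; split; [apply cond_pos|]. intros x' y' _ H1 H2. apply (Hd x' y'); auto.
Qed.

Lemma cont2_plus u v : cont2 u -> cont2 v -> cont2 (fun x y => u x y + v x y).
Proof. intros H1 H2. apply c2d_cont2. intros x y Hy. apply continuity_2d_pt_plus; apply cont2_2d; auto. Qed.

Lemma cont2_mult u v : cont2 u -> cont2 v -> cont2 (fun x y => u x y * v x y).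
Proof. intros H1 H2. apply c2d_cont2. intros x y Hy. apply continuity_2d_pt_mult; apply cont2_2d; auto. Qed.

Lemma cont2_const c : cont2 (fun _ _ => c).
Proof. intros x y Hy eps He. exists 1; split; [lra|]. intros. rewrite Rminus_diag, Rabs_R0; lra. Qed.

Lemma cont2_y : cont2 (fun _ y => y).
Proof. intros x y Hy eps He. exists eps; split; auto. Qed.

Lemma sclos_deriv u : sclos u -> cont2 u /\ exists ux uy, pdx u ux /\ pdy u uy /\ sclos ux /\ sclos uy.
Proof.
induction 1 as [u Hu|u v Hu [Cu [ux [uy [Ux [Uy [Sx Sy]]]]]] Hv [Cv [vx [vy [Vx [Vy [Tx Ty]]]]]]
  |u Hu [Cu [ux [uy [Ux [Uy [Sx Sy]]]]]]|c u Hu [Cu [ux [uy [Ux [Uy [Sx Sy]]]]]]].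
- split; [apply smooth2_cont; auto|]. destruct (smooth2_inv u Hu) as [ux [uy [H1 [H2 [H3 H4]]]]].
  exists ux, uy. split; [|split; [|split]]; auto using sc_base.
- split; [apply cont2_plus; auto|]. exists (fun x y => ux x y + vx x y), (fun x y => uy x y + vy x y).
  split; [|split; [|split; apply sc_plus; auto]].
  + intros x y Hy. apply (is_derive_plus (fun t => u t y) (fun t => v t y)); auto.
  + intros x y Hy. apply (is_derive_plus (fun t => u x t) (fun t => v x t)); auto.
- split; [apply cont2_mult; auto; apply cont2_y|]. exists (fun x y => y * ux x y), (fun x y => u x y + y * uy x y).
  split; [|split; [|split; [apply sc_y; auto|apply sc_plus; auto; apply sc_y; auto]]].
  + intros x y Hy. apply is_derive_scal; auto.
  + intros x y Hy. apply is_derive_ext_val with (1 * u x y + y * uy x y); [|ring].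
    apply (is_derive_mult (fun t => t) (fun t => u x t)); auto. auto_derive; auto.
- split; [apply cont2_mult; auto; apply cont2_const|]. exists (fun x y => c * ux x y), (fun x y => c * uy x y).
  split; [|split; [|split; apply sc_scal; auto]]; intros x y Hy; apply is_derive_scal; auto.
Qed.

Lemma sclos_smooth : forall u, sclos u -> smooth2 u.
Proof.
cofix IH. intros u Hu. destruct (sclos_deriv u Hu) as [Hc [ux [uy [H1 [H2 [H3 H4]]]]]].
apply (smooth2_intro u ux uy); auto.
Qed.

Lemma smooth2_plus u v : smooth2 u -> smooth2 v -> smooth2 (fun x y => u x y + v x y).
Proof. intros; apply sclos_smooth, sc_plus; apply sc_base; auto. Qed.

Lemma smooth2_scal c u : smooth2 u -> smooth2 (fun x y => c * u x y).
Proof. intros; apply sclos_smooth, sc_scal; apply sc_base; auto. Qed.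

Lemma smooth2_y u : smooth2 u -> smooth2 (fun x y => y * u x y).
Proof. intros; apply sclos_smooth, sc_y; apply sc_base; auto. Qed.

Definition lap (u h : R -> R -> R) : Prop := exists ux uy uxx uyy,
  pdx u ux /\ pdy u uy /\ pdx ux uxx /\ pdy uy uyy /\ forall x y, 0 < y -> h x y = y ^ 2 * (uxx x y + uyy x y).

Lemma lap_smooth u h : smooth2 u -> lap u h -> smooth2 h.
Proof.
intros Hu [ux [uy [uxx [uyy [H1 [H2 [H3 [H4 H5]]]]]]]].
apply smooth2_ext with (fun x y => y * (y * (uxx x y + uyy x y))).
- intros x y Hy. rewrite H5 by auto. ring.
- do 2 apply smooth2_y. apply smooth2_plus.
  + apply smooth2_dx with ux; auto. apply smooth2_dx with u; auto.
  + apply smooth2_dy with uy; auto. apply smooth2_dy with u; auto.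
Qed.

(** A horizontal step by the mean value theorem, where continuity of [ux] enters, and a vertical
    step by the derivative at the point itself. *)
Lemma smooth2_diff u ux uy x y : pdx u ux -> pdy u uy -> cont2 ux -> 0 < y ->
  differentiable_pt_lim u x y (ux x y) (uy x y).
Proof.
intros Hx Hy Hc Hyp eps.
destruct (Hc x y Hyp (eps / 2)) as [d [Hd Hd']]; [apply is_pos_div_2|].
assert (Hdy := Hy x y Hyp). apply is_derive_Reals in Hdy.
destruct (Hdy (eps / 2)) as [e He]; [apply is_pos_div_2|].
assert (Hm : 0 < Rmin (Rmin d e) y) by (repeat apply Rmin_pos; auto; apply cond_pos).
exists (mkposreal _ Hm). intros a b Ha Hb. simpl in Ha, Hb.
assert (Hm1 : Rmin (Rmin d e) y <= d) by (eapply Rle_trans; [apply Rmin_l|apply Rmin_l]).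
assert (Hm2 : Rmin (Rmin d e) y <= e) by (eapply Rle_trans; [apply Rmin_l|apply Rmin_r]).
assert (Hm3 : Rmin (Rmin d e) y <= y) by apply Rmin_r.
assert (Hb0 : 0 < b). { assert (H : Rabs (b - y) < y) by lra. apply Rabs_def2 in H. lra. }
replace (u a b - u x y - (ux x y * (a - x) + uy x y * (b - y))) with
  (((u a b - ux x y * a) - (u x b - ux x y * x)) + (u x b - u x y - uy x y * (b - y))) by ring.
eapply Rle_trans; [apply Rabs_triang|].
replace (eps * Rmax (Rabs (a - x)) (Rabs (b - y))) with (eps / 2 * Rmax (Rabs (a - x)) (Rabs (b - y)) + eps / 2 * Rmax (Rabs (a - x)) (Rabs (b - y))) by field.
pose proof (cond_pos eps) as Heps.
apply Rplus_le_compat.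
- apply Rle_trans with (eps / 2 * Rabs (a - x)); [|apply Rmult_le_compat_l; [lra|apply Rmax_l]].
  apply (MVT_le (fun t => u t b - ux x y * t) (fun t => ux t b - ux x y)).
  + intros t _. apply (is_derive_minus (fun t => u t b) (fun t => ux x y * t)); auto. auto_derive; auto; ring.
  + intros t Ht. left. apply Hd'; auto; [|lra]. apply Rabs_between_min in Ht. lra.
- apply Rle_trans with (eps / 2 * Rabs (b - y)); [|apply Rmult_le_compat_l; [lra|apply Rmax_r]].
  destruct (Req_dec b y) as [->|n].
  + rewrite !Rminus_diag, Rmult_0_r, Rminus_diag, !Rabs_R0. lra.
  + assert (Hn : b - y <> 0) by lra. specialize (He (b - y) Hn ltac:(lra)).
    replace (y + (b - y)) with b in He by ring.
    replace (u x b - u x y - uy x y * (b - y)) with (((u x b - u x y) / (b - y) - uy x y) * (b - y)) by (field; auto).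
    rewrite Rabs_mult. apply Rmult_le_compat_r; [apply Rabs_pos|lra].
Qed.

Lemma chain_rule u ux uy (p q : R -> R) t p' q' : smooth2 u -> pdx u ux -> pdy u uy -> 0 < q t ->
  is_derive p t p' -> is_derive q t q' ->
  is_derive (fun s => u (p s) (q s)) t (ux (p t) (q t) * p' + uy (p t) (q t) * q').
Proof.
intros Hu Hx Hy Hq Hp Hq'. apply is_derive_Reals. apply derivable_pt_lim_comp_2d; try (apply is_derive_Reals; auto).
apply smooth2_diff; auto. apply smooth2_cont, (smooth2_dx u); auto.
Qed.

Definition fourier_coef (w : R -> R) (u : R -> R -> R) (y : R) : R := RInt (fun x => u x y * w x) 0 1.

Lemma cont2_x u y : cont2 u -> 0 < y -> contR (fun x => u x y).
Proof.
intros H Hy x. apply continuity_pt_filterlim. intros eps He.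
destruct (H x y Hy eps He) as [d [Hd Hd']]. exists d; split; auto.
intros t [_ Ht]. simpl in *. unfold R_dist in *. apply Hd'; auto. rewrite Rminus_diag, Rabs_R0; auto.
Qed.

Lemma cont2_w (w : R -> R) : contR w -> cont2 (fun x _ => w x).
Proof.
intros H x y Hy eps He. assert (Hc : continuity_pt w x) by (apply continuity_pt_filterlim, H).
destruct (Hc eps He) as [d [Hd Hd']]. exists d; split; auto. intros x' y' _ Hx _.
destruct (Req_dec x' x) as [->|n]; [rewrite Rminus_diag, Rabs_R0; auto|].
apply (Hd' x'). split; [split; [exact I|auto]|]. auto.
Qed.

Lemma fourier_coef_dy w u uy y : contR w -> cont2 u -> cont2 uy -> pdy u uy -> 0 < y -> is_derive (fourier_coef w u) y (fourier_coef w uy y).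
Proof.
intros Hw Hu Huy Hd Hy.
assert (Hder : forall t s, 0 < s -> is_derive (fun z => u t z * w t) s (uy t s * w t)).
{ intros t s Hs. apply is_derive_ext with (fun z => w t * u t z); [intros; rring|].
  rewrite (Rmult_comm (uy t s)). apply is_derive_scal; auto. }
apply is_derive_ext_val with (RInt (fun t => Derive (fun z => u t z * w t) y) 0 1).
- apply (is_derive_RInt_param (fun y t => u t y * w t)).
  + apply pd_local; auto. intros s Hs t _. exists (uy t s * w t). auto.
  + intros t _.
    apply continuity_2d_pt_ext_loc with (fun s t => uy t s * w t).
    * exists (mkposreal y Hy). intros s r Hs _. symmetry. apply is_derive_unique, Hder. apply Rabs_def2 in Hs. simpl in Hs. lra.
    * assert (Hc := cont2_2d _ (cont2_mult _ _ Huy (cont2_w w Hw)) t y Hy).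
      intros eps. destruct (Hc eps) as [d Hd']. exists d. intros a b Ha Hb. apply Hd'; auto.
  + apply pd_local; auto. intros s Hs. apply contR_ex_RInt. apply contR_mult; auto. apply cont2_x; auto.
- apply RInt_ext. intros t _. apply is_derive_unique; auto.
Qed.

Definition periodic_x (u : R -> R -> R) : Prop := forall y, 0 < y -> periodic1 (fun x => u x y).

Lemma periodic_x_dx u ux : pdx u ux -> periodic_x u -> periodic_x ux.
Proof.
intros Hd Hp y Hy x. rewrite <- (is_derive_unique _ _ _ (Hd x y Hy)). symmetry. apply is_derive_unique.
apply is_derive_ext with (fun t => u (t + 1) y); [intros; apply Hp; auto|].
apply is_derive_ext_val with (1 * ux (x + 1) y); [|ring].
apply (is_derive_comp (fun t => u t y) (fun t => t + 1)); [apply Hd; auto|auto_derive; auto].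
Qed.

Lemma periodic_x_dy u uy : pdy u uy -> periodic_x u -> periodic_x uy.
Proof.
intros Hd Hp y Hy x. rewrite <- (is_derive_unique _ _ _ (Hd x y Hy)). symmetry. apply is_derive_unique.
apply is_derive_ext_loc with (fun t => u (x + 1) t); [|apply Hd; auto].
apply (pd_local y (fun t => u (x + 1) t = u x t)); auto. intros; apply Hp; auto.
Qed.

Lemma fourier_coef_ext w u v y : eq_half u v -> 0 < y -> fourier_coef w u y = fourier_coef w v y.
Proof. intros E Hy. apply RInt_ext. intros; rewrite E; auto. Qed.

(* One integration by parts moves [d/dx] onto the periodic weight. *)
Lemma fourier_coef_parts (w w1 : R -> R) u ux y : (forall x, is_derive w x (w1 x)) -> contR w1 -> periodic1 w ->
  pdx u ux -> cont2 u -> cont2 ux -> periodic_x u -> 0 < y -> fourier_coef w ux y = - fourier_coef w1 u y.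
Proof.
intros Hw Hc1 Hpw Hd Hu Hux Hp Hy. unfold fourier_coef.
assert (Hcw := derive_contR _ _ Hw).
assert (H1 : contR (fun x => ux x y * w x)) by (apply contR_mult; auto; apply cont2_x; auto).
assert (H2 : contR (fun x => u x y * w1 x)) by (apply contR_mult; auto; apply cont2_x; auto).
assert (E : RInt (fun x => ux x y * w x + u x y * w1 x) 0 1 = 0).
{ rewrite (FTC (fun x => u x y * w x)).
  - pose proof (Hp y Hy 0) as E1. pose proof (Hpw 0) as E2. rewrite Rplus_0_l in E1, E2. rewrite E1, E2. rring.
  - intros x. apply (is_derive_mult (fun x => u x y) w); auto.
  - apply contR_plus; auto. }
rewrite RIplus in E by auto. lra.
Qed.

(** * Invariant polyharmonic functions of moderate growth *)

Definition moderate1 (g : R -> R) : Prop := exists K n Y, 0 <= K /\ 1 <= Y /\ forall y, Y < y -> Rabs (g y) <= K * y ^ n.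

Definition contP (g : R -> R) : Prop := forall y, 0 < y -> continuous g y.

(* Growth is assumed for the form only, so its Fourier coefficients and their Laplacians are tracked
   as [N]-th derivatives of functions of moderate growth. *)
Fixpoint deriv_moderate (N : nat) (g : R -> R) : Prop :=
  match N with
  | O => contP g /\ moderate1 g
  | S N => exists G, deriv_moderate N G /\ forall y, 0 < y -> is_derive G y (g y)
  end.

Lemma moderate1_ext g h : (forall y, 0 < y -> g y = h y) -> moderate1 g -> moderate1 h.
Proof.
intros E [K [n [Y [HK [HY H]]]]]. exists K, n, Y. split; [|split]; auto.
intros y Hy. rewrite <- E by lra. auto.
Qed.

Lemma moderate1_plus g h : moderate1 g -> moderate1 h -> moderate1 (fun y => g y + h y).
Proof.
intros [K [n [Y [HK [HY H]]]]] [K' [n' [Y' [HK' [HY' H']]]]].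
exists (K + K'), (n + n')%nat, (Rmax Y Y'). split; [lra|]. split; [eapply Rle_trans; [apply HY|apply Rmax_l]|].
intros y Hy. assert (H1 : Y < y) by (eapply Rle_lt_trans; [apply Rmax_l|apply Hy]).
assert (H2 : Y' < y) by (eapply Rle_lt_trans; [apply Rmax_r|apply Hy]).
eapply Rle_trans; [apply Rabs_triang|]. rewrite Rmult_plus_distr_r. apply Rplus_le_compat.
- eapply Rle_trans; [apply H; auto|]. apply Rmult_le_compat_l; auto. apply Rle_pow; [lra|lia].
- eapply Rle_trans; [apply H'; auto|]. apply Rmult_le_compat_l; auto. apply Rle_pow; [lra|lia].
Qed.

Lemma moderate1_scal c g : moderate1 g -> moderate1 (fun y => c * g y).
Proof.
intros [K [n [Y [HK [HY H]]]]]. exists (Rabs c * K), n, Y. split; [apply Rmult_le_pos; auto; apply Rabs_pos|]. split; auto.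
intros y Hy. rewrite Rabs_mult, Rmult_assoc. apply Rmult_le_compat_l; [apply Rabs_pos|auto].
Qed.

Lemma moderate1_y g : moderate1 g -> moderate1 (fun y => y * g y).
Proof.
intros [K [n [Y [HK [HY H]]]]]. exists K, (S n), Y. split; [|split]; auto.
intros y Hy. rewrite Rabs_mult, Rabs_pos_eq by lra. simpl.
replace (K * (y * y ^ n)) with (y * (K * y ^ n)) by ring. apply Rmult_le_compat_l; [lra|auto].
Qed.

Lemma moderate1_antider G g : (forall y, 0 < y -> is_derive G y (g y)) -> moderate1 g -> moderate1 G.
Proof.
intros Hd [K [n [Y [HK [HY H]]]]]. set (Y' := Y + 1).
exists (Rabs (G Y') + K), (S n), Y'. split; [pose proof (Rabs_pos (G Y')); lra|]. split; [unfold Y'; lra|].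
intros y Hy. unfold Y' in Hy.
assert (H1 : Rabs (G y - G Y') <= (K * y ^ n) * Rabs (y - Y')).
{ apply (MVT_le G g); rewrite Rmin_left, Rmax_right by (unfold Y'; lra); intros t Ht; unfold Y' in Ht.
  - apply Hd; lra.
  - eapply Rle_trans; [apply H; lra|]. apply Rmult_le_compat_l; auto. apply pow_incr; lra. }
assert (Hyn : 1 <= y ^ n) by (apply pow_R1_Rle; lra).
assert (H2 : Rabs (y - Y') <= y) by (apply Rabs_le; unfold Y'; lra).
replace (G y) with (G Y' + (G y - G Y')) by ring. eapply Rle_trans; [apply Rabs_triang|].
rewrite Rmult_plus_distr_r. apply Rplus_le_compat.
- rewrite <- (Rmult_1_r (Rabs (G Y'))) at 1. apply Rmult_le_compat_l; [apply Rabs_pos|]. apply pow_R1_Rle; lra.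
- eapply Rle_trans; [apply H1|]. simpl. replace (K * (y * y ^ n)) with (K * y ^ n * y) by ring.
  apply Rmult_le_compat_l; auto. apply Rmult_le_pos; lra.
Qed.

Lemma contP_antider g : contP g -> exists G, forall y, 0 < y -> is_derive G y (g y).
Proof.
intros Hc. exists (fun y => RInt g 1 y). intros y Hy.
apply (is_derive_RInt (V := R_CompleteNormedModule) g _ 1 y); auto.
apply (pd_local y (fun b => is_RInt g 1 b (RInt g 1 b))); auto. intros b Hb. apply (RInt_correct (V := R_CompleteNormedModule)).
apply (ex_RInt_continuous (V := R_CompleteNormedModule)). intros z Hz. apply Hc.
unfold Rmin in Hz; destruct Rle_dec; lra.
Qed.

Lemma contP_deriv G g : (forall y, 0 < y -> is_derive G y (g y)) -> contP G.
Proof. intros H y Hy. apply (ex_derive_continuous G y). eexists; apply H; auto. Qed.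

Lemma deriv_moderate_ext N : forall g h, (forall y, 0 < y -> g y = h y) -> deriv_moderate N g -> deriv_moderate N h.
Proof.
induction N; simpl; intros g h E H.
- destruct H as [Hc Hm]. split; [|eapply moderate1_ext; eauto]. intros y Hy.
  apply (continuous_ext_loc h g y); [apply (pd_local y (fun t => g t = h t)); auto|auto].
- destruct H as [G [HG Hd]]. exists G; split; auto. intros y Hy. rewrite <- E by auto. auto.
Qed.

Lemma deriv_moderate_up N : forall g, deriv_moderate N g -> deriv_moderate (S N) g.
Proof.
induction N; intros g H.
- destruct H as [Hc Hm]. destruct (contP_antider g Hc) as [G HG]. exists G. split; auto.
  split; [eapply contP_deriv; eauto|eapply moderate1_antider; eauto].
- destruct H as [G [HG Hd]]. exists G; split; auto.
Qed.

Lemma deriv_moderate_plus N : forall g h, deriv_moderate N g -> deriv_moderate N h -> deriv_moderate N (fun y => g y + h y).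
Proof.
induction N; simpl; intros g h.
- intros [Hc Hm] [Hc' Hm']. split; [|apply moderate1_plus; auto]. intros y Hy. apply (continuous_plus g h); auto.
- intros [G [HG Hd]] [H [HH Hd']]. exists (fun y => G y + H y). split; auto.
  intros y Hy. apply (is_derive_plus G H); auto.
Qed.

Lemma deriv_moderate_scal N : forall c g, deriv_moderate N g -> deriv_moderate N (fun y => c * g y).
Proof.
induction N; simpl; intros c g.
- intros [Hc Hm]. split; [|apply moderate1_scal; auto]. intros y Hy. apply (continuous_mult (fun _ => c) g); auto. apply continuous_const.
- intros [G [HG Hd]]. exists (fun y => c * G y). split; auto.
  intros y Hy. apply is_derive_scal; auto.
Qed.

(** y G' = (y G)' - G. The factor y^2 of the hyperbolic Laplacian therefore does not leave the
    class. *)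
Lemma deriv_moderate_y N : forall g, deriv_moderate N g -> deriv_moderate N (fun y => y * g y).
Proof.
induction N; intros g H.
- destruct H as [Hc Hm]. split; [|apply moderate1_y; auto]. intros y Hy. apply (continuous_mult (fun y => y) g); auto. apply continuous_id.
- destruct H as [G [HG Hd]].
  apply deriv_moderate_ext with (fun y => (G y + y * g y) + (-1) * G y); [intros; ring|].
  apply deriv_moderate_plus; [|apply deriv_moderate_scal, deriv_moderate_up; auto].
  exists (fun y => y * G y). split; [apply IHN; auto|]. intros y Hy.
  apply is_derive_ext_val with (1 * G y + y * g y); [|ring].
  apply (is_derive_mult (fun y => y) G); auto. auto_derive; auto.
Qed.

Lemma deriv_moderate_deriv2 N (g g1 g2 : R -> R) : deriv_moderate N g -> (forall y, 0 < y -> is_derive g y (g1 y)) ->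
  (forall y, 0 < y -> is_derive g1 y (g2 y)) -> deriv_moderate (S (S N)) g2.
Proof. intros H H1 H2. exists g1; split; auto. exists g; split; auto. Qed.

(** A single term of degree n + 1 of the exponential series already exceeds K y^n somewhere beyond
    Y. *)
Lemma exp_beats_pow lam n K Y : 0 < lam -> exists y, Y < y /\ K * y ^ n < exp (lam * y).
Proof.
intros Hl. assert (Hl2 : 0 < lam ^ S n / INR (fact (S n))).
{ apply Rdiv_lt_0_compat; [apply pow_lt; auto|apply INR_fact_lt_0]. }
set (c := lam ^ S n / INR (fact (S n))) in *.
set (y := Rmax Y 0 + Rabs K / c + 1).
assert (Hq : 0 <= Rabs K / c) by (apply Rmult_le_pos; [apply Rabs_pos|left; apply Rinv_0_lt_compat; auto]).
pose proof (Rmax_l Y 0). pose proof (Rmax_r Y 0).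
exists y. split; [unfold y; lra|]. assert (Hy : 0 < y) by (unfold y; lra).
apply Rlt_le_trans with ((lam * y) ^ S n / INR (fact (S n))).
- replace ((lam * y) ^ S n / INR (fact (S n))) with (c * y * y ^ n).
  + apply Rmult_lt_compat_r; [apply pow_lt; auto|].
    apply Rle_lt_trans with (Rabs K); [apply Rle_abs|].
    apply Rle_lt_trans with (c * (Rabs K / c)); [apply Req_le; field; lra|].
    apply Rmult_lt_compat_l; auto. unfold y; lra.
  + unfold c. rewrite Rpow_mult_distr. simpl. field. apply (INR_fact_neq_0 (S n)).
- apply pow_fact_le_exp. apply Rmult_le_pos; lra.
Qed.

Lemma moderate1_exp al lam : 0 < lam -> moderate1 (fun y => al * exp (lam * y)) -> al = 0.
Proof.
intros Hl [K [n [Y [HK [HY H]]]]]. destruct (Req_dec al 0) as [|Hal]; auto. exfalso.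
assert (Hp : 0 < Rabs al) by (apply Rabs_pos_lt; auto).
destruct (exp_beats_pow lam n (K / Rabs al) Y Hl) as [y [Hy Hlt]].
specialize (H y Hy). rewrite Rabs_mult, (Rabs_pos_eq (exp _)) in H by (left; apply exp_pos).
apply (Rmult_lt_compat_l (Rabs al)) in Hlt; auto.
replace (Rabs al * (K / Rabs al * y ^ n)) with (K * y ^ n) in Hlt by (field; lra). lra.
Qed.

(** Passing to an antiderivative replaces al e^(lam y) by (al / lam) e^(lam y) and keeps the
    remainder moderate. After N such steps the exponential term would itself have to be moderate. *)
Lemma deriv_moderate_exp lam N : 0 < lam -> forall g al, deriv_moderate N g -> moderate1 (fun y => g y - al * exp (lam * y)) -> al = 0.
Proof.
intros Hl. induction N; intros g al H Hm.
- destruct H as [_ Hg]. apply (moderate1_exp al lam Hl).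
  apply moderate1_ext with (fun y => g y + (-1) * (g y - al * exp (lam * y))); [intros; ring|].
  apply moderate1_plus; auto. apply moderate1_scal; auto.
- destruct H as [G [HG Hd]].
  assert (E : al / lam = 0).
  { apply (IHN G); auto. apply moderate1_antider with (fun y => g y - al * exp (lam * y)); auto.
    intros y Hy. apply (is_derive_minus G (fun y => al / lam * exp (lam * y))); auto.
    auto_derive; auto. field; lra. }
  replace al with (al / lam * lam) by (field; lra). rewrite E; ring.
Qed.

Lemma deriv0_const (f : R -> R) : (forall y, 0 < y -> is_derive f y 0) -> forall y, 0 < y -> f y = f 1.
Proof.
intros Hd y Hy. assert (H : Rabs (f y - f 1) <= 0 * Rabs (y - 1)).
{ apply (MVT_le f (fun _ => 0)).
  - intros t Ht. apply Hd. unfold Rmin in Ht; destruct Rle_dec; lra.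
  - intros; rewrite Rabs_R0; lra. }
rewrite Rmult_0_l in H. apply Rle_eps_eq. intros; lra.
Qed.

(** The equation b'' = lam^2 b factors: (b' + lam b) e^(-lam y) and (b' - lam b) e^(lam y) are
    constant. [deriv_moderate_exp] then removes the growing solution. *)
Lemma ode_decay (lam : R) N (b b1 : R -> R) : 0 < lam -> (forall y, 0 < y -> is_derive b y (b1 y)) ->
  (forall y, 0 < y -> is_derive b1 y (lam ^ 2 * b y)) -> deriv_moderate N b ->
  forall y, 0 < y -> b y = b 1 * exp (- (lam * (y - 1))).
Proof.
intros Hl H1 H2 HM.
set (p := fun y => (b1 y + lam * b y) * exp (- (lam * y))).
set (q := fun y => (b1 y - lam * b y) * exp (lam * y)).
assert (Hp : forall y, 0 < y -> p y = p 1).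
{ apply deriv0_const. intros y Hy. unfold p.
  apply is_derive_ext_val with ((lam ^ 2 * b y + lam * b1 y) * exp (- (lam * y)) + (b1 y + lam * b y) * (- lam * exp (- (lam * y)))); [|ring].
  apply (is_derive_mult (fun y => b1 y + lam * b y) (fun y => exp (- (lam * y)))).
  - apply (is_derive_plus b1 (fun y => lam * b y)); auto. apply is_derive_scal; auto.
  - auto_derive; auto; ring. }
assert (Hq : forall y, 0 < y -> q y = q 1).
{ apply deriv0_const. intros y Hy. unfold q.
  apply is_derive_ext_val with ((lam ^ 2 * b y - lam * b1 y) * exp (lam * y) + (b1 y - lam * b y) * (lam * exp (lam * y))); [|ring].
  apply (is_derive_mult (fun y => b1 y - lam * b y) (fun y => exp (lam * y))).
  - apply (is_derive_minus b1 (fun y => lam * b y)); auto. apply is_derive_scal; auto.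
  - auto_derive; auto; ring. }
set (c := p 1) in *. set (d := q 1) in *.
assert (Hb : forall y, 0 < y -> b y = c / (2 * lam) * exp (lam * y) - d / (2 * lam) * exp (- (lam * y))).
{ intros y Hy. rewrite <- (Hp y Hy), <- (Hq y Hy). unfold p, q.
  assert (E : exp (lam * y) * exp (- (lam * y)) = 1) by (rewrite <- exp_plus, Rplus_opp_r; apply exp_0).
  set (e1 := exp (lam * y)) in *. set (e2 := exp (- (lam * y))) in *.
  replace ((b1 y + lam * b y) * e2 / (2 * lam) * e1 - (b1 y - lam * b y) * e1 / (2 * lam) * e2)
    with ((e1 * e2) * b y) by (field; lra). rewrite E; ring. }
assert (Hc : c / (2 * lam) = 0).
{ apply (deriv_moderate_exp lam N Hl b); auto.
  exists (Rabs (d / (2 * lam))), 0%nat, 1. split; [apply Rabs_pos|]. split; [lra|]. intros y Hy. rewrite Hb by lra.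
  replace (c / (2 * lam) * exp (lam * y) - d / (2 * lam) * exp (- (lam * y)) - c / (2 * lam) * exp (lam * y)) with
    (- (d / (2 * lam) * exp (- (lam * y)))) by ring.
  rewrite Rabs_Ropp, Rabs_mult, (Rabs_pos_eq (exp _)) by (left; apply exp_pos).
  simpl. apply Rmult_le_compat_l; [apply Rabs_pos|]. rewrite <- exp_0. apply exp_le.
  assert (0 <= lam * y) by (apply Rmult_le_pos; lra). lra. }
intros y Hy. rewrite (Hb y Hy), (Hb 1 Rlt_0_1), Hc.
replace (- (lam * y)) with (- (lam * 1) + - (lam * (y - 1))) by ring. rewrite (exp_plus (- (lam * 1))). ring.
Qed.

Lemma ode_linear (b b1 : R -> R) : (forall y, 0 < y -> is_derive b y (b1 y)) -> (forall y, 0 < y -> is_derive b1 y 0) ->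
  forall y, 0 < y -> b y = (b 1 - b1 1) + b1 1 * y.
Proof.
intros H1 H2 y Hy. pose proof (deriv0_const b1 H2) as Hc.
assert (E : b y - b1 1 * y = b 1 - b1 1 * 1); [|lra].
apply (deriv0_const (fun y => b y - b1 1 * y)); auto. intros t Ht.
apply is_derive_ext_val with (b1 t - b1 1); [|rewrite Hc; auto; ring].
apply (is_derive_minus b (fun y => b1 1 * y)); auto. auto_derive; auto; ring.
Qed.

Lemma fourier_coef_scal c (w : R -> R) u y : contR w -> cont2 u -> 0 < y -> fourier_coef (fun x => c * w x) u y = c * fourier_coef w u y.
Proof.
intros Hw Hu Hy. unfold fourier_coef. rewrite <- RIscal.
- apply RInt_ext; intros; rring.
- apply contR_mult; auto. apply cont2_x; auto.
Qed.

Definition trigw (w : R -> R) (n : nat) : Prop := w = ccos n \/ w = ssin n.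

Lemma trigw_cont w n : trigw w n -> contR w.
Proof. intros [-> | ->]; [apply contR_cos|apply contR_sin]. Qed.

Lemma ccos_deriv n x : is_derive (ccos n) x (- (2 * PI * INR n) * ssin n x).
Proof. unfold ccos, ssin. set (c := 2 * PI * INR n). auto_derive; auto. ring. Qed.

Lemma ssin_deriv n x : is_derive (ssin n) x (2 * PI * INR n * ccos n x).
Proof. unfold ccos, ssin. set (c := 2 * PI * INR n). auto_derive; auto. ring. Qed.

Lemma fourier_coef_xx w n u ux uxx y : trigw w n -> smooth2 u -> pdx u ux -> pdx ux uxx -> periodic_x u -> 0 < y ->
  fourier_coef w uxx y = - (2 * PI * INR n) ^ 2 * fourier_coef w u y.
Proof.
intros Hw Hu Hx Hxx Hp Hy. assert (Hux := smooth2_dx _ _ Hu Hx). assert (Huxx := smooth2_dx _ _ Hux Hxx).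
assert (Hpx := periodic_x_dx _ _ Hx Hp).
assert (Cu := smooth2_cont _ Hu). assert (Cux := smooth2_cont _ Hux). assert (Cuxx := smooth2_cont _ Huxx).
set (c := 2 * PI * INR n).
assert (Hcc : contR (ccos n)) by apply contR_cos. assert (Hcs : contR (ssin n)) by apply contR_sin.
assert (Hcc1 : contR (fun x => - c * ssin n x)) by (apply contR_mult; auto; apply contR_const).
assert (Hcs1 : contR (fun x => c * ccos n x)) by (apply contR_mult; auto; apply contR_const).
destruct Hw as [-> | ->].
- rewrite (fourier_coef_parts (ccos n) _ ux uxx y (ccos_deriv n)), fourier_coef_scal; auto using ccos_period.
  rewrite (fourier_coef_parts (ssin n) _ u ux y (ssin_deriv n)), fourier_coef_scal; auto using ssin_period. fold c. ring.
- rewrite (fourier_coef_parts (ssin n) _ ux uxx y (ssin_deriv n)), fourier_coef_scal; auto using ssin_period.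
  rewrite (fourier_coef_parts (ccos n) _ u ux y (ccos_deriv n)), fourier_coef_scal; auto using ccos_period. fold c. ring.
Qed.

Lemma fourier_coef_lap w n u h : trigw w n -> smooth2 u -> periodic_x u -> lap u h -> exists b1 b2 : R -> R,
  (forall y, 0 < y -> is_derive (fourier_coef w u) y (b1 y)) /\ (forall y, 0 < y -> is_derive b1 y (b2 y)) /\
  forall y, 0 < y -> fourier_coef w h y = y ^ 2 * (b2 y - (2 * PI * INR n) ^ 2 * fourier_coef w u y).
Proof.
intros Hw Hu Hp [ux [uy [uxx [uyy [H1 [H2 [H3 [H4 H5]]]]]]]].
assert (Hux := smooth2_dx _ _ Hu H1). assert (Huxx := smooth2_dx _ _ Hux H3).
assert (Huy := smooth2_dy _ _ Hu H2). assert (Huyy := smooth2_dy _ _ Huy H4).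
assert (Hcw := trigw_cont w n Hw).
exists (fourier_coef w uy), (fourier_coef w uyy). split; [|split].
- intros y Hy. apply fourier_coef_dy; auto using smooth2_cont.
- intros y Hy. apply fourier_coef_dy; auto using smooth2_cont.
- intros y Hy. rewrite (fourier_coef_ext w h (fun x y => y ^ 2 * (uxx x y + uyy x y))) by auto.
  unfold fourier_coef at 1. rewrite (RInt_ext _ (fun x => y ^ 2 * (uxx x y * w x + uyy x y * w x))) by (intros; rring).
  assert (C1 : contR (fun x => uxx x y * w x)) by (apply contR_mult; auto; apply cont2_x; auto using smooth2_cont).
  assert (C2 : contR (fun x => uyy x y * w x)) by (apply contR_mult; auto; apply cont2_x; auto using smooth2_cont).
  rewrite RIscal, RIplus; auto; [|apply contR_plus; auto].
  change (y ^ 2 * (fourier_coef w uxx y + fourier_coef w uyy y) = y ^ 2 * (fourier_coef w uyy y - (2 * PI * INR n) ^ 2 * fourier_coef w u y)).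
  rewrite (fourier_coef_xx w n u ux uxx y); auto. ring.
Qed.

Lemma periodic_x_lap u h : lap u h -> periodic_x u -> periodic_x h.
Proof.
intros [ux [uy [uxx [uyy [H1 [H2 [H3 [H4 H5]]]]]]]] Hp y Hy x.
rewrite !H5 by auto. rewrite (periodic_x_dx _ _ H3 (periodic_x_dx _ _ H1 Hp) y Hy x), (periodic_x_dy _ _ H4 (periodic_x_dy _ _ H2 Hp) y Hy x). auto.
Qed.

Inductive iterlap : nat -> (R -> R -> R) -> (R -> R -> R) -> Prop :=
| il0 f : iterlap 0 f f
| ilS n f g h : iterlap n f g -> lap g h -> iterlap (S n) f h.

Definition moderate2 (u : R -> R -> R) : Prop := exists K n Y, 0 <= K /\ 1 <= Y /\ forall x y, Y < y -> Rabs (u x y) <= K * y ^ n.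

Lemma trigw_le1 w n : trigw w n -> forall x, Rabs (w x) <= 1.
Proof. intros [-> | ->] x; apply Rabs_le; [apply COS_bound|apply SIN_bound]. Qed.

Lemma fourier_coef_bound w n u y B : trigw w n -> cont2 u -> 0 < y -> (forall x, 0 <= x <= 1 -> Rabs (u x y) <= B) -> Rabs (fourier_coef w u y) <= B.
Proof.
intros Hw Hu Hy HB. replace B with ((1 - 0) * B) by ring. apply RIabs_const; [lra| |].
- apply contR_mult; [apply cont2_x; auto|eapply trigw_cont; eauto].
- intros x Hx. rewrite Rabs_mult. pose proof (trigw_le1 w n Hw x). specialize (HB x Hx).
  pose proof (Rabs_pos (u x y)). pose proof (Rabs_pos (w x)). nra.
Qed.

(** Each Laplacian differentiates twice in y, whereas derivatives in x become factors after
    integration by parts; hence the order 2i. *)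
Lemma iterlap_deriv_moderate i f g : iterlap i f g -> smooth2 f -> periodic_x f -> moderate2 f ->
  smooth2 g /\ periodic_x g /\ forall w n, trigw w n -> deriv_moderate (2 * i) (fourier_coef w g).
Proof.
induction 1 as [f|i f g h Hfg IH Hgh]; intros Hf Hp Hm.
- split; [auto|]. split; [auto|]. intros w n Hw. simpl. split.
  + destruct (smooth2_inv f Hf) as [ux [uy [H1 [H2 [H3 H4]]]]].
    apply contP_deriv with (fourier_coef w uy). intros y Hy. apply fourier_coef_dy; auto using smooth2_cont. eapply trigw_cont; eauto.
  + destruct Hm as [K [k [Y [HK [HY H]]]]]. exists K, k, Y. split; [|split]; auto.
    intros y Hy. apply fourier_coef_bound with n; auto using smooth2_cont. lra.
- destruct IH as [Sg [Pg Mg]]; auto. split; [eapply lap_smooth; eauto|]. split; [eapply periodic_x_lap; eauto|].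
  intros w n Hw. destruct (fourier_coef_lap w n g h Hw Sg Pg Hgh) as [b1 [b2 [H1 [H2 H3]]]].
  apply deriv_moderate_ext with (fun y => y * (y * (b2 y + (- (2 * PI * INR n) ^ 2) * fourier_coef w g y))).
  + intros y Hy. rewrite H3 by auto. ring.
  + replace (2 * S i)%nat with (S (S (2 * i))) by lia. do 2 apply deriv_moderate_y. apply deriv_moderate_plus.
    * exact (deriv_moderate_deriv2 (2 * i) (fourier_coef w g) b1 b2 (Mg w n Hw) H1 H2).
    * exact (deriv_moderate_scal _ _ _ (deriv_moderate_up _ _ (deriv_moderate_up _ _ (Mg w n Hw)))).
Qed.

Definition harmonic (h : R -> R -> R) : Prop := exists h0, lap h h0 /\ forall x y, 0 < y -> h0 x y = 0.

Lemma rsum_half n : rsum (fun k => (/ 2) ^ S k) n <= 1.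
Proof.
assert (H : rsum (fun k => (/ 2) ^ S k) n = 1 - (/ 2) ^ n).
{ induction n; cbn [rsum]; [simpl; ring|]. rewrite IHn. simpl. field. }
rewrite H. assert (0 < (/ 2) ^ n) by (apply pow_lt; lra). lra.
Qed.

Lemma exp_neg_INR n : exp (- INR n) <= (/ 2) ^ n.
Proof.
induction n; [simpl; rewrite Ropp_0, exp_0; lra|].
rewrite S_INR, Ropp_plus_distr, exp_plus. simpl. rewrite Rmult_comm.
apply Rmult_le_compat; [left; apply exp_pos|left; apply exp_pos| |auto].
eapply Rle_trans; [apply exp_neg_le; lra|lra].
Qed.

(** The zeroth Fourier coefficient is affine in y; for n >= 1 the n-th is its value at height 1
    times e^(-2 PI n (y - 1)). [fourier_bound] converts these bounds into a uniform bound on h minus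
    its affine part. *)
Lemma harmonic_asymp h : smooth2 h -> periodic_x h -> harmonic h ->
  (forall w n, trigw w n -> exists N, deriv_moderate N (fourier_coef w h)) ->
  exists a b C, forall x y, 2 <= y -> Rabs (h x y - (a + b * y)) <= C * exp (- y).
Proof.
intros Hs Hp [h0 [Hlap H0]] HM. pose proof PI_gt_3 as HPI.
assert (Hode : forall w n, trigw w n -> exists b1 : R -> R, (forall y, 0 < y -> is_derive (fourier_coef w h) y (b1 y)) /\
   (forall y, 0 < y -> is_derive b1 y ((2 * PI * INR n) ^ 2 * fourier_coef w h y))).
{ intros w n Hw. destruct (fourier_coef_lap w n h h0 Hw Hs Hp Hlap) as [b1 [b2 [H1 [H2 H3]]]]. exists b1; split; auto.
  intros y Hy. apply is_derive_ext_val with (b2 y); auto.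
  assert (E : fourier_coef w h0 y = 0).
  { unfold fourier_coef. rewrite (RInt_ext _ (fun _ => 0)); [rewrite RIconst; rring|]. intros; rewrite H0 by auto; rring. }
  rewrite H3 in E by auto. assert (0 < y ^ 2) by (apply pow_lt; auto).
  apply Rmult_integral in E. destruct E; lra. }
assert (Hc1 : trigw (ccos 0) 0) by (left; auto).
destruct (Hode _ _ Hc1) as [b1 [Hb1 Hb2]].
assert (Hlin : forall y, 0 < y -> fourier_coef (ccos 0) h y = (fourier_coef (ccos 0) h 1 - b1 1) + b1 1 * y).
{ apply ode_linear; auto. intros y Hy. eapply is_derive_ext_val; [apply Hb2; auto|]. simpl; ring. }
set (a := fourier_coef (ccos 0) h 1 - b1 1) in *. set (b := b1 1) in *.
assert (Cx : contR (fun x => h x 1)) by (apply cont2_x; [apply smooth2_cont; auto|lra]).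
assert (H01 : 0 <= 1) by lra.
destruct (contR_bounded _ 0 1 H01 Cx) as [B [HB0 HB]].
exists a, b, (4 * B * exp 1). intros x y Hy. revert x.
assert (Cy : contR (fun x => h x y)) by (apply cont2_x; [apply smooth2_cont; auto|lra]).
assert (Hcoef : forall w n, trigw w (S n) -> RInt w 0 1 = 0 ->
  Rabs (RInt (fun t => (h t y - (a + b * y)) * w t) 0 1) <= B * exp (- (y - 1)) * (/ 2) ^ S n).
{ intros w n Hw Hw0. assert (Hcw := trigw_cont _ _ Hw).
  rewrite (RInt_ext _ (fun t => h t y * w t - (a + b * y) * w t)) by (intros; rring).
  rewrite RIminus, RIscal, Hw0; auto.
  2: apply contR_mult; auto. 2: apply contR_mult; auto; apply contR_const.
  change (Rabs (fourier_coef w h y - (a + b * y) * 0) <= B * exp (- (y - 1)) * (/ 2) ^ S n).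
  rewrite Rmult_0_r, Rminus_0_r.
  destruct (Hode w (S n) Hw) as [c1 [Hc1' Hc2]]. destruct (HM w (S n) Hw) as [N HN].
  assert (Hn : 1 <= INR (S n)) by (rewrite S_INR; pose proof (pos_INR n); lra).
  assert (Hl : 0 < 2 * PI * INR (S n)) by (apply Rmult_lt_0_compat; lra).
  rewrite (ode_decay (2 * PI * INR (S n)) N (fourier_coef w h) c1); auto; [|lra].
  rewrite Rabs_mult, (Rabs_pos_eq (exp _)) by (left; apply exp_pos). rewrite (Rmult_assoc B).
  apply Rmult_le_compat; [apply Rabs_pos|left; apply exp_pos| |].
  - apply fourier_coef_bound with (S n); auto using smooth2_cont. lra.
  (* For y >= 2 and k = n + 1, 2 PI k (y - 1) >= 2k (y - 1) >= (y - 1) + k: one summand keeps the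
     decay in y, the other makes the sum over k geometric. *)
  - apply Rle_trans with (exp (- (y - 1)) * exp (- INR (S n))).
    + rewrite <- exp_plus. apply exp_le.
      assert (2 * INR (S n) * (y - 1) <= 2 * PI * INR (S n) * (y - 1)).
      { apply Rmult_le_compat_r; [lra|]. apply Rmult_le_compat_r; lra. }
      assert (0 <= (INR (S n) - 1) * (y - 1)) by (apply Rmult_le_pos; lra).
      assert (0 <= INR (S n) * (y - 1 - 1)) by (apply Rmult_le_pos; lra). lra.
    + apply Rmult_le_compat_l; [left; apply exp_pos|apply exp_neg_INR]. }
apply (fourier_bound (fun t => h t y - (a + b * y)) 0 (fun n => B * exp (- (y - 1)) * (/ 2) ^ S n)).
- apply contR_minus; auto. apply contR_const.
- intros t. rewrite (Hp y ltac:(lra)). auto.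
- rewrite RIminus, RIconst; auto; [|apply contR_const].
  replace (RInt (fun x => h x y) 0 1) with (fourier_coef (ccos 0) h y).
  + rewrite Hlin by lra. replace (a + b * y - (1 - 0) * (a + b * y)) with 0 by ring. rewrite Rabs_R0; lra.
  + apply RInt_ext. intros t _. unfold ccos. simpl. rewrite Rmult_0_r, Rmult_0_l, cos_0. rring.
- intros n. apply Hcoef; [left; auto|]. unfold ccos. rewrite INR_IZR_INZ, RInt_period_cos. destruct Z.eq_dec; [lia|auto].
- intros n. apply Hcoef; [right; auto|]. unfold ssin. rewrite INR_IZR_INZ. apply RInt_period_sin.
- intros n. rewrite rsum_scal. pose proof (rsum_half n).
  assert (E : exp 1 * exp (- y) = exp (- (y - 1))) by (rewrite <- exp_plus; f_equal; ring).
  replace (4 * B * exp 1 * exp (- y)) with (4 * (B * (exp 1 * exp (- y)))) by ring. rewrite E, Rplus_0_l.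
  assert (0 <= B * exp (- (y - 1))) by (apply Rmult_le_pos; auto; left; apply exp_pos). nra.
Qed.

(** * The mean value property and the minimum principle *)

Lemma nonneg_RInt_zero (f : R -> R) a b : contR f -> (forall x, a <= x <= b -> 0 <= f x) -> RInt f a b = 0 ->
  forall c, a < c < b -> f c = 0.
Proof.
intros Hc Hp H0 c Hcab.
assert (HF : forall x, a <= x <= b -> RInt f a x = 0).
{ intros x Hx. pose proof (RIChasles f a x b Hc) as E. rewrite H0 in E.
  assert (Hnn : forall s t, a <= s -> s <= t -> t <= b -> 0 <= RInt f s t).
  { intros s t H1 H2 H3. apply Rle_trans with (RInt (fun _ => 0) s t); [rewrite RIconst; lra|].
    apply RIle; auto; [apply contR_const|]. intros; apply Hp; lra. }
  pose proof (Hnn a x). pose proof (Hnn x b). lra. }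
pose proof (FTC_is_derive f a c Hc) as Hd. rewrite <- (is_derive_unique _ _ _ Hd).
apply is_derive_unique. apply is_derive_ext_loc with (fun _ => 0).
- assert (He : 0 < Rmin (c - a) (b - c)) by (apply Rmin_pos; lra).
  exists (mkposreal _ He). intros t Ht. symmetry. apply HF.
  change (Rabs (t - c) < Rmin (c - a) (b - c)) in Ht.
  assert (H1 : Rabs (t - c) < c - a) by (eapply Rlt_le_trans; [apply Ht|apply Rmin_l]).
  assert (H2 : Rabs (t - c) < b - c) by (eapply Rlt_le_trans; [apply Ht|apply Rmin_r]).
  apply Rabs_def2 in H1. apply Rabs_def2 in H2. lra.
- apply (is_derive_const 0).
Qed.

Lemma harmonic_inv h : smooth2 h -> harmonic h -> exists hx hy hxx hxy hyx hyy,
  pdx h hx /\ pdy h hy /\ pdx hx hxx /\ pdy hx hxy /\ pdx hy hyx /\ pdy hy hyy /\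
  smooth2 hx /\ smooth2 hy /\ smooth2 hxx /\ smooth2 hxy /\ smooth2 hyx /\ smooth2 hyy /\
  forall x y, 0 < y -> hxx x y + hyy x y = 0.
Proof.
intros Hs [h0 [[hx [hy [hxx [hyy [H1 [H2 [H3 [H4 H5]]]]]]]] H0]].
assert (Sx := smooth2_dx _ _ Hs H1). assert (Sy := smooth2_dy _ _ Hs H2).
destruct (smooth2_inv hx Sx) as [hxx' [hxy [_ [Dxy [_ Sxy]]]]].
destruct (smooth2_inv hy Sy) as [hyx [hyy' [Dyx [_ [Syx _]]]]].
exists hx, hy, hxx, hxy, hyx, hyy.
assert (Sxx := smooth2_dx _ _ Sx H3). assert (Syy := smooth2_dy _ _ Sy H4).
do 12 (split; [assumption|]). intros x y Hy. specialize (H5 x y Hy). rewrite H0 in H5 by auto.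
assert (0 < y ^ 2) by (apply pow_lt; auto). symmetry in H5. apply Rmult_integral in H5. destruct H5; lra.
Qed.

Lemma circle_pos r y0 th : Rabs r < y0 -> 0 < y0 + r * sin th.
Proof.
intros Hr. assert (H : Rabs (r * sin th) <= Rabs r * 1).
{ rewrite Rabs_mult. apply Rmult_le_compat_l; [apply Rabs_pos|apply Rabs_le, SIN_bound]. }
apply Rabs_le_between in H. lra.
Qed.

Lemma circle_cont u x0 y0 r : cont2 u -> Rabs r < y0 -> contR (fun th => u (x0 + r * cos th) (y0 + r * sin th)).
Proof.
intros Hu Hr th. apply continuity_pt_filterlim. intros eps He.
destruct (Hu (x0 + r * cos th) (y0 + r * sin th) (circle_pos r y0 th Hr) eps He) as [d [Hd Hd']].
assert (Hc : continuity_pt (fun th => x0 + r * cos th) th).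
{ apply continuity_pt_filterlim, (ex_derive_continuous (fun th => x0 + r * cos th) th). auto_derive; auto. }
assert (Hs : continuity_pt (fun th => y0 + r * sin th) th).
{ apply continuity_pt_filterlim, (ex_derive_continuous (fun th => y0 + r * sin th) th). auto_derive; auto. }
destruct (Hc d Hd) as [d1 [Hd1 H1]]. destruct (Hs d Hd) as [d2 [Hd2 H2]].
exists (Rmin d1 d2). split; [apply Rmin_pos; auto|]. intros t [Ht Htd]. simpl in *; unfold R_dist in *.
apply Hd'; [apply circle_pos; auto|apply (H1 t)|apply (H2 t)]; split; auto.
- eapply Rlt_le_trans; [apply Htd|apply Rmin_l].
- eapply Rlt_le_trans; [apply Htd|apply Rmin_r].
Qed.

Lemma circle_deriv (F F' : R -> R -> R) a b y0 r : Rabs r < y0 ->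
  (forall s th, Rabs s < y0 -> is_derive (fun s => F s th) s (F' s th)) ->
  (forall s th, Rabs s < y0 -> continuity_2d_pt F' s th) ->
  (forall s, Rabs s < y0 -> contR (F s)) ->
  is_derive (fun s => RInt (F s) a b) r (RInt (F' r) a b).
Proof.
intros Hr Hd Hc HF.
assert (Hp : 0 < y0 - Rabs r) by lra.
assert (Hloc : forall P : R -> Prop, (forall s, Rabs s < y0 -> P s) -> locally r P).
{ intros P HP. exists (mkposreal _ Hp). intros s Hs. apply HP. change (Rabs (s - r) < y0 - Rabs r) in Hs.
  replace s with (r + (s - r)) by ring. eapply Rle_lt_trans; [apply Rabs_triang|lra]. }
apply is_derive_ext_val with (RInt (fun t => Derive (fun z => F z t) r) a b).
- apply (is_derive_RInt_param F).
  + apply Hloc. intros s Hs t _. exists (F' s t). auto.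
  + intros t _. apply continuity_2d_pt_ext_loc with F'; [|auto].
    exists (mkposreal _ Hp). intros s t' Hs _. simpl in Hs. symmetry. apply is_derive_unique, Hd.
    replace s with (r + (s - r)) by ring. eapply Rle_lt_trans; [apply Rabs_triang|lra].
  + apply Hloc. intros s Hs. apply contR_ex_RInt. apply HF; auto.
- apply RInt_ext. intros t _. apply is_derive_unique; auto.
Qed.

Lemma circle_c2d u x0 y0 s th : cont2 u -> Rabs s < y0 -> continuity_2d_pt (fun s th => u (x0 + s * cos th) (y0 + s * sin th)) s th.
Proof.
intros Hu Hs. 
assert (Hp : continuity_2d_pt (fun s th => x0 + s * cos th) s th).
{ apply continuity_2d_pt_plus; [apply continuity_2d_pt_const|]. apply continuity_2d_pt_mult; [apply continuity_2d_pt_id1|].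
  apply (continuity_1d_2d_pt_comp cos (fun _ t => t)); [apply continuity_cos|apply continuity_2d_pt_id2]. }
assert (Hq : continuity_2d_pt (fun s th => y0 + s * sin th) s th).
{ apply continuity_2d_pt_plus; [apply continuity_2d_pt_const|]. apply continuity_2d_pt_mult; [apply continuity_2d_pt_id1|].
  apply (continuity_1d_2d_pt_comp sin (fun _ t => t)); [apply continuity_sin|apply continuity_2d_pt_id2]. }
intros eps. destruct (cont2_2d u Hu (x0 + s * cos th) (y0 + s * sin th) (circle_pos s y0 th Hs) eps) as [d Hd].
destruct (Hp d) as [d1 H1]. destruct (Hq d) as [d2 H2].
assert (Hm : 0 < Rmin d1 d2) by (apply Rmin_pos; apply cond_pos).
exists (mkposreal _ Hm). intros a b Ha Hb. simpl in Ha, Hb. apply Hd.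
- apply H1; (eapply Rlt_le_trans; [eassumption|apply Rmin_l]).
- apply H2; (eapply Rlt_le_trans; [eassumption|apply Rmin_r]).
Qed.

Lemma c2d_cos s th : continuity_2d_pt (fun _ th => cos th) s th.
Proof. apply (continuity_1d_2d_pt_comp cos (fun _ t => t)); [apply continuity_cos|apply continuity_2d_pt_id2]. Qed.

Lemma c2d_sin s th : continuity_2d_pt (fun _ th => sin th) s th.
Proof. apply (continuity_1d_2d_pt_comp sin (fun _ t => t)); [apply continuity_sin|apply continuity_2d_pt_id2]. Qed.

Lemma contR_cos1 : contR cos.
Proof. intros x. apply (ex_derive_continuous cos x). auto_derive; auto. Qed.

Lemma contR_sin1 : contR sin.
Proof. intros x. apply (ex_derive_continuous sin x). auto_derive; auto. Qed.

(** In polar coordinates Laplace's equation reads d/ds (s h_s) = - d/dtheta (h_theta / s).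
    Integrated over the circle the right side vanishes, so the integral of s h_s is constant in s,
    hence 0, and the circle mean does not depend on the radius. *)
Lemma circle_mean h x0 y0 a r : smooth2 h -> harmonic h -> 0 <= r < y0 ->
  RInt (fun th => h (x0 + r * cos th) (y0 + r * sin th)) a (a + 2 * PI) = 2 * PI * h x0 y0.
Proof.
intros Hs Hh Hr.
destruct (harmonic_inv h Hs Hh) as [hx [hy [hxx [hxy [hyx [hyy [Dx [Dy [Dxx [Dxy [Dyx [Dyy [Sx [Sy [Sxx [Sxy [Syx [Syy Hlap]]]]]]]]]]]]]]]]]].
set (X := fun s th => x0 + s * cos th). set (Y := fun s th => y0 + s * sin th).
assert (HXs : forall s th, is_derive (fun s => X s th) s (cos th)) by (intros; unfold X; auto_derive; auto; ring).
assert (HYs : forall s th, is_derive (fun s => Y s th) s (sin th)) by (intros; unfold Y; auto_derive; auto; ring).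
assert (HXt : forall s th, is_derive (fun th => X s th) th (- s * sin th)) by (intros; unfold X; auto_derive; auto; ring).
assert (HYt : forall s th, is_derive (fun th => Y s th) th (s * cos th)) by (intros; unfold Y; auto_derive; auto; ring).
assert (HYp : forall s th, Rabs s < y0 -> 0 < Y s th) by (intros; apply circle_pos; auto).
assert (Hcc : forall u, cont2 u -> forall s, Rabs s < y0 -> contR (fun th => u (X s th) (Y s th))).
{ intros u Hu s Hs'. apply circle_cont; auto. }
assert (H2d : forall u s th, smooth2 u -> Rabs s < y0 -> continuity_2d_pt (fun s th => u (X s th) (Y s th)) s th).
{ intros u s th Hu Hs'. apply circle_c2d; auto. apply smooth2_cont; auto. }
set (g := fun s th => hx (X s th) (Y s th) * cos th + hy (X s th) (Y s th) * sin th).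
set (g' := fun s th => (hxx (X s th) (Y s th) * cos th + hxy (X s th) (Y s th) * sin th) * cos th +
   (hyx (X s th) (Y s th) * cos th + hyy (X s th) (Y s th) * sin th) * sin th).
set (k' := fun s th => 1 * g s th + s * g' s th).
(* This is h_theta / s with the division carried out, so that s = 0 causes no trouble. *)
set (e := fun s th => - hx (X s th) (Y s th) * sin th + hy (X s th) (Y s th) * cos th).
assert (Hgc : forall s, Rabs s < y0 -> contR (g s)).
{ intros s Hs'. apply contR_plus; apply contR_mult; try apply contR_cos1; try apply contR_sin1; apply Hcc; auto using smooth2_cont. }
assert (Hm : forall s, Rabs s < y0 -> is_derive (fun s => RInt (fun th => h (X s th) (Y s th)) a (a + 2 * PI)) s (RInt (g s) a (a + 2 * PI))).
{ intros s Hs'. apply (circle_deriv (fun s th => h (X s th) (Y s th)) g a _ y0); auto.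
  - intros t th Ht. apply (chain_rule h hx hy (fun s => X s th) (fun s => Y s th)); auto.
  - intros t th Ht. apply continuity_2d_pt_plus; apply continuity_2d_pt_mult; auto using c2d_cos, c2d_sin.
  - intros t Ht. apply Hcc; auto using smooth2_cont. }
assert (Hk : forall s, Rabs s < y0 -> is_derive (fun s => RInt (fun th => s * g s th) a (a + 2 * PI)) s (RInt (k' s) a (a + 2 * PI))).
{ intros s Hs'. apply (circle_deriv (fun s th => s * g s th) k' a _ y0); auto.
  - intros t th Ht. apply (is_derive_mult (fun s => s) (fun s => g s th)).
    + auto_derive; auto.
    + apply (is_derive_plus (fun s => hx (X s th) (Y s th) * cos th) (fun s => hy (X s th) (Y s th) * sin th)).
      * apply is_derive_ext with (fun s => cos th * hx (X s th) (Y s th)); [intros; rring|].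
        rewrite (Rmult_comm _ (cos th)). apply is_derive_scal, (chain_rule hx hxx hxy (fun s => X s th) (fun s => Y s th)); auto.
      * apply is_derive_ext with (fun s => sin th * hy (X s th) (Y s th)); [intros; rring|].
        rewrite (Rmult_comm _ (sin th)). apply is_derive_scal, (chain_rule hy hyx hyy (fun s => X s th) (fun s => Y s th)); auto.
  - intros t th Ht. unfold k', g, g'.
    repeat first [apply continuity_2d_pt_plus|apply c2d_cos|apply c2d_sin|apply continuity_2d_pt_const|apply continuity_2d_pt_id1|(apply H2d; assumption)|apply continuity_2d_pt_mult].
  - intros t Ht. apply contR_mult; auto; apply contR_const. }
assert (Hk0 : forall s, Rabs s < y0 -> RInt (k' s) a (a + 2 * PI) = 0).
{ intros s Hs'.
  assert (Ek : RInt (k' s) a (a + 2 * PI) = - e s (a + 2 * PI) - (- e s a)).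
  { apply (FTC (fun th => - e s th) (k' s)).
    - intros th. unfold e.
      assert (H1 := chain_rule hx hxx hxy (X s) (Y s) th _ _ Sx Dxx Dxy (HYp s th Hs') (HXt s th) (HYt s th)).
      assert (H2 := chain_rule hy hyx hyy (X s) (Y s) th _ _ Sy Dyx Dyy (HYp s th Hs') (HXt s th) (HYt s th)).
      apply is_derive_ext with (fun th => hx (X s th) (Y s th) * sin th - hy (X s th) (Y s th) * cos th); [intros; rring|].
      eapply is_derive_ext_val.
      + apply (is_derive_minus (fun th => hx (X s th) (Y s th) * sin th) (fun th => hy (X s th) (Y s th) * cos th)).
        * apply (is_derive_mult (fun th => hx (X s th) (Y s th)) sin); [apply H1|apply is_derive_Reals, derivable_pt_lim_sin].
        * apply (is_derive_mult (fun th => hy (X s th) (Y s th)) cos); [apply H2|apply is_derive_Reals, derivable_pt_lim_cos].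
      + specialize (Hlap (X s th) (Y s th) (HYp s th Hs')).
        unfold k', g, g', minus, plus, opp, mult; simpl. unfold mult; simpl.
        replace (hyy (X s th) (Y s th)) with (- hxx (X s th) (Y s th)) by lra. ring.
    - assert (Cu : forall u, smooth2 u -> contR (fun th => u (X s th) (Y s th))) by (intros; apply Hcc; auto using smooth2_cont).
      assert (Cg : contR (g' s)).
      { assert (Cl : forall u v, smooth2 u -> smooth2 v -> contR (fun th => u (X s th) (Y s th) * cos th + v (X s th) (Y s th) * sin th)).
        { intros u v Hu Hv. apply contR_plus; apply contR_mult; [apply Cu; auto|apply contR_cos1|apply Cu; auto|apply contR_sin1]. }
        apply contR_plus; apply contR_mult; [apply Cl; auto|apply contR_cos1|apply Cl; auto|apply contR_sin1]. }
      apply contR_plus; apply contR_mult; [apply contR_const|apply Hgc; auto|apply contR_const|apply Cg]. }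
  rewrite Ek. unfold e, X, Y.
  rewrite (cos_plus a), (sin_plus a), cos_2PI, sin_2PI. rewrite !Rmult_1_r, !Rmult_0_r, Rminus_0_r, Rplus_0_r. rring. }
assert (Hkc : forall s, Rabs s < y0 -> RInt (fun th => s * g s th) a (a + 2 * PI) = 0).
{ intros s Hs'. apply Rle_eps_eq. intros eps He.
  assert (E0 : RInt (fun th => 0 * g 0 th) a (a + 2 * PI) = 0).
  { rewrite (RInt_ext _ (fun _ => 0)); [rewrite RIconst; rring|intros; rring]. }
  rewrite <- E0. apply Rle_trans with (0 * Rabs (s - 0)); [|lra].
  apply (MVT_le (fun s => RInt (fun th => s * g s th) a (a + 2 * PI)) (fun s => RInt (k' s) a (a + 2 * PI))).
  - intros t Ht. apply Hk. apply Rabs_between_min in Ht. rewrite !Rminus_0_r in Ht. lra.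
  - intros t Ht. rewrite Hk0; [rewrite Rabs_R0; lra|]. apply Rabs_between_min in Ht. rewrite !Rminus_0_r in Ht. lra. }
assert (Hg0 : forall s, Rabs s < y0 -> RInt (g s) a (a + 2 * PI) = 0).
{ intros s Hs'. destruct (Req_dec s 0) as [->|n].
  - rewrite (FTC (fun th => hx x0 y0 * sin th - hy x0 y0 * cos th)).
    + rewrite (cos_plus a), (sin_plus a), cos_2PI, sin_2PI. rring.
    + intros th. unfold g, X, Y. rewrite !Rmult_0_l, !Rplus_0_r. auto_derive; auto; ring.
    + apply Hgc; auto.
  - pose proof (Hkc s Hs') as E. rewrite RIscal in E by (apply Hgc; auto).
    apply Rmult_integral in E. destruct E; [contradiction|auto]. }
assert (Hfin : Rabs (RInt (fun th => h (X r th) (Y r th)) a (a + 2 * PI) - RInt (fun th => h (X 0 th) (Y 0 th)) a (a + 2 * PI)) <= 0 * Rabs (r - 0)).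
{ apply (MVT_le (fun s => RInt (fun th => h (X s th) (Y s th)) a (a + 2 * PI)) (fun s => RInt (g s) a (a + 2 * PI))).
  - intros t Ht. apply Hm. apply Rabs_between_min in Ht. rewrite !Rminus_0_r, (Rabs_pos_eq r) in Ht by lra. lra.
  - intros t Ht. rewrite Hg0; [rewrite Rabs_R0; lra|]. apply Rabs_between_min in Ht. rewrite !Rminus_0_r, (Rabs_pos_eq r) in Ht by lra. lra. }
rewrite Rmult_0_l in Hfin.
assert (E0 : RInt (fun th => h (X 0 th) (Y 0 th)) a (a + 2 * PI) = 2 * PI * h x0 y0).
{ rewrite (RInt_ext _ (fun _ => h x0 y0)).
  - rewrite RIconst. rring.
  - intros th _. unfold X, Y. rewrite !Rmult_0_l, !Rplus_0_r. auto. }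
rewrite E0 in Hfin. apply Rle_eps_eq. intros eps He. unfold X, Y in Hfin. lra.
Qed.

Lemma polar x y : exists r th, 0 <= r /\ x = r * cos th /\ y = r * sin th /\ r ^ 2 = x ^ 2 + y ^ 2.
Proof.
set (r := sqrt (x ^ 2 + y ^ 2)).
assert (Hp : 0 <= x ^ 2 + y ^ 2) by (pose proof (pow2_ge_0 x); pose proof (pow2_ge_0 y); lra).
assert (Hr2 : r ^ 2 = x ^ 2 + y ^ 2) by (apply pow2_sqrt; auto).
assert (Hr : 0 <= r) by apply sqrt_pos.
destruct (Req_dec r 0) as [E|E].
- exists 0, 0. rewrite E in Hr2. pose proof (pow2_ge_0 x). pose proof (pow2_ge_0 y).
  assert (x = 0) by nra. assert (y = 0) by nra. subst x y. repeat split; try lra; ring.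
- assert (Hr0 : 0 < r) by lra.
  assert (Hb : -1 <= x / r <= 1).
  { assert (Hx : Rabs x <= r).
    { apply Rsqr_incr_0; try apply Rabs_pos; auto. rewrite <- Rsqr_abs. unfold Rsqr. pose proof (pow2_ge_0 y). nra. }
    apply Rabs_le_between in Hx.
    split; [apply Rmult_le_reg_r with r; auto; replace (x / r * r) with x by (field; auto); lra|
            apply Rmult_le_reg_r with r; auto; replace (x / r * r) with x by (field; auto); lra]. }
  assert (Hsin : sqrt (1 - (x / r)²) = Rabs y / r).
  { replace (1 - (x / r)²) with ((Rabs y / r)²).
    - apply sqrt_Rsqr. apply Rmult_le_pos; [apply Rabs_pos|left; apply Rinv_0_lt_compat; auto].
    - unfold Rsqr. replace (Rabs y / r * (Rabs y / r)) with (Rabs y ^ 2 / r ^ 2) by (field; auto).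
      rewrite pow2_abs. replace (y ^ 2) with (r ^ 2 - x ^ 2) by lra. field; auto. }
  destruct (Rle_dec 0 y) as [Hy|Hy].
  + exists r, (acos (x / r)). rewrite cos_acos, sin_acos, Hsin, Rabs_pos_eq by auto. repeat split; auto; field; auto.
  + exists r, (- acos (x / r)). rewrite cos_neg, sin_neg, cos_acos, sin_acos, Hsin, Rabs_left by lra || auto. repeat split; auto; field; auto.
Qed.

(** On a circle about the minimum, h minus its least value is nonnegative with mean 0. Radii below
    y0 are those whose circles stay in the half-plane. *)
Lemma min_ball h x0 y0 : smooth2 h -> harmonic h -> 0 < y0 -> (forall x y, 0 < y -> h x0 y0 <= h x y) ->
  forall x y, (x - x0) ^ 2 + (y - y0) ^ 2 < y0 ^ 2 -> h x y = h x0 y0.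
Proof.
intros Hs Hh Hy0 Hmin x y Hxy.
destruct (polar (x - x0) (y - y0)) as [r [th [Hr [E1 [E2 E3]]]]].
assert (Hry : r < y0) by (apply Rsqr_incrst_0; [unfold Rsqr; nra|auto|lra]).
assert (Hra : Rabs r < y0) by (rewrite Rabs_pos_eq; auto).
(* Starting the circle at th - PI places the angle th strictly inside the interval, as
   [nonneg_RInt_zero] requires. *)
pose proof (circle_mean h x0 y0 (th - PI) r Hs Hh (conj Hr Hry)) as Hm. pose proof PI_RGT_0.
assert (Hc := circle_cont h x0 y0 r (smooth2_cont h Hs) Hra).
assert (H0 : RInt (fun t => h (x0 + r * cos t) (y0 + r * sin t) - h x0 y0) (th - PI) (th - PI + 2 * PI) = 0).
{ rewrite RIminus, Hm, RIconst; auto; [rring|apply contR_const]. }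
pose proof (nonneg_RInt_zero (fun t => h (x0 + r * cos t) (y0 + r * sin t) - h x0 y0) (th - PI) (th - PI + 2 * PI) (contR_minus _ _ Hc (contR_const _))) as Hz.
assert (E : h (x0 + r * cos th) (y0 + r * sin th) - h x0 y0 = 0).
{ apply Hz; auto; [|lra]. intros t _. assert (h x0 y0 <= h (x0 + r * cos t) (y0 + r * sin t)); [|lra]. apply Hmin. apply circle_pos; auto. }
rewrite <- E1, <- E2 in E. replace (x0 + (x - x0)) with x in E by ring. replace (y0 + (y - y0)) with y in E by ring. lra.
Qed.

(* Balls [B(z, Im z)] of growing height exhaust the half-plane. *)
Lemma min_const h x0 y0 : smooth2 h -> harmonic h -> 0 < y0 -> (forall x y, 0 < y -> h x0 y0 <= h x y) ->
  forall x y, 0 < y -> h x y = h x0 y0.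
Proof.
intros Hs Hh Hy0 Hmin.
(* The ball of radius t about height t contains the point at height 3t/2 above it, so the minimal
   value propagates upwards geometrically. *)
assert (Hup : forall n, 0 < y0 * (3 / 2) ^ n /\ h x0 (y0 * (3 / 2) ^ n) = h x0 y0).
{ induction n.
  - simpl. rewrite Rmult_1_r. auto.
  - destruct IHn as [Hp E]. set (t := y0 * (3 / 2) ^ n) in *.
    replace (y0 * (3 / 2) ^ S n) with (t * (3 / 2)) by (unfold t; simpl; ring). split; [lra|].
    rewrite <- E. apply min_ball; auto.
    + intros; rewrite E; auto.
    + replace ((x0 - x0) ^ 2 + (t * (3 / 2) - t) ^ 2) with (/ 4 * t ^ 2) by field. assert (0 < t ^ 2) by (apply pow_lt; auto). lra. }
intros x y Hy.
(* A point (x, y) lies in the ball of radius t about (x0, t) as soon as (x - x0)^2 + y^2 < 2 y t,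
   which determines how large t has to be. *)
destruct (Pow_x_infinity (3 / 2) ltac:(rewrite Rabs_pos_eq; lra) (((x - x0) ^ 2 + y ^ 2 + 1) / (2 * y * y0))) as [N HN].
specialize (HN N (le_n _)). rewrite Rabs_pos_eq in HN by (left; apply pow_lt; lra).
destruct (Hup N) as [Hp E]. rewrite <- E. apply min_ball; auto; [intros; rewrite E; auto|].
set (t := y0 * (3 / 2) ^ N) in *.
assert (H : (x - x0) ^ 2 + y ^ 2 + 1 <= 2 * y * t).
{ apply Rge_le in HN. apply (Rmult_le_compat_l (2 * y * y0)) in HN; [|apply Rmult_le_pos; nra].
  replace (2 * y * y0 * (((x - x0) ^ 2 + y ^ 2 + 1) / (2 * y * y0))) with ((x - x0) ^ 2 + y ^ 2 + 1) in HN by (field; lra).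
  unfold t. lra. }
nra.
Qed.

(* Composing with [atan] makes the infimum finite without a separate boundedness argument. *)
Lemma min_rect h Y : cont2 h -> / 2 <= Y -> exists x0 y0, / 2 <= y0 <= Y /\
  forall x y, - / 2 <= x <= / 2 -> / 2 <= y <= Y -> h x0 y0 <= h x y.
Proof.
intros Hc HY. set (f := fun x y => atan (h x y)).
assert (Hcf : cont2 f).
{ apply c2d_cont2. intros x y Hy. apply (continuity_1d_2d_pt_comp atan h); [|apply cont2_2d; auto].
  apply continuity_pt_filterlim, (ex_derive_continuous atan (h x y)). exists (/ (1 + h x y ^ 2)). apply is_derive_Reals, derivable_pt_lim_atan. }
set (V := fun v => exists x y, - / 2 <= x <= / 2 /\ / 2 <= y <= Y /\ v = - f x y).
destruct (completeness V) as [M [Hub Hlub]].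
- exists (PI / 2). intros v [x [y [_ [_ ->]]]]. unfold f. pose proof (atan_bound (h x y)). lra.
- exists (- f 0 (/ 2)), 0, (/ 2). repeat split; lra.
- destruct (classic (exists x0 y0, (- / 2 <= x0 <= / 2 /\ / 2 <= y0 <= Y) /\ f x0 y0 <= - M)) as [[x0 [y0 [[Hx0 Hy0] H0]]]|Hn].
  + exists x0, y0. split; auto. intros x y Hx Hy.
    assert (Hf : f x0 y0 <= f x y). { assert (- f x y <= M) by (apply Hub; exists x, y; auto). lra. }
    apply Rnot_lt_le. intros Hlt. apply atan_increasing in Hlt. unfold f in Hf. lra.
  + exfalso.
    (* If the infimum [- M] is not attained, each point has a radius d within which f is at least
       [- M + d]. One number serves as radius and as margin, so compactness yields a uniform margin,
       contradicting the choice of M. *)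
    assert (Hd : forall u v, exists d : posreal, (- / 2 <= u <= / 2 -> / 2 <= v <= Y ->
      forall x y, 0 < y -> Rabs (x - u) < d -> Rabs (y - v) < d -> - M + d <= f x y)).
    { intros u v. destruct (classic (- / 2 <= u <= / 2 /\ / 2 <= v <= Y)) as [[Hu Hv]|Hout].
      - assert (Hp : 0 < (f u v + M) / 2). { apply Rnot_le_lt. intros Hle. apply Hn. exists u, v. split; auto. lra. }
        assert (Hv0 : 0 < v) by lra.
        destruct (Hcf u v Hv0 _ Hp) as [d [Hd Hd']].
        assert (Hm : 0 < Rmin d ((f u v + M) / 2)) by (apply Rmin_pos; auto).
        exists (mkposreal _ Hm). intros _ _ x y Hy Hx1 Hy1. simpl in *.
        pose proof (Rmin_l d ((f u v + M) / 2)). pose proof (Rmin_r d ((f u v + M) / 2)).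
        assert (H1 : Rabs (f x y - f u v) < (f u v + M) / 2) by (apply Hd'; auto; lra).
        apply Rabs_def2 in H1. lra.
      - exists (mkposreal 1 Rlt_0_1). intros; tauto. }
    set (delta := fun u v => epsilon (inhabits (mkposreal 1 Rlt_0_1)) (fun d : posreal => (- / 2 <= u <= / 2 -> / 2 <= v <= Y ->
      forall x y, 0 < y -> Rabs (x - u) < d -> Rabs (y - v) < d -> - M + d <= f x y))).
    assert (Hdel : forall u v, - / 2 <= u <= / 2 -> / 2 <= v <= Y ->
      forall x y, 0 < y -> Rabs (x - u) < delta u v -> Rabs (y - v) < delta u v -> - M + delta u v <= f x y).
    { intros u v. apply (epsilon_spec (inhabits (mkposreal 1 Rlt_0_1)) _ (Hd u v)). }
    destruct (compactness_value_2d (- / 2) (/ 2) (/ 2) Y delta) as [d Hcomp].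
    assert (Hall : forall x y, - / 2 <= x <= / 2 -> / 2 <= y <= Y -> - M + d <= f x y).
    { intros x y Hx Hy. apply Rnot_lt_le. intros Hlt. apply (Hcomp x y Hx Hy).
      intros [u [v [Hu [Hv [H1 [H2 H3]]]]]].
      assert (- M + delta u v <= f x y) by (apply Hdel; auto; lra). lra. }
    assert (M <= M - d).
    { apply Hlub. intros v [x [y [Hx [Hy ->]]]]. specialize (Hall x y Hx Hy). lra. }
    pose proof (cond_pos d). lra.
Qed.

Definition inv_invariant (u : R -> R -> R) : Prop := forall x y, 0 < y -> u (- x / (x ^ 2 + y ^ 2)) (y / (x ^ 2 + y ^ 2)) = u x y.

Lemma round_half x : exists n, - / 2 <= x + IZR n <= / 2.
Proof.
destruct (archimed (x - / 2)) as [H1 H2]. exists (- up (x - / 2))%Z. rewrite opp_IZR. lra.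
Qed.

Lemma sq_pos x y : 0 < y -> 0 < x ^ 2 + y ^ 2.
Proof. intros Hy. pose proof (pow2_ge_0 x). assert (0 < y ^ 2) by (apply pow_lt; auto). lra. Qed.

(* Below height 1/2 and with |x| <= 1/2, the inversion at least doubles the height. *)
Lemma reduction u : periodic_x u -> inv_invariant u -> forall x y, 0 < y ->
  exists x' y', - / 2 <= x' <= / 2 /\ / 2 <= y' /\ u x' y' = u x y.
Proof.
intros Hp HS.
(* Induction on the number of doublings that lift the height to 1/2. The threshold 1/2 lies below
   the floor of the fundamental domain, which merely enlarges the compact rectangle. *)
assert (H : forall n x y, 0 < y -> (/ 2) ^ S n <= y -> exists x' y', - / 2 <= x' <= / 2 /\ / 2 <= y' /\ u x' y' = u x y).
{ induction n; intros x y Hy Hn.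
  - destruct (round_half x) as [k Hk]. exists (x + IZR k), y. split; auto. split; [simpl in Hn; lra|].
    apply (periodic1_Z (fun x => u x y) (Hp y Hy)).
  - destruct (round_half x) as [k Hk]. set (t := x + IZR k) in *.
    assert (Et : u t y = u x y) by apply (periodic1_Z (fun x => u x y) (Hp y Hy)).
    destruct (Rle_dec (/ 2) y) as [Hh|Hh]; [exists t, y; auto|].
    assert (HD : 0 < t ^ 2 + y ^ 2) by (apply sq_pos; auto).
    assert (HD2 : t ^ 2 + y ^ 2 <= / 2) by nra.
    assert (Hy2 : 2 * y <= y / (t ^ 2 + y ^ 2)).
    { apply Rmult_le_reg_r with (t ^ 2 + y ^ 2); auto. replace (y / (t ^ 2 + y ^ 2) * (t ^ 2 + y ^ 2)) with y by (field; lra). nra. }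
    destruct (IHn (- t / (t ^ 2 + y ^ 2)) (y / (t ^ 2 + y ^ 2))) as [x' [y' [H1 [H2 H3]]]].
    + lra.
    + simpl in *. lra.
    + exists x', y'. split; auto. split; auto. rewrite H3, HS; auto. }
intros x y Hy.
destruct (pow_lt_1_zero (/ 2) ltac:(rewrite Rabs_pos_eq; lra) y Hy) as [N HN].
specialize (HN (S N) ltac:(lia)). rewrite Rabs_pos_eq in HN by (left; apply pow_lt; lra).
apply (H N); auto; lra.
Qed.

Lemma harmonic_opp h : harmonic h -> harmonic (fun x y => (-1) * h x y).
Proof.
intros [h0 [[ux [uy [uxx [uyy [H1 [H2 [H3 [H4 H5]]]]]]]] H0]].
exists (fun x y => (-1) * h0 x y). split; [|intros; rewrite H0 by auto; ring].
exists (fun x y => (-1) * ux x y), (fun x y => (-1) * uy x y), (fun x y => (-1) * uxx x y), (fun x y => (-1) * uyy x y).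
split; [|split; [|split; [|split]]]; try (intros x y Hy; apply is_derive_scal; auto).
intros x y Hy. rewrite H5 by auto. ring.
Qed.

(** After [reduction] every value is taken in the rectangle, where a minimum exists, or above it,
    where (x1, y1) is lower. The smaller of the two candidates is a global minimum, and [min_const]
    applies. *)
Lemma const_of_low_point h x1 y1 Y : smooth2 h -> harmonic h -> periodic_x h -> inv_invariant h -> 0 < y1 ->
  (forall x y, Y <= y -> h x1 y1 <= h x y) -> forall x y, 0 < y -> h x y = h x1 y1.
Proof.
intros Hs Hh Hp HS Hy1 Hlow.
destruct (min_rect h (Rmax Y 1) (smooth2_cont h Hs)) as [x0 [y0 [Hy0 Hmin]]].
{ eapply Rle_trans; [|apply Rmax_r]. lra. }
assert (Hred : forall x y, 0 < y -> h x0 y0 <= h x y \/ h x1 y1 <= h x y).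
{ intros x y Hy. destruct (reduction h Hp HS x y Hy) as [x' [y' [Hx' [Hy' E]]]]. rewrite <- E.
  destruct (Rle_dec y' (Rmax Y 1)) as [Hle|Hgt]; [left; apply Hmin; auto|right].
  apply Hlow. pose proof (Rmax_l Y 1). lra. }
intros x y Hy.
destruct (Rle_dec (h x0 y0) (h x1 y1)) as [Hle|Hgt].
- assert (Hm : forall x y, 0 < y -> h x0 y0 <= h x y) by (intros a b Hb; destruct (Hred a b Hb); lra).
  assert (Hc := min_const h x0 y0 Hs Hh ltac:(lra) Hm). rewrite (Hc x y Hy), (Hc x1 y1 Hy1). auto.
- assert (Hm : forall x y, 0 < y -> h x1 y1 <= h x y) by (intros a b Hb; destruct (Hred a b Hb); lra).
  apply (min_const h x1 y1 Hs Hh Hy1 Hm x y Hy).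
Qed.

Lemma exp_decay_le_eps C eps : 0 < eps -> exists Y, 2 <= Y /\ forall y, Y <= y -> C * exp (- y) <= eps.
Proof.
intros He. destruct (exp_decay_small C 1 Rlt_0_1 eps He) as [b0 [_ Hb]].
exists (Rmax 2 b0). split; [apply Rmax_l|]. intros y Hy.
assert (Hy' : b0 <= y) by (eapply Rle_trans; [apply Rmax_r|apply Hy]).
specialize (Hb y Hy'). rewrite Rmult_1_l in Hb. eapply Rle_trans; [apply Rle_abs|apply Hb].
Qed.

(** If b is nonzero, h or -h tends to infinity at the cusp, so any point is low. If b = 0 and h is
    not identically a, then up to sign some value lies strictly below a, and high up the
    exponentially small error keeps h above that value. *)
Lemma harmonic_const h a b C : smooth2 h -> harmonic h -> periodic_x h -> inv_invariant h ->
  (forall x y, 2 <= y -> Rabs (h x y - (a + b * y)) <= C * exp (- y)) ->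
  exists c, forall x y, 0 < y -> h x y = c.
Proof.
assert (Hpos : forall h a b, smooth2 h -> harmonic h -> periodic_x h -> inv_invariant h ->
  (forall x y, 2 <= y -> Rabs (h x y - (a + b * y)) <= C * exp (- y)) -> 0 < b \/ (b = 0 /\ exists x1 y1, 0 < y1 /\ h x1 y1 < a) ->
  exists c, forall x y, 0 < y -> h x y = c).
{ clear h a b. intros h a b Hs Hh Hp HS Has [Hb|[-> [x1 [y1 [Hy1 Hlt]]]]].
  - exists (h 0 1). destruct (exp_decay_le_eps C 1 Rlt_0_1) as [Y [HY2 HY]].
    apply const_of_low_point with (Rmax Y ((h 0 1 - a + 1) / b)); auto; [lra|].
    intros x y Hy. assert (H1 : Y <= y) by (eapply Rle_trans; [apply Rmax_l|apply Hy]).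
    assert (H2 : (h 0 1 - a + 1) / b <= y) by (eapply Rle_trans; [apply Rmax_r|apply Hy]).
    assert (H3 : 2 <= y) by lra. specialize (Has x y H3). specialize (HY y H1).
    apply Rabs_le_between in Has. apply (Rmult_le_compat_l b) in H2; [|lra].
    replace (b * ((h 0 1 - a + 1) / b)) with (h 0 1 - a + 1) in H2 by (field; lra). lra.
  - exists (h x1 y1). destruct (exp_decay_le_eps C (a - h x1 y1)) as [Y [HY2 HY]]; [lra|].
    apply const_of_low_point with Y; auto. intros x y Hy. assert (H3 : 2 <= y) by lra.
    specialize (Has x y H3). specialize (HY y Hy). apply Rabs_le_between in Has. lra. }
intros Hs Hh Hp HS Has.
assert (Hneg : 0 < - b \/ (- b = 0 /\ exists x1 y1, 0 < y1 /\ (-1) * h x1 y1 < - a) -> exists c, forall x y, 0 < y -> h x y = c).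
{ intros Hcase. destruct (Hpos (fun x y => (-1) * h x y) (- a) (- b)) as [c Hc]; auto.
  - apply smooth2_scal; auto.
  - apply harmonic_opp; auto.
  - intros y Hy x. rewrite (Hp y Hy x). auto.
  - intros x y Hy. rewrite HS; auto.
  - intros x y Hy. replace (-1 * h x y - (- a + - b * y)) with (- (h x y - (a + b * y))) by ring. rewrite Rabs_Ropp; auto.
  - exists (- c). intros x y Hy. specialize (Hc x y Hy). lra. }
destruct (Rtotal_order b 0) as [Hb|[Hb|Hb]].
- apply Hneg. left; lra.
- destruct (classic (exists x1 y1, 0 < y1 /\ h x1 y1 < a)) as [H1|H1]; [apply (Hpos h a b); auto|].
  destruct (classic (exists x1 y1, 0 < y1 /\ (-1) * h x1 y1 < - a)) as [H2|H2]; [apply Hneg; right; split; auto; lra|].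
  exists a. intros x y Hy. apply Rle_antisym; apply Rnot_lt_le; intros Hlt.
  + apply H2. exists x, y. split; auto; lra.
  + apply H1. exists x, y. auto.
- apply (Hpos h a b); auto.
Qed.

(* The inversion is conformal, so it commutes with the hyperbolic Laplacian. *)
Lemma lap_inv_invariant u h : smooth2 u -> inv_invariant u -> lap u h -> inv_invariant h.
Proof.
intros Hs HS [ux [uy [uxx [uyy [Dx [Dy [Dxx [Dyy Hlap]]]]]]]].
assert (Sx := smooth2_dx _ _ Hs Dx). assert (Sy := smooth2_dy _ _ Hs Dy).
destruct (smooth2_inv ux Sx) as [uxx' [uxy [_ [Dxy _]]]].
destruct (smooth2_inv uy Sy) as [uyx [uyy' [Dyx [_ _]]]].
set (D := fun x y : R => x ^ 2 + y ^ 2).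
set (p := fun x y => - x / D x y). set (q := fun x y => y / D x y).
(* p + iq = -1/z has derivative 1/z^2 = A - iB; the Cauchy-Riemann equations read p_x = q_y = A and
   p_y = -q_x = B. *)
set (A := fun x y => (x ^ 2 - y ^ 2) / D x y ^ 2). set (B := fun x y => 2 * x * y / D x y ^ 2).
assert (HD : forall x y, 0 < y -> 0 < D x y) by (intros; apply sq_pos; auto).
assert (Hq : forall x y, 0 < y -> 0 < q x y) by (intros; apply Rdiv_lt_0_compat; auto).
assert (Dpx : forall x y, 0 < y -> is_derive (fun x => p x y) x (A x y)).
{ intros x y Hy. pose proof (HD x y Hy). unfold p, A, D in *. auto_derive; [simpl in *; lra|]. pow2n. field. lra. }
assert (Dpy : forall x y, 0 < y -> is_derive (fun y => p x y) y (B x y)).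
{ intros x y Hy. pose proof (HD x y Hy). unfold p, B, D in *. auto_derive; [simpl in *; lra|]. pow2n. field. lra. }
assert (Dqx : forall x y, 0 < y -> is_derive (fun x => q x y) x (- B x y)).
{ intros x y Hy. pose proof (HD x y Hy). unfold q, B, D in *. auto_derive; [simpl in *; lra|]. pow2n. field. lra. }
assert (Dqy : forall x y, 0 < y -> is_derive (fun y => q x y) y (A x y)).
{ intros x y Hy. pose proof (HD x y Hy). unfold q, A, D in *. auto_derive; [simpl in *; lra|]. pow2n. field. lra. }
set (Ax := fun x y => 2 * x / D x y ^ 2 - 4 * x * (x ^ 2 - y ^ 2) / D x y ^ 3).
set (Ay := fun x y => - 2 * y / D x y ^ 2 - 4 * y * (x ^ 2 - y ^ 2) / D x y ^ 3).
set (Bx := fun x y => 2 * y / D x y ^ 2 - 8 * x ^ 2 * y / D x y ^ 3).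
set (By := fun x y => 2 * x / D x y ^ 2 - 8 * x * y ^ 2 / D x y ^ 3).
assert (DAx : forall x y, 0 < y -> is_derive (fun x => A x y) x (Ax x y)).
{ intros x y Hy. pose proof (HD x y Hy) as H. unfold A, Ax, D in *. auto_derive; [simpl in *; apply Rgt_not_eq; repeat apply Rmult_lt_0_compat; lra|]. pow2n. field. lra. }
assert (DAy : forall x y, 0 < y -> is_derive (fun y => A x y) y (Ay x y)).
{ intros x y Hy. pose proof (HD x y Hy) as H. unfold A, Ay, D in *. auto_derive; [simpl in *; apply Rgt_not_eq; repeat apply Rmult_lt_0_compat; lra|]. pow2n. field. lra. }
assert (DBx : forall x y, 0 < y -> is_derive (fun x => B x y) x (Bx x y)).
{ intros x y Hy. pose proof (HD x y Hy) as H. unfold B, Bx, D in *. auto_derive; [simpl in *; apply Rgt_not_eq; repeat apply Rmult_lt_0_compat; lra|]. pow2n. field. lra. }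
assert (DBy : forall x y, 0 < y -> is_derive (fun y => B x y) y (By x y)).
{ intros x y Hy. pose proof (HD x y Hy) as H. unfold B, By, D in *. auto_derive; [simpl in *; apply Rgt_not_eq; repeat apply Rmult_lt_0_compat; lra|]. pow2n. field. lra. }
assert (HS' : forall x y, 0 < y -> u (p x y) (q x y) = u x y) by (intros; apply HS; auto).
assert (Ex : forall x y, 0 < y -> ux x y = ux (p x y) (q x y) * A x y + uy (p x y) (q x y) * - B x y).
{ intros x y Hy. rewrite <- (is_derive_unique _ _ _ (Dx x y Hy)). apply is_derive_unique.
  apply is_derive_ext with (fun t => u (p t y) (q t y)); [intros; auto|].
  apply (chain_rule u ux uy (fun t => p t y) (fun t => q t y)); auto. }
assert (Ey : forall x y, 0 < y -> uy x y = ux (p x y) (q x y) * B x y + uy (p x y) (q x y) * A x y).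
{ intros x y Hy. rewrite <- (is_derive_unique _ _ _ (Dy x y Hy)). apply is_derive_unique.
  apply is_derive_ext_loc with (fun t => u (p x t) (q x t)).
  - apply (pd_local y (fun t => u (p x t) (q x t) = u x t)); auto.
  - apply (chain_rule u ux uy (fun t => p x t) (fun t => q x t)); auto. }
assert (Exx : forall x y, 0 < y -> uxx x y =
   ((uxx (p x y) (q x y) * A x y + uxy (p x y) (q x y) * - B x y) * A x y + ux (p x y) (q x y) * Ax x y) +
   ((uyx (p x y) (q x y) * A x y + uyy (p x y) (q x y) * - B x y) * - B x y + uy (p x y) (q x y) * - Bx x y)).
{ intros x y Hy. rewrite <- (is_derive_unique _ _ _ (Dxx x y Hy)). apply is_derive_unique.
  apply is_derive_ext with (fun t => ux (p t y) (q t y) * A t y + uy (p t y) (q t y) * - B t y); [intros; symmetry; apply Ex; auto|].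
  apply (is_derive_plus (fun t => ux (p t y) (q t y) * A t y) (fun t => uy (p t y) (q t y) * - B t y)).
  - apply (is_derive_mult (fun t => ux (p t y) (q t y)) (fun t => A t y)); auto.
    apply (chain_rule ux uxx uxy (fun t => p t y) (fun t => q t y)); auto.
  - apply (is_derive_mult (fun t => uy (p t y) (q t y)) (fun t => - B t y)).
    + apply (chain_rule uy uyx uyy (fun t => p t y) (fun t => q t y)); auto.
    + apply (is_derive_opp (fun t => B t y)); auto. }
assert (Eyy : forall x y, 0 < y -> uyy x y =
   ((uxx (p x y) (q x y) * B x y + uxy (p x y) (q x y) * A x y) * B x y + ux (p x y) (q x y) * By x y) +
   ((uyx (p x y) (q x y) * B x y + uyy (p x y) (q x y) * A x y) * A x y + uy (p x y) (q x y) * Ay x y)).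
{ intros x y Hy. rewrite <- (is_derive_unique _ _ _ (Dyy x y Hy)). apply is_derive_unique.
  apply is_derive_ext_loc with (fun t => ux (p x t) (q x t) * B x t + uy (p x t) (q x t) * A x t).
  - apply (pd_local y (fun t => ux (p x t) (q x t) * B x t + uy (p x t) (q x t) * A x t = uy x t)); auto. intros; symmetry; apply Ey; auto.
  - apply (is_derive_plus (fun t => ux (p x t) (q x t) * B x t) (fun t => uy (p x t) (q x t) * A x t)).
    + apply (is_derive_mult (fun t => ux (p x t) (q x t)) (fun t => B x t)); auto.
      apply (chain_rule ux uxx uxy (fun t => p x t) (fun t => q x t)); auto.
    + apply (is_derive_mult (fun t => uy (p x t) (q x t)) (fun t => A x t)); auto.
      apply (chain_rule uy uyx uyy (fun t => p x t) (fun t => q x t)); auto. }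
intros x y Hy. change (h (p x y) (q x y) = h x y). rewrite !Hlap, (Exx x y), (Eyy x y); auto.
assert (Hd := HD x y Hy).
(* p and q are harmonic, so first-order terms cancel; the conformal factor A^2 + B^2 is exactly the
   one by which y^2 changes. *)
assert (E1 : Ax x y + By x y = 0) by (unfold Ax, By, D in *; field; lra).
assert (E2 : - Bx x y + Ay x y = 0) by (unfold Ay, Bx, D in *; field; lra).
assert (E3 : q x y ^ 2 = y ^ 2 * (A x y ^ 2 + B x y ^ 2)) by (unfold q, A, B, D in *; field; lra).
rewrite E3. replace (By x y) with (- Ax x y) by lra. replace (Ay x y) with (Bx x y) by lra. ring.
Qed.

Lemma iterlap_inv_invariant i f g : iterlap i f g -> smooth2 f -> periodic_x f -> moderate2 f -> inv_invariant f -> inv_invariant g.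
Proof.
intros H. induction H as [f|i f g h Hfg IH Hgh]; intros Hf Hp Hm HS; auto.
apply lap_inv_invariant with g; auto. apply (iterlap_deriv_moderate i f g); auto.
Qed.

Lemma polyharmonic_const i f g : iterlap i f g -> smooth2 f -> periodic_x f -> moderate2 f -> inv_invariant f -> harmonic g ->
  exists c, forall x y, 0 < y -> g x y = c.
Proof.
intros H Hf Hp Hm HS Hh. destruct (iterlap_deriv_moderate i f g H Hf Hp Hm) as [Sg [Pg Mg]].
destruct (harmonic_asymp g Sg Pg Hh) as [a [b [C Has]]].
- intros w n Hw. exists (2 * i)%nat. eapply Mg; eauto.
- apply (harmonic_const g a b C); auto. eapply iterlap_inv_invariant; eauto.
Qed.

(** * Complex numbers and the Gamma function *)

Lemma Ceq (z w : Cplx) : Re z = Re w -> Im z = Im w -> z = w.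
Proof. destruct z, w; simpl; intros -> ->; auto. Qed.

Lemma Cplx_ring : ring_theory C0 C1 Cadd Cmul Csub Copp (@eq Cplx).
Proof. split; intros; apply Ceq; simpl; ring. Qed.

Lemma Cnorm2_pos z : z <> C0 -> 0 < Re z * Re z + Im z * Im z.
Proof.
intros Hz. destruct (Req_dec (Re z) 0) as [E|E], (Req_dec (Im z) 0) as [E'|E'].
- exfalso; apply Hz, Ceq; auto.
- assert (0 < Im z * Im z) by (apply Rsqr_pos_lt; auto). nra.
- assert (0 < Re z * Re z) by (apply Rsqr_pos_lt; auto). nra.
- assert (0 < Re z * Re z) by (apply Rsqr_pos_lt; auto). nra.
Qed.

Lemma Cplx_field : field_theory C0 C1 Cadd Cmul Csub Copp Cdiv Cinv (@eq Cplx).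
Proof.
split.
- apply Cplx_ring.
- intros H. apply (f_equal Re) in H. simpl in H. lra.
- intros; auto.
- intros z Hz. pose proof (Cnorm2_pos z Hz). apply Ceq; simpl; field; lra.
Qed.

Add Field Cplx_field_inst : Cplx_field.

Lemma Cnorm_ge0 z : 0 <= Cnorm z.
Proof. apply sqrt_pos. Qed.

Lemma Cnorm_sq z : Cnorm z ^ 2 = Re z * Re z + Im z * Im z.
Proof. apply pow2_sqrt. nra. Qed.

Lemma Cnorm_mul z w : Cnorm (Cmul z w) = Cnorm z * Cnorm w.
Proof.
unfold Cnorm. rewrite <- sqrt_mult_alt by nra. f_equal. simpl. ring.
Qed.

Lemma Re_le_Cnorm z : Rabs (Re z) <= Cnorm z.
Proof.
apply Rsqr_incr_0; try apply Rabs_pos; try apply Cnorm_ge0. rewrite <- Rsqr_abs.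
pose proof (Cnorm_sq z). unfold Rsqr. nra.
Qed.

Lemma Im_le_Cnorm z : Rabs (Im z) <= Cnorm z.
Proof.
apply Rsqr_incr_0; try apply Rabs_pos; try apply Cnorm_ge0. rewrite <- Rsqr_abs.
pose proof (Cnorm_sq z). unfold Rsqr. nra.
Qed.

Lemma Cnorm_le_sum z : Cnorm z <= Rabs (Re z) + Rabs (Im z).
Proof.
pose proof (Rabs_pos (Re z)). pose proof (Rabs_pos (Im z)).
apply Rsqr_incr_0; try apply Cnorm_ge0; try lra. unfold Rsqr.
pose proof (Cnorm_sq z). pose proof (pow2_abs (Re z)). pose proof (pow2_abs (Im z)). nra.
Qed.

Lemma Cnorm_triang z w : Cnorm (Cadd z w) <= Cnorm z + Cnorm w.
Proof.
pose proof (Cnorm_ge0 z). pose proof (Cnorm_ge0 w).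
apply Rsqr_incr_0; try apply Cnorm_ge0; try lra. unfold Rsqr.
pose proof (Cnorm_sq (Cadd z w)) as E. simpl in E.
pose proof (Cnorm_sq z). pose proof (Cnorm_sq w).
assert (H3 : Re z * Re w + Im z * Im w <= Cnorm z * Cnorm w).
{ eapply Rle_trans; [apply Rle_abs|]. apply Rsqr_incr_0; [|apply Rabs_pos|apply Rmult_le_pos; auto].
  rewrite <- Rsqr_abs. unfold Rsqr.
  replace (Cnorm z * Cnorm w * (Cnorm z * Cnorm w)) with (Cnorm z ^ 2 * Cnorm w ^ 2) by ring. rewrite H1, H2.
  pose proof (pow2_ge_0 (Re z * Im w - Im z * Re w)). nra. }
nra.
Qed.

Lemma Cnorm_opp z : Cnorm (Copp z) = Cnorm z.
Proof. unfold Cnorm. f_equal. simpl. ring. Qed.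

Lemma Cnorm_RtoC r : Cnorm (RtoC r) = Rabs r.
Proof. unfold Cnorm; simpl. rewrite Rmult_0_l, Rplus_0_r. apply sqrt_Rsqr_abs. Qed.

Lemma Cseq_cv_unique u a b : Cseq_cv u a -> Cseq_cv u b -> a = b.
Proof.
intros Ha Hb.
assert (H : forall eps, 0 < eps -> Cnorm (Csub a b) <= eps).
{ intros eps He. destruct (Ha (eps / 2)) as [N HN]; [lra|]. destruct (Hb (eps / 2)) as [M HM]; [lra|].
  specialize (HN (max N M) ltac:(lia)). specialize (HM (max N M) ltac:(lia)).
  set (w := u (max N M)) in *. replace (Csub a b) with (Cadd (Copp (Csub w a)) (Csub w b)) by ring.
  eapply Rle_trans; [apply Cnorm_triang|]. rewrite Cnorm_opp. lra. }
apply Ceq; apply Rle_eps_eq; intros eps He.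
- eapply Rle_trans; [apply (Re_le_Cnorm (Csub a b))|auto].
- eapply Rle_trans; [apply (Im_le_Cnorm (Csub a b))|auto].
Qed.

(** The power t^s at t = e^u; [Rcpow r s] is [ce s (ln r)] by conversion. *)
Definition ce (s : Cplx) (u : R) : Cplx := Cexp (Cmul s (RtoC u)).

Lemma ce_Re s u : Re (ce s u) = exp (Re s * u) * cos (Im s * u).
Proof. unfold ce, Cexp; simpl. do 2 f_equal; ring. Qed.

Lemma ce_Im s u : Im (ce s u) = exp (Re s * u) * sin (Im s * u).
Proof. unfold ce, Cexp; simpl. do 2 f_equal; ring. Qed.

Lemma Cexp_add z w : Cexp (Cadd z w) = Cmul (Cexp z) (Cexp w).
Proof.
apply Ceq; simpl; rewrite exp_plus; [rewrite cos_plus|rewrite sin_plus]; ring.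
Qed.

Lemma ce_add s u v : ce s (u + v) = Cmul (ce s u) (ce s v).
Proof. unfold ce. rewrite <- Cexp_add. f_equal. apply Ceq; simpl; ring. Qed.

Lemma ce_plus s t u : ce (Cadd s t) u = Cmul (ce s u) (ce t u).
Proof. unfold ce. rewrite <- Cexp_add. f_equal. ring. Qed.

Lemma ce_0 s : ce s 0 = C1.
Proof. apply Ceq; rewrite ?ce_Re, ?ce_Im; rewrite !Rmult_0_r, exp_0, ?cos_0, ?sin_0; simpl; ring. Qed.

Lemma Cnorm_ce s u : Cnorm (ce s u) = exp (Re s * u).
Proof.
unfold Cnorm. rewrite ce_Re, ce_Im. set (e := exp (Re s * u)).
replace (e * cos (Im s * u) * (e * cos (Im s * u)) + e * sin (Im s * u) * (e * sin (Im s * u))) with (e * e * ((sin (Im s * u))² + (cos (Im s * u))²)) by (unfold Rsqr; ring).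
rewrite sin2_cos2, Rmult_1_r. apply sqrt_square. left; apply exp_pos.
Qed.

Lemma egrowth_ce s : egrowth (fun u => Re (ce s u)) 1 (Rabs (Re s)) /\ egrowth (fun u => Im (ce s u)) 1 (Rabs (Re s)).
Proof.
assert (Hb : forall u, Cnorm (ce s u) <= 1 * exp (Rabs (Re s) * Rabs u)).
{ intros u. rewrite Cnorm_ce, Rmult_1_l, <- Rabs_mult. apply exp_le, Rle_abs. }
split; (split; [|split; [apply Rabs_pos|]]).
- intros u. apply (continuous_ext (fun u => exp (Re s * u) * cos (Im s * u))); [intros; rewrite ce_Re; auto|].
  apply (ex_derive_continuous (fun u => exp (Re s * u) * cos (Im s * u)) u). auto_derive; auto.
- intros u. eapply Rle_trans; [apply Re_le_Cnorm|auto].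
- intros u. apply (continuous_ext (fun u => exp (Re s * u) * sin (Im s * u))); [intros; rewrite ce_Im; auto|].
  apply (ex_derive_continuous (fun u => exp (Re s * u) * sin (Im s * u)) u). auto_derive; auto.
- intros u. eapply Rle_trans; [apply Im_le_Cnorm|auto].
Qed.

Lemma egrowthE_ceRe s : egrowthE (fun u => Re (ce s u)).
Proof. exact (ex_intro _ _ (ex_intro _ _ (proj1 (egrowth_ce s)))). Qed.

Lemma egrowthE_ceIm s : egrowthE (fun u => Im (ce s u)).
Proof. exact (ex_intro _ _ (ex_intro _ _ (proj2 (egrowth_ce s)))). Qed.

(** The order k + 1 in [exp_le_Rpower] absorbs the weight e^(ku) and leaves the decay e^(-u). *)
Lemma nice_pos q w : 0 < q -> egrowthE w -> nice (fun u => exp (- (q * exp u)) * w u).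
Proof.
intros Hq [C [k Hw]]. pose proof (egrowth_C _ _ _ Hw) as HC. destruct Hw as [Hc [Hk Hw]].
apply nice_le with (Rpower (k + 1) (k + 1) * Rpower q (- (k + 1)) * C) 1; [|lra|].
- apply contR_mult; auto. intros u. apply (ex_derive_continuous (fun u => exp (- (q * exp u))) u). auto_derive; auto.
- intros u Hu. rewrite Rabs_mult, Rabs_pos_eq by (left; apply exp_pos).
  apply Rle_trans with ((Rpower (k + 1) (k + 1) * Rpower (q * exp u) (- (k + 1))) * (C * exp (k * u))).
  + apply Rmult_le_compat; [left; apply exp_pos|apply Rabs_pos| |].
    * apply exp_le_Rpower; [lra|apply Rmult_lt_0_compat; auto; apply exp_pos].
    * specialize (Hw u). rewrite (Rabs_pos_eq u) in Hw by auto. auto.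
  + apply Req_le. rewrite <- Rpower_mult_distr by (auto; apply exp_pos).
    replace (Rpower (exp u) (- (k + 1))) with (exp (- ((k + 1) * u))) by (unfold Rpower; rewrite ln_exp; f_equal; ring).
    replace (- (1 * u)) with (- ((k + 1) * u) + k * u) by ring. rewrite exp_plus. ring.
Qed.

(** As u tends to minus infinity the factor exp(-q e^u) tends to 1, so the decay has to come from
    the weight. *)
Definition wneg (w : R -> R) (C e : R) : Prop := contR w /\ 0 < e /\ forall u, 0 <= u -> Rabs (w (- u)) <= C * exp (- (e * u)).

Lemma nice_neg q w C e : 0 < q -> wneg w C e -> nice (fun u => exp (- (q * exp (- u))) * w (- u)).
Proof.
intros Hq [Hc [He Hw]]. apply nice_le with C e; auto.
- apply contR_mult.
  + intros u. apply (ex_derive_continuous (fun u => exp (- (q * exp (- u)))) u). auto_derive; auto.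
  + apply (contR_comp w); auto. intros u. apply (ex_derive_continuous Ropp u). auto_derive; auto.
- intros u Hu. rewrite Rabs_mult, Rabs_pos_eq by (left; apply exp_pos). specialize (Hw u Hu).
  rewrite <- (Rmult_1_l (C * _)). apply Rmult_le_compat; auto using Rabs_pos; [left; apply exp_pos|].
  rewrite <- exp_0. apply exp_le. assert (0 < q * exp (- u)) by (apply Rmult_lt_0_compat; auto; apply exp_pos). lra.
Qed.

Definition line_int (f : R -> R) : R := II f + II (fun u => f (- u)).

Definition nice2 (f : R -> R) : Prop := nice f /\ nice (fun u => f (- u)).

Lemma line_int_plus f g : nice2 f -> nice2 g -> line_int (fun u => f u + g u) = line_int f + line_int g.
Proof. intros [H1 H2] [H3 H4]. unfold line_int. rewrite II_plus, (II_plus (fun u => f (- u)) (fun u => g (- u))); auto. ring. Qed.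

Lemma line_int_scal c f : nice2 f -> line_int (fun u => c * f u) = c * line_int f.
Proof. intros [H1 H2]. unfold line_int. rewrite II_scal, (II_scal c (fun u => f (- u))); auto. ring. Qed.

Lemma nice2_plus f g : nice2 f -> nice2 g -> nice2 (fun u => f u + g u).
Proof. intros [H1 H2] [H3 H4]. split; [apply nice_plus; auto|apply (nice_plus (fun u => f (- u)) (fun u => g (- u))); auto]. Qed.

Lemma nice2_scal c f : nice2 f -> nice2 (fun u => c * f u).
Proof. intros [H1 H2]. split; [apply nice_scal; auto|apply (nice_scal c (fun u => f (- u))); auto]. Qed.

Lemma line_int_ext f g : (forall u, f u = g u) -> line_int f = line_int g.
Proof. intros E. unfold line_int. rewrite (II_ext f g E), (II_ext (fun u => f (- u)) (fun u => g (- u))); auto. Qed.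

Lemma II_ge0 f : nice f -> (forall u, 0 <= u -> 0 <= f u) -> 0 <= II f.
Proof.
intros Hn Hf. apply Rnot_lt_le. intros Hlt. destruct (nice_II f Hn (- II f / 2)) as [b0 Hb]; [lra|].
specialize (Hb (Rmax 0 b0) (Rmax_r _ _)). pose proof (Rmax_l 0 b0).
assert (0 <= RInt f 0 (Rmax 0 b0)).
{ apply Rle_trans with (RInt (fun _ => 0) 0 (Rmax 0 b0)); [rewrite RIconst; lra|].
  apply RIle; auto; [apply contR_const|apply nice_cont; auto|]. intros; apply Hf; lra. }
apply Rabs_le_between in Hb. lra.
Qed.

Lemma line_int_abs f g : nice2 f -> nice2 g -> (forall u, Rabs (f u) <= g u) -> Rabs (line_int f) <= line_int g.
Proof.
intros Hf Hg H.
assert (Hge : forall h, nice2 h -> (forall u, 0 <= h u) -> 0 <= line_int h).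
{ intros h [H1 H2] H3. unfold line_int. apply Rplus_le_le_0_compat; apply II_ge0; auto. }
assert (Hb : forall u, - g u <= f u <= g u) by (intros u; apply Rabs_le_between; auto).
apply Rabs_le; split.
- assert (E : 0 <= line_int (fun u => g u + f u)).
  { apply Hge; [apply nice2_plus; auto|]. intros u; specialize (Hb u); lra. }
  rewrite line_int_plus in E by auto. lra.
- assert (E : 0 <= line_int (fun u => g u + (-1) * f u)).
  { apply Hge; [apply nice2_plus; auto; apply nice2_scal; auto|]. intros u; specialize (Hb u); lra. }
  rewrite line_int_plus, line_int_scal in E; auto; [lra|apply nice2_scal; auto].
Qed.

(** The two half-line integrals change by opposite multiples of the integral from 0 to c. *)
Lemma line_int_shift f c : nice2 f -> line_int (fun u => f (u + c)) = line_int f.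
Proof.
intros [H1 H2]. assert (Hc := nice_cont f H1).
assert (Hcs : contR (fun u => f (u + c))).
{ apply (contR_comp f); auto. intros u. apply (ex_derive_continuous (fun u => u + c) u). auto_derive; auto. }
unfold line_int. rewrite (II_unique (fun u => f (u + c)) (II f - RInt f 0 c)), (II_unique (fun u => f (- u + c)) (II (fun u => f (- u)) + RInt f 0 c)); [ring| |].
- intros eps He. destruct (nice_II _ H2 eps He) as [b0 Hb]. exists (b0 + c). intros b Hbb.
  rewrite (RI_opp (fun u => f (u + c)) 0 b Hcs), RI_shift by auto.
  rewrite <- (RIChasles f (- b + c) 0) by auto.
  specialize (Hb (b - c) ltac:(lra)). rewrite RI_opp in Hb by auto. rewrite Ropp_0 in *. rewrite Rplus_0_l.
  replace (- (b - c)) with (- b + c) in Hb by ring.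
  replace (RInt f (- b + c) 0 + RInt f 0 c - (II (fun u => f (- u)) + RInt f 0 c)) with (RInt f (- b + c) 0 - II (fun u => f (- u))) by ring. auto.
- intros eps He. destruct (nice_II _ H1 eps He) as [b0 Hb]. exists (b0 - c). intros b Hbb.
  rewrite RI_shift by auto. rewrite Rplus_0_l. specialize (Hb (b + c) ltac:(lra)).
  rewrite <- (RIChasles f 0 c (b + c)) in Hb by auto.
  replace (RInt f c (b + c) - (II f - RInt f 0 c)) with (RInt f 0 c + RInt f c (b + c) - II f) by ring. auto.
Qed.

Lemma line_int_FTC (F f : R -> R) : (forall x, is_derive F x (f x)) -> contR f -> nice2 F -> line_int f = 0.
Proof.
intros Hd Hc [[C [e [_ [He H1]]]] [C' [e' [_ [He' H2]]]]]. unfold line_int. rewrite (II_FTC F f C e) by auto.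
rewrite (II_FTC (fun u => - F (- u)) (fun u => f (- u)) C' e'); auto.
- rewrite Ropp_0. ring.
- intros x. apply is_derive_ext_val with (- (-1 * f (- x))); [|ring].
  apply (is_derive_opp (fun u => F (- u))). apply (is_derive_comp F Ropp); auto. auto_derive; auto.
- apply (contR_comp f); auto. intros u. apply (ex_derive_continuous Ropp u). auto_derive; auto.
- intros u Hu. rewrite Rabs_Ropp. auto.
Qed.

Definition wgood (w : R -> R) : Prop := egrowthE w /\ exists C e, wneg w C e.

Definition gamma_weight (q : R) (w : R -> R) (u : R) : R := exp (- (q * exp u)) * w u.

Lemma wgood_nice2 q w : 0 < q -> wgood w -> nice2 (gamma_weight q w).
Proof.
intros Hq [H1 [C [e H2]]]. split; [apply nice_pos; auto|apply (nice_neg q w C e); auto].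
Qed.

Lemma wgood_ce s : 0 < Re s -> wgood (fun u => Re (ce s u)) /\ wgood (fun u => Im (ce s u)).
Proof.
intros Hs.
assert (Hb : forall u, 0 <= u -> Cnorm (ce s (- u)) <= 1 * exp (- (Re s * u))).
{ intros u _. rewrite Cnorm_ce, Rmult_1_l. apply Req_le. f_equal; ring. }
split.
- split; [exact (egrowthE_ceRe s)|]. exists 1, (Re s). split; [exact (proj1 (proj1 (egrowth_ce s)))|split; [exact Hs|]].
  intros u Hu. eapply Rle_trans; [exact (Re_le_Cnorm (ce s (- u)))|exact (Hb u Hu)].
- split; [exact (egrowthE_ceIm s)|]. exists 1, (Re s). split; [exact (proj1 (proj2 (egrowth_ce s)))|split; [exact Hs|]].
  intros u Hu. eapply Rle_trans; [exact (Im_le_Cnorm (ce s (- u)))|exact (Hb u Hu)].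
Qed.

(* With [t = e^u], this is the integral of [e^(-qt) t^(s-1) dt] over [t > 0]. *)
Definition gamma_int (q : R) (s : Cplx) : Cplx := mkC (line_int (gamma_weight q (fun u => Re (ce s u)))) (line_int (gamma_weight q (fun u => Im (ce s u)))).

Lemma ce_S s u : ce (Cadd s C1) u = Cmul (RtoC (exp u)) (ce s u).
Proof.
rewrite ce_plus. replace (ce C1 u) with (RtoC (exp u)); [ring|].
apply Ceq; rewrite ?ce_Re, ?ce_Im; simpl; rewrite Rmult_0_l, ?cos_0, ?sin_0, Rmult_1_l; ring.
Qed.

Lemma is_derive_gw q (w w1 : R -> R) u : is_derive w u (w1 u) ->
  is_derive (gamma_weight q w) u (gamma_weight q (fun u => w1 u - q * (exp u * w u)) u).
Proof.
intros H. unfold gamma_weight.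
apply is_derive_ext_val with ((- (q * exp u) * exp (- (q * exp u))) * w u + exp (- (q * exp u)) * w1 u); [|ring].
apply (is_derive_mult (fun u => exp (- (q * exp u))) w); auto. auto_derive; auto; ring.
Qed.

Lemma ce_Re_deriv s u : is_derive (fun u => Re (ce s u)) u (Re s * Re (ce s u) - Im s * Im (ce s u)).
Proof.
apply is_derive_ext with (fun u => exp (Re s * u) * cos (Im s * u)); [intros; rewrite ce_Re; auto|].
rewrite ce_Re, ce_Im. auto_derive; auto. ring.
Qed.

Lemma ce_Im_deriv s u : is_derive (fun u => Im (ce s u)) u (Re s * Im (ce s u) + Im s * Re (ce s u)).
Proof.
apply is_derive_ext with (fun u => exp (Re s * u) * sin (Im s * u)); [intros; rewrite ce_Im; auto|].
rewrite ce_Re, ce_Im. auto_derive; auto. ring.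
Qed.

(** The derivative of exp(-q e^u) w is exp(-q e^u)(w' - q e^u w), and its integral over the line is
    0. For w = e^(su) this is the functional equation of Gamma. *)
Lemma line_int_gw_parts q (w w1 ew : R -> R) : 0 < q -> wgood w -> wgood w1 -> wgood ew ->
  (forall u, is_derive w u (w1 u)) -> (forall u, ew u = exp u * w u) -> line_int (gamma_weight q w1) = q * line_int (gamma_weight q ew).
Proof.
intros Hq Hw Hw1 Hew Hd He.
assert (N1 := wgood_nice2 q _ Hq Hw). assert (N2 := wgood_nice2 q _ Hq Hw1). assert (N3 := wgood_nice2 q _ Hq Hew).
assert (E : line_int (fun u => gamma_weight q w1 u + (- q) * gamma_weight q ew u) = 0).
{ apply (line_int_FTC (gamma_weight q w)); auto.
  - intros u. apply is_derive_ext_val with (gamma_weight q (fun u => w1 u - q * (exp u * w u)) u); [apply is_derive_gw; auto|].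
    unfold gamma_weight. rewrite He. ring.
  - apply contR_plus; [apply nice_cont; apply N2|]. apply contR_mult; [apply contR_const|apply nice_cont; apply N3]. }
rewrite line_int_plus, line_int_scal in E; auto; [lra|apply nice2_scal; auto].
Qed.

Lemma wgood_plus w1 w2 : wgood w1 -> wgood w2 -> wgood (fun u => w1 u + w2 u).
Proof.
intros [H1 [C [e [Hc [He H]]]]] [H2 [C' [e' [Hc' [He' H']]]]]. split; [apply egrowthE_plus; auto|].
exists (Rabs C + Rabs C'), (Rmin e e'). split; [apply contR_plus; auto|]. split; [apply Rmin_pos; auto|].
intros u Hu. eapply Rle_trans; [apply Rabs_triang|]. rewrite Rmult_plus_distr_r.
assert (Rmin e e' <= e) by apply Rmin_l. assert (Rmin e e' <= e') by apply Rmin_r.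
apply Rplus_le_compat; (eapply Rle_trans; [apply H || apply H'; auto|]).
- apply Rle_trans with (Rabs C * exp (- (e * u))); [apply Rmult_le_compat_r; [left; apply exp_pos|apply Rle_abs]|].
  apply Rmult_le_compat_l; [apply Rabs_pos|apply exp_le; nra].
- apply Rle_trans with (Rabs C' * exp (- (e' * u))); [apply Rmult_le_compat_r; [left; apply exp_pos|apply Rle_abs]|].
  apply Rmult_le_compat_l; [apply Rabs_pos|apply exp_le; nra].
Qed.

Lemma wgood_scal c w : wgood w -> wgood (fun u => c * w u).
Proof.
intros [H1 [C [e [Hc [He H]]]]]. split; [apply egrowthE_scal; auto|].
exists (Rabs c * C), e. split; [apply contR_mult; auto; apply contR_const|]. split; auto.
intros u Hu. rewrite Rabs_mult, Rmult_assoc. apply Rmult_le_compat_l; [apply Rabs_pos|auto].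
Qed.

Lemma wgood_ext w1 w2 : (forall u, w1 u = w2 u) -> wgood w1 -> wgood w2.
Proof.
intros E. assert (w1 = w2) by (apply FunctionalExtensionality.functional_extensionality; auto). subst; auto.
Qed.

Lemma line_int_gw_plus q w1 w2 : 0 < q -> wgood w1 -> wgood w2 -> line_int (gamma_weight q (fun u => w1 u + w2 u)) = line_int (gamma_weight q w1) + line_int (gamma_weight q w2).
Proof.
intros Hq H1 H2. rewrite <- line_int_plus by (apply wgood_nice2; auto). apply line_int_ext. intros; unfold gamma_weight; ring.
Qed.

Lemma line_int_gw_scal q c w : 0 < q -> wgood w -> line_int (gamma_weight q (fun u => c * w u)) = c * line_int (gamma_weight q w).
Proof.
intros Hq H. rewrite <- line_int_scal by (apply wgood_nice2; auto). apply line_int_ext. intros; unfold gamma_weight; ring.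
Qed.

Lemma gamma_int_rec q s : 0 < q -> 0 < Re s -> Cmul s (gamma_int q s) = Cmul (RtoC q) (gamma_int q (Cadd s C1)).
Proof.
intros Hq Hs. destruct (wgood_ce s Hs) as [G1 G2].
assert (Hs1 : 0 < Re (Cadd s C1)) by (simpl; lra). destruct (wgood_ce _ Hs1) as [G3 G4].
apply Ceq.
- assert (E : line_int (gamma_weight q (fun u => Re s * Re (ce s u) + (- Im s) * Im (ce s u))) = q * line_int (gamma_weight q (fun u => Re (ce (Cadd s C1) u)))).
  { apply (line_int_gw_parts q (fun u => Re (ce s u))); auto.
    - apply wgood_plus; apply wgood_scal; auto.
    - intros u. apply is_derive_ext_val with (Re s * Re (ce s u) - Im s * Im (ce s u)); [exact (ce_Re_deriv s u)|ring].
    - intros u. rewrite ce_S. simpl. ring. }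
  rewrite line_int_gw_plus, !line_int_gw_scal in E; auto using wgood_scal.
  change (Re s * line_int (gamma_weight q (fun u => Re (ce s u))) - Im s * line_int (gamma_weight q (fun u => Im (ce s u))) =
    q * line_int (gamma_weight q (fun u => Re (ce (Cadd s C1) u))) - 0 * line_int (gamma_weight q (fun u => Im (ce (Cadd s C1) u)))). lra.
- assert (E : line_int (gamma_weight q (fun u => Re s * Im (ce s u) + Im s * Re (ce s u))) = q * line_int (gamma_weight q (fun u => Im (ce (Cadd s C1) u)))).
  { apply (line_int_gw_parts q (fun u => Im (ce s u))); auto.
    - apply wgood_plus; apply wgood_scal; auto.
    - exact (ce_Im_deriv s).
    - intros u. rewrite ce_S. simpl. ring. }
  rewrite line_int_gw_plus, !line_int_gw_scal in E; auto using wgood_scal.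
  change (Re s * line_int (gamma_weight q (fun u => Im (ce s u))) + Im s * line_int (gamma_weight q (fun u => Re (ce s u))) =
    q * line_int (gamma_weight q (fun u => Im (ce (Cadd s C1) u))) + 0 * line_int (gamma_weight q (fun u => Re (ce (Cadd s C1) u)))). lra.
Qed.

(** Translation of u by ln q turns q e^u into e^u and multiplies e^(su) by a constant. *)
Lemma gamma_int_scale q s : 0 < q -> 0 < Re s -> gamma_int q s = Cmul (ce s (- ln q)) (gamma_int 1 s).
Proof.
intros Hq Hs. destruct (wgood_ce s Hs) as [G1 G2].
assert (H1 : 0 < 1) by lra.
assert (Hsh : forall w, wgood w -> line_int (gamma_weight q (fun u => w (u + ln q))) = line_int (gamma_weight 1 w)).
{ intros w Hw. rewrite <- (line_int_shift (gamma_weight 1 w) (ln q)) by (apply wgood_nice2; auto).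
  apply line_int_ext. intros u. unfold gamma_weight. rewrite exp_plus, exp_ln, Rmult_1_l, (Rmult_comm q); auto. }
assert (Ece : forall u, ce s u = Cmul (ce s (- ln q)) (ce s (u + ln q))).
{ intros u. rewrite <- ce_add. f_equal. ring. }
set (c := ce s (- ln q)) in *.
apply Ceq.
- change (line_int (gamma_weight q (fun u => Re (ce s u))) = Re c * line_int (gamma_weight 1 (fun u => Re (ce s u))) - Im c * line_int (gamma_weight 1 (fun u => Im (ce s u)))).
  rewrite (line_int_ext (gamma_weight q (fun u => Re (ce s u))) (gamma_weight q (fun u => (fun v => Re c * Re (ce s v) + (- Im c) * Im (ce s v)) (u + ln q)))).
  + rewrite (Hsh (fun v => Re c * Re (ce s v) + (- Im c) * Im (ce s v))) by (apply wgood_plus; apply wgood_scal; auto).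
    rewrite line_int_gw_plus, !line_int_gw_scal; auto using wgood_scal. ring.
  + intros u. unfold gamma_weight. rewrite (Ece u). simpl. ring.
- change (line_int (gamma_weight q (fun u => Im (ce s u))) = Re c * line_int (gamma_weight 1 (fun u => Im (ce s u))) + Im c * line_int (gamma_weight 1 (fun u => Re (ce s u)))).
  rewrite (line_int_ext (gamma_weight q (fun u => Im (ce s u))) (gamma_weight q (fun u => (fun v => Re c * Im (ce s v) + Im c * Re (ce s v)) (u + ln q)))).
  + rewrite (Hsh (fun v => Re c * Im (ce s v) + Im c * Re (ce s v))) by (apply wgood_plus; apply wgood_scal; auto).
    rewrite line_int_gw_plus, !line_int_gw_scal; auto using wgood_scal.
  + intros u. unfold gamma_weight. rewrite (Ece u). simpl. ring.
Qed.

(** Euler's integral for Gamma(a) at a real argument a > 0. *)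
Definition mom (a : R) : R := line_int (gamma_weight 1 (fun u => exp (a * u))).

Lemma wgood_exp a : 0 < a -> wgood (fun u => exp (a * u)).
Proof.
intros Ha. apply wgood_ext with (fun u => Re (ce (RtoC a) u)); [|exact (proj1 (wgood_ce (RtoC a) Ha))].
intros u. rewrite ce_Re. simpl. rewrite Rmult_0_l, cos_0. ring.
Qed.

Lemma mom_rec a : 0 < a -> mom (a + 1) = a * mom a.
Proof.
intros Ha. assert (H1 : 0 < 1) by lra. unfold mom. rewrite <- line_int_gw_scal by (auto; apply wgood_exp; auto).
rewrite (line_int_gw_parts 1 (fun u => exp (a * u)) (fun u => a * exp (a * u)) (fun u => exp ((a + 1) * u))); auto.
- ring.
- apply wgood_exp; auto.
- apply wgood_scal, wgood_exp; auto.
- apply wgood_exp; lra.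
- intros u. auto_derive; auto; ring.
- intros u. rewrite <- exp_plus. f_equal; ring.
Qed.

Lemma mom_1 : mom 1 = 1.
Proof.
unfold mom, line_int.
rewrite (II_FTC (fun u => - exp (- (1 * exp u))) (gamma_weight 1 (fun u => exp (1 * u))) 1 1).
- rewrite (II_FTC (fun u => exp (- (1 * exp (- u))) - 1) (fun u => gamma_weight 1 (fun u => exp (1 * u)) (- u)) 1 1).
  + rewrite Ropp_0. ring.
  + intros u. unfold gamma_weight. auto_derive; auto. rewrite !Rmult_1_l. ring.
  + apply (contR_comp (gamma_weight 1 (fun u => exp (1 * u)))).
    * apply (nice_cont _ (proj1 (wgood_nice2 1 _ Rlt_0_1 (wgood_exp 1 Rlt_0_1)))).
    * intros u. apply (ex_derive_continuous Ropp u). auto_derive; auto.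
  + lra.
  + intros u Hu. rewrite !Rmult_1_l. pose proof (exp_ineq1_le (- exp (- u))). pose proof (exp_pos (- u)).
    assert (exp (- exp (- u)) <= 1) by (rewrite <- exp_0; apply exp_le; lra). apply Rabs_le. lra.
- intros u. unfold gamma_weight. auto_derive; auto. rewrite !Rmult_1_l. ring.
- apply (nice_cont _ (proj1 (wgood_nice2 1 _ Rlt_0_1 (wgood_exp 1 Rlt_0_1)))).
- lra.
- intros u Hu. rewrite Rabs_Ropp, Rabs_pos_eq by (left; apply exp_pos). rewrite !Rmult_1_l. apply exp_le.
  pose proof (exp_ineq1_le u). lra.
Qed.

Lemma mom_fact n : mom (INR n + 1) = INR (fact n).
Proof.
induction n; [simpl; rewrite Rplus_0_l; apply mom_1|].
rewrite mom_rec by (rewrite S_INR; pose proof (pos_INR n); lra).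
rewrite S_INR, IHn, fact_simpl, mult_INR, S_INR. auto.
Qed.

Lemma gamma_int_prod s n : 0 < Re s -> Cmul (Cprod (fun j => Cadd s (RtoC (INR j))) n) (gamma_int 1 s) = gamma_int 1 (Cadd s (RtoC (INR n))).
Proof.
intros Hs. induction n.
- simpl Cprod. replace (Cadd s (RtoC (INR 0))) with s by (apply Ceq; simpl; ring). ring.
- simpl Cprod. transitivity (Cmul (Cadd s (RtoC (INR n))) (Cmul (Cprod (fun j => Cadd s (RtoC (INR j))) n) (gamma_int 1 s))); [ring|].
  rewrite IHn, gamma_int_rec; [|lra|simpl; pose proof (pos_INR n); lra].
  replace (Cadd s (RtoC (INR (S n)))) with (Cadd (Cadd s (RtoC (INR n))) C1) by (apply Ceq; rewrite ?S_INR; simpl; try ring; rewrite S_INR || idtac; ring).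
  change (RtoC 1) with C1. ring.
Qed.

Lemma gamma_int_mul q s c : 0 < q -> 0 < Re s ->
  Re (Cmul c (gamma_int q s)) = line_int (gamma_weight q (fun u => Re (Cmul c (ce s u)))) /\ Im (Cmul c (gamma_int q s)) = line_int (gamma_weight q (fun u => Im (Cmul c (ce s u)))).
Proof.
intros Hq Hs. destruct (wgood_ce s Hs) as [G1 G2]. split.
- change (Re c * line_int (gamma_weight q (fun u => Re (ce s u))) - Im c * line_int (gamma_weight q (fun u => Im (ce s u))) =
    line_int (gamma_weight q (fun u => Re c * Re (ce s u) - Im c * Im (ce s u)))).
  rewrite (line_int_ext (gamma_weight q (fun u => Re c * Re (ce s u) - Im c * Im (ce s u))) (gamma_weight q (fun u => Re c * Re (ce s u) + (- Im c) * Im (ce s u)))) by (intros; unfold gamma_weight; ring).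
  rewrite line_int_gw_plus by auto using wgood_scal. rewrite (line_int_gw_scal q (Re c)) by auto. rewrite (line_int_gw_scal q (- Im c)) by auto. ring.
- change (Re c * line_int (gamma_weight q (fun u => Im (ce s u))) + Im c * line_int (gamma_weight q (fun u => Re (ce s u))) =
    line_int (gamma_weight q (fun u => Re c * Im (ce s u) + Im c * Re (ce s u)))).
  rewrite line_int_gw_plus by auto using wgood_scal. rewrite (line_int_gw_scal q (Re c)) by auto. rewrite (line_int_gw_scal q (Im c)) by auto. ring.
Qed.

(** Continuity near v = 0 and crude growth elsewhere, in a form whose right side is a combination of
    exponentials e^(kv). Integrated against the Gamma density these are moments given by the
    recursion [mom_rec]. *)
Lemma ce_near s N : 0 < Re s <= INR N -> forall eps, 0 < eps -> exists C, 0 <= C /\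
  forall v, Cnorm (Csub (ce s v) C1) <= eps + C * ((exp v - 1) ^ 2 * (2 + exp (INR N * v))).
Proof.
intros Hs eps He.
assert (CR : continuity_pt (fun v => Re (ce s v)) 0) by (apply continuity_pt_filterlim; exact (proj1 (proj1 (egrowth_ce s)) 0)).
assert (CI : continuity_pt (fun v => Im (ce s v)) 0) by (apply continuity_pt_filterlim; exact (proj1 (proj2 (egrowth_ce s)) 0)).
destruct (CR (eps / 2)) as [d1 [Hd1 H1]]; [lra|]. destruct (CI (eps / 2)) as [d2 [Hd2 H2]]; [lra|].
set (d := Rmin d1 d2). assert (Hd : 0 < d) by (apply Rmin_pos; auto).
(* A lower bound for |e^v - 1| once |v| >= d, hence the factor 1/k^2. *)
set (k := Rmin (exp d - 1) (1 - exp (- d))).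
assert (Hk : 0 < k).
{ apply Rmin_pos; [pose proof (exp_increasing 0 d Hd) as H; rewrite exp_0 in H; lra|].
  assert (H : exp (- d) < exp 0) by (apply exp_increasing; lra). rewrite exp_0 in H. lra. }
exists (/ k ^ 2). split; [left; apply Rinv_0_lt_compat, pow_lt; auto|]. intros v.
assert (Hnn : 0 <= / k ^ 2 * ((exp v - 1) ^ 2 * (2 + exp (INR N * v)))).
{ apply Rmult_le_pos; [left; apply Rinv_0_lt_compat, pow_lt; auto|]. apply Rmult_le_pos; [apply pow2_ge_0|]. pose proof (exp_pos (INR N * v)); lra. }
destruct (Rlt_dec (Rabs v) d) as [Hv|Hv].
- destruct (Req_dec v 0) as [->|Hv0].
  + rewrite ce_0. replace (Csub C1 C1) with (RtoC 0) by (apply Ceq; simpl; ring). rewrite Cnorm_RtoC, Rabs_R0. lra.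
  + assert (Hx : D_x no_cond 0 v /\ Rabs (v - 0) < d1).
    { split; [split; [exact I|auto]|]. rewrite Rminus_0_r. eapply Rlt_le_trans; [apply Hv|apply Rmin_l]. }
    assert (Hy : D_x no_cond 0 v /\ Rabs (v - 0) < d2).
    { split; [split; [exact I|auto]|]. rewrite Rminus_0_r. eapply Rlt_le_trans; [apply Hv|apply Rmin_r]. }
    specialize (H1 v Hx). specialize (H2 v Hy). change (Rabs (Re (ce s v) - Re (ce s 0)) < eps / 2) in H1. change (Rabs (Im (ce s v) - Im (ce s 0)) < eps / 2) in H2. rewrite ce_0 in H1, H2.
    eapply Rle_trans; [apply Cnorm_le_sum|].
    change (Rabs (Re (ce s v) - Re C1) + Rabs (Im (ce s v) - Im C1) <= eps + / k ^ 2 * ((exp v - 1) ^ 2 * (2 + exp (INR N * v)))). lra.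
- assert (Hbig : Cnorm (Csub (ce s v) C1) <= 2 + exp (INR N * v)).
  { unfold Csub. eapply Rle_trans; [apply Cnorm_triang|]. rewrite Cnorm_opp, Cnorm_ce. change C1 with (RtoC 1). rewrite Cnorm_RtoC, Rabs_R1.
    destruct (Rle_dec 0 v) as [Hv0|Hv0].
    - assert (exp (Re s * v) <= exp (INR N * v)) by (apply exp_le; nra). lra.
    - assert (exp (Re s * v) <= exp 0) by (apply exp_le; nra). rewrite exp_0 in H. pose proof (exp_pos (INR N * v)). lra. }
  assert (Hx2 : k ^ 2 <= (exp v - 1) ^ 2).
  { rewrite <- (pow2_abs (exp v - 1)). apply pow_incr. split; [lra|].
    unfold Rabs in Hv. destruct Rcase_abs.
    - apply Rle_trans with (1 - exp (- d)); [apply Rmin_r|]. assert (exp v <= exp (- d)) by (apply exp_le; lra).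
      rewrite Rabs_minus_sym. eapply Rle_trans; [|apply Rle_abs]. lra.
    - apply Rle_trans with (exp d - 1); [apply Rmin_l|]. assert (exp d <= exp v) by (apply exp_le; lra).
      eapply Rle_trans; [|apply Rle_abs]. lra. }
  assert (Hp : 0 < k ^ 2) by (apply pow_lt; auto). pose proof (exp_pos (INR N * v)).
  assert (2 + exp (INR N * v) <= / k ^ 2 * ((exp v - 1) ^ 2 * (2 + exp (INR N * v)))); [|lra].
  apply Rmult_le_reg_l with (k ^ 2); auto. rewrite <- Rmult_assoc, Rinv_r, Rmult_1_l by lra. apply Rmult_le_compat_r; lra.
Qed.

(** The k-th moment of t/n under the probability density t^n e^(-t) / n!. That all these moments
    tend to 1 expresses the concentration at t = n. *)
Definition muk (k n : nat) : R := mom (INR n + 1 + INR k) * exp (- (INR k * ln (INR n))) / INR (fact n).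

Lemma muk_lim k : is_lim_seq (muk k) 1.
Proof.
induction k.
- apply is_lim_seq_ext with (fun _ => 1); [|apply is_lim_seq_const].
  intros n. unfold muk. simpl INR. rewrite Rplus_0_r, Rmult_0_l, Ropp_0, exp_0, mom_fact. field. apply INR_fact_neq_0.
- apply is_lim_seq_ext_loc with (fun n => muk k n * (1 + (INR k + 1) * / INR n)).
  + exists 1%nat. intros n Hn. assert (Hn0 : 0 < INR n) by (apply lt_0_INR; lia). unfold muk.
    rewrite (S_INR k), <- Rplus_assoc, mom_rec by (pose proof (pos_INR k); lra).
    replace (- ((INR k + 1) * ln (INR n))) with (- (INR k * ln (INR n)) + - ln (INR n)) by ring.
    rewrite exp_plus, (exp_Ropp (ln (INR n))), exp_ln by auto. field. split; [lra|apply INR_fact_neq_0].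
  + replace (Finite 1) with (Rbar_mult 1 (1 + (INR k + 1) * 0)) by (simpl; f_equal; ring).
    apply is_lim_seq_mult with (1 : Rbar) (Finite (1 + (INR k + 1) * 0)); [auto| |simpl; auto].
    * apply is_lim_seq_plus'; [apply is_lim_seq_const|]. apply is_lim_seq_mult'; [apply is_lim_seq_const|].
      replace (Finite 0) with (Rbar_inv p_infty) by auto. apply is_lim_seq_inv; [apply is_lim_seq_INR|discriminate].
    * exact I || (unfold is_Rbar_mult; simpl; f_equal; f_equal; ring).
Qed.

Lemma line_int_gw_abs q w1 w2 : 0 < q -> wgood w1 -> wgood w2 -> (forall u, Rabs (w1 u) <= w2 u) -> Rabs (line_int (gamma_weight q w1)) <= line_int (gamma_weight q w2).
Proof.
intros Hq H1 H2 H. apply line_int_abs; auto using wgood_nice2. intros u. unfold gamma_weight. rewrite Rabs_mult, Rabs_pos_eq by (left; apply exp_pos).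
apply Rmult_le_compat_l; [left; apply exp_pos|auto].
Qed.

(** The expectation of eps + C (T - 1)^2 (2 + T^N) with T = t/n, expanded in moments. When all
    moments tend to 1 the bracket tends to 0 and eps is left. *)
Definition gerr (C eps : R) (N n : nat) : R :=
  eps + C * (2 * muk 2 n - 4 * muk 1 n + 2 + muk (N + 2) n - 2 * muk (N + 1) n + muk N n).

(** n^(-s) Gamma(s + n + 1) / n! is the mean of (t/n)^s, whose distance from 1 is controlled
    pointwise by [ce_near]. The factor 2 comes from treating real and imaginary parts separately. *)
Lemma gamma_err s N C eps n : 0 < Re s -> (1 <= n)%nat -> 
  (forall v, Cnorm (Csub (ce s v) C1) <= eps + C * ((exp v - 1) ^ 2 * (2 + exp (INR N * v)))) ->
  Cnorm (Csub (Cmul (ce s (- ln (INR n))) (gamma_int 1 (Cadd s (RtoC (INR (S n)))))) (RtoC (INR (fact n)))) <= 2 * (INR (fact n) * gerr C eps N n).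
Proof.
intros Hs Hn Hb. assert (Hn0 : 0 < INR n) by (apply lt_0_INR; lia). set (L := ln (INR n)).
set (s' := Cadd s (RtoC (INR (S n)))).
assert (H01 : 0 < 1) by lra.
assert (Hs' : 0 < Re s') by (change (0 < Re s + INR (S n)); pose proof (pos_INR (S n)); lra).
set (wk := fun (k : nat) u => exp (- (INR k * L)) * exp ((INR n + 1 + INR k) * u)).
assert (Gk : forall k, wgood (wk k)).
{ intros k. apply wgood_scal, wgood_exp. pose proof (pos_INR k); lra. }
set (W := fun u => eps * wk 0%nat u + C * (2 * wk 2%nat u + ((-4) * wk 1%nat u + (2 * wk 0%nat u + (wk (N + 2)%nat u + ((-2) * wk (N + 1)%nat u + wk N u)))))).
assert (GW : wgood W).
{ apply wgood_plus; [apply wgood_scal; auto|]. apply wgood_scal.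
  apply wgood_plus; [apply wgood_scal; auto|]. apply wgood_plus; [apply wgood_scal; auto|]. apply wgood_plus; [apply wgood_scal; auto|].
  apply wgood_plus; auto. apply wgood_plus; [apply wgood_scal; auto|auto]. }
assert (Ek : forall k, line_int (gamma_weight 1 (wk k)) = INR (fact n) * muk k n).
{ intros k. unfold wk. rewrite line_int_gw_scal by (auto; apply wgood_exp; pose proof (pos_INR k); lra). fold (mom (INR n + 1 + INR k)).
  unfold muk. fold L. field. apply INR_fact_neq_0. }
assert (EW : line_int (gamma_weight 1 W) = INR (fact n) * gerr C eps N n).
{ unfold W. rewrite line_int_gw_plus, line_int_gw_scal; auto using wgood_scal.
  2: { apply wgood_scal. apply wgood_plus; [apply wgood_scal; auto|]. apply wgood_plus; [apply wgood_scal; auto|]. apply wgood_plus; [apply wgood_scal; auto|].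
       apply wgood_plus; auto. apply wgood_plus; [apply wgood_scal; auto|auto]. }
  assert (G5 : wgood (fun u => (-2) * wk (N + 1)%nat u + wk N u)) by (apply wgood_plus; [apply wgood_scal; auto|auto]).
  assert (G4 : wgood (fun u => wk (N + 2)%nat u + ((-2) * wk (N + 1)%nat u + wk N u))) by (apply wgood_plus; auto).
  assert (G3 : wgood (fun u => 2 * wk 0%nat u + (wk (N + 2)%nat u + ((-2) * wk (N + 1)%nat u + wk N u)))) by (apply wgood_plus; [apply wgood_scal; auto|auto]).
  assert (G2 : wgood (fun u => (-4) * wk 1%nat u + (2 * wk 0%nat u + (wk (N + 2)%nat u + ((-2) * wk (N + 1)%nat u + wk N u))))) by (apply wgood_plus; [apply wgood_scal; auto|auto]).
  rewrite line_int_gw_scal by auto using wgood_plus, wgood_scal.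
  rewrite !line_int_gw_plus, !line_int_gw_scal; auto using wgood_scal. rewrite !Ek. unfold gerr.
  assert (E0 : muk 0 n = 1). { unfold muk. simpl INR. rewrite Rplus_0_r, Rmult_0_l, Ropp_0, exp_0, mom_fact. field. apply INR_fact_neq_0. }
  rewrite E0. ring. }
assert (Hpt : forall u, Cnorm (Csub (Cmul (ce s (- L)) (ce s' u)) (RtoC (exp ((INR n + 1) * u)))) <= W u).
{ intros u.
  replace (Csub (Cmul (ce s (- L)) (ce s' u)) (RtoC (exp ((INR n + 1) * u)))) with (Cmul (RtoC (exp ((INR n + 1) * u))) (Csub (ce s (u + - L)) C1)).
  - rewrite Cnorm_mul, Cnorm_RtoC, Rabs_pos_eq by (left; apply exp_pos).
    eapply Rle_trans; [apply Rmult_le_compat_l; [left; apply exp_pos|apply Hb]|].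
    apply Req_le. unfold W, wk. rewrite !plus_INR. simpl INR.
    assert (EN : exp (INR N * (u + - L)) = exp (INR N * u) * exp (- (INR N * L))) by (rewrite <- exp_plus; f_equal; ring).
    rewrite EN, (exp_plus u).
    replace (- (0 * L)) with 0 by ring. rewrite exp_0.
    replace ((INR n + 1 + 0) * u) with ((INR n + 1) * u) by ring.
    replace (- ((1 + 1) * L)) with (- L + - L) by ring. replace (- (1 * L)) with (- L) by ring.
    replace ((INR n + 1 + (1 + 1)) * u) with ((INR n + 1) * u + u + u) by ring.
    replace ((INR n + 1 + 1) * u) with ((INR n + 1) * u + u) by ring.
    replace (- ((INR N + (1 + 1)) * L)) with (- (INR N * L) + - L + - L) by ring.
    replace (- ((INR N + 1) * L)) with (- (INR N * L) + - L) by ring.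
    replace ((INR n + 1 + (INR N + (1 + 1))) * u) with ((INR n + 1) * u + INR N * u + u + u) by ring.
    replace ((INR n + 1 + (INR N + 1)) * u) with ((INR n + 1) * u + INR N * u + u) by ring.
    replace ((INR n + 1 + INR N) * u) with ((INR n + 1) * u + INR N * u) by ring.
    rewrite !exp_plus. ring.
  - unfold s'. rewrite ce_plus, ce_add.
    replace (ce (RtoC (INR (S n))) u) with (RtoC (exp ((INR n + 1) * u))); [ring|].
    rewrite <- S_INR. apply Ceq; rewrite ?ce_Re, ?ce_Im; cbn [Re Im RtoC]; rewrite Rmult_0_l, ?cos_0, ?sin_0; ring. }
destruct (gamma_int_mul 1 s' (ce s (- L)) H01 Hs') as [ER EI].
assert (GE : wgood (fun u => (-1) * exp ((INR n + 1) * u))) by (apply wgood_scal, wgood_exp; lra).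
destruct (wgood_ce s' Hs') as [G1 G2].
assert (GR : wgood (fun u => Re (Cmul (ce s (- L)) (ce s' u)))).
{ apply wgood_ext with (fun u => Re (ce s (- L)) * Re (ce s' u) + (- Im (ce s (- L))) * Im (ce s' u)).
  - intros u. change (Re (ce s (- L)) * Re (ce s' u) + - Im (ce s (- L)) * Im (ce s' u) = Re (ce s (- L)) * Re (ce s' u) - Im (ce s (- L)) * Im (ce s' u)). ring.
  - apply wgood_plus; apply wgood_scal; auto. }
assert (GI : wgood (fun u => Im (Cmul (ce s (- L)) (ce s' u)))).
{ apply wgood_ext with (fun u => Re (ce s (- L)) * Im (ce s' u) + Im (ce s (- L)) * Re (ce s' u)).
  - intros u. reflexivity.
  - apply wgood_plus; apply wgood_scal; auto. }
assert (Efact : line_int (gamma_weight 1 (fun u => exp ((INR n + 1) * u))) = INR (fact n)) by (apply mom_fact).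
eapply Rle_trans; [apply Cnorm_le_sum|]. replace (2 * (INR (fact n) * gerr C eps N n)) with (line_int (gamma_weight 1 W) + line_int (gamma_weight 1 W)) by (rewrite EW; ring).
apply Rplus_le_compat.
- change (Rabs (Re (Cmul (ce s (- L)) (gamma_int 1 s')) - INR (fact n)) <= line_int (gamma_weight 1 W)). rewrite ER, <- Efact.
  replace (line_int (gamma_weight 1 (fun u => Re (Cmul (ce s (- L)) (ce s' u)))) - line_int (gamma_weight 1 (fun u => exp ((INR n + 1) * u)))) with
    (line_int (gamma_weight 1 (fun u => Re (Cmul (ce s (- L)) (ce s' u)) + (-1) * exp ((INR n + 1) * u)))).
  + apply line_int_gw_abs; auto; [apply wgood_plus; auto|]. intros u. eapply Rle_trans; [|apply Hpt]. eapply Rle_trans; [|apply Re_le_Cnorm].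
    apply Req_le. f_equal.
    change (Re (Cmul (ce s (- L)) (ce s' u)) + -1 * exp ((INR n + 1) * u) = Re (Cmul (ce s (- L)) (ce s' u)) - exp ((INR n + 1) * u)). ring.
  + rewrite line_int_gw_plus, (line_int_gw_scal 1 (-1)); auto; [ring|apply wgood_exp; lra].
- change (Rabs (Im (Cmul (ce s (- L)) (gamma_int 1 s')) - 0) <= line_int (gamma_weight 1 W)). rewrite Rminus_0_r, EI.
  apply line_int_gw_abs; auto. intros u. eapply Rle_trans; [|apply Hpt]. eapply Rle_trans; [|apply Im_le_Cnorm].
  apply Req_le. f_equal.
  change (Im (Cmul (ce s (- L)) (ce s' u)) = Im (Cmul (ce s (- L)) (ce s' u)) - 0). ring.
Qed.

Lemma gerr_lim C eps N : is_lim_seq (gerr C eps N) eps.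
Proof.
unfold gerr.
replace (Finite eps) with (Finite (eps + C * (2 * 1 - 4 * 1 + 2 + 1 - 2 * 1 + 1))) by (f_equal; ring).
apply is_lim_seq_plus'; [apply is_lim_seq_const|]. apply is_lim_seq_mult'; [apply is_lim_seq_const|].
apply is_lim_seq_plus'; [|apply muk_lim]. apply is_lim_seq_minus'; [|apply is_lim_seq_mult'; [apply is_lim_seq_const|apply muk_lim]].
apply is_lim_seq_plus'; [|apply muk_lim]. apply is_lim_seq_plus'; [|apply is_lim_seq_const].
apply is_lim_seq_minus'; apply is_lim_seq_mult'; try apply is_lim_seq_const; apply muk_lim.
Qed.

Lemma Cmul_eq0 z w : Cmul z w = C0 -> z = C0 \/ w = C0.
Proof.
intros H. destruct (classic (z = C0)) as [|Hz]; auto. right.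
transitivity (Cmul (Cinv z) (Cmul z w)); [field; auto|rewrite H; ring].
Qed.

Lemma Cprod_neq0 s n : 0 < Re s -> Cprod (fun j => Cadd s (RtoC (INR j))) n <> C0.
Proof.
intros Hs. induction n.
- simpl. intros H. apply (f_equal Re) in H. simpl in H. lra.
- simpl Cprod. intros H. apply Cmul_eq0 in H as [H|H]; auto.
  apply (f_equal Re) in H. change (Re s + INR n = 0) in H. pose proof (pos_INR n). lra.
Qed.

(** Gauss's quotient a and Euler's integral t satisfy t = a (1 + D/F), and D/F is small by
    [gamma_err]. *)
Lemma Gamma_val_gamma_int s : 0 < Re s -> Gamma_val s (gamma_int 1 s).
Proof.
intros Hs eps Heps. set (t := gamma_int 1 s).
destruct (INR_unbounded (Re s)) as [N HN].
(* eta <= 1/8 gives |D/F| <= 4 eta <= 1/2, whence |a| <= 2 |t|; the second entry makes the final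
   bound 8 |t| eta smaller than eps. *)
set (eta := Rmin (/ 8) (eps / (8 * (Cnorm t + 1)))).
pose proof (Cnorm_ge0 t) as Ht.
assert (Heta : 0 < eta) by (apply Rmin_pos; [lra|apply Rdiv_lt_0_compat; lra]).
destruct (ce_near s N ltac:(lra) eta Heta) as [C [HC Hb]].
assert (Hl := gerr_lim C eta N). apply is_lim_seq_spec in Hl. destruct (Hl (mkposreal eta Heta)) as [N0 HN0]. simpl in HN0.
exists (max 1 N0). intros n Hn.
specialize (HN0 n ltac:(lia)). apply Rabs_def2 in HN0.
assert (Hn1 : (1 <= n)%nat) by lia.
assert (Hn0 : 0 < INR n) by (apply lt_0_INR; lia).
pose proof (gamma_err s N C eta n Hs Hn1 Hb) as HE.
assert (Hf : 0 < INR (fact n)) by apply INR_fact_lt_0.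
set (P := Cprod (fun j => Cadd s (RtoC (INR j))) (S n)).
assert (HP : P <> C0) by (apply Cprod_neq0; auto).
assert (EP : Cmul P t = gamma_int 1 (Cadd s (RtoC (INR (S n))))) by (apply gamma_int_prod; auto).
set (c := ce s (ln (INR n))). set (c' := ce s (- ln (INR n))) in *.
assert (Ecc : Cmul c c' = C1).
{ unfold c, c'. rewrite <- ce_add, Rplus_opp_r. apply ce_0. }
rewrite <- EP in HE. set (F := RtoC (INR (fact n))) in *.
change (Rcpow (INR n) s) with c.
assert (HF : F <> C0). { intros H. apply (f_equal Re) in H. change (INR (fact n) = 0) in H. lra. }
set (D := Csub (Cmul c' (Cmul P t)) F) in *.
set (a := Cdiv (Cmul c F) P).
assert (HFn : Cnorm F = INR (fact n)) by (unfold F; rewrite Cnorm_RtoC, Rabs_pos_eq; lra).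
assert (E1 : t = Cadd a (Cmul a (Cdiv D F))).
{ transitivity (Cdiv (Cmul c (Cadd F D)) P); [|unfold a; field; split; auto].
  unfold D. transitivity (Cdiv (Cmul (Cmul c c') (Cmul P t)) P); [rewrite Ecc; field; auto|field; auto]. }
assert (HDF : Cnorm (Cdiv D F) <= 4 * eta).
{ assert (E : Cmul F (Cdiv D F) = D) by (field; auto). apply (f_equal Cnorm) in E. rewrite Cnorm_mul, HFn in E.
  apply Rmult_le_reg_l with (INR (fact n)); auto. rewrite E. eapply Rle_trans; [apply HE|].
  assert (INR (fact n) * gerr C eta N n <= INR (fact n) * (2 * eta)) by (apply Rmult_le_compat_l; lra). lra. }
assert (Heta8 : eta <= / 8) by apply Rmin_l.
assert (Ha : Cnorm a <= 2 * Cnorm t).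
{ assert (E2 : a = Cadd t (Copp (Cmul a (Cdiv D F)))) by (rewrite E1 at 1; ring).
  assert (Hle : Cnorm a <= Cnorm t + Cnorm a * Cnorm (Cdiv D F)).
  { rewrite E2 at 1. eapply Rle_trans; [apply Cnorm_triang|]. rewrite Cnorm_opp, Cnorm_mul. lra. }
  pose proof (Cnorm_ge0 a). assert (Cnorm a * Cnorm (Cdiv D F) <= Cnorm a * / 2) by (apply Rmult_le_compat_l; lra). lra. }
replace (Csub a t) with (Copp (Cmul a (Cdiv D F))) by (rewrite E1; ring).
rewrite Cnorm_opp, Cnorm_mul.
assert (He2 : eta <= eps / (8 * (Cnorm t + 1))) by apply Rmin_r.
apply Rle_lt_trans with (2 * Cnorm t * (4 * eta)).
- apply Rmult_le_compat; auto using Cnorm_ge0.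
- apply Rle_lt_trans with (8 * Cnorm t * (eps / (8 * (Cnorm t + 1)))).
  + replace (2 * Cnorm t * (4 * eta)) with (8 * Cnorm t * eta) by ring. apply Rmult_le_compat_l; lra.
  + apply Rmult_lt_reg_r with (Cnorm t + 1); [lra|].
    replace (8 * Cnorm t * (eps / (8 * (Cnorm t + 1))) * (Cnorm t + 1)) with (Cnorm t * eps) by (field; lra). nra.
Qed.

(** * Exchange of lattice sums with integrals of theta *)

Lemma usum_nz_theta_lat t x y : 0 < t -> 0 < y -> is_usum (fun v => nz v (exp (- (PI * t * Q x y v)))) (theta_lat t x y - 1).
Proof.
intros Ht Hy.
assert (H := is_usum_plus _ _ _ _ (is_usum_theta_lat t x y Ht Hy) (is_usum_scal (-1) _ _ is_usum_single)).
replace (theta_lat t x y - 1) with (theta_lat t x y + -1 * 1) by ring.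
apply is_usum_ext with (2 := H). intros v. unfold nz. destruct eq_dec_cl as [->|n]; [|ring].
rewrite Q_0, Rmult_0_r, Ropp_0, exp_0. ring.
Qed.

Lemma Qbound_pos x y t v A : 0 < t -> 0 < y -> 0 < A -> v <> (0, 0)%Z ->
  exp (- (PI * t * Q x y v)) <= Rpower A A * Rpower (Qc (Rabs x) (/ y) / y) (- A) * Rpower t (- A) * pw A v.
Proof.
intros Ht Hy HA Hv. apply exp_Q_le; auto; [lra|apply Rinv_0_lt_compat; auto|rewrite Rinv_inv; lra].
Qed.

Lemma exp_Rpower_opp A u : Rpower (exp u) (- A) = exp (- (A * u)).
Proof. unfold Rpower. rewrite ln_exp. f_equal; ring. Qed.

Lemma nz_abs_le v a M : 0 <= M -> (v <> (0, 0)%Z -> Rabs a <= M) -> Rabs (nz v a) <= M.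
Proof. intros HM H. unfold nz. destruct eq_dec_cl; [rewrite Rabs_R0; auto|auto]. Qed.

Lemma contR_nz v (f : R -> R) : contR f -> contR (fun u => nz v (f u)).
Proof. intros Hf. unfold nz. destruct eq_dec_cl; [apply contR_const|auto]. Qed.

Lemma II_nz v f : nz v (II f) = II (fun u => nz v (f u)).
Proof.
unfold nz. destruct eq_dec_cl; auto. symmetry. apply II_unique. intros eps He. exists 0. intros b Hb.
rewrite RIconst. replace ((b - 0) * 0 - 0) with 0 by ring. rewrite Rabs_R0; lra.
Qed.

Lemma usum_nz_scal t x y c : 0 < t -> 0 < y -> usum (fun v => nz v (exp (- (PI * t * Q x y v)) * c)) = (theta_lat t x y - 1) * c.
Proof.
intros Ht Hy. apply usum_unique. rewrite (Rmult_comm _ c).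
apply is_usum_ext with (2 := is_usum_scal c _ _ (usum_nz_theta_lat t x y Ht Hy)).
intros v. unfold nz. destruct eq_dec_cl; ring.
Qed.

(** Moves the lattice sum inside the integral, where the functional equation of theta can be
    applied. *)
Lemma Lam_as_II w x y : egrowthE w -> 0 < y ->
  nice (fun u => (theta_lat (exp u) x y - 1) * w u) /\ LamW w x y = II (fun u => (theta_lat (exp u) x y - 1) * w u).
Proof.
intros Hw Hy. destruct (cls_dd _ x y (cls_baseE w Hw) Hy) as [C [HC [Hc Hb]]].
destruct Hw as [D [k Hw]]. assert (HD := egrowth_C _ _ _ Hw). destruct Hw as [Hcw [Hk Hw]].
set (K := Rpower 2 2 * Rpower (Qc (Rabs x) (/ y) / y) (- (2))).
assert (HK : 0 < K) by (apply Rmult_lt_0_compat; apply exp_pos).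
destruct (usum_II (fun v u => nz v (base w v u x y)) (fun v => C * pw 2 v) (fun X v => (K * exp (2 * X) * (D * exp (k * X))) * pw 2 v) 1) as [H1 H2].
- intros v. apply contR_nz. apply Hc.
- lra.
- apply dom_scal; auto. apply dom_pw; lra.
- intros v u Hu. apply nz_abs_le; [|intros Hv; apply Hb; auto].
  apply Rmult_le_pos; [apply Rmult_le_pos; auto; left; apply pw_pos|left; apply exp_pos].
- intros X. apply dom_scal; [|apply dom_pw; lra].
  apply Rmult_le_pos; apply Rmult_le_pos; auto; try (left; apply exp_pos). lra.
- intros X v u Hu. pose proof (pw_pos 2 v). apply nz_abs_le.
  + apply Rmult_le_pos; [|lra]. apply Rmult_le_pos; apply Rmult_le_pos; auto; try (left; apply exp_pos). lra.
  + intros Hv. unfold base. rewrite Rabs_mult. unfold theta_term. rewrite Rabs_pos_eq by (left; apply exp_pos).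
    replace (K * exp (2 * X) * (D * exp (k * X)) * pw 2 v) with ((K * exp (2 * X) * pw 2 v) * (D * exp (k * X))) by ring.
    apply Rmult_le_compat; [left; apply exp_pos|apply Rabs_pos| |].
    * eapply Rle_trans; [apply (Qbound_pos x y (exp u) v 2); auto; [apply exp_pos|lra]|].
      rewrite exp_Rpower_opp. fold K. apply Rmult_le_compat_r; [lra|]. apply Rmult_le_compat_l; [lra|].
      apply exp_le. apply Rabs_le_between in Hu. lra.
    * eapply Rle_trans; [apply Hw|]. apply Rmult_le_compat_l; auto. apply exp_le. apply Rmult_le_compat_l; auto.
- assert (E : forall u, usum (fun v => nz v (base w v u x y)) = (theta_lat (exp u) x y - 1) * w u).
  { intros u. apply usum_nz_scal; auto. apply exp_pos. }
  split; [apply nice_ext with (2 := H1); auto|].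
  rewrite <- (II_ext _ _ E). unfold LamW, Lam, lattice_II. apply usum_unique.
  apply is_usum_ext with (2 := H2). intros v. rewrite II_nz. auto.
Qed.

(** For u < 0 theta is no longer small and the decay comes from the weight; this is where sg > 1,
    that is Re s > 1, enters. *)
Lemma neg_as_II w x y D sg : contR w -> 1 < sg -> 0 <= D -> (forall u, Rabs (w u) <= D * exp (sg * u)) -> 0 < y ->
  nice (fun u => (theta_lat (exp (- u)) x y - 1) * w (- u)) /\
  is_usum (fun v => nz v (II (fun u => exp (- (PI * exp (- u) * Q x y v)) * w (- u)))) (II (fun u => (theta_lat (exp (- u)) x y - 1) * w (- u))).
Proof.
(* An exponent strictly between 1 and sg: above 1 the lattice sum converges, below sg a factor
   e^(-(sg - A) u) is left for the integral. *)
intros Hcw Hsg HD Hw Hy. set (A := (1 + sg) / 2). assert (HA : 1 < A < sg) by (unfold A; lra).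
set (K := Rpower A A * Rpower (Qc (Rabs x) (/ y) / y) (- A)).
assert (HK : 0 < K) by (apply Rmult_lt_0_compat; apply exp_pos).
assert (Hb : forall v u, v <> (0, 0)%Z -> Rabs (exp (- (PI * exp (- u) * Q x y v)) * w (- u)) <= (K * D * pw A v) * exp (- ((sg - A) * u))).
{ intros v u Hv. rewrite Rabs_mult, Rabs_pos_eq by (left; apply exp_pos).
  apply Rle_trans with ((K * exp (- (A * - u)) * pw A v) * (D * exp (sg * - u))).
  - apply Rmult_le_compat; [left; apply exp_pos|apply Rabs_pos| |auto].
    rewrite <- (exp_Rpower_opp A (- u)). unfold K. apply Qbound_pos; auto; [apply exp_pos|lra].
  - apply Req_le. replace (- ((sg - A) * u)) with (- (A * - u) + sg * - u) by ring. rewrite exp_plus. ring. }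
assert (Hcn : contR (fun u => w (- u))).
{ apply (contR_comp w); auto. intros u. apply (ex_derive_continuous Ropp u). auto_derive; auto. }
destruct (usum_II (fun v u => nz v (exp (- (PI * exp (- u) * Q x y v)) * w (- u))) (fun v => K * D * pw A v) (fun X v => (K * D * exp ((sg - A) * X)) * pw A v) (sg - A)) as [H1 H2].
- intros v. apply contR_nz. apply contR_mult; auto.
  intros u. apply (ex_derive_continuous (fun u => exp (- (PI * exp (- u) * Q x y v))) u). auto_derive; auto.
- lra.
- apply dom_scal; [apply Rmult_le_pos; lra|apply dom_pw; lra].
- intros v u Hu. apply nz_abs_le; [|intros; apply Hb; auto].
  apply Rmult_le_pos; [|left; apply exp_pos]. apply Rmult_le_pos; [apply Rmult_le_pos; lra|left; apply pw_pos].
- intros X. apply dom_scal; [|apply dom_pw; lra]. apply Rmult_le_pos; [apply Rmult_le_pos; lra|left; apply exp_pos].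
- intros X v u Hu. pose proof (pw_pos A v). apply nz_abs_le.
  + apply Rmult_le_pos; [|lra]. apply Rmult_le_pos; [apply Rmult_le_pos; lra|left; apply exp_pos].
  + intros Hv. eapply Rle_trans; [apply Hb; auto|].
    replace (K * D * exp ((sg - A) * X) * pw A v) with (K * D * pw A v * exp ((sg - A) * X)) by ring.
    apply Rmult_le_compat_l; [apply Rmult_le_pos; [apply Rmult_le_pos; lra|lra]|].
    apply exp_le. apply Rabs_le_between in Hu. nra.
- assert (E : forall u, usum (fun v => nz v (exp (- (PI * exp (- u) * Q x y v)) * w (- u))) = (theta_lat (exp (- u)) x y - 1) * w (- u)).
  { intros u. apply usum_nz_scal; auto. apply exp_pos. }
  split; [apply nice_ext with (2 := H1); auto|].
  rewrite <- (II_ext _ _ E). apply is_usum_ext with (2 := H2). intros v. rewrite II_nz. auto.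
Qed.

(** theta(e^(-u)) - 1 = e^u (theta(e^u) - 1) + (e^u - 1): the first part is again an integral over u
    >= 0 of the same kind, the second is elementary and produces the poles. *)
Lemma neg_sum w x y D sg : contR w -> 1 < sg -> 0 <= D -> (forall u, Rabs (w u) <= D * exp (sg * u)) -> 0 < y ->
  egrowthE (fun u => exp u * w (- u)) ->
  is_usum (fun v => nz v (II (fun u => exp (- (PI * exp (- u) * Q x y v)) * w (- u))))
    (LamW (fun u => exp u * w (- u)) x y + II (fun u => (exp u - 1) * w (- u))).
Proof.
intros Hcw Hsg HD Hw Hy Hwe.
destruct (neg_as_II w x y D sg Hcw Hsg HD Hw Hy) as [N1 S1].
destruct (Lam_as_II _ x y Hwe Hy) as [N2 S2].
rewrite S2.
assert (N3 : nice (fun u => (exp u - 1) * w (- u))).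
{ apply nice_le with (2 * D) (sg - 1); [|lra|].
  - apply contR_mult; [apply contR_minus; [apply contR_exp|apply contR_const]|].
    apply (contR_comp w); auto. intros u. apply (ex_derive_continuous Ropp u). auto_derive; auto.
  - intros u Hu. rewrite Rabs_mult. specialize (Hw (- u)).
    assert (He : Rabs (exp u - 1) <= 2 * exp u).
    { pose proof (exp_pos u). assert (1 <= exp u) by (rewrite <- exp_0; apply exp_le; auto). apply Rabs_le; lra. }
    apply Rle_trans with (2 * exp u * (D * exp (sg * - u))); [apply Rmult_le_compat; auto using Rabs_pos|].
    apply Req_le. replace (- ((sg - 1) * u)) with (u + sg * - u) by ring. rewrite exp_plus. ring. }
rewrite <- II_plus by auto.
replace (II (fun u => (theta_lat (exp u) x y - 1) * (exp u * w (- u)) + (exp u - 1) * w (- u))) with (II (fun u => (theta_lat (exp (- u)) x y - 1) * w (- u))); auto.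
apply II_ext. intros u. rewrite exp_Ropp, theta_lat_functional; [ring|apply exp_pos|auto].
Qed.

(** * The Eisenstein series as a Mellin transform *)

Lemma Cseq_cv_comp u l : is_lim_seq (fun n => Re (u n)) (Re l) -> is_lim_seq (fun n => Im (u n)) (Im l) -> Cseq_cv u l.
Proof.
intros H1 H2 eps Heps. apply is_lim_seq_spec in H1. apply is_lim_seq_spec in H2.
destruct (H1 (pos_div_2 (mkposreal eps Heps))) as [N1 HN1]. destruct (H2 (pos_div_2 (mkposreal eps Heps))) as [N2 HN2].
exists (max N1 N2). intros n Hn. specialize (HN1 n ltac:(lia)). specialize (HN2 n ltac:(lia)). simpl in HN1, HN2.
eapply Rle_lt_trans; [apply Cnorm_le_sum|].
change (Rabs (Re (u n) - Re l) + Rabs (Im (u n) - Im l) < eps). lra.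
Qed.

(** The index range of [eis_partial] in the order of its sums, so that the partial sums agree
    literally with finite sums of a family. *)
Definition zlist (N : nat) : list Z := map (fun i => (Z.of_nat i - Z.of_nat N)%Z) (seq 0 (2 * N + 1)).

Definition zlist2 (N : nat) : list (Z * Z) := flat_map (fun m => map (pair m) (zlist N)) (zlist N).

Lemma zlist_NoDup N : NoDup (zlist N).
Proof. apply FinFun.Injective_map_NoDup; [intros a b; lia|apply seq_NoDup]. Qed.

Lemma zlist_In N n : (Z.abs n <= Z.of_nat N)%Z -> In n (zlist N).
Proof.
intros H. apply in_map_iff. exists (Z.to_nat (n + Z.of_nat N)). split; [lia|]. apply in_seq. lia.
Qed.

Lemma zlist2_NoDup N : NoDup (zlist2 N).
Proof. apply (NoDup_fiber (fun _ => zlist N)); intros; apply zlist_NoDup. Qed.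

Lemma zlist2_In v : exists N0, forall N, (N0 <= N)%nat -> In v (zlist2 N).
Proof.
destruct v as [m n]. exists (max (Z.abs_nat m) (Z.abs_nat n)). intros N HN. apply in_flat_map. exists m.
split; [apply zlist_In; lia|]. apply in_map, zlist_In. lia.
Qed.

Lemma Csum_proj (p : Cplx -> R) (f : nat -> Cplx) n : p C0 = 0 -> (forall z w, p (Cadd z w) = p z + p w) ->
  p (Csum f n) = fsum (fun i => p (f i)) (seq 0 n).
Proof.
intros H0 Hp. induction n; [auto|]. rewrite seq_S, fsum_app. simpl Csum. rewrite Hp, IHn. simpl. ring.
Qed.

Lemma Csum2_proj (p : Cplx -> R) (f : Z -> Z -> Cplx) N : p C0 = 0 -> (forall z w, p (Cadd z w) = p z + p w) ->
  p (Csum (fun i => Csum (fun j => f (Z.of_nat i - Z.of_nat N)%Z (Z.of_nat j - Z.of_nat N)%Z) (2 * N + 1)) (2 * N + 1)) =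
  fsum (fun v => p (f (fst v) (snd v))) (zlist2 N).
Proof.
intros H0 Hp. unfold zlist2. rewrite <- (fsum_fiber (fun v => p (f (fst v) (snd v))) (fun _ => zlist N)).
rewrite Csum_proj by auto. unfold zlist at 2. rewrite fsum_map. apply fsum_ext. intros i _.
rewrite Csum_proj by auto. unfold zlist. rewrite fsum_map. auto.
Qed.

(** |mz + n|^2 = y Q, so at weight 0 the quotient y^s / |mz + n|^(2s) is Q^(-s). *)
Lemma eis_term_Q z s m n : inH z -> (m, n) <> (0, 0)%Z -> eis_term 0 z s m n = ce s (- ln (Q (Re z) (Im z) (m, n))).
Proof.
intros Hz Hv. unfold inH in Hz. assert (HQ := Q_pos (Re z) (Im z) (m, n) Hz Hv).
unfold eis_term. set (w := Cadd (Cmul (RtoC (IZR m)) z) (RtoC (IZR n))).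
assert (Ew : Re w * Re w + Im w * Im w = Im z * Q (Re z) (Im z) (m, n)).
{ unfold w, Q. simpl. field. lra. }
rewrite Ew. change (Cdiv (ce s (ln (Im z))) (Cmul C1 (ce s (ln (Im z * Q (Re z) (Im z) (m, n))))) = ce s (- ln (Q (Re z) (Im z) (m, n)))).
rewrite ln_mult, ce_add by auto.
assert (Hce : forall u, ce s u <> C0).
{ intros u H. pose proof (Cnorm_ce s u) as E. rewrite H in E. change C0 with (RtoC 0) in E. rewrite Cnorm_RtoC, Rabs_R0 in E.
  pose proof (exp_pos (Re s * u)). lra. }
assert (E1 : Cmul (ce s (ln (Q (Re z) (Im z) (m, n)))) (ce s (- ln (Q (Re z) (Im z) (m, n)))) = C1).
{ rewrite <- ce_add, Rplus_opp_r. apply ce_0. }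
pose proof (Hce (ln (Im z))). pose proof (Hce (ln (Q (Re z) (Im z) (m, n)))).
set (a := ce s (ln (Im z))) in *. set (b := ce s (ln (Q (Re z) (Im z) (m, n)))) in *. set (c := ce s (- ln (Q (Re z) (Im z) (m, n)))) in *.
transitivity (Cmul (Cdiv a (Cmul C1 (Cmul a b))) (Cmul b c)); [rewrite E1; ring|field; split; auto].
Qed.

Lemma eis_dom x y s v : 1 < Re s -> 0 < y -> v <> (0, 0)%Z ->
  Cnorm (ce s (- ln (Q x y v))) <= Rpower (Qc (Rabs x) (/ y) / y) (- Re s) * pw (Re s) v.
Proof.
intros Hs Hy Hv. rewrite Cnorm_ce, pw_latD. pose proof (latD_ge1 v).
assert (Hc : 0 < Qc (Rabs x) (/ y) / y) by (apply Rdiv_lt_0_compat; auto; apply Qc_pos).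
rewrite Rpower_mult_distr by lra.
replace (exp (Re s * - ln (Q x y v))) with (Rpower (Q x y v) (- Re s)) by (unfold Rpower; f_equal; ring).
apply Rpower_neg_antimono; [lra|]. split; [apply Rmult_lt_0_compat; lra|].
apply Q_lower; auto; [lra|apply Rinv_0_lt_compat; auto|rewrite Rinv_inv; lra].
Qed.

Definition eis_fam (p : Cplx -> R) (x y : R) (s : Cplx) (v : Z * Z) : R := nz v (p (ce s (- ln (Q x y v)))).

Lemma is_usum_eisf p x y s : (forall z, Rabs (p z) <= Cnorm z) -> 1 < Re s -> 0 < y ->
  is_usum (eis_fam p x y s) (usum (eis_fam p x y s)).
Proof.
intros Hp Hs Hy. apply is_usum_dom with (fun v => Rpower (Qc (Rabs x) (/ y) / y) (- Re s) * pw (Re s) v).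
- apply dom_scal; [left; apply exp_pos|apply dom_pw; auto].
- intros v. apply nz_abs_le; [apply Rmult_le_pos; left; [apply exp_pos|apply pw_pos]|].
  intros Hv. eapply Rle_trans; [apply Hp|apply eis_dom; auto].
Qed.

Definition Eis_usum (z s : Cplx) : Cplx := mkC (1 / 2 * usum (eis_fam Re (Re z) (Im z) s)) (1 / 2 * usum (eis_fam Im (Re z) (Im z) s)).

Lemma Eis_val_Eis_usum z s : inH z -> 1 < Re s -> Eis_val 0 z s (Eis_usum z s).
Proof.
intros Hz Hs. unfold inH in Hz.
assert (Hproj : forall p, p C0 = 0 -> (forall a b, p (Cadd a b) = p a + p b) -> (forall z, Rabs (p z) <= Cnorm z) ->
  is_lim_seq (fun N => 1 / 2 * p (eis_partial 0 z s N)) (1 / 2 * usum (eis_fam p (Re z) (Im z) s))).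
{ intros p H0 Hp Hb. apply is_lim_seq_mult'; [apply is_lim_seq_const|].
  apply is_lim_seq_ext with (fun N => fsum (eis_fam p (Re z) (Im z) s) (zlist2 N)).
  - intros N. unfold eis_partial.
    rewrite (Csum2_proj p (fun m n => if (Z.eqb m 0 && Z.eqb n 0)%bool then C0 else eis_term 0 z s m n) N H0 Hp).
    apply fsum_ext. intros [m n] _. unfold eis_fam, nz. cbn [fst snd].
    destruct (eq_dec_cl (m, n) (0, 0)%Z) as [E|E].
    + injection E as -> ->. simpl. auto.
    + destruct (Z.eqb_spec m 0), (Z.eqb_spec n 0); subst; try (exfalso; apply E; reflexivity); cbn [andb]; rewrite eis_term_Q; auto.
  - apply is_usum_seq; [apply is_usum_eisf; auto|apply zlist2_NoDup|apply zlist2_In]. }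
apply Cseq_cv_comp.
- apply is_lim_seq_ext with (fun N => 1 / 2 * Re (eis_partial 0 z s N)).
  + intros N. change (1 / 2 * Re (eis_partial 0 z s N) = 1 / 2 * Re (eis_partial 0 z s N) - 0 * Im (eis_partial 0 z s N)). ring.
  + apply (Hproj Re); auto. apply Re_le_Cnorm.
- apply is_lim_seq_ext with (fun N => 1 / 2 * Im (eis_partial 0 z s N)).
  + intros N. change (1 / 2 * Im (eis_partial 0 z s N) = 1 / 2 * Im (eis_partial 0 z s N) + 0 * Re (eis_partial 0 z s N)). ring.
  + apply (Hproj Im); auto. apply Im_le_Cnorm.
Qed.

(** The value is 1/p, by [exp_decay_int_inv]; the integral form is the one that comes out of
    [mellin_theta]. *)
Definition exp_decay_int (p : Cplx) : Cplx := mkC (II (fun u => Re (ce (Copp p) u))) (II (fun u => Im (ce (Copp p) u))).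

Lemma nice_ce_neg p : 0 < Re p -> nice (fun u => Re (ce (Copp p) u)) /\ nice (fun u => Im (ce (Copp p) u)).
Proof.
intros Hp. assert (Hb : forall u, Cnorm (ce (Copp p) u) <= 1 * exp (- (Re p * u))).
{ intros u. rewrite Cnorm_ce. change (Re (Copp p)) with (- Re p). apply Req_le. rewrite Rmult_1_l. f_equal; ring. }
split.
- apply nice_le with 1 (Re p); auto; [exact (proj1 (proj1 (egrowth_ce (Copp p))))|].
  intros u _. eapply Rle_trans; [exact (Re_le_Cnorm (ce (Copp p) u))|exact (Hb u)].
- apply nice_le with 1 (Re p); auto; [exact (proj1 (proj2 (egrowth_ce (Copp p))))|].
  intros u _. eapply Rle_trans; [exact (Im_le_Cnorm (ce (Copp p) u))|exact (Hb u)].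
Qed.

Lemma exp_decay_int_inv p : 0 < Re p -> Cmul p (exp_decay_int p) = C1.
Proof.
intros Hp. destruct (nice_ce_neg p Hp) as [N1 N2].
assert (Hb : forall u, Cnorm (ce (Copp p) u) <= 1 * exp (- (Re p * u))).
{ intros u. rewrite Cnorm_ce. change (Re (Copp p)) with (- Re p). apply Req_le. rewrite Rmult_1_l. f_equal; ring. }
assert (E : forall w w1 c d w0, nice w -> nice w1 -> (forall u, is_derive w0 u (c * w u + d * w1 u)) -> 
  (forall u, Rabs (w0 u) <= 1 * exp (- (Re p * u))) -> c * II w + d * II w1 = - w0 0).
{ intros w w1 c d w0 H1 H2 H3 H4. rewrite <- (II_FTC w0 (fun u => c * w u + d * w1 u) 1 (Re p)); auto.
  - rewrite II_plus, !II_scal; auto using nice_scal.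
  - apply nice_cont, nice_plus; apply nice_scal; auto. }
apply Ceq.
- change (Re p * II (fun u => Re (ce (Copp p) u)) - Im p * II (fun u => Im (ce (Copp p) u)) = 1).
  pose proof (E _ _ (- Re p) (Im p) (fun u => Re (ce (Copp p) u)) N1 N2) as E1.
  assert (E2 : - Re p * II (fun u => Re (ce (Copp p) u)) + Im p * II (fun u => Im (ce (Copp p) u)) = - Re (ce (Copp p) 0)).
  { apply E1.
    - intros u. apply is_derive_ext_val with (Re (Copp p) * Re (ce (Copp p) u) - Im (Copp p) * Im (ce (Copp p) u)); [exact (ce_Re_deriv (Copp p) u)|].
      change (- Re p * Re (ce (Copp p) u) - - Im p * Im (ce (Copp p) u) = - Re p * Re (ce (Copp p) u) + Im p * Im (ce (Copp p) u)). ring.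
    - intros u. eapply Rle_trans; [exact (Re_le_Cnorm (ce (Copp p) u))|exact (Hb u)]. }
  rewrite ce_0 in E2. change (Re C1) with 1 in E2. lra.
- change (Re p * II (fun u => Im (ce (Copp p) u)) + Im p * II (fun u => Re (ce (Copp p) u)) = 0).
  pose proof (E _ _ (- Re p) (- Im p) (fun u => Im (ce (Copp p) u)) N2 N1) as E1.
  assert (E2 : - Re p * II (fun u => Im (ce (Copp p) u)) + - Im p * II (fun u => Re (ce (Copp p) u)) = - Im (ce (Copp p) 0)).
  { apply E1.
    - intros u. apply is_derive_ext_val with (Re (Copp p) * Im (ce (Copp p) u) + Im (Copp p) * Re (ce (Copp p) u)); [exact (ce_Im_deriv (Copp p) u)|].
      change (- Re p * Im (ce (Copp p) u) + - Im p * Re (ce (Copp p) u) = - Re p * Im (ce (Copp p) u) + - Im p * Re (ce (Copp p) u)). ring.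
    - intros u. eapply Rle_trans; [exact (Im_le_Cnorm (ce (Copp p) u))|exact (Hb u)]. }
  rewrite ce_0 in E2. change (Im C1) with 0 in E2. lra.
Qed.

Definition Lambda (x y : R) (s : Cplx) : Cplx := mkC (LamW (fun u => Re (ce s u)) x y) (LamW (fun u => Im (ce s u)) x y).

Lemma ce_reflect s u : ce (Csub C1 s) u = Cmul (RtoC (exp u)) (ce s (- u)).
Proof.
replace (Csub C1 s) with (Cadd (Copp s) C1) by ring. rewrite ce_S. f_equal. unfold ce. f_equal.
apply Ceq; simpl; ring.
Qed.

(* Mellin transform of theta: the lattice sum of the complete Gamma integrals splits at [u = 0],
   and the functional equation folds the half [u < 0] onto [u > 0]. *)
Lemma mellin_theta x y s : 0 < y -> 1 < Re s ->
  Cmul (RtoC 2) (Cmul (Cmul (ce s (- ln PI)) (gamma_int 1 s)) (mkC (1 / 2 * usum (eis_fam Re x y s)) (1 / 2 * usum (eis_fam Im x y s)))) =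
  Cadd (Cadd (Lambda x y s) (Lambda x y (Csub C1 s))) (Csub (exp_decay_int (Csub s C1)) (exp_decay_int s)).
Proof.
intros Hy Hs. assert (Hs0 : 0 < Re s) by lra. pose proof PI_RGT_0 as HPI.
set (G := Cmul (ce s (- ln PI)) (gamma_int 1 s)).
(* Each term of the Eisenstein series is a Gamma integral: PI^(-s) Gamma(s) Q^(-s) is the integral
   of exp(-PI Q t) t^(s-1). *)
assert (HT : forall v, v <> (0, 0)%Z -> gamma_int (PI * Q x y v) s = Cmul G (ce s (- ln (Q x y v)))).
{ intros v Hv. pose proof (Q_pos x y v Hy Hv). rewrite gamma_int_scale by (auto; apply Rmult_lt_0_compat; auto).
  rewrite ln_mult, Ropp_plus_distr, ce_add by auto. unfold G. ring. }
assert (HSR := is_usum_eisf Re x y s Re_le_Cnorm Hs Hy). assert (HSI := is_usum_eisf Im x y s Im_le_Cnorm Hs Hy).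
destruct (egrowth_ce s) as [WR WI]. destruct (wgood_ce s Hs0) as [GR GI].
assert (Hbd : forall u, Cnorm (ce s u) <= 1 * exp (Re s * u)) by (intros; rewrite Cnorm_ce; lra).
assert (ERr : forall u, exp u * Re (ce s (- u)) = Re (ce (Csub C1 s) u)).
{ intros u. rewrite ce_reflect. change (exp u * Re (ce s (- u)) = exp u * Re (ce s (- u)) - 0 * Im (ce s (- u))). ring. }
assert (EIr : forall u, exp u * Im (ce s (- u)) = Im (ce (Csub C1 s) u)).
{ intros u. rewrite ce_reflect. change (exp u * Im (ce s (- u)) = exp u * Im (ce s (- u)) + 0 * Re (ce s (- u))). ring. }
assert (Hsum : forall w, wgood w -> egrowthE (fun u => exp u * w (- u)) -> (forall u, Rabs (w u) <= 1 * exp (Re s * u)) ->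
  is_usum (fun v => nz v (line_int (gamma_weight (PI * Q x y v) w))) (LamW w x y + (LamW (fun u => exp u * w (- u)) x y + II (fun u => (exp u - 1) * w (- u))))).
{ intros w Hg Hwe Hb. assert (Hcw : contR w) by (destruct (proj1 Hg) as [? [? [H _]]]; auto).
  assert (H01 : 0 <= 1) by lra.
  pose proof (neg_sum w x y 1 (Re s) Hcw Hs H01 Hb Hy Hwe) as Hn.
  pose proof (is_usum_lattice_II _ (cls_dd _ x y (cls_baseE w (proj1 Hg)) Hy)) as Hp.
  apply is_usum_ext with (2 := is_usum_plus _ _ _ _ Hp Hn).
  intros v. unfold nz. destruct eq_dec_cl; [ring|]. unfold line_int. f_equal; apply II_ext; intros u; unfold base, theta_term, gamma_weight; do 3 f_equal; ring. }
assert (WeR : egrowthE (fun u => exp u * Re (ce s (- u)))) by (apply egrowthE_ext with (fun u => Re (ce (Csub C1 s) u)); [intros; symmetry; apply ERr|exact (egrowthE_ceRe _)]).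
assert (WeI : egrowthE (fun u => exp u * Im (ce s (- u)))) by (apply egrowthE_ext with (fun u => Im (ce (Csub C1 s) u)); [intros; symmetry; apply EIr|exact (egrowthE_ceIm _)]).
assert (SR := Hsum _ GR WeR (fun u => Rle_trans _ _ _ (Re_le_Cnorm (ce s u)) (Hbd u))).
assert (SI := Hsum _ GI WeI (fun u => Rle_trans _ _ _ (Im_le_Cnorm (ce s u)) (Hbd u))).
assert (Hs1 : 0 < Re (Csub s C1)) by (change (0 < Re s + - 1); lra).
destruct (nice_ce_neg _ Hs1) as [N1 N2]. destruct (nice_ce_neg _ Hs0) as [N3 N4].
assert (Eo : Copp (Csub s C1) = Csub C1 s) by ring. rewrite Eo in N1, N2.
assert (Ecn : forall u, ce s (- u) = ce (Copp s) u) by (intros u; unfold ce; f_equal; apply Ceq; simpl; ring).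
assert (IR : II (fun u => (exp u - 1) * Re (ce s (- u))) = II (fun u => Re (ce (Csub C1 s) u)) - II (fun u => Re (ce (Copp s) u))).
{ rewrite <- II_minus by auto. apply II_ext. intros u. rewrite <- ERr, <- Ecn. ring. }
assert (IM : II (fun u => (exp u - 1) * Im (ce s (- u))) = II (fun u => Im (ce (Csub C1 s) u)) - II (fun u => Im (ce (Copp s) u))).
{ rewrite <- II_minus by auto. apply II_ext. intros u. rewrite <- EIr, <- Ecn. ring. }
assert (LR : LamW (fun u => exp u * Re (ce s (- u))) x y = LamW (fun u => Re (ce (Csub C1 s) u)) x y).
{ unfold LamW, Lam. apply lattice_II_ext. intros v u _. unfold base. rewrite ERr. auto. }
assert (LI : LamW (fun u => exp u * Im (ce s (- u))) x y = LamW (fun u => Im (ce (Csub C1 s) u)) x y).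
{ unfold LamW, Lam. apply lattice_II_ext. intros v u _. unfold base. rewrite EIr. auto. }
cbv beta in SR, SI. rewrite IR, LR in SR. rewrite IM, LI in SI.
(* The same lattice sum is evaluated a second time, termwise through [HT]; uniqueness of sums then
   gives the identity. *)
assert (TR : is_usum (fun v => nz v (line_int (gamma_weight (PI * Q x y v) (fun u => Re (ce s u))))) (Re G * usum (eis_fam Re x y s) + (- Im G) * usum (eis_fam Im x y s))).
{ apply is_usum_ext with (2 := is_usum_plus _ _ _ _ (is_usum_scal (Re G) _ _ HSR) (is_usum_scal (- Im G) _ _ HSI)).
  intros v. unfold eis_fam, nz. destruct eq_dec_cl as [E|Hv]; [ring|].
  pose proof (f_equal Re (HT v Hv)) as E.
  change (line_int (gamma_weight (PI * Q x y v) (fun u => Re (ce s u))) = Re G * Re (ce s (- ln (Q x y v))) - Im G * Im (ce s (- ln (Q x y v)))) in E.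
  rewrite E. ring. }
assert (TI : is_usum (fun v => nz v (line_int (gamma_weight (PI * Q x y v) (fun u => Im (ce s u))))) (Re G * usum (eis_fam Im x y s) + Im G * usum (eis_fam Re x y s))).
{ apply is_usum_ext with (2 := is_usum_plus _ _ _ _ (is_usum_scal (Re G) _ _ HSI) (is_usum_scal (Im G) _ _ HSR)).
  intros v. unfold eis_fam, nz. destruct eq_dec_cl as [E|Hv]; [ring|].
  pose proof (f_equal Im (HT v Hv)) as E.
  change (line_int (gamma_weight (PI * Q x y v) (fun u => Im (ce s u))) = Re G * Im (ce s (- ln (Q x y v))) + Im G * Re (ce s (- ln (Q x y v)))) in E.
  rewrite E. ring. }
pose proof (is_usum_unique _ _ _ TR SR) as ER. pose proof (is_usum_unique _ _ _ TI SI) as EI.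
unfold exp_decay_int. rewrite Eo. apply Ceq.
- change (2 * (Re G * (1 / 2 * usum (eis_fam Re x y s)) - Im G * (1 / 2 * usum (eis_fam Im x y s))) - 0 * (Re G * (1 / 2 * usum (eis_fam Im x y s)) + Im G * (1 / 2 * usum (eis_fam Re x y s))) =
   LamW (fun u => Re (ce s u)) x y + LamW (fun u => Re (ce (Csub C1 s) u)) x y + (II (fun u => Re (ce (Csub C1 s) u)) + - II (fun u => Re (ce (Copp s) u)))). lra.
- change (2 * (Re G * (1 / 2 * usum (eis_fam Im x y s)) + Im G * (1 / 2 * usum (eis_fam Re x y s))) + 0 * (Re G * (1 / 2 * usum (eis_fam Re x y s)) - Im G * (1 / 2 * usum (eis_fam Im x y s))) =
   LamW (fun u => Im (ce s u)) x y + LamW (fun u => Im (ce (Csub C1 s) u)) x y + (II (fun u => Im (ce (Csub C1 s) u)) + - II (fun u => Im (ce (Copp s) u)))). lra.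
Qed.

(* Only integrals over [t >= 1] are left, so this is the analytic continuation to all [s]. *)
Definition hhE0 (x y : R) (s : Cplx) : Cplx :=
  Cadd (RtoC (1 / 2)) (Cmul (Cmul (RtoC (1 / 2)) (Cmul s (Csub s C1))) (Cadd (Lambda x y s) (Lambda x y (Csub C1 s)))).

(** s (s - 1) (1/(s - 1) - 1/s) = 1: the two poles become the constant 1/2. *)
Lemma hhE_val_hhE0 z s : inH z -> 1 < Re s -> hhE_val 0 z s (hhE0 (Re z) (Im z) s).
Proof.
intros Hz Hs. unfold hhE_val. 
assert (E0 : Cadd s (RtoC (0 / 2)) = s) by (apply Ceq; simpl; field).
change (IZR (Z.abs 0)) with 0. rewrite E0, E0.
exists (Eis_usum z s), (gamma_int 1 s). split; [apply Eis_val_Eis_usum; auto|]. split; [apply Gamma_val_gamma_int; lra|].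
assert (Ep : Rcpow PI (Copp s) = ce s (- ln PI)) by (unfold Rcpow, ce; f_equal; apply Ceq; simpl; ring).
rewrite Ep. pose proof (mellin_theta (Re z) (Im z) s Hz Hs) as H. fold (Eis_usum z s) in H.
assert (Hs1 : 0 < Re (Csub s C1)) by (change (0 < Re s + - 1); lra).
pose proof (exp_decay_int_inv (Csub s C1) Hs1) as J1. assert (Hs0 : 0 < Re s) by lra. pose proof (exp_decay_int_inv s Hs0) as J2.
unfold hhE0. set (A := Cadd (Lambda (Re z) (Im z) s) (Lambda (Re z) (Im z) (Csub C1 s))) in *.
assert (E2 : Cmul (RtoC (1 / 2)) (RtoC 2) = C1) by (apply Ceq; simpl; field).
transitivity (Cmul (Cmul (RtoC (1 / 2)) (Cmul s (Csub s C1))) (Cadd A (Csub (exp_decay_int (Csub s C1)) (exp_decay_int s)))).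
- transitivity (Cadd (Cmul (Cmul (RtoC (1 / 2)) (Cmul s (Csub s C1))) A) (Cmul (RtoC (1 / 2)) (Csub (Cmul s (Cmul (Csub s C1) (exp_decay_int (Csub s C1)))) (Cmul (Csub s C1) (Cmul s (exp_decay_int s)))))); [|ring].
  rewrite J1, J2. ring.
- rewrite <- H. transitivity (Cmul (Cmul (RtoC (1 / 2)) (RtoC 2)) (Cmul (Cmul (Cmul s (Csub s C1)) (ce s (- ln PI))) (Cmul (gamma_int 1 s) (Eis_usum z s)))); [ring|].
  rewrite E2. ring.
Qed.

(** * Taylor coefficients of the completed Eisenstein series *)

(** Real-linear functionals on the complex numbers, with [Re] and [Im] as instances, so that both
    parts share one argument. *)
Definition Clin (p : Cplx -> R) : Prop :=
  p C0 = 0 /\ (forall z w, p (Cadd z w) = p z + p w) /\ (forall r z, p (Cmul (RtoC r) z) = r * p z).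

Lemma Clin_Re : Clin Re.
Proof. split; [auto|]. split; [auto|]. intros; simpl; ring. Qed.

Lemma Clin_Im : Clin Im.
Proof. split; [auto|]. split; [auto|]. intros; simpl; ring. Qed.

Lemma Clin_sub p z w : Clin p -> p (Csub z w) = p z - p w.
Proof.
intros [H0 [Ha Hs]]. replace (Csub z w) with (Cadd z (Cmul (RtoC (-1)) w)) by (apply Ceq; simpl; ring).
rewrite Ha, Hs. ring.
Qed.

Definition exp_partial (s : Cplx) (N : nat) (u : R) : Cplx := Csum (fun j => Cmul (RtoC (u ^ j / INR (fact j))) (Cpow s j)) N.

Lemma exp_partial_deriv p s N u : Clin p -> is_derive (fun u => p (exp_partial s (S N) u)) u (p (Cmul s (exp_partial s N u))).
Proof.
intros [H0 [Ha Hs]]. induction N as [|N IH].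
- apply is_derive_ext with (fun _ => p C1).
  + intros t. unfold exp_partial. simpl Csum. f_equal. apply Ceq; simpl; field.
  + apply is_derive_ext_val with 0; [apply (is_derive_const (V := R_NormedModule))|]. rewrite <- H0. f_equal. unfold exp_partial. simpl Csum. apply Ceq; simpl; ring.
- apply is_derive_ext with (fun u => p (exp_partial s (S N) u) + u ^ S N / INR (fact (S N)) * p (Cpow s (S N))).
  + intros t. unfold exp_partial. rewrite <- Hs, <- Ha. auto.
  + apply is_derive_ext_val with (p (Cmul s (exp_partial s N u)) + u ^ N / INR (fact N) * p (Cpow s (S N))).
    * apply (is_derive_plus (fun u => p (exp_partial s (S N) u)) (fun u => u ^ S N / INR (fact (S N)) * p (Cpow s (S N)))); auto.
      apply (is_derive_scal_l (fun u => u ^ S N / INR (fact (S N))) u (u ^ N / INR (fact N)) (p (Cpow s (S N)))), is_derive_pow_fact.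
    * rewrite <- Hs, <- Ha. f_equal. unfold exp_partial. simpl Csum. simpl Cpow. ring.
Qed.

Lemma exp_partial_0 s N : exp_partial s (S N) 0 = C1.
Proof.
unfold exp_partial. induction N as [|N IH]; [apply Ceq; simpl; field|].
change (Cadd (Csum (fun j => Cmul (RtoC (0 ^ j / INR (fact j))) (Cpow s j)) (S N)) (Cmul (RtoC (0 ^ S N / INR (fact (S N)))) (Cpow s (S N))) = C1).
rewrite IH. rewrite pow_i by lia. replace (0 / INR (fact (S N))) with 0 by (unfold Rdiv; ring). apply Ceq; simpl; ring.
Qed.

Definition exp_remainder (s : Cplx) (N : nat) (u : R) : Cplx := Csub (ce s u) (exp_partial s N u).

(** Real and imaginary parts are bounded separately; multiplication by s enlarges a common bound for
    both by at most this factor. *)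
Definition Cnorm1 (s : Cplx) : R := Rabs (Re s) + Rabs (Im s).

Lemma ce_p_deriv p s u : p = Re \/ p = Im -> is_derive (fun u => p (ce s u)) u (p (Cmul s (ce s u))).
Proof. intros [->| ->]; [apply ce_Re_deriv|apply ce_Im_deriv]. Qed.

Lemma Clin_proj p : p = Re \/ p = Im -> Clin p.
Proof. intros [->| ->]; [apply Clin_Re|apply Clin_Im]. Qed.

Lemma exp_remainder_deriv p s N u : p = Re \/ p = Im -> is_derive (fun u => p (exp_remainder s (S N) u)) u (p (Cmul s (exp_remainder s N u))).
Proof.
intros Hp. pose proof (Clin_proj p Hp) as Hl.
apply is_derive_ext with (fun u => p (ce s u) - p (exp_partial s (S N) u)); [intros; symmetry; apply Clin_sub; auto|].
replace (Cmul s (exp_remainder s N u)) with (Csub (Cmul s (ce s u)) (Cmul s (exp_partial s N u))) by (unfold exp_remainder; ring).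
rewrite Clin_sub by auto. apply (is_derive_minus (fun u => p (ce s u)) (fun u => p (exp_partial s (S N) u))).
- apply ce_p_deriv; auto.
- apply exp_partial_deriv; auto.
Qed.

Lemma contR_ce_mul p s z : p = Re \/ p = Im -> contR (fun u => p (Cmul z (ce s u))).
Proof.
intros [->| ->] u.
- apply (ex_derive_continuous (fun u => Re (Cmul z (ce s u))) u). simpl. auto_derive; auto.
- apply (ex_derive_continuous (fun u => Im (Cmul z (ce s u))) u). simpl. auto_derive; auto.
Qed.

Lemma proj_mul_le p s z B : p = Re \/ p = Im -> Rabs (Re z) <= B -> Rabs (Im z) <= B -> Rabs (p (Cmul s z)) <= Cnorm1 s * B.
Proof.
intros Hp HR HI. unfold Cnorm1. rewrite Rmult_plus_distr_r.
assert (H : forall r t, Rabs t <= B -> Rabs (r * t) <= Rabs r * B).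
{ intros r t Ht. rewrite Rabs_mult. apply Rmult_le_compat_l; auto; apply Rabs_pos. }
destruct Hp as [->| ->]; simpl.
- unfold Rminus. eapply Rle_trans; [apply Rabs_triang|]. rewrite Rabs_Ropp. apply Rplus_le_compat; auto.
- eapply Rle_trans; [apply Rabs_triang|]. apply Rplus_le_compat; auto.
Qed.

(** The remainder of order N + 1 vanishes at 0 and has derivative s times the remainder of order N,
    so each bound integrates to the next. *)
Lemma exp_remainder_bound_pos s N U : 0 <= U -> forall p t, p = Re \/ p = Im -> 0 <= t <= U ->
  Rabs (p (exp_remainder s N t)) <= (Cnorm1 s * t) ^ N / INR (fact N) * exp (Cnorm1 s * U).
Proof.
intros HU. set (K := Cnorm1 s). assert (HK : 0 <= K) by (unfold K, Cnorm1; pose proof (Rabs_pos (Re s)); pose proof (Rabs_pos (Im s)); lra).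
induction N as [|N IH]; intros p t Hp Ht.
- simpl. replace (1 / 1 * exp (K * U)) with (exp (K * U)) by field.
  apply Rle_trans with (Cnorm (ce s t)).
  + replace (exp_remainder s 0 t) with (ce s t) by (unfold exp_remainder, exp_partial; simpl Csum; ring).
    destruct Hp as [->| ->]; [apply Re_le_Cnorm|apply Im_le_Cnorm].
  + rewrite Cnorm_ce. apply exp_le. pose proof (Rle_abs (Re s)). pose proof (Rabs_pos (Im s)).
    assert (Re s <= K) by (unfold K, Cnorm1; lra). apply Rle_trans with (K * t); [apply Rmult_le_compat_r|apply Rmult_le_compat_l]; lra.
- assert (E0 : p (exp_remainder s (S N) 0) = 0).
  { unfold exp_remainder. rewrite ce_0, exp_partial_0. replace (Csub C1 C1) with C0 by ring. apply Clin_proj; auto. }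
  assert (Hc : contR (fun t => p (Cmul s (exp_remainder s N t)))).
  { destruct N.
    - intros u. apply (continuous_ext (fun u => p (Cmul s (ce s u)))); [|apply contR_ce_mul; auto].
      intros v. f_equal. unfold exp_remainder, exp_partial; simpl Csum. ring.
    - assert (Hc : forall q, q = Re \/ q = Im -> contR (fun t => q (exp_remainder s (S N) t))).
      { intros q Hq. apply derive_contR with (fun u => q (Cmul s (exp_remainder s N u))). intros; apply exp_remainder_deriv; auto. }
      destruct Hp as [->| ->].
      + apply (contR_minus (fun t => Re s * Re (exp_remainder s (S N) t)) (fun t => Im s * Im (exp_remainder s (S N) t))).
        * apply (contR_mult (fun _ => Re s)); [apply contR_const|apply (Hc Re); auto].
        * apply (contR_mult (fun _ => Im s)); [apply contR_const|apply (Hc Im); auto].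
      + apply (contR_plus (fun t => Re s * Im (exp_remainder s (S N) t)) (fun t => Im s * Re (exp_remainder s (S N) t))).
        * apply (contR_mult (fun _ => Re s)); [apply contR_const|apply (Hc Im); auto].
        * apply (contR_mult (fun _ => Im s)); [apply contR_const|apply (Hc Re); auto]. }
  set (g := fun t => K * ((K * t) ^ N / INR (fact N)) * exp (K * U)).
  set (G := fun t => (K * t) ^ S N / INR (fact (S N)) * exp (K * U)).
  assert (Hg : forall t, is_derive G t (g t)).
  { intros v. apply (is_derive_scal_l (fun t => (K * t) ^ S N / INR (fact (S N))) v (K * ((K * v) ^ N / INR (fact N))) (exp (K * U))).
    apply (is_derive_comp (fun t => t ^ S N / INR (fact (S N))) (fun t => K * t)); [apply is_derive_pow_fact|].
    auto_derive; auto. ring. }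
  assert (Hgc : contR g) by (intros v; apply (ex_derive_continuous g v); unfold g; auto_derive; auto).
  assert (H := RIabs (fun t => p (Cmul s (exp_remainder s N t))) g 0 t (proj1 Ht) Hc Hgc).
  assert (H1 : RInt (fun t => p (Cmul s (exp_remainder s N t))) 0 t = p (exp_remainder s (S N) t) - p (exp_remainder s (S N) 0)).
  { apply (FTC (fun t => p (exp_remainder s (S N) t))); auto. intros v; apply exp_remainder_deriv; auto. }
  rewrite H1, (FTC G g 0 t Hg Hgc) in H.
  rewrite E0, Rminus_0_r in H.
  assert (G0 : G 0 = 0) by (unfold G; rewrite Rmult_0_r, pow_i by lia; unfold Rdiv; ring).
  rewrite G0, Rminus_0_r in H.
  apply H. intros v Hv. unfold g. rewrite Rmult_assoc. apply proj_mul_le; auto; apply IH; auto; lra.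
Qed.

Lemma exp_remainder_opp s N u : exp_remainder (Copp s) N (- u) = exp_remainder s N u.
Proof.
unfold exp_remainder. f_equal; [unfold ce; f_equal; apply Ceq; simpl; ring|].
unfold exp_partial. induction N as [|N IH]; [auto|]. simpl Csum. rewrite IH. f_equal.
replace (Cpow (Copp s) N) with (Cmul (RtoC ((-1) ^ N)) (Cpow s N)).
- replace (- u) with ((-1) * u) by ring. rewrite Rpow_mult_distr.
  assert (E : (-1) ^ N * (-1) ^ N = 1) by (rewrite <- Rpow_mult_distr; replace (-1 * -1) with 1 by ring; apply pow1).
  transitivity (Cmul (RtoC ((-1) ^ N * (-1) ^ N)) (Cmul (RtoC (u ^ N / INR (fact N))) (Cpow s N))).
  + apply Ceq; simpl; unfold Rdiv; ring.
  + rewrite E. apply Ceq; simpl; ring.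
- clear IH. induction N as [|N IH]; [apply Ceq; simpl; ring|]. simpl Cpow. rewrite <- IH.
  apply Ceq; simpl; ring.
Qed.

(** (K u)^N / N! = 2^(-N) (2 K u)^N / N! <= 2^(-N) e^(2 K u). The geometric factor does not depend
    on u and the exponential rate does not depend on N, which is the form that [LamW_egrowth_bound]
    accepts. *)
Lemma exp_remainder_bound p s N u : p = Re \/ p = Im ->
  Rabs (p (exp_remainder s N u)) <= (/ 2) ^ N * exp (3 * Cnorm1 s * Rabs u).
Proof.
intros Hp. assert (H : forall s u, 0 <= u -> Rabs (p (exp_remainder s N u)) <= (/ 2) ^ N * exp (3 * Cnorm1 s * u)).
{ clear s u. intros s u Hu. set (K := Cnorm1 s). assert (HK : 0 <= K) by (unfold K, Cnorm1; pose proof (Rabs_pos (Re s)); pose proof (Rabs_pos (Im s)); lra).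
  eapply Rle_trans; [apply (exp_remainder_bound_pos s N u); auto; lra|]. fold K.
  replace (3 * K * u) with (2 * (K * u) + K * u) by ring. rewrite exp_plus, <- Rmult_assoc. apply Rmult_le_compat_r; [left; apply exp_pos|].
  assert (H0 : 0 <= K * u) by (apply Rmult_le_pos; auto).
  replace (K * u) with (/ 2 * (2 * (K * u))) at 1 by field. rewrite Rpow_mult_distr. unfold Rdiv. rewrite Rmult_assoc.
  apply Rmult_le_compat_l; [apply pow_le; lra|]. apply pow_fact_le_exp. lra. }
destruct (Rle_dec 0 u) as [Hu|Hu].
- rewrite (Rabs_pos_eq u) by auto. apply H; auto.
- rewrite (Rabs_left u) by lra. rewrite <- exp_remainder_opp. replace (Cnorm1 s) with (Cnorm1 (Copp s)); [apply H; lra|].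
  unfold Cnorm1; simpl. rewrite !Rabs_Ropp; auto.
Qed.

Lemma LamW_plus w1 w2 x y : egrowthE w1 -> egrowthE w2 -> 0 < y -> LamW (fun u => w1 u + w2 u) x y = LamW w1 x y + LamW w2 x y.
Proof.
intros H1 H2 Hy. unfold LamW, Lam.
rewrite <- (lattice_II_plus _ _ (cls_dd _ x y (cls_baseE w1 H1) Hy) (cls_dd _ x y (cls_baseE w2 H2) Hy)).
apply lattice_II_ext. intros v u _. unfold base. ring.
Qed.

Lemma LamW_scal c w x y : egrowthE w -> 0 < y -> LamW (fun u => c * w u) x y = c * LamW w x y.
Proof.
intros H Hy. unfold LamW, Lam. rewrite <- (lattice_II_scal c _ (cls_dd _ x y (cls_baseE w H) Hy)).
apply lattice_II_ext. intros v u _. unfold base. ring.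
Qed.

Lemma LamW_ext w1 w2 x y : (forall u, w1 u = w2 u) -> LamW w1 x y = LamW w2 x y.
Proof. intros E. apply lattice_II_ext. intros v u _. unfold base. rewrite E; auto. Qed.

Lemma LamW_minus w1 w2 x y : egrowthE w1 -> egrowthE w2 -> 0 < y -> LamW (fun u => w1 u - w2 u) x y = LamW w1 x y - LamW w2 x y.
Proof.
intros H1 H2 Hy. rewrite (LamW_ext _ (fun u => w1 u + (-1) * w2 u)) by (intros; ring).
rewrite LamW_plus, LamW_scal; auto; [ring|]. apply egrowthE_scal; auto.
Qed.

(** The constant depends on the rate k but not on the weight, so geometric convergence of weights of
    a fixed rate passes to their theta integrals. *)
Lemma LamW_egrowth_bound x y k : 0 < y -> 0 <= k -> exists M, 0 <= M /\ forall w C, egrowth w C k -> Rabs (LamW w x y) <= C * M.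
Proof.
intros Hy Hk. set (E := Rpower (2 + k) (2 + k) * Rpower (Qc (Rabs x) (/ y) / y) (- (2 + k))).
assert (HE : 0 < E) by (apply Rmult_lt_0_compat; apply exp_pos).
assert (Hus : 0 <= usum (pw 2)).
{ eapply Rle_trans; [apply Rabs_pos|]. apply usum_abs; [apply dom_pw; lra|].
  intros v; rewrite Rabs_pos_eq; [apply Rle_refl|left; apply pw_pos]. }
exists (E * usum (pw 2)). split; [apply Rmult_le_pos; lra|]. intros w C Hw. pose proof (egrowth_C _ _ _ Hw) as HC.
rewrite <- Rmult_assoc. apply lattice_II_bound. split; [apply Rmult_le_pos; lra|]. split.
- intros v. apply (cls_cont (base w)). apply cls_baseE. exists C, k; auto.
- intros v u Hv Hu. eapply Rle_trans; [apply (base_dom w C k (Rabs x) (/ y) y 2); auto; try lra|].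
  + apply Rinv_0_lt_compat; auto.
  + rewrite Rinv_inv; lra.
  + apply Rmult_le_compat_l; [apply Rmult_le_pos; [apply Rmult_le_pos; lra|left; apply pw_pos]|]. apply exp_le. lra.
Qed.

Definition LamW_partial (x y : R) (s : Cplx) (N : nat) : Cplx := Csum (fun j => Cmul (RtoC (LamW (W (S (S j))) x y)) (Cpow s j)) N.

Definition W_partial (s : Cplx) (N : nat) (u : R) : Cplx := Csum (fun j => Cmul (RtoC (W (S (S j)) u)) (Cpow s j)) N.

Lemma W_partial_expP s N u : W_partial s N u = Cadd (exp_partial s N u) (Cmul (RtoC (exp u)) (exp_partial s N (- u))).
Proof.
unfold W_partial, exp_partial. induction N as [|N IH]; simpl Csum; [ring|]. rewrite IH.
replace (RtoC (W (S (S N)) u)) with (Cadd (RtoC (u ^ N / INR (fact N))) (Cmul (RtoC ((- u) ^ N / INR (fact N))) (RtoC (exp u)))).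
- ring.
- unfold W, wA, wB. apply Ceq; simpl; ring.
Qed.

Lemma LamW_partial_LamW p s N x y : Clin p -> 0 < y -> egrowthE (fun u => p (W_partial s N u)) /\ p (LamW_partial x y s N) = LamW (fun u => p (W_partial s N u)) x y.
Proof.
intros [H0 [Ha Hs]] Hy. induction N as [|N [IH1 IH2]].
- unfold W_partial, LamW_partial. simpl Csum. rewrite H0. split; [apply egrowthE_const|].
  transitivity (0 * LamW (fun _ => 0) x y); [ring|]. rewrite <- LamW_scal; auto; [|apply egrowthE_const].
  apply LamW_ext; intros; ring.
- assert (E : forall u, p (W_partial s (S N) u) = p (W_partial s N u) + p (Cpow s N) * W (S (S N)) u).
  { intros u. unfold W_partial. simpl Csum. rewrite Ha, Hs. ring. }
  assert (Hw : egrowthE (fun u => p (Cpow s N) * W (S (S N)) u)) by (apply egrowthE_scal, egrowthE_W).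
  split.
  + apply egrowthE_ext with (fun u => p (W_partial s N u) + p (Cpow s N) * W (S (S N)) u); [intros; rewrite E; auto|].
    apply egrowthE_plus; auto.
  + rewrite (LamW_ext _ _ x y E), LamW_plus, LamW_scal, <- IH2; auto; [|apply egrowthE_W].
    unfold LamW_partial. simpl Csum. rewrite Ha, Hs. ring.
Qed.

Lemma Lambda_proj p x y s : p = Re \/ p = Im -> p (Lambda x y s) = LamW (fun u => p (ce s u)) x y.
Proof. intros [->| ->]; auto. Qed.

Lemma egrowthE_ce p s : p = Re \/ p = Im -> egrowthE (fun u => p (ce s u)).
Proof. intros [->| ->]; [apply egrowthE_ceRe|apply egrowthE_ceIm]. Qed.

Lemma Cnorm1_ge0 s : 0 <= Cnorm1 s.
Proof. unfold Cnorm1. pose proof (Rabs_pos (Re s)). pose proof (Rabs_pos (Im s)). lra. Qed.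

Lemma LamW_partial_cv x y s : 0 < y -> exists M, 0 <= M /\ forall N,
  Cnorm (Csub (LamW_partial x y s N) (Cadd (Lambda x y s) (Lambda x y (Csub C1 s)))) <= (/ 2) ^ N * M.
Proof.
(* The additional 1 in the rate covers the factor e^u in front of the reflected exponential. *)
intros Hy. pose proof (Cnorm1_ge0 s) as HK. set (k := 3 * Cnorm1 s + 1).
destruct (LamW_egrowth_bound x y k Hy) as [M [HM HB]]; [unfold k; lra|].
exists (4 * M). split; [lra|]. intros N.
assert (H : forall p, p = Re \/ p = Im -> Rabs (p (Csub (LamW_partial x y s N) (Cadd (Lambda x y s) (Lambda x y (Csub C1 s))))) <= (/ 2) ^ N * (2 * M)).
{ intros p Hp. pose proof (Clin_proj p Hp) as Hl.
  destruct (LamW_partial_LamW p s N x y Hl Hy) as [W1 E1].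
  pose proof (egrowthE_ce p s Hp) as W2. pose proof (egrowthE_ce p (Csub C1 s) Hp) as W3.
  pose proof (egrowthE_plus _ _ W2 W3) as W4.
  rewrite Clin_sub by auto. rewrite E1, (proj1 (proj2 Hl)), !Lambda_proj by auto.
  rewrite <- (LamW_plus _ _ x y W2 W3 Hy), <- (LamW_minus _ _ x y W1 W4 Hy).
  rewrite (Rmult_comm 2 M), (Rmult_comm M 2), <- Rmult_assoc. apply HB. split; [|split; [unfold k; lra|]].
  - destruct (egrowthE_minus _ _ W1 W4) as [? [? [Hc _]]]. exact Hc.
  - intros u. replace (p (W_partial s N u) - (p (ce s u) + p (ce (Csub C1 s) u))) with (- (p (exp_remainder s N u) + exp u * p (exp_remainder s N (- u)))).
    + rewrite Rabs_Ropp. eapply Rle_trans; [apply Rabs_triang|]. rewrite Rabs_mult, (Rabs_pos_eq (exp u)) by (left; apply exp_pos).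
      pose proof (exp_remainder_bound p s N u Hp) as B1. pose proof (exp_remainder_bound p s N (- u) Hp) as B2. rewrite Rabs_Ropp in B2.
      assert (HX : exp (k * Rabs u) = exp (3 * Cnorm1 s * Rabs u) * exp (Rabs u)) by (rewrite <- exp_plus; f_equal; unfold k; ring).
      rewrite HX. set (X := exp (3 * Cnorm1 s * Rabs u)) in *. set (q := (/ 2) ^ N) in *.
      assert (Hq : 0 <= q) by (apply pow_le; lra). assert (HX0 : 0 < X) by apply exp_pos.
      assert (H1 : 1 <= exp (Rabs u)) by (rewrite <- exp_0 at 1; apply exp_le, Rabs_pos).
      assert (H2 : exp u <= exp (Rabs u)) by (apply exp_le, Rle_abs).
      assert (HqX : 0 <= q * X) by (apply Rmult_le_pos; lra).
      apply Rle_trans with (q * X * exp (Rabs u) + exp (Rabs u) * (q * X)); [|apply Req_le; ring].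
      apply Rplus_le_compat.
      * apply Rle_trans with (q * X * 1); [lra|]. apply Rmult_le_compat_l; lra.
      * apply Rmult_le_compat; auto using Rabs_pos. left; apply exp_pos.
    + rewrite W_partial_expP, ce_reflect. unfold exp_remainder. destruct Hl as [H0 [Ha Hs]].
      rewrite !Clin_sub, !Ha, !Hs by (split; auto). ring. }
eapply Rle_trans; [apply Cnorm_le_sum|]. pose proof (H Re (or_introl eq_refl)). pose proof (H Im (or_intror eq_refl)). lra.
Qed.

(* The coefficient of [s^n] in [hhE0 x y s]. *)
Definition F_real (n : nat) (x y : R) : R := (if Nat.eqb n 0 then 1 / 2 else 0) + 1 / 2 * (LamW (W n) x y - LamW (W (S n)) x y).

Lemma LamW_W0 x y : 0 < y -> LamW (W 0) x y = 0 /\ LamW (W 1) x y = 0.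
Proof.
intros Hy. assert (H : LamW (fun _ => 0) x y = 0).
{ transitivity (0 * LamW (fun _ => 0) x y); [|ring]. rewrite <- LamW_scal; auto; [|apply egrowthE_const]. apply LamW_ext; intros; ring. }
split; (transitivity (LamW (fun _ => 0) x y); [apply LamW_ext; intros; unfold W, wA, wB; ring|exact H]).
Qed.

(** Multiplication by s^2 - s shifts indices by two and by one; this is why partial sums of lengths
    N and N + 1 face N + 2 coefficients. *)
Lemma Csum_F_real x y s N : 0 < y -> Csum (fun n => Cmul (RtoC (F_real n x y)) (Cpow s n)) (S (S N)) =
  Cadd (RtoC (1 / 2)) (Cmul (RtoC (1 / 2)) (Csub (Cmul (Cmul s s) (LamW_partial x y s N)) (Cmul s (LamW_partial x y s (S N))))).
Proof.
intros Hy. destruct (LamW_W0 x y Hy) as [E0 E1].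
assert (HE : forall n, RtoC (F_real (S (S n)) x y) = Cmul (RtoC (1 / 2)) (Csub (RtoC (LamW (W (S (S n))) x y)) (RtoC (LamW (W (S (S (S n)))) x y)))).
{ intros n. unfold F_real. simpl Nat.eqb. apply Ceq; simpl; ring. }
induction N as [|N IH].
- unfold LamW_partial. simpl Csum. simpl Cpow.
  assert (H0 : RtoC (F_real 0 x y) = RtoC (1 / 2)) by (unfold F_real; rewrite E0, E1; simpl; f_equal; ring).
  assert (H1 : RtoC (F_real 1 x y) = Cmul (RtoC (1 / 2)) (Copp (RtoC (LamW (W 2) x y)))) by (unfold F_real; rewrite E1; apply Ceq; simpl; ring).
  rewrite H0, H1. ring.
- change (Cadd (Csum (fun n => Cmul (RtoC (F_real n x y)) (Cpow s n)) (S (S N))) (Cmul (RtoC (F_real (S (S N)) x y)) (Cpow s (S (S N)))) =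
    Cadd (RtoC (1 / 2)) (Cmul (RtoC (1 / 2)) (Csub (Cmul (Cmul s s) (LamW_partial x y s (S N))) (Cmul s (LamW_partial x y s (S (S N))))))).
  rewrite IH, HE. unfold LamW_partial. simpl Csum. simpl Cpow. ring.
Qed.

Lemma Cseries_hhE0 x y s : 0 < y -> Cseries_cv (fun n => Cmul (RtoC (F_real n x y)) (Cpow s n)) (hhE0 x y s).
Proof.
intros Hy. destruct (LamW_partial_cv x y s Hy) as [M [HM HB]]. set (A := Cadd (Lambda x y s) (Lambda x y (Csub C1 s))) in *.
set (B := (Cnorm s * Cnorm s + Cnorm s) * M).
pose proof (Cnorm_ge0 s) as Hs. assert (HB0 : 0 <= B) by (unfold B; apply Rmult_le_pos; auto; nra).
intros eps He. destruct (pow_lt_1_zero (/ 2) ltac:(rewrite Rabs_pos_eq; lra) (eps / (B + 1))) as [N0 HN0]; [apply Rdiv_lt_0_compat; lra|].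
exists (S (S N0)). intros n Hn. destruct n as [|[|N]]; [lia|lia|].
rewrite Csum_F_real by auto. specialize (HN0 N ltac:(lia)). rewrite Rabs_pos_eq in HN0 by (apply pow_le; lra).
replace (Csub _ (hhE0 x y s)) with (Cmul (RtoC (1 / 2)) (Cadd (Cmul (Cmul s s) (Csub (LamW_partial x y s N) A)) (Copp (Cmul s (Csub (LamW_partial x y s (S N)) A))))).
- rewrite Cnorm_mul, Cnorm_RtoC, (Rabs_pos_eq (1 / 2)) by lra.
  assert (H : Cnorm (Cadd (Cmul (Cmul s s) (Csub (LamW_partial x y s N) A)) (Copp (Cmul s (Csub (LamW_partial x y s (S N)) A)))) <= (/ 2) ^ N * B).
  { eapply Rle_trans; [apply Cnorm_triang|]. rewrite Cnorm_opp, !Cnorm_mul.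
    pose proof (HB N) as B1. pose proof (HB (S N)) as B2. simpl pow in B2.
    assert (0 <= (/ 2) ^ N) by (apply pow_le; lra).
    assert (/ 2 * (/ 2) ^ N * M <= (/ 2) ^ N * M) by (apply Rmult_le_compat_r; auto; lra).
    unfold B. replace ((/ 2) ^ N * ((Cnorm s * Cnorm s + Cnorm s) * M)) with (Cnorm s * Cnorm s * ((/ 2) ^ N * M) + Cnorm s * ((/ 2) ^ N * M)) by ring.
    apply Rplus_le_compat; apply Rmult_le_compat_l; auto; try nra. }
  assert ((/ 2) ^ N * (B + 1) < eps).
  { apply Rmult_lt_compat_r with (r := B + 1) in HN0; [|lra]. replace (eps / (B + 1) * (B + 1)) with eps in HN0 by (field; lra). auto. }
  assert (0 <= (/ 2) ^ N) by (apply pow_le; lra). nra.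
- unfold hhE0. fold A. ring.
Qed.

Lemma is_taylor_F_real z : inH z -> is_taylor_hhE 0 z (fun n => RtoC (F_real n (Re z) (Im z))).
Proof.
intros Hz s. exists (hhE0 (Re z) (Im z) s). split; [apply Cseries_hhE0; auto|].
intros Hs. apply hhE_val_hhE0; auto. simpl in Hs; lra.
Qed.

(** * Uniqueness of the Taylor coefficients *)

Lemma fact_add_le n k : INR (fact (n + k)) <= 2 ^ (n + k) * (INR (fact n) * INR (fact k)).
Proof.
revert k. induction n as [|n IH]; intros k.
- simpl fact. rewrite Rmult_1_l. simpl (0 + k)%nat. pose proof (pos_INR (fact k)). pose proof (pow_R1_Rle 2 k ltac:(lra)). simpl INR at 2. nra.
- induction k as [|k IHk].
  + rewrite Nat.add_0_r. simpl (fact 0). simpl (INR 1). pose proof (pos_INR (fact (S n))). pose proof (pow_R1_Rle 2 (S n) ltac:(lra)). nra.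
  + specialize (IH (S k)). replace (S n + S k)%nat with (S (n + S k)) by lia. rewrite fact_simpl, mult_INR.
    replace (S (n + S k)) with (S n + S k)%nat at 1 by lia. rewrite plus_INR.
    replace (n + S k)%nat with (S n + k)%nat in * by lia. 
    assert (En : INR (fact (S n)) = INR (S n) * INR (fact n)) by (rewrite fact_simpl, mult_INR; auto).
    assert (Ek : INR (fact (S k)) = INR (S k) * INR (fact k)) by (rewrite fact_simpl, mult_INR; auto).
    pose proof (pos_INR (S n)). pose proof (pos_INR (S k)).
    assert (H1 := Rmult_le_compat_l _ _ _ H IH). assert (H2 := Rmult_le_compat_l _ _ _ H0 IHk).
    rewrite Ek in *. rewrite En in *. change (2 ^ S (S n + k)) with (2 * 2 ^ (S n + k)). set (X := 2 ^ (S n + k)) in *.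
    set (a := INR (S n)) in *. set (b := INR (S k)) in *. set (F := INR (fact (S n + k))) in *.
    (* Pascal's rule: the factor a + b is split, and each summand is covered by one of the two
       induction hypotheses. *)
    replace (2 * X * (a * INR (fact n) * (b * INR (fact k)))) with (a * (X * (INR (fact n) * (b * INR (fact k)))) + b * (X * (a * INR (fact n) * INR (fact k)))) by ring.
    lra.
Qed.

Lemma geom_zero B r : (forall N, Rabs r <= B * (/ 2) ^ S N) -> r = 0.
Proof.
intros H. apply Rle_eps_eq. intros eps He. rewrite Rminus_0_r.
assert (HB : 0 <= B) by (specialize (H 0%nat); pose proof (Rabs_pos r); simpl in H; lra).
destruct (pow_lt_1_zero (/ 2) ltac:(rewrite Rabs_pos_eq; lra) (eps / (B + 1))) as [N HN]; [apply Rdiv_lt_0_compat; lra|].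
specialize (HN (S N) ltac:(lia)). rewrite Rabs_pos_eq in HN by (apply pow_le; lra).
apply Rmult_lt_compat_r with (r := B + 1) in HN; [|lra]. replace (eps / (B + 1) * (B + 1)) with eps in HN by (field; lra).
specialize (H N). assert (0 <= (/ 2) ^ S N) by (apply pow_le; lra). nra.
Qed.

Lemma entire_radius d : (forall r, ex_series (fun n => d n * r ^ n)) -> forall x, Rbar_lt (Finite x) (CV_radius d).
Proof.
intros H x. destruct (CV_radius_bounded d) as [Hu _].
assert (Hb : exists M, forall n, Rabs (d n * (x + 1) ^ n) <= M).
{ pose proof (ex_series_lim_0 _ (H (x + 1))) as Hl.
  destruct (filterlim_bounded (K := R_AbsRing) (V := R_NormedModule) (fun n => d n * (x + 1) ^ n)) as [M HM]; [exists 0; exact Hl|].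
  exists M. exact HM. }
specialize (Hu (x + 1) Hb). apply Rbar_lt_le_trans with (2 := Hu). simpl. lra.
Qed.

(* Taylor expansion at [-2], where all derivatives vanish, reaches a neighbourhood of [0]. *)
Lemma entire_zero_neg d : (forall r, ex_series (fun n => d n * r ^ n)) -> (forall r, r < -1 -> PSeries d r = 0) -> forall n, d n = 0.
Proof.
intros Hex Hz. pose proof (entire_radius d Hex) as Hrad.
destruct (CV_radius_bounded d) as [Hu _].
(* The radius 12 fixes the constants. From |d_m| <= B 12^(-m) and binomials at most 2^(n+k),
   derivatives of order n on |t| <= 3 are at most 2 B n! 6^(-n), the inner series having ratio 2/12
   times 3, that is 1/2. Points of (-1, 1) are within 3 of -2, and 3/6 = 1/2 beats the
   factorials. *)
assert (Hb : exists B, forall n, Rabs (d n * 12 ^ n) <= B).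
{ destruct (filterlim_bounded (K := R_AbsRing) (V := R_NormedModule) (fun n => d n * 12 ^ n)) as [M HM]; [|exists M; exact HM].
  exists 0. exact (ex_series_lim_0 _ (Hex 12)). }
destruct Hb as [B HB].
assert (HB0 : 0 <= B) by (eapply Rle_trans; [apply Rabs_pos|apply (HB 0%nat)]).
assert (Hd : forall m, Rabs (d m) <= B * (/ 12) ^ m).
{ intros m. specialize (HB m). rewrite Rabs_mult, (Rabs_pos_eq (12 ^ m)) in HB by (apply pow_le; lra).
  assert (Hp : 0 < (/ 12) ^ m) by (apply pow_lt; lra).
  apply Rmult_le_compat_r with (r := (/ 12) ^ m) in HB; [|lra].
  rewrite Rmult_assoc, <- Rpow_mult_distr in HB. replace (12 * / 12) with 1 in HB by field. rewrite pow1, Rmult_1_r in HB. auto. }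
assert (Hgeo : ex_series (fun k => (/ 2) ^ k)) by (apply ex_series_geom; rewrite Rabs_pos_eq; lra).
assert (HD : forall n t, Rabs t <= 3 -> Rabs (Derive_n (PSeries d) n t) <= 2 * B * INR (fact n) * (/ 6) ^ n).
{ intros n t Ht. rewrite Derive_n_PSeries by apply Hrad. unfold PSeries.
  set (c := B * INR (fact n) * (/ 6) ^ n).
  assert (Hc : forall k, Rabs (PS_derive_n n d k * t ^ k) <= c * (/ 2) ^ k).
  { intros k. unfold PS_derive_n, Rdiv. rewrite !Rabs_mult, Rabs_inv, <- RPow_abs, !(Rabs_pos_eq (INR _)) by apply pos_INR.
    pose proof (fact_add_le n k) as Hf. pose proof (INR_fact_lt_0 k) as Hk. pose proof (INR_fact_lt_0 n) as Hn.
    replace (k + n)%nat with (n + k)%nat by lia.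
    apply Rle_trans with (2 ^ (n + k) * INR (fact n) * (B * (/ 12) ^ (n + k)) * 3 ^ k).
    - apply Rmult_le_compat; [|apply pow_le, Rabs_pos| |apply pow_incr; split; auto using Rabs_pos].
      + apply Rmult_le_pos; [|apply Rabs_pos]. apply Rmult_le_pos; [apply pos_INR|]. left; apply Rinv_0_lt_compat; auto.
      + apply Rmult_le_compat; auto using Rabs_pos.
        * apply Rmult_le_pos; [apply pos_INR|]. left; apply Rinv_0_lt_compat; auto.
        * apply Rmult_le_reg_r with (INR (fact k)); auto. rewrite Rmult_assoc, Rinv_l, Rmult_1_r by lra. lra.
    - apply Req_le. unfold c. rewrite !pow_add.
      replace (2 ^ n * 2 ^ k * INR (fact n) * (B * ((/ 12) ^ n * (/ 12) ^ k)) * 3 ^ k)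
        with (B * INR (fact n) * ((2 ^ n * (/ 12) ^ n) * (2 ^ k * (/ 12) ^ k * 3 ^ k))) by ring.
      rewrite <- !Rpow_mult_distr. replace (2 * / 12) with (/ 6) by field. replace (/ 6 * 3) with (/ 2) by field. ring. }
  assert (He : ex_series (fun k => c * (/ 2) ^ k)) by (apply (ex_series_scal_l c (fun k => (/ 2) ^ k)); auto).
  eapply Rle_trans; [apply Series_Rabs; apply (ex_series_le (K := R_AbsRing) (V := R_CompleteNormedModule)) with (2 := He)|].
  - intros k. simpl. unfold norm; simpl. unfold abs; simpl. rewrite Rabs_Rabsolu. apply Hc.
  - eapply Rle_trans; [apply Series_le with (2 := He); intros k; split; [apply Rabs_pos|apply Hc]|].
    rewrite Series_scal_l, Series_geom by (rewrite Rabs_pos_eq; lra). apply Req_le. unfold c. field. }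
assert (Hm2 : forall n, Derive_n (PSeries d) n (-2) = 0).
{ intros n. rewrite (Derive_n_ext_loc _ (fun _ => 0)).
  - destruct n; [auto|apply Derive_n_const].
  - exists (mkposreal 1 Rlt_0_1). intros t Ht. apply Hz. apply Rabs_def2 in Ht. simpl in Ht. unfold minus, plus, opp in Ht; simpl in Ht. lra. }
assert (H0 : forall y, -1 < y < 1 -> PSeries d y = 0).
{ intros y Hy. apply (geom_zero (2 * B)). intros N.
  (* All terms of the Taylor polynomial at -2 vanish, so the value is its own Lagrange remainder,
     for every order. *)
  destruct (Taylor_Lagrange (PSeries d) N (-2) y) as [zt [Hzt E]]; [lra|intros; apply ex_derive_n_PSeries, Hrad|].
  assert (ES : sum_f_R0 (fun m => (y - -2) ^ m / INR (fact m) * Derive_n (PSeries d) m (-2)) N = 0).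
  { apply sum_eq_R0. intros m _. rewrite Hm2. ring. }
  rewrite ES, Rplus_0_l in E. rewrite E. rewrite Rabs_mult.
  pose proof (INR_fact_lt_0 (S N)) as Hf.
  apply Rle_trans with (3 ^ S N * / INR (fact (S N)) * (2 * B * INR (fact (S N)) * (/ 6) ^ S N)).
  - apply Rmult_le_compat; auto using Rabs_pos.
    + unfold Rdiv. rewrite Rabs_mult, <- RPow_abs, Rabs_inv, (Rabs_pos_eq (INR _)) by apply pos_INR.
      apply Rmult_le_compat_r; [left; apply Rinv_0_lt_compat; auto|]. apply pow_incr. split; [apply Rabs_pos|]. apply Rabs_le; lra.
    + apply HD. apply Rabs_le; lra.
  - replace (3 ^ S N * / INR (fact (S N)) * (2 * B * INR (fact (S N)) * (/ 6) ^ S N)) with (2 * B * (3 ^ S N * (/ 6) ^ S N)) by (field; lra).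
    rewrite <- Rpow_mult_distr. replace (3 * / 6) with (/ 2) by field. apply Rle_refl. }
intros n. assert (E : d n * INR (fact n) = 0).
{ rewrite <- Derive_n_coef by apply Hrad. rewrite (Derive_n_ext_loc _ (fun _ => 0)).
  - destruct n; [auto|apply Derive_n_const].
  - exists (mkposreal 1 Rlt_0_1). intros t Ht. apply Rabs_def2 in Ht. simpl in Ht. unfold minus, plus, opp in Ht; simpl in Ht.
    apply H0; lra. }
pose proof (INR_fact_lt_0 n). apply Rmult_integral in E. destruct E; [auto|lra].
Qed.

Lemma hhE_val_unique k z s v v' : hhE_val k z s v -> hhE_val k z s v' -> v = v'.
Proof.
intros [e [g [He [Hg Hv]]]] [e' [g' [He' [Hg' Hv']]]].
rewrite (Cseq_cv_unique _ _ _ He He'), (Cseq_cv_unique _ _ _ Hg Hg') in Hv. congruence.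
Qed.

Lemma Cpow_RtoC r n : Cpow (RtoC r) n = RtoC (r ^ n).
Proof. induction n as [|n IH]; [auto|]. simpl Cpow. rewrite IH. apply Ceq; simpl; ring. Qed.

Lemma Cseries_is_series p a v r : p = Re \/ p = Im -> Cseries_cv (fun n => Cmul (a n) (Cpow (RtoC r) n)) v ->
  is_series (fun n => p (a n) * r ^ n) (p v).
Proof.
intros Hp H. pose proof (Clin_proj p Hp) as [H0 [Ha Hs]].
assert (E : forall N, sum_n (fun n => p (a n) * r ^ n) N = p (Csum (fun n => Cmul (a n) (Cpow (RtoC r) n)) (S N))).
{ assert (Ht : forall n, p (Cmul (a n) (Cpow (RtoC r) n)) = p (a n) * r ^ n).
  { intros n. rewrite Cpow_RtoC. replace (Cmul (a n) (RtoC (r ^ n))) with (Cmul (RtoC (r ^ n)) (a n)) by ring. rewrite Hs; ring. }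
  intros N. induction N as [|N IH].
  - rewrite sum_O. change (p (a 0%nat) * r ^ 0 = p (Cadd C0 (Cmul (a 0%nat) (Cpow (RtoC r) 0)))). rewrite Ha, H0, Ht. ring.
  - rewrite sum_Sn, IH. change (p (Csum (fun n => Cmul (a n) (Cpow (RtoC r) n)) (S N)) + p (a (S N)) * r ^ S N = p (Cadd (Csum (fun n => Cmul (a n) (Cpow (RtoC r) n)) (S N)) (Cmul (a (S N)) (Cpow (RtoC r) (S N))))).
    rewrite Ha, Ht. auto. }
assert (HL : is_lim_seq (sum_n (fun n => p (a n) * r ^ n)) (p v)); [|exact HL].
apply is_lim_seq_spec. intros eps. destruct (H eps (cond_pos eps)) as [N HN]. exists N. intros n Hn.
rewrite E. eapply Rle_lt_trans; [|apply (HN (S n)); lia]. rewrite <- Clin_sub by (split; auto).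
destruct Hp as [->| ->]; [apply Re_le_Cnorm|apply Im_le_Cnorm].
Qed.

(** The two series agree for real s > 1. Putting s = -r moves this half-line to r < -1, from where
    the Taylor formula, which expands to the right of its base point, reaches 0; the coefficients
    acquire signs (-1)^n. *)
Lemma taylor_unique z a b : is_taylor_hhE 0 z a -> is_taylor_hhE 0 z b -> forall n, a n = b n.
Proof.
intros Ha Hb.
assert (H : forall p, p = Re \/ p = Im -> forall n, p (a n) = p (b n)).
{ intros p Hp.
  assert (Hd : forall n, (-1) ^ n * (p (a n) - p (b n)) = 0).
  { assert (HS : forall r, exists l, is_series (fun n => (-1) ^ n * (p (a n) - p (b n)) * r ^ n) l /\ (r < -1 -> l = 0)).
    { intros r. destruct (Ha (RtoC (- r))) as [v [Hv1 Hv2]]. destruct (Hb (RtoC (- r))) as [v' [Hv1' Hv2']].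
      exists (p v - p v'). split.
      - pose proof (is_series_minus _ _ _ _ (Cseries_is_series p a v (- r) Hp Hv1) (Cseries_is_series p b v' (- r) Hp Hv1')) as Hm.
        apply (is_series_ext _ _ (p v - p v')) with (2 := Hm). intros n.
        change (p (a n) * (- r) ^ n - p (b n) * (- r) ^ n = (-1) ^ n * (p (a n) - p (b n)) * r ^ n).
        replace (- r) with ((-1) * r) by ring. rewrite Rpow_mult_distr. ring.
      - intros Hr. assert (Hr2 : 2 * Re (RtoC (- r)) + 0 > 2) by (simpl; lra).
        rewrite (hhE_val_unique _ _ _ _ _ (Hv2 Hr2) (Hv2' Hr2)). apply Rminus_diag_eq; auto. }
    apply entire_zero_neg.
    - intros r. destruct (HS r) as [l [Hl _]]. exists l; exact Hl.
    - intros r Hr. destruct (HS r) as [l [Hl H0]]. rewrite (H0 Hr) in Hl. exact (is_series_unique _ _ Hl). }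
  intros n. specialize (Hd n). apply Rmult_integral in Hd. destruct Hd as [Hd|Hd]; [|lra].
  exfalso. revert Hd. apply pow_nonzero. lra. }
intros n. apply Ceq; apply H; auto.
Qed.

(** [is_taylor_F_real] shows that the predicate under [epsilon] is satisfiable, so the chosen
    sequence satisfies it, and uniqueness identifies it. *)
Lemma F_n_F_real n z : inH z -> F_n n z = RtoC (F_real n (Re z) (Im z)).
Proof.
intros Hz. pose proof (is_taylor_F_real z Hz) as H.
change (epsilon (inhabits (fun _ : nat => C0)) (is_taylor_hhE 0 z) n = RtoC (F_real n (Re z) (Im z))).
apply (taylor_unique z (epsilon (inhabits (fun _ : nat => C0)) (is_taylor_hhE 0 z)) (fun n => RtoC (F_real n (Re z) (Im z)))); auto.
apply epsilon_spec. eexists; exact H.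
Qed.

(** * Weight-zero forms *)

Definition comp (p : Cplx -> R) (f : Cplx -> Cplx) (x y : R) : R := p (f (mkC x y)).

Definition lift (u v : R -> R -> R) (z : Cplx) : Cplx := mkC (u (Re z) (Im z)) (v (Re z) (Im z)).

Definition eq_on_H (f g : Cplx -> Cplx) : Prop := forall z, inH z -> f z = g z.

Lemma mkC_eta z : mkC (Re z) (Im z) = z.
Proof. destruct z; auto. Qed.

Lemma eq_on_H_comp f g : eq_on_H f g <-> eq_half (comp Re f) (comp Re g) /\ eq_half (comp Im f) (comp Im g).
Proof.
split.
- intros H. split; intros x y Hy; unfold comp; rewrite H; auto.
- intros [H1 H2] z Hz. rewrite <- (mkC_eta z). apply Ceq; [apply H1|apply H2]; auto.
Qed.

Lemma dx_pdx f g : is_dx f g <-> pdx (comp Re f) (comp Re g) /\ pdx (comp Im f) (comp Im g).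
Proof.
split.
- intros H. split; intros x y Hy; apply is_derive_Reals; apply (H (mkC x y) Hy).
- intros [H1 H2] [x y] Hz. split; apply is_derive_Reals; [apply H1|apply H2]; auto.
Qed.

Lemma dy_pdy f g : is_dy f g <-> pdy (comp Re f) (comp Re g) /\ pdy (comp Im f) (comp Im g).
Proof.
split.
- intros H. split; intros x y Hy; apply is_derive_Reals; apply (H (mkC x y) Hy).
- intros [H1 H2] [x y] Hz. split; apply is_derive_Reals; [apply H1|apply H2]; auto.
Qed.

Lemma cont_cont2 f : continuous_on_H f <-> cont2 (comp Re f) /\ cont2 (comp Im f).
Proof.
split.
- intros H. assert (Hp : forall p, p = Re \/ p = Im -> cont2 (comp p f)).
  { intros p Hp x y Hy eps He. destruct (H (mkC x y) Hy eps He) as [d [Hd Hd']]. exists (d / 2). split; [lra|].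
    intros x' y' Hy' Hx1 Hy1. unfold comp. rewrite <- Clin_sub by (apply Clin_proj; auto).
    eapply Rle_lt_trans; [|apply (Hd' (mkC x' y')); auto].
    - destruct Hp as [->| ->]; [apply Re_le_Cnorm|apply Im_le_Cnorm].
    - eapply Rle_lt_trans; [apply Cnorm_le_sum|]. simpl. unfold Rminus in *. lra. }
  split; apply Hp; auto.
- intros [H1 H2] [x y] Hz eps He. destruct (H1 x y Hz (eps / 2)) as [d [Hd Hd']]; [lra|]. destruct (H2 x y Hz (eps / 2)) as [e [He' He'']]; [lra|].
  exists (Rmin d e). split; [apply Rmin_pos; auto|]. intros [x' y'] Hw Hn.
  assert (HR : Rabs (x' - x) < Rmin d e) by (eapply Rle_lt_trans; [apply (Re_le_Cnorm (Csub (mkC x' y') (mkC x y)))|auto]).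
  assert (HI : Rabs (y' - y) < Rmin d e) by (eapply Rle_lt_trans; [apply (Im_le_Cnorm (Csub (mkC x' y') (mkC x y)))|auto]).
  pose proof (Rmin_l d e). pose proof (Rmin_r d e).
  eapply Rle_lt_trans; [apply Cnorm_le_sum|].
  specialize (Hd' x' y' Hw ltac:(lra) ltac:(lra)). specialize (He'' x' y' Hw ltac:(lra) ltac:(lra)). unfold comp in *.
  rewrite !(Clin_sub _ _ _ Clin_Re), !(Clin_sub _ _ _ Clin_Im). lra.
Qed.

Lemma smooth_comp p : p = Re \/ p = Im -> forall f, smooth_on_H f -> smooth2 (comp p f).
Proof.
intros Hp. cofix IH. intros f [fx fy Hc Hx Hy Sx Sy].
apply (smooth2_intro (comp p f) (comp p fx) (comp p fy)).
- clear IH. destruct (proj1 (cont_cont2 f) Hc); destruct Hp as [->| ->]; auto.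
- clear IH. destruct (proj1 (dx_pdx f fx) Hx); destruct Hp as [->| ->]; auto.
- clear IH. destruct (proj1 (dy_pdy f fy) Hy); destruct Hp as [->| ->]; auto.
- apply IH; auto.
- apply IH; auto.
Qed.

Lemma comp_smooth : forall f, smooth2 (comp Re f) -> smooth2 (comp Im f) -> smooth_on_H f.
Proof.
(* The components are abstracted to [u] and [v], tied to [f] by equations, so that the corecursion
   can open both proofs of [smooth2] and restart from [lift] of the derivatives. *)
assert (H : forall u v, smooth2 u -> smooth2 v -> forall f, comp Re f = u -> comp Im f = v -> smooth_on_H f).
{ cofix IH. intros u v [ux uy Cu Ux Uy Sx Sy] [vx vy Cv Vx Vy Tx Ty] f Eu Ev.
  apply (smooth_intro f (lift ux vx) (lift uy vy)).
  - clear IH. apply cont_cont2. rewrite Eu, Ev; auto.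
  - clear IH. apply dx_pdx. rewrite Eu, Ev; auto.
  - clear IH. apply dy_pdy. rewrite Eu, Ev; auto.
  - apply (IH ux vx); auto.
  - apply (IH uy vy); auto. }
intros f H1 H2. apply (H _ _ H1 H2); auto.
Qed.

(** At weight 0 the first-order term carries the factor k = 0, so real and imaginary parts
    decouple. *)
Lemma Delta_lap f g : is_Delta 0 f g <-> lap (comp Re f) (comp Re g) /\ lap (comp Im f) (comp Im g).
Proof.
assert (E0 : forall z a, Cmul (Cmul Ci (RtoC (0 * Im z))) a = C0) by (intros; apply Ceq; simpl; ring).
split.
- intros [fx [fy [fxx [fyy [H1 [H2 [H3 [H4 H5]]]]]]]].
  apply dx_pdx in H1, H3. apply dy_pdy in H2, H4.
  split.
  + exists (comp Re fx), (comp Re fy), (comp Re fxx), (comp Re fyy).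
    split; [apply H1|]. split; [apply H2|]. split; [apply H3|]. split; [apply H4|].
    intros x y Hy. unfold comp. rewrite H5 by auto. simpl. ring.
  + exists (comp Im fx), (comp Im fy), (comp Im fxx), (comp Im fyy).
    split; [apply H1|]. split; [apply H2|]. split; [apply H3|]. split; [apply H4|].
    intros x y Hy. unfold comp. rewrite H5 by auto. simpl. ring.
- intros [[ux [uy [uxx [uyy [H1 [H2 [H3 [H4 H5]]]]]]]] [vx [vy [vxx [vyy [K1 [K2 [K3 [K4 K5]]]]]]]]].
  exists (lift ux vx), (lift uy vy), (lift uxx vxx), (lift uyy vyy).
  split; [apply dx_pdx; auto|]. split; [apply dy_pdy; auto|]. split; [apply dx_pdx; auto|]. split; [apply dy_pdy; auto|].
  intros [x y] Hz. specialize (H5 x y Hz). specialize (K5 x y Hz). unfold comp in *.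
  rewrite E0. apply Ceq; simpl; [rewrite H5|rewrite K5]; ring.
Qed.

Lemma lap_ext u u' h h' : eq_half u u' -> eq_half h h' -> lap u h -> lap u' h'.
Proof.
intros E E' [ux [uy [uxx [uyy [H1 [H2 [H3 [H4 H5]]]]]]]]. exists ux, uy, uxx, uyy.
split; [apply pdx_ext with u ux; auto; intros x y _; auto|]. split; [apply pdy_ext with u uy; auto; intros x y _; auto|].
split; auto. split; auto. intros x y Hy. rewrite <- E' by auto; auto.
Qed.

Lemma lap_unique u h h' : lap u h -> lap u h' -> eq_half h h'.
Proof.
intros [ux [uy [uxx [uyy [H1 [H2 [H3 [H4 H5]]]]]]]] [vx [vy [vxx [vyy [K1 [K2 [K3 [K4 K5]]]]]]]] x y Hy.
rewrite H5, K5 by auto. do 2 f_equal.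
- apply (pdx_unique ux); auto. apply pdx_ext with vx vxx; auto; intros a b Hb; [apply (pdx_unique u); auto|auto].
- apply (pdy_unique uy); auto. apply pdy_ext with vy vyy; auto; intros a b Hb; [apply (pdy_unique u); auto|auto].
Qed.

Lemma pdx_lin u v ux vx a b : pdx u ux -> pdx v vx -> pdx (fun x y => a * u x y + b * v x y) (fun x y => a * ux x y + b * vx x y).
Proof.
intros H K x y Hy. apply (is_derive_plus (fun t => a * u t y) (fun t => b * v t y)); apply is_derive_scal; auto.
Qed.

Lemma pdy_lin u v uy vy a b : pdy u uy -> pdy v vy -> pdy (fun x y => a * u x y + b * v x y) (fun x y => a * uy x y + b * vy x y).
Proof.
intros H K x y Hy. apply (is_derive_plus (fun t => a * u x t) (fun t => b * v x t)); apply is_derive_scal; auto.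
Qed.

Lemma lap_lin u v h k a b : lap u h -> lap v k -> lap (fun x y => a * u x y + b * v x y) (fun x y => a * h x y + b * k x y).
Proof.
intros [ux [uy [uxx [uyy [H1 [H2 [H3 [H4 H5]]]]]]]] [vx [vy [vxx [vyy [K1 [K2 [K3 [K4 K5]]]]]]]].
exists (fun x y => a * ux x y + b * vx x y), (fun x y => a * uy x y + b * vy x y),
  (fun x y => a * uxx x y + b * vxx x y), (fun x y => a * uyy x y + b * vyy x y).
split; [apply pdx_lin; auto|]. split; [apply pdy_lin; auto|]. split; [apply pdx_lin; auto|]. split; [apply pdy_lin; auto|].
intros x y Hy. rewrite H5, K5 by auto. ring.
Qed.

Lemma lap_const c : lap (fun _ _ => c) (fun _ _ => 0).
Proof.
exists (fun _ _ => 0), (fun _ _ => 0), (fun _ _ => 0), (fun _ _ => 0).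
split; [|split; [|split; [|split]]]; try (intros x y Hy; apply (is_derive_const (V := R_NormedModule))).
intros; ring.
Qed.

Definition add_scal (f g : Cplx -> Cplx) (c : Cplx) (z : Cplx) : Cplx := Cadd (f z) (Cmul c (g z)).

Lemma Delta_lin f g f' g' c : is_Delta 0 f f' -> is_Delta 0 g g' -> is_Delta 0 (add_scal f g c) (add_scal f' g' c).
Proof.
intros H K. apply Delta_lap in H. apply Delta_lap in K. apply Delta_lap. destruct H as [H1 H2], K as [K1 K2].
split.
- apply (lap_ext (fun x y => 1 * comp Re f x y + 1 * (Re c * comp Re g x y + (- Im c) * comp Im g x y)) _
    (fun x y => 1 * comp Re f' x y + 1 * (Re c * comp Re g' x y + (- Im c) * comp Im g' x y)));
    [intros x y _; unfold comp, add_scal; simpl; ring|intros x y _; unfold comp, add_scal; simpl; ring|].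
  apply lap_lin; auto. apply lap_lin; auto.
- apply (lap_ext (fun x y => 1 * comp Im f x y + 1 * (Re c * comp Im g x y + Im c * comp Re g x y)) _
    (fun x y => 1 * comp Im f' x y + 1 * (Re c * comp Im g' x y + Im c * comp Re g' x y)));
    [intros x y _; unfold comp, add_scal; simpl; ring|intros x y _; unfold comp, add_scal; simpl; ring|].
  apply lap_lin; auto. apply lap_lin; auto.
Qed.

Lemma Delta_ext f f' g g' : eq_on_H f f' -> eq_on_H g g' -> is_Delta 0 f g -> is_Delta 0 f' g'.
Proof.
intros E E' H. apply eq_on_H_comp in E. apply eq_on_H_comp in E'. apply Delta_lap in H. apply Delta_lap.
split; eapply lap_ext; (apply E || apply E' || apply H).
Qed.

Lemma Delta_unique f g g' : is_Delta 0 f g -> is_Delta 0 f g' -> eq_on_H g g'.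
Proof.
intros H K. apply Delta_lap in H. apply Delta_lap in K. apply eq_on_H_comp.
split; eapply lap_unique; (apply H || apply K).
Qed.

Lemma Delta_const c : is_Delta 0 (fun _ => c) (fun _ => C0).
Proof. apply Delta_lap. split; apply lap_const. Qed.

(* [iterDelta] with the Laplacians peeled off from the left, up to equality on the half-plane. *)
Fixpoint iterDelta_l (n : nat) (f g : Cplx -> Cplx) : Prop :=
  match n with
  | O => eq_on_H f g
  | S n => exists h, is_Delta 0 f h /\ iterDelta_l n h g
  end.

Lemma eq_on_H_refl f : eq_on_H f f.
Proof. intros z _; auto. Qed.

Lemma eq_on_H_sym f g : eq_on_H f g -> eq_on_H g f.
Proof. intros H z Hz; symmetry; auto. Qed.

Lemma eq_on_H_trans f g h : eq_on_H f g -> eq_on_H g h -> eq_on_H f h.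
Proof. intros H K z Hz; rewrite H; auto. Qed.

Lemma iterDelta_l_ext n : forall f f' g g', eq_on_H f f' -> eq_on_H g g' -> iterDelta_l n f g -> iterDelta_l n f' g'.
Proof.
induction n as [|n IH]; simpl; intros f f' g g' E E' H.
- apply eq_on_H_trans with f; [apply eq_on_H_sym; auto|]. apply eq_on_H_trans with g; auto.
- destruct H as [h [H1 H2]]. exists h. split.
  + apply Delta_ext with f h; auto. apply eq_on_H_refl.
  + apply IH with h g; auto. apply eq_on_H_refl.
Qed.

Lemma iterDelta_l_unique n : forall f g g', iterDelta_l n f g -> iterDelta_l n f g' -> eq_on_H g g'.
Proof.
induction n as [|n IH]; simpl; intros f g g' H K.
- apply eq_on_H_trans with f; auto. apply eq_on_H_sym; auto.
- destruct H as [h [H1 H2]], K as [k [K1 K2]]. apply (IH h); auto.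
  apply iterDelta_l_ext with k g'; auto; [|apply eq_on_H_refl]. apply (Delta_unique f); auto.
Qed.

Lemma iterDelta_l_lin n : forall f g f' g' c, iterDelta_l n f f' -> iterDelta_l n g g' -> iterDelta_l n (add_scal f g c) (add_scal f' g' c).
Proof.
induction n as [|n IH]; simpl; intros f g f' g' c H K.
- intros z Hz. unfold add_scal. rewrite H, K; auto.
- destruct H as [h [H1 H2]], K as [k [K1 K2]]. exists (add_scal h k c). split; [apply Delta_lin; auto|apply IH; auto].
Qed.

Lemma iterDelta_l_comp n m : forall f g h, iterDelta_l n f g -> iterDelta_l m g h -> iterDelta_l (n + m) f h.
Proof.
induction n as [|n IH]; simpl; intros f g h H K.
- apply iterDelta_l_ext with g h; auto; [apply eq_on_H_sym; auto|apply eq_on_H_refl].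
- destruct H as [k [H1 H2]]. exists k. split; auto. apply IH with g; auto.
Qed.

Lemma iterDelta_l_zero n : iterDelta_l n (fun _ => C0) (fun _ => C0).
Proof.
induction n as [|n IH]; [apply eq_on_H_refl|]. exists (fun _ => C0). split; [apply Delta_const|auto].
Qed.

Lemma iterDelta_iterDelta_l n f g : iterDelta 0 n f g -> iterDelta_l n f g.
Proof.
induction 1 as [f|n f g h H IH HD]; [apply eq_on_H_refl|].
replace (S n) with (n + 1)%nat by lia. apply iterDelta_l_comp with g; auto. exists h; split; auto. apply eq_on_H_refl.
Qed.

Lemma iterDelta_left n f g h : iterDelta 0 n g h -> is_Delta 0 f g -> iterDelta 0 (S n) f h.
Proof.
intros H; revert f. induction H as [g|n g h k H IH HD]; intros f Hf.
- apply iterDeltaS with f; auto. constructor.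
- apply iterDeltaS with h; auto.
Qed.

Lemma iterDelta_l_iterDelta n : forall f g, iterDelta_l n f g -> exists g', iterDelta 0 n f g' /\ eq_on_H g g'.
Proof.
induction n as [|n IH]; simpl; intros f g H.
- exists f. split; [constructor|apply eq_on_H_sym; auto].
- destruct H as [h [H1 H2]]. destruct (IH h g H2) as [g' [Hg' E]]. exists g'. split; auto. apply iterDelta_left with h; auto.
Qed.

Lemma iterDelta_iterlap p n f g : p = Re \/ p = Im -> iterDelta 0 n f g -> iterlap n (comp p f) (comp p g).
Proof.
intros Hp. induction 1 as [f|n f g h H IH HD]; [constructor|].
apply ilS with (comp p g); auto. apply Delta_lap in HD. destruct Hp as [->| ->]; apply HD.
Qed.

Lemma iterDelta_smooth p n f g : p = Re \/ p = Im -> smooth_on_H f -> iterDelta 0 n f g -> smooth2 (comp p g).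
Proof.
intros Hp Hs H. revert Hs. induction H as [f|n f g h H IH HD]; intros Hs; [apply smooth_comp; auto|].
apply lap_smooth with (comp p g); auto. apply Delta_lap in HD. destruct Hp as [->| ->]; apply HD.
Qed.

Lemma Rpower_le_pow a : exists n, forall y, 1 <= y -> Rpower y a <= y ^ n.
Proof.
destruct (INR_unbounded a) as [n Hn]. exists n. intros y Hy. rewrite <- Rpower_pow by lra.
apply Rle_Rpower; lra.
Qed.

Lemma moderate_growth_moderate2 p f : p = Re \/ p = Im -> moderate_growth f -> moderate2 (comp p f).
Proof.
intros Hp [al [K [Y [HY H]]]]. destruct (Rpower_le_pow al) as [n Hn].
exists (Rabs K), n, (Rmax Y 1). split; [apply Rabs_pos|]. split; [apply Rmax_r|].
intros x y Hy. pose proof (Rmax_l Y 1). pose proof (Rmax_r Y 1).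
apply Rle_trans with (Cnorm (f (mkC x y))); [destruct Hp as [->| ->]; [apply Re_le_Cnorm|apply Im_le_Cnorm]|].
eapply Rle_trans; [apply H; lra|]. apply Rle_trans with (Rabs K * Rpower y al).
- apply Rmult_le_compat_r; [left; apply exp_pos|apply Rle_abs].
- apply Rmult_le_compat_l; [apply Rabs_pos|apply Hn; lra].
Qed.

Lemma moebius_coord a b c d x y : (a * d - b * c = 1)%Z -> 0 < y ->
  let den := (IZR c * x + IZR d) ^ 2 + (IZR c * y) ^ 2 in
  0 < den /\ moebius a b c d (mkC x y) = mkC (((IZR a * x + IZR b) * (IZR c * x + IZR d) + IZR a * IZR c * y ^ 2) / den) (y / den).
Proof.
intros Hdet Hy den.
assert (HD : IZR a * IZR d - IZR b * IZR c = 1) by (rewrite <- !mult_IZR, <- minus_IZR, Hdet; auto).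
assert (Hden : 0 < den).
{ unfold den. destruct (Req_dec (IZR c) 0) as [E|E].
  - assert (IZR d <> 0) by (intros E'; rewrite E, E' in HD; lra).
    rewrite E, !Rmult_0_l. assert (0 < (0 + IZR d) ^ 2) by (apply pow2_gt_0; lra). lra.
  - assert (0 < (IZR c * y) ^ 2) by (apply pow2_gt_0, Rmult_integral_contrapositive_currified; lra).
    pose proof (pow2_ge_0 (IZR c * x + IZR d)). lra. }
split; auto. unfold moebius, Cdiv, Cmul, Cadd, Cinv, RtoC. cbn [Re Im].
assert (E : (IZR c * x - 0 * y + IZR d) * (IZR c * x - 0 * y + IZR d) + (IZR c * y + 0 * x + 0) * (IZR c * y + 0 * x + 0) = den) by (unfold den; ring).
rewrite E. apply Ceq; cbn [Re Im].
- field. lra.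
- transitivity (y * (IZR a * IZR d - IZR b * IZR c) / den); [field; lra|]. rewrite HD. field. lra.
Qed.

Definition modular_moderate (f : Cplx -> Cplx) : Prop := modular_of_weight 0 f /\ moderate_growth f.

Lemma modular_inv f a b c d x y : modular_of_weight 0 f -> (a * d - b * c = 1)%Z -> 0 < y ->
  let den := (IZR c * x + IZR d) ^ 2 + (IZR c * y) ^ 2 in
  f (mkC (((IZR a * x + IZR b) * (IZR c * x + IZR d) + IZR a * IZR c * y ^ 2) / den) (y / den)) = f (mkC x y).
Proof.
intros [_ H] Hdet Hy den. destruct (moebius_coord a b c d x y Hdet Hy) as [_ E]. unfold den. rewrite <- E.
rewrite (H a b c d Hdet (mkC x y) Hy). simpl Cpowz. ring.
Qed.

(** The matrix (1, 1; 0, 1). Together with the inversion it supplies the invariance that [reduction]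
    works with. *)
Lemma modular_periodic_x p f : modular_of_weight 0 f -> periodic_x (comp p f).
Proof.
intros H y Hy x. pose proof (modular_inv f 1 1 0 1 x y H eq_refl Hy) as E. unfold comp. rewrite <- E. do 2 f_equal. f_equal; field.
Qed.

Lemma modular_inv_invariant p f : modular_of_weight 0 f -> inv_invariant (comp p f).
Proof.
intros H x y Hy. pose proof (modular_inv f 0 (-1) 1 0 x y H eq_refl Hy) as E. unfold comp. rewrite <- E.
assert (x ^ 2 + y ^ 2 <> 0) by (assert (0 < y ^ 2) by (apply pow_lt; auto); pose proof (pow2_ge_0 x); lra).
do 2 f_equal. f_equal; field; (lra || (split; [lra|]) || idtac); try (replace ((1 * x + 0)^2 + (1*y)^2) with (x^2+y^2) by ring; auto); nra.
Qed.

Lemma modular_moderate_const n f g : modular_moderate f -> iterDelta 0 n f g -> harmonic (comp Re g) -> harmonic (comp Im g) -> exists c, eq_on_H g (fun _ => c).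
Proof.
intros [Hm Hg] H H1 H2.
assert (HH : forall p, p = Re \/ p = Im -> harmonic (comp p g) -> exists c, forall x y, 0 < y -> comp p g x y = c).
{ intros p Hp Hh. apply (polyharmonic_const n (comp p f)); auto.
  - apply iterDelta_iterlap; auto.
  - apply smooth_comp; auto. apply Hm.
  - apply modular_periodic_x; auto.
  - apply moderate_growth_moderate2; auto.
  - apply modular_inv_invariant; auto. }
destruct (HH Re (or_introl eq_refl) H1) as [c1 E1]. destruct (HH Im (or_intror eq_refl) H2) as [c2 E2].
exists (mkC c1 c2). apply eq_on_H_comp. split; intros x y Hy; unfold comp at 2; simpl; auto.
Qed.

Lemma harmonic_Delta g h : is_Delta 0 g h -> eq_on_H h (fun _ => C0) -> harmonic (comp Re g) /\ harmonic (comp Im g).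
Proof.
intros H E. apply Delta_lap in H. split; [exists (comp Re h)|exists (comp Im h)]; (split; [apply H|]);
 intros x y Hy; unfold comp; rewrite E; auto.
Qed.

Lemma pd_commute u ux uy uxy uyx : smooth2 u -> pdx u ux -> pdy u uy -> pdy ux uxy -> pdx uy uyx -> eq_half uxy uyx.
Proof.
intros Hs Hx Hy Hxy Hyx x y Hyp.
assert (Cxy : cont2 uxy) by (apply smooth2_cont, (smooth2_dy ux); auto; apply (smooth2_dx u); auto).
assert (Cyx : cont2 uyx) by (apply smooth2_cont, (smooth2_dx uy); auto; apply (smooth2_dy u); auto).
assert (D1 : forall a b, 0 < b -> Derive (fun t => u t b) a = ux a b) by (intros; apply is_derive_unique; apply Hx; auto).
assert (D2 : forall a b, 0 < b -> Derive (fun t => u a t) b = uy a b) by (intros; apply is_derive_unique; apply Hy; auto).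
assert (I1 : forall a b, 0 < b -> is_derive (fun z => Derive (fun t => u t z) a) b (uxy a b)).
{ intros a b Hb. apply is_derive_ext_loc with (fun t => ux a t); [|apply Hxy; auto].
  apply (pd_local b (fun t => ux a t = Derive (fun s => u s t) a)); auto. intros; symmetry; apply D1; auto. }
assert (I2 : forall a b, 0 < b -> is_derive (fun z => Derive (fun t => u z t) b) a (uyx a b)).
{ intros a b Hb. apply is_derive_ext with (fun t => uy t b); [|apply Hyx; auto]. intros; symmetry; apply D2; auto. }
assert (HL : locally_2d (fun a b => 0 < b) x y).
{ exists (mkposreal y Hyp). intros a b _ Hb. apply Rabs_def2 in Hb. simpl in Hb. lra. }
rewrite <- (is_derive_unique _ _ _ (I1 x y Hyp)), <- (is_derive_unique _ _ _ (I2 x y Hyp)). symmetry. apply Schwarz.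
- apply locally_2d_impl with (2 := HL). apply locally_2d_forall. intros a b Hb.
  split; [eexists; apply Hx; auto|]. split; [eexists; apply Hy; auto|].
  split; [eexists; apply I2; auto|eexists; apply I1; auto].
- apply continuity_2d_pt_ext_loc with uyx; [|apply cont2_2d; auto].
  apply locally_2d_impl with (2 := HL). apply locally_2d_forall. intros a b Hb. symmetry. apply is_derive_unique, I2; auto.
- apply continuity_2d_pt_ext_loc with uxy; [|apply cont2_2d; auto].
  apply locally_2d_impl with (2 := HL). apply locally_2d_forall. intros a b Hb. symmetry. apply is_derive_unique, I1; auto.
Qed.

(** u_xx + u_yy is the difference of the two mixed derivatives of v, which vanishes by
    [pd_commute]. *)
Lemma CR_harmonic u v a b : smooth2 v -> pdx u a -> pdy u (fun x y => - b x y) -> pdx v b -> pdy v a -> harmonic u.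
Proof.
intros Hv Ua Ub Vb Va.
destruct (smooth2_inv a (smooth2_dy _ _ Hv Va)) as [ax [_ [Hax _]]].
destruct (smooth2_inv b (smooth2_dx _ _ Hv Vb)) as [_ [b_y [_ [Hby _]]]].
exists (fun x y => y ^ 2 * (ax x y + - b_y x y)). split.
- exists a, (fun x y => - b x y), ax, (fun x y => - b_y x y).
  split; auto. split; auto. split; auto. split; [|auto]. intros x y Hy. apply (is_derive_opp (fun t => b x t)); auto.
- intros x y Hy. rewrite (pd_commute v b a b_y ax Hv Vb Va Hby Hax x y Hy). ring.
Qed.

(** Real and purely imaginary increments in the complex difference quotient. *)
Lemma holomorphic_CR g x y : holomorphic_on_H g -> 0 < y -> exists l,
  is_derive (fun t => comp Re g t y) x (Re l) /\ is_derive (fun t => comp Im g t y) x (Im l) /\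
  is_derive (fun t => comp Re g x t) y (- Im l) /\ is_derive (fun t => comp Im g x t) y (Re l).
Proof.
intros Hg Hy. destruct (Hg (mkC x y) Hy) as [l Hl]. exists l.
set (w := fun h => Csub (g (Cadd (mkC x y) h)) (g (mkC x y))).
assert (HR : forall t, t <> 0 -> Cdiv (w (mkC t 0)) (mkC t 0) = mkC (Re (w (mkC t 0)) / t) (Im (w (mkC t 0)) / t)).
{ intros t Ht. apply Ceq; unfold Cdiv, Cmul, Cinv; cbn [Re Im]; field; nra. }
assert (HI : forall t, t <> 0 -> Cdiv (w (mkC 0 t)) (mkC 0 t) = mkC (Im (w (mkC 0 t)) / t) (- Re (w (mkC 0 t)) / t)).
{ intros t Ht. apply Ceq; unfold Cdiv, Cmul, Cinv; cbn [Re Im]; field; nra. }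
assert (HzR : forall t, t <> 0 -> mkC t 0 <> C0) by (intros t Ht E; apply Ht; exact (f_equal Re E)).
assert (HzI : forall t, t <> 0 -> mkC 0 t <> C0) by (intros t Ht E; apply Ht; exact (f_equal Im E)).
assert (NR : forall t, Cnorm (mkC t 0) = Rabs t) by (intros; apply Cnorm_RtoC).
assert (NI : forall t, Cnorm (mkC 0 t) = Rabs t).
{ intros t. unfold Cnorm; cbn [Re Im]. rewrite <- sqrt_Rsqr_abs. unfold Rsqr. f_equal; ring. }
assert (ER : forall t, Cadd (mkC x y) (mkC t 0) = mkC (x + t) y) by (intros; apply Ceq; simpl; ring).
assert (EI : forall t, Cadd (mkC x y) (mkC 0 t) = mkC x (y + t)) by (intros; apply Ceq; simpl; ring).
split; [|split; [|split]]; apply is_derive_Reals; intros eps He; destruct (Hl eps He) as [d [Hd Hd']]; exists (mkposreal d Hd); intros h Hh Hhd; simpl in Hhd.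
- specialize (Hd' (mkC h 0) (HzR h Hh) ltac:(rewrite NR; auto)). fold (w (mkC h 0)) in Hd'. rewrite HR in Hd' by auto.
  eapply Rle_lt_trans; [|apply Hd']. eapply Rle_trans; [|apply Re_le_Cnorm]. apply Req_le. unfold w. rewrite ER. auto.
- specialize (Hd' (mkC h 0) (HzR h Hh) ltac:(rewrite NR; auto)). fold (w (mkC h 0)) in Hd'. rewrite HR in Hd' by auto.
  eapply Rle_lt_trans; [|apply Hd']. eapply Rle_trans; [|apply Im_le_Cnorm]. apply Req_le. unfold w. rewrite ER. auto.
- specialize (Hd' (mkC 0 h) (HzI h Hh) ltac:(rewrite NI; auto)). fold (w (mkC 0 h)) in Hd'. rewrite HI in Hd' by auto.
  eapply Rle_lt_trans; [|apply Hd']. eapply Rle_trans; [|apply Im_le_Cnorm]. apply Req_le. unfold w. rewrite EI. rewrite <- Rabs_Ropp. f_equal.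
  unfold comp. simpl. field. auto.
- specialize (Hd' (mkC 0 h) (HzI h Hh) ltac:(rewrite NI; auto)). fold (w (mkC 0 h)) in Hd'. rewrite HI in Hd' by auto.
  eapply Rle_lt_trans; [|apply Hd']. eapply Rle_trans; [|apply Re_le_Cnorm]. apply Req_le. unfold w. rewrite EI. auto.
Qed.

Lemma is_derive_R_unique (f : R -> R) (x a b : R) : is_derive f x a -> is_derive f x b -> a = b.
Proof. intros H K. rewrite <- (is_derive_unique _ _ _ H). apply is_derive_unique; auto. Qed.

Lemma holomorphic_harmonic g : holomorphic_on_H g -> smooth2 (comp Re g) -> smooth2 (comp Im g) ->
  harmonic (comp Re g) /\ harmonic (comp Im g).
Proof.
intros Hg HR HI. set (u := comp Re g) in *. set (v := comp Im g) in *.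
destruct (smooth2_inv u HR) as [a [uy [Ua [Uy _]]]]. destruct (smooth2_inv v HI) as [b [vy [Vb [Vy _]]]].
assert (E1 : eq_half uy (fun x y => - b x y)).
{ intros x y Hy. destruct (holomorphic_CR g x y Hg Hy) as [l [H1 [H2 [H3 H4]]]].
  rewrite (is_derive_R_unique _ _ _ _ (Uy x y Hy) H3), (is_derive_R_unique _ _ _ _ (Vb x y Hy) H2). auto. }
assert (E2 : eq_half vy a).
{ intros x y Hy. destruct (holomorphic_CR g x y Hg Hy) as [l [H1 [H2 [H3 H4]]]].
  rewrite (is_derive_R_unique _ _ _ _ (Vy x y Hy) H4), (is_derive_R_unique _ _ _ _ (Ua x y Hy) H1). auto. }
assert (Ub : pdy u (fun x y => - b x y)) by (apply pdy_ext with u uy; auto; intros x y _; auto).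
assert (Va : pdy v a) by (apply pdy_ext with v vy; auto; intros x y _; auto).
split.
- apply (CR_harmonic u v a b); auto.
(* v is the real part of -i g, whose imaginary part is -u. *)
- apply (CR_harmonic v (fun x y => (-1) * u x y) b (fun x y => - a x y)); auto.
  + apply smooth2_scal; auto.
  + apply pdy_ext with v a; auto; intros x y _; ring.
  + intros x y Hy. apply is_derive_ext_val with ((-1) * a x y); [|ring]. apply (is_derive_scal (fun t => u t y)); auto.
  + intros x y Hy. apply is_derive_ext_val with ((-1) * - b x y); [|ring]. apply (is_derive_scal (fun t => u x t)); auto.
Qed.

Lemma const_holomorphic g c : eq_on_H g (fun _ => c) -> holomorphic_on_H g.
Proof.
(* The radius Im z keeps z + h in the half-plane, where alone g is known to be constant. *)
intros E z Hz. exists C0. intros eps He. exists (Im z). split; auto. intros h Hh Hn.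
assert (Hw : inH (Cadd z h)).
{ unfold inH in *. simpl. pose proof (Im_le_Cnorm h) as H. assert (Rabs (Im h) < Im z) by lra. apply Rabs_def2 in H0. lra. }
rewrite !E by auto. replace (Csub (Cdiv (Csub c c) h) C0) with (RtoC 0).
- rewrite Cnorm_RtoC, Rabs_R0; auto.
- change (RtoC 0) with C0. field. exact Hh.
Qed.

(** The link between the two sides is that Delta^n f is constant: it is harmonic in either case, by
    assumption or by Cauchy-Riemann. *)
Lemma inV_S_iff_half n f : inV 0 (S n) f <-> inV_half 0 n f.
Proof.
split.
- intros [Hm [Hg [h [Hi H0]]]]. split; auto. split; auto. inversion Hi as [|n' f' g h' Hi' HD]; subst.
  exists g. split; auto. destruct (harmonic_Delta g h HD H0) as [H1 H2].
  destruct (modular_moderate_const n f g (conj Hm Hg) Hi' H1 H2) as [c Hc]. apply const_holomorphic with c; auto.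
- intros [Hm [Hg [g [Hi Hh]]]]. split; auto. split; auto.
  assert (Hs : smooth_on_H f) by apply Hm.
  destruct (holomorphic_harmonic g Hh) as [H1 H2]; [eapply iterDelta_smooth; eauto|eapply iterDelta_smooth; eauto|].
  destruct (modular_moderate_const n f g (conj Hm Hg) Hi H1 H2) as [c Hc].
  exists (fun _ => C0). split; auto. apply iterDeltaS with g; auto.
  apply Delta_ext with (fun _ => c) (fun _ => C0); [apply eq_on_H_sym; auto|apply eq_on_H_refl|apply Delta_const].
Qed.

Lemma is_usum_zero : is_usum (fun _ : Z * Z => 0) 0.
Proof.
pose proof (is_usum_scal 0 _ _ is_usum_single) as H. rewrite Rmult_0_l in H.
apply is_usum_ext with (2 := H). intros; ring.
Qed.

(** Only for n = 0 does the weight [W (S (S n))] have nonzero value and slope at u = 0, namely 2 and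
    1, so [boundary_sum] contributes its 1 exactly there. *)
Lemma lap_LamW n : lap (LamW (W (S (S n)))) (fun x y => LamW (W n) x y - LamW (W (S n)) x y + (if Nat.eqb n 0 then 1 else 0)).
Proof.
destruct (Lam_laplacian (W (S (S n))) (W1 n) (W2 n) (egrowthE_W _) (egrowthE_W1 _) (egrowthE_W2 _) (W_deriv n) (W1_deriv n))
  as [fx [fy [fxx [fyy [H1 [H2 [H3 [H4 H5]]]]]]]].
exists fx, fy, fxx, fyy. split; auto. split; auto. split; auto. split; auto. intros x y Hy. specialize (H5 x y Hy).
rewrite (LamW_ext _ _ x y (W_ode n)), LamW_minus in H5 by (auto; apply egrowthE_W).
assert (E : y ^ 2 * (fxx x y + fyy x y) - (LamW (W n) x y - LamW (W (S n)) x y) = if Nat.eqb n 0 then 1 else 0); [|rewrite <- E; ring].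
apply is_usum_unique with (1 := H5). destruct n as [|n]; simpl Nat.eqb.
- apply is_usum_ext with (2 := boundary_sum x y Hy). intros v. unfold W, W1, wA, wB. rewrite exp_0. simpl. do 2 f_equal. field.
- apply is_usum_ext with (2 := is_usum_zero). intros v.
  assert (E1 : W (S (S (S n))) 0 = 0) by (unfold W, wA, wB; rewrite Ropp_0, pow_i by lia; unfold Rdiv; ring).
  assert (E2 : W1 (S n) 0 = 0) by (unfold W1, wA, wB; rewrite Ropp_0, exp_0, (pow_i (S n)) by lia; unfold Rdiv; ring).
  rewrite E1, E2. unfold nz. destruct eq_dec_cl; ring.
Qed.

Lemma F_real_0 x y : 0 < y -> F_real 0 x y = 1 / 2.
Proof. intros Hy. destruct (LamW_W0 x y Hy) as [E0 E1]. unfold F_real. rewrite E0, E1. simpl. ring. Qed.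

Lemma lap_LamW1 : lap (LamW (W 1)) (fun _ _ => 0).
Proof.
apply lap_ext with (fun _ _ => 0) (fun _ _ => 0); [|intros x y _; auto|apply lap_const].
intros x y Hy. symmetry. apply LamW_W0; auto.
Qed.

(** The coefficient of s^(n+1) in Delta E = s (s - 1) E. The constant 1 from [lap_LamW] is what
    makes F_0 = 1/2 reappear on the right. *)
Lemma lap_F_real n : lap (F_real (S n)) (fun x y => match n with O => 0 | S k => F_real k x y end - F_real n x y).
Proof.
destruct n as [|n].
- apply (lap_ext (fun x y => 1 / 2 * LamW (W 1) x y + (- (1 / 2)) * LamW (W 2) x y) _ (fun x y => 1 / 2 * 0 + (- (1 / 2)) * (LamW (W 0) x y - LamW (W 1) x y + 1))).
  + intros x y Hy. unfold F_real. cbn [Nat.eqb]. ring.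
  + intros x y Hy. rewrite F_real_0 by auto. destruct (LamW_W0 x y Hy) as [E0 E1]. rewrite E0, E1. field.
  + apply lap_lin; [apply lap_LamW1|apply (lap_LamW 0)].
- apply (lap_ext (fun x y => 1 / 2 * LamW (W (S (S n))) x y + (- (1 / 2)) * LamW (W (S (S (S n)))) x y) _
    (fun x y => 1 / 2 * (LamW (W n) x y - LamW (W (S n)) x y + (if Nat.eqb n 0 then 1 else 0)) + (- (1 / 2)) * (LamW (W (S n)) x y - LamW (W (S (S n))) x y + 0))).
  + intros x y Hy. unfold F_real. cbn [Nat.eqb]. ring.
  + intros x y Hy. unfold F_real. cbn [Nat.eqb]. destruct (Nat.eqb n 0); field.
  + apply lap_lin; [apply (lap_LamW n)|apply (lap_LamW (S n))].
Qed.

Lemma comp_F n : eq_half (comp Re (F_n n)) (F_real n) /\ eq_half (comp Im (F_n n)) (fun _ _ => 0).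
Proof. split; intros x y Hy; unfold comp; rewrite F_n_F_real by exact Hy; auto. Qed.

Lemma F_n_0 : eq_on_H (F_n 0) (fun _ => RtoC (1 / 2)).
Proof. intros z Hz. rewrite F_n_F_real, F_real_0; auto. Qed.

Lemma Delta_F n : is_Delta 0 (F_n (S n)) (add_scal (match n with O => fun _ => C0 | S k => F_n k end) (F_n n) (RtoC (-1))).
Proof.
apply Delta_lap. destruct (comp_F (S n)) as [E1 E2]. destruct (comp_F n) as [E3 E4]. split.
- apply lap_ext with (3 := lap_F_real n); [apply eq_half_sym; auto|].
  intros x y Hy. unfold add_scal, comp. destruct n as [|k]; simpl.
  + rewrite F_n_F_real by exact Hy. simpl. ring.
  + rewrite !F_n_F_real by exact Hy. simpl. ring.
- apply lap_ext with (3 := lap_const 0); [apply eq_half_sym; auto|].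
  intros x y Hy. unfold add_scal, comp. destruct n as [|k]; simpl.
  + rewrite F_n_F_real by exact Hy. simpl. ring.
  + rewrite !F_n_F_real by exact Hy. simpl. ring.
Qed.

Definition top_coeff (n : nat) : Cplx := RtoC ((-1) ^ n / 2).

Lemma iterDelta_l_S_const n f c : iterDelta_l n f (fun _ => c) -> iterDelta_l (S n) f (fun _ => C0).
Proof.
intros H. replace (S n) with (n + 1)%nat by lia. apply iterDelta_l_comp with (fun _ => c); auto.
exists (fun _ => C0). split; [apply Delta_const|apply eq_on_H_refl].
Qed.

(** Delta^(n+1) F_(n+1) = Delta^n F_(n-1) - Delta^n F_n, and the first term is 0 because Delta^(n-1)
    F_(n-1) is constant. Each step changes the sign, starting from 1/2. *)
Lemma iterDelta_l_F n : iterDelta_l n (F_n n) (fun _ => top_coeff n).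
Proof.
(* The recursion refers to two predecessors, so the induction carries two consecutive indices. *)
assert (H : iterDelta_l n (F_n n) (fun _ => top_coeff n) /\ iterDelta_l (S n) (F_n (S n)) (fun _ => top_coeff (S n))); [|apply H].
assert (HS : forall n (P : Cplx -> Cplx), iterDelta_l n P (fun _ => C0) -> iterDelta_l n (F_n n) (fun _ => top_coeff n) ->
   is_Delta 0 (F_n (S n)) (add_scal P (F_n n) (RtoC (-1))) -> iterDelta_l (S n) (F_n (S n)) (fun _ => top_coeff (S n))).
{ intros k P HP HF HD. exists (add_scal P (F_n k) (RtoC (-1))). split; auto.
  apply iterDelta_l_ext with (3 := iterDelta_l_lin k _ _ _ _ (RtoC (-1)) HP HF); [apply eq_on_H_refl|].
  intros z Hz. unfold add_scal, top_coeff. apply Ceq; simpl; field. }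
assert (H0 : iterDelta_l 0 (F_n 0) (fun _ => top_coeff 0)).
{ apply eq_on_H_trans with (1 := F_n_0). intros z Hz. unfold top_coeff. apply Ceq; simpl; field. }
induction n as [|n [IH1 IH2]].
- split; auto. apply (HS 0%nat (fun _ => C0)); auto; [apply iterDelta_l_zero|apply (Delta_F 0)].
- split; auto. apply (HS (S n) (F_n n)); auto; [apply iterDelta_l_S_const with (top_coeff n); auto|apply (Delta_F (S n))].
Qed.

Lemma smooth2_const : forall c, smooth2 (fun _ _ => c).
Proof.
cofix IH. intros c. apply (smooth2_intro _ (fun _ _ => 0) (fun _ _ => 0)).
- apply cont2_const.
- intros x y Hy. apply (is_derive_const (V := R_NormedModule)).
- intros x y Hy. apply (is_derive_const (V := R_NormedModule)).
- apply IH.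
- apply IH.
Qed.

Lemma smooth2_F_real n : smooth2 (F_real n).
Proof.
assert (HL : forall k, smooth2 (LamW (W k))) by (intros; apply Lam_smooth, cls_baseE, egrowthE_W).
apply smooth2_ext with (fun x y => ((fun _ _ => if Nat.eqb n 0 then 1 / 2 else 0) x y) + (1 / 2 * LamW (W n) x y + (- (1 / 2)) * LamW (W (S n)) x y)).
- intros x y Hy. unfold F_real. ring.
- apply smooth2_plus; [|apply smooth2_plus; apply smooth2_scal; auto]. apply smooth2_const.
Qed.

Lemma modular_moderate_F n : modular_moderate (F_n n).
Proof.
destruct (comp_F n) as [E1 E2]. split; [split|].
- apply comp_smooth.
  + apply smooth2_ext with (F_real n); [apply eq_half_sym; auto|apply smooth2_F_real].
  + apply smooth2_ext with (fun _ _ => 0); [apply eq_half_sym; auto|apply smooth2_const].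
- intros a b c d Hdet [x y] Hz. destruct (moebius_coord a b c d x y Hdet Hz) as [Hden E]. rewrite E.
  set (x' := _ / _) in *. set (y' := y / _) in *.
  assert (Hy' : 0 < y') by (apply Rdiv_lt_0_compat; auto).
  rewrite !F_n_F_real by auto. cbn [Re Im]. simpl Cpowz. replace (F_real n x' y') with (F_real n x y); [ring|].
  unfold F_real. rewrite (LamW_modular (W n) a b c d x y x' y' (egrowthE_W n) Hdet Hz), (LamW_modular (W (S n)) a b c d x y x' y' (egrowthE_W (S n)) Hdet Hz); auto.
- destruct (LamW_growth (W n) (egrowthE_W n)) as [A [K [HK H]]]. destruct (LamW_growth (W (S n)) (egrowthE_W (S n))) as [B [L [HL H']]].
  (* A nonnegative exponent, so that y^M >= 1 bounds the constant term of F_0 as well. *)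
  set (M := Rmax 0 (Rmax A B)). exists M, (1 + K + L), 1. split; [lra|]. intros x y Hy.
  rewrite F_n_F_real by (unfold inH; simpl; lra). cbn [Re Im]. rewrite Cnorm_RtoC.
  assert (HA : Rpower y A <= Rpower y M) by (apply Rle_Rpower; [lra|unfold M; eapply Rle_trans; [|apply Rmax_r]; apply Rmax_l]).
  assert (HB : Rpower y B <= Rpower y M) by (apply Rle_Rpower; [lra|unfold M; eapply Rle_trans; [|apply Rmax_r]; apply Rmax_r]).
  assert (H1 : 1 <= Rpower y M) by (rewrite <- (Rpower_O y) by lra; apply Rle_Rpower; [lra|apply Rmax_l]).
  specialize (H x y Hy). specialize (H' x y Hy).
  assert (Rabs (LamW (W n) x y) <= K * Rpower y M) by (eapply Rle_trans; [apply H|apply Rmult_le_compat_l; auto]).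
  assert (Rabs (LamW (W (S n)) x y) <= L * Rpower y M) by (eapply Rle_trans; [apply H'|apply Rmult_le_compat_l; auto]).
  unfold F_real. set (e := if Nat.eqb n 0 then 1 / 2 else 0). assert (He : 0 <= e <= 1 / 2) by (unfold e; destruct (Nat.eqb n 0); lra).
  apply Rabs_le. apply Rabs_le_between in H0, H2. lra.
Qed.

Lemma modular_moderate_lin f g c : modular_moderate f -> modular_moderate g -> modular_moderate (add_scal f g c).
Proof.
intros [[Sf Mf] [a1 [K1 [Y1 [HY1 H1]]]]] [[Sg Mg] [a2 [K2 [Y2 [HY2 H2]]]]]. split; [split|].
- apply comp_smooth.
  + apply smooth2_ext with (fun x y => comp Re f x y + (Re c * comp Re g x y + (- Im c) * comp Im g x y)).
    * intros x y Hy. unfold comp, add_scal. simpl. ring.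
    * apply smooth2_plus; [|apply smooth2_plus; apply smooth2_scal]; apply smooth_comp; auto.
  + apply smooth2_ext with (fun x y => comp Im f x y + (Re c * comp Im g x y + Im c * comp Re g x y)).
    * intros x y Hy. unfold comp, add_scal. simpl. ring.
    * apply smooth2_plus; [|apply smooth2_plus; apply smooth2_scal]; apply smooth_comp; auto.
- intros p q r s Hdet z Hz. unfold add_scal. rewrite Mf, Mg by auto. simpl Cpowz. ring.
(* Above height 1 the power y^a increases with a, so both bounds can be raised to the common
   exponent. *)
- exists (Rmax a1 a2), (Rabs K1 + Cnorm c * Rabs K2), (Rmax 1 (Rmax Y1 Y2)).
  pose proof (Rmax_l 1 (Rmax Y1 Y2)). pose proof (Rmax_r 1 (Rmax Y1 Y2)). pose proof (Rmax_l Y1 Y2). pose proof (Rmax_r Y1 Y2).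
  split; [lra|]. intros x y Hy.
  assert (HB : forall K a, a <= Rmax a1 a2 -> K * Rpower y a <= Rabs K * Rpower y (Rmax a1 a2)).
  { intros K a Ha. apply Rle_trans with (Rabs K * Rpower y a).
    - apply Rmult_le_compat_r; [left; apply exp_pos|apply Rle_abs].
    - apply Rmult_le_compat_l; [apply Rabs_pos|]. apply Rle_Rpower; lra. }
  unfold add_scal. eapply Rle_trans; [apply Cnorm_triang|]. rewrite Cnorm_mul, Rmult_plus_distr_r, Rmult_assoc. apply Rplus_le_compat.
  + eapply Rle_trans; [apply H1; lra|]. apply HB, Rmax_l.
  + apply Rmult_le_compat_l; [apply Cnorm_ge0|]. eapply Rle_trans; [apply H2; lra|]. apply HB, Rmax_r.
Qed.

(** [iterDelta] fixes representatives off the half-plane; in terms of [iterDelta_l] the iterated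
    Laplacian is additive, composable and single-valued on the half-plane. *)
Lemma inV_iterDelta_l n f : inV 0 n f <-> modular_moderate f /\ iterDelta_l n f (fun _ => C0).
Proof.
split.
- intros [Hm [Hg [g [Hi H0]]]]. split; [split; auto|]. apply iterDelta_l_ext with f g; [apply eq_on_H_refl|auto|apply iterDelta_iterDelta_l; auto].
- intros [[Hm Hg] H]. split; auto. split; auto. destruct (iterDelta_l_iterDelta n f _ H) as [g [Hi E]]. exists g. split; auto.
  intros z Hz. rewrite <- E; auto.
Qed.

(** The last function before 0 is harmonic, hence constant: raising m by one adds at most one
    dimension. *)
Lemma iterDelta_l_const n f : modular_moderate f -> iterDelta_l (S n) f (fun _ => C0) -> exists c, iterDelta_l n f (fun _ => c).
Proof.
intros HA H. destruct (iterDelta_l_iterDelta (S n) f _ H) as [h [Hi E]]. inversion Hi as [|n' f' g h' Hi' HD]; subst.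
destruct (harmonic_Delta g h HD (eq_on_H_sym _ _ E)) as [H1 H2]. destruct (modular_moderate_const n f g HA Hi' H1 H2) as [c Hc].
exists c. apply iterDelta_l_ext with f g; [apply eq_on_H_refl|auto|apply iterDelta_iterDelta_l; auto].
Qed.

Lemma iterDelta_l_le n m f : (n <= m)%nat -> iterDelta_l n f (fun _ => C0) -> iterDelta_l m f (fun _ => C0).
Proof.
intros Hle H. replace m with (n + (m - n))%nat by lia. apply iterDelta_l_comp with (fun _ => C0); auto. apply iterDelta_l_zero.
Qed.

Definition Fcomb (c : nat -> Cplx) (m : nat) (z : Cplx) : Cplx := Csum (fun j => Cmul (c j) (F_n j z)) m.

Lemma iterDelta_l_Fcomb c m : iterDelta_l m (Fcomb c m) (fun _ => C0).
Proof.
induction m as [|m IH]; [intros z Hz; auto|].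
apply iterDelta_l_ext with (3 := iterDelta_l_lin (S m) _ _ _ _ (c m) (iterDelta_l_le m (S m) _ (Nat.le_succ_diag_r m) IH) (iterDelta_l_S_const m _ _ (iterDelta_l_F m))).
- intros z Hz. auto.
- intros z Hz. unfold add_scal. ring.
Qed.

Lemma iterDelta_l_Fcomb_top c m : iterDelta_l m (Fcomb c (S m)) (fun _ => Cmul (c m) (top_coeff m)).
Proof.
apply iterDelta_l_ext with (3 := iterDelta_l_lin m _ _ _ _ (c m) (iterDelta_l_Fcomb c m) (iterDelta_l_F m)).
- intros z Hz. auto.
- intros z Hz. unfold add_scal. ring.
Qed.

Lemma top_coeff_neq0 n : top_coeff n <> C0.
Proof.
intros E. apply (f_equal Re) in E. unfold top_coeff in E. simpl in E.
assert ((-1) ^ n <> 0) by (apply pow_nonzero; lra). lra.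
Qed.

Lemma inH_i : inH Ci.
Proof. unfold inH; simpl; lra. Qed.

(** Delta^m sends a combination of F_0, ..., F_m to its last coefficient times the nonzero
    [top_coeff m]; the other coefficients follow by induction. *)
Lemma F_indep m : forall c, (forall z, inH z -> Fcomb c m z = C0) -> forall j, (j < m)%nat -> c j = C0.
Proof.
induction m as [|m IH]; intros c H j Hj; [lia|].
assert (Hm : c m = C0).
{ assert (E : Cmul (c m) (top_coeff m) = C0).
  (* Two constants that agree on the half-plane are compared at the point i. *)
  { apply (iterDelta_l_unique m (Fcomb c (S m)) (fun _ => Cmul (c m) (top_coeff m)) (fun _ => C0) (iterDelta_l_Fcomb_top c m)) with (z := Ci); [|apply inH_i].
    apply iterDelta_l_ext with (fun _ => C0) (fun _ => C0); [apply eq_on_H_sym; exact H|apply eq_on_H_refl|apply iterDelta_l_zero]. }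
  apply Cmul_eq0 in E. destruct E as [E|E]; auto. destruct (top_coeff_neq0 m E). }
destruct (Nat.eq_dec j m) as [->|n]; auto.
apply IH; [|lia]. intros z Hz. specialize (H z Hz). unfold Fcomb in *. simpl Csum in H. rewrite Hm in H.
rewrite <- H. ring.
Qed.

Lemma Csum_ext (f g : nat -> Cplx) n : (forall j, (j < n)%nat -> f j = g j) -> Csum f n = Csum g n.
Proof. intros H. induction n as [|n IH]; simpl; auto. rewrite IH, H; auto. Qed.

Lemma F_span m : forall f, modular_moderate f -> iterDelta_l m f (fun _ => C0) -> exists c, forall z, inH z -> f z = Fcomb c m z.
Proof.
induction m as [|m IH]; intros f HA H.
- exists (fun _ => C0). intros z Hz. apply H; auto.
(* With b = a / [top_coeff m], the function f - b F_m satisfies Delta^m = 0 and is again modular of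
   moderate growth, so the induction hypothesis applies to it. *)
- destruct (iterDelta_l_const m f HA H) as [a Ha]. set (b := Cdiv a (top_coeff m)).
  assert (Hk := top_coeff_neq0 m).
  assert (HD : iterDelta_l m (add_scal f (F_n m) (Copp b)) (fun _ => C0)).
  { apply iterDelta_l_ext with (3 := iterDelta_l_lin m _ _ _ _ (Copp b) Ha (iterDelta_l_F m)); [apply eq_on_H_refl|].
    intros z Hz. unfold add_scal, b. field. auto. }
  destruct (IH _ (modular_moderate_lin f (F_n m) (Copp b) HA (modular_moderate_F m)) HD) as [c Hc].
  exists (fun j => if Nat.eq_dec j m then b else c j). intros z Hz. specialize (Hc z Hz). unfold add_scal in Hc.
  unfold Fcomb in *. simpl Csum. destruct Nat.eq_dec as [_|n]; [|destruct n; auto].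
  rewrite (Csum_ext _ (fun j => Cmul (c j) (F_n j z))).
  + rewrite <- Hc. ring.
  + intros j Hj. destruct Nat.eq_dec; [lia|auto].
Qed.

Theorem theorem1p1 (m : nat) (hm : (1 <= m)%nat) :
  (forall f : Cplx -> Cplx, inV 0 m f <-> inV_half 0 (m - 1) f) /\
  is_basis_on_H (inV 0 m) m F_n.
Proof.
split; [|split; [|split]].
- intros f. destruct m as [|m]; [lia|]. replace (S m - 1)%nat with m by lia. apply inV_S_iff_half.
(* F_j is killed by Delta^(j+1), hence by Delta^m, as j < m. *)
- intros j Hj. apply inV_iterDelta_l. split; [apply modular_moderate_F|]. apply iterDelta_l_le with (S j); auto. apply iterDelta_l_S_const with (top_coeff j), iterDelta_l_F.
- apply F_indep.
- intros f Hf. apply inV_iterDelta_l in Hf. apply F_span; apply Hf.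
Qed.
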